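(* Let $1\le p<\infty$ and let $g$ be holomorphic on $\mathbb{B}_n$. The following statements are equivalent: (a) $V_g$ is bounded on $A^p_\psi(\mathbb{B}_n)$; (b) $|\mathcal{R}g(z)|^p(1-|z|^2)^{2p}\,dv(z)$ is a Carleson measure for $A^p_\psi(\mathbb{B}_n)$; (c) $|\mathcal{R}g(z)|(1-|z|^2)^2$ is bounded on $\mathbb{B}_n$.
   Context: $\mathbb{B}_n$ is the open unit ball of $\mathbb{C}^n$, $v$ is Lebesgue measure, $\psi(z)=\frac{1}{1-|z|^2}$. $A^p_\psi(\mathbb{B}_n)$ is the space of holomorphic $f$ on $\mathbb{B}_n$ with $\int|f|^pe^{-\psi}dv<\infty$. A positive Borel measure $\mu$ is a Carleson measure for $A^p_\psi(\mathbb{B}_n)$ if there is $C>0$ with $\int|f|^pe^{-\psi}d\mu\le C\int|f|^pe^{-\psi}dv$ for all $f\in A^p_\psi(\mathbb{B}_n)$. $\mathcal{R}g(z)=\sum_{j=1}^nz_j\frac{\partial g}{\partial z_j}(z)$ is the radial derivative, and the extended Cesàro operator is $V_gf(z)=\int_0^1f(tz)\mathcal{R}g(tz)\frac{dt}{t}$ for $z\in\mathbb{B}_n$. *)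

(* Defs.v *)
From HB Require Import structures.
From mathcomp Require Import all_boot all_order all_algebra.
From mathcomp Require Import complex.
From mathcomp Require Import all_classical all_reals all_analysis.
Set Implicit Arguments.
Unset Strict Implicit.
Unset Printing Implicit Defensive.
Import Order.TTheory GRing.Theory Num.Theory.
Import numFieldNormedType.Exports.
Local Open Scope ring_scope.
Local Open Scope classical_set_scope.

Notation Cn R n := ('rV[R[i]]_n : normedModType R[i]).

Section Defs.
Variable R : realType.
Local Notation C := (R[i]).

Definition cabs (w : C) : R := Normc.normc w.

Definition sqnorm n (z : Cn R n) : R := \sum_(j < n) cabs (z ord0 j) ^+ 2.

Definition ball_n n : set (Cn R n) := [set z | sqnorm z < 1].

Definition holomorphic_on_ball n (g : Cn R n -> C^o) : Prop :=
  forall z, @ball_n n z -> differentiable g z.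

Definition radial_deriv n (g : Cn R n -> C^o) (z : Cn R n) : C :=
  \sum_(j < n) z ord0 j * ('D_('e_j) g z : C).

(* e^{-psi(z)} with psi(z) = 1/(1-|z|^2) *)
Definition weight n (z : Cn R n) : R := expR (- (1 - sqnorm z)^-1).

(* Lebesgue measure v on C^n = R^(2n): integral of a nonnegative function,
   written as the iterated Lebesgue integral over the 2n real coordinates
   (Re z_j, Im z_j) (Tonelli). *)
Fixpoint iter_int (k : nat) (F : (nat -> C) -> \bar R) : \bar R :=
  match k with
  | 0 => F (fun _ => 0)
  | k'.+1 =>
      (\int[@lebesgue_measure R]_(x in [set: R])
        \int[@lebesgue_measure R]_(y in [set: R])
          iter_int k' (fun w => F (fun j => if j == k' then Complex x y else w j)))%E
  end.

Definition vol_int n (F : Cn R n -> \bar R) : \bar R :=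
  iter_int n (fun w => F (\row_(i < n) w i)).

Definition ball_int n (p : R) (w : Cn R n -> R) (f : Cn R n -> C^o) : \bar R :=
  vol_int (fun z => if sqnorm z < 1
                    then ((cabs (f z) `^ p) * weight z * w z)%:E
                    else 0%E).

Definition in_Apsi n (p : R) (f : Cn R n -> C^o) : Prop :=
  holomorphic_on_ball f /\ (ball_int p (fun _ => 1%R) f < +oo)%E.

Definition carleson_density n (p : R) (w : Cn R n -> R) : Prop :=
  exists c : R, 0 < c /\
    forall f, in_Apsi p f ->
      (ball_int p w f <= c%:E * ball_int p (fun _ => 1%R) f)%E.

Definition cesaro n (g f : Cn R n -> C^o) (z : Cn R n) : C^o :=
  let h := fun t : R => f ((t%:C)%C *: z) * radial_deriv g ((t%:C)%C *: z) / (t%:C)%C in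
  Complex (Rintegral (@lebesgue_measure R) `]0, 1]%classic (fun t => complex.Re (h t)))
          (Rintegral (@lebesgue_measure R) `]0, 1]%classic (fun t => complex.Im (h t))).

Definition cesaro_bounded n (p : R) (g : Cn R n -> C^o) : Prop :=
  exists c : R, 0 < c /\
    forall f, in_Apsi p f ->
      in_Apsi p (cesaro g f) /\
      (ball_int p (fun _ => 1%R) (cesaro g f) <= c%:E * ball_int p (fun _ => 1%R) f)%E.

End Defs.
Arguments ball_n {R} n _.

(* Main.v *)
Require Import Defs.
From HB Require Import structures.
From mathcomp Require Import all_boot all_order all_algebra.
From mathcomp Require Import complex.
From mathcomp Require Import all_classical all_reals all_analysis.
From mathcomp Require Import measurable_realfun.
From mathcomp Require Import ring lra.
Set Implicit Arguments.
Unset Strict Implicit.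
Unset Printing Implicit Defensive.
Import Order.TTheory GRing.Theory Num.Theory.
Import numFieldNormedType.Exports.
Local Open Scope ring_scope.
Local Open Scope classical_set_scope.

(** The test functions [f_a(z) = exp((2/p)/(1 - <z,a>) - (1/p)/(1 - |a|^2))] satisfy
    [|f_a|^p e^(-psi) = e^(-D)], where [D] is comparable with the anisotropic form
    [Q = |z-a|^2/(1-|a|^2)^2 + |<z-a,a>|^2/(1-|a|^2)^3]: [1 + Q] is at most a constant times
    [(1 + D)^9], and [D] is bounded where [Q] is small. Completing squares one coordinate at
    a time makes [Q] a sum of squares, which gives an upper bound for the norm of [f_a] and a
    sub-mean value inequality for [|h|^p] on ellipsoids [Q < d], with the same volume factor.

    (b) implies (c) by the sub-mean value inequality for [Rg]. For (a) implies (c), put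
    [F = V_g f_a], so that [RF = f_a Rg]; the inequality for [F / f_a] bounds [|F|] by a
    constant times [|f_a(a)|] on a disc of radius [(1-|a|^2)^2 / 12] in the direction of [a],
    and Cauchy's estimate there bounds [|Rg(a)| (1-|a|^2)^2]. For (c) implies (a), the part
    [t <= 1/2] of the integral defining [V_g f] is bounded by local boundedness. On the rest
    Jensen's inequality for the density [e^(s/(1-t^2|z|^2)) (1-t^2|z|^2)^(-2)], [s = 1/(2p)],
    followed by Tonelli and the dilation [w = tz], leaves an integral over [t] alone. *)

(** Holomorphy is complex differentiability at each point, with no continuity of derivatives given,
    so the one-variable theory is built in Goursat's manner: Green's formula on squares for fields
    whose divergence alone is continuous, then averages against the kernel [(r - |z-c|^2)_+^2]. This
    kernel dies at the rim of the disc, so no boundary integrals appear, and moving its centre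
    differentiates a holomorphic function. Volume is an iterated integral in a fixed order of
    coordinates. Hence [Q] is diagonalized not by a rotation but by shifting each coordinate by a
    combination of those integrated outside it, and one-variable bounds are iterated. The ninth
    power in the comparison costs nothing, since [e^(-D)] beats every power; integrability only asks
    for [(1 + Q)^(-2n)]. The mass of Jensen's density is [O(e^(s/(1-|z|^2)))]. Its power [p - 1]
    consumes the part [s (p - 1)] of the exponent of the weight; [s = 1/(2p)] leaves more than half.
    That remainder, integrated over [t], yields the factor [(1-|w|^2)^2] which cancels the
    denominator of the density. *)

Section ComplexModulus.
Variable R : realType.
Implicit Types (a b : R[i]) (x y : R).

Lemma cabs_ge0 a : 0 <= cabs a.
Proof. by case: a => x y; rewrite /cabs /= sqrtr_ge0. Qed.

Lemma cabsM a b : cabs (a * b) = cabs a * cabs b.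
Proof. exact: Normc.normcM. Qed.

Lemma cabs0 : cabs (0 : R[i]) = 0.
Proof. exact: Normc.normc0. Qed.

Lemma cabs1 : cabs (1 : R[i]) = 1.
Proof. exact: Normc.normc1. Qed.

Lemma cabsN a : cabs (- a) = cabs a.
Proof. exact: normcN. Qed.

Lemma cabsD a b : cabs (a + b) <= cabs a + cabs b.
Proof. exact: le_normcD. Qed.

Lemma cabsB a b : cabs (a - b) <= cabs a + cabs b.
Proof. by rewrite -(cabsN b) cabsD. Qed.

Lemma cabs_distC a b : cabs (a - b) = cabs (b - a).
Proof. by rewrite -cabsN opprB. Qed.

Lemma cabsV a : cabs a^-1 = (cabs a)^-1.
Proof. exact: Normc.normcV. Qed.

Lemma cabs_eq0 a : (cabs a == 0) = (a == 0).
Proof.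
apply/eqP/eqP => [|->]; last exact: cabs0.
exact: Normc.eq0_normc.
Qed.

Lemma cabs_gt0 a : (0 < cabs a) = (a != 0).
Proof. by rewrite lt_def cabs_ge0 andbT cabs_eq0. Qed.

Lemma cabsE a : cabs a = Num.sqrt (complex.Re a ^+ 2 + complex.Im a ^+ 2).
Proof. by case: a. Qed.

Lemma sqr_cabs a : cabs a ^+ 2 = complex.Re a ^+ 2 + complex.Im a ^+ 2.
Proof. by rewrite cabsE sqr_sqrtr // addr_ge0 ?sqr_ge0. Qed.

Lemma cabs_real x : cabs (x%:C)%C = `|x|.
Proof. by rewrite cabsE /= expr0n addr0 sqrtr_sqr. Qed.

Lemma cabs_conj a : cabs (conjc a) = cabs a.
Proof. by rewrite !cabsE; case: a => x y /=; rewrite sqrrN. Qed.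

Lemma le_Re_cabs a : `|complex.Re a| <= cabs a.
Proof.
by rewrite cabsE -sqrtr_sqr ler_sqrt ?addr_ge0 ?sqr_ge0 // lerDl sqr_ge0.
Qed.

Lemma le_Im_cabs a : `|complex.Im a| <= cabs a.
Proof.
by rewrite cabsE -sqrtr_sqr ler_sqrt ?addr_ge0 ?sqr_ge0 // lerDr sqr_ge0.
Qed.

Lemma Re_le_cabs a : complex.Re a <= cabs a.
Proof. exact: le_trans (ler_norm _) (le_Re_cabs _). Qed.

Lemma cabs_le_ReIm a : cabs a <= `|complex.Re a| + `|complex.Im a|.
Proof.
rewrite -(@ler_pXn2r _ 2) ?nnegrE ?cabs_ge0 ?addr_ge0 // sqr_cabs.
rewrite -(real_normK (num_real (complex.Re a))).
rewrite -(real_normK (num_real (complex.Im a))).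
by rewrite sqrrD -addrA lerD2l lerDr mulrn_wge0 // mulr_ge0.
Qed.

Lemma normE_cabs a : `|a| = ((cabs a)%:C)%C.
Proof. by rewrite normc_def cabsE. Qed.

Lemma ReD a b : complex.Re (a + b) = complex.Re a + complex.Re b.
Proof. by case: a; case: b. Qed.
Lemma ImD a b : complex.Im (a + b) = complex.Im a + complex.Im b.
Proof. by case: a; case: b. Qed.
Lemma ReN a : complex.Re (- a) = - complex.Re a.
Proof. by case: a. Qed.
Lemma ImN a : complex.Im (- a) = - complex.Im a.
Proof. by case: a. Qed.
Lemma ReM a b : complex.Re (a * b) =
  complex.Re a * complex.Re b - complex.Im a * complex.Im b.
Proof. by case: a; case: b. Qed.
Lemma ImM a b : complex.Im (a * b) =
  complex.Re a * complex.Im b + complex.Im a * complex.Re b.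
Proof. by case: a => ? ?; case: b => ? ? /=; rewrite [X in X = _]addrC addrC. Qed.

Lemma complexP a b : complex.Re a = complex.Re b ->
  complex.Im a = complex.Im b -> a = b.
Proof. by case: a => ? ?; case: b => ? ? /= -> ->. Qed.

Lemma cabs_sum (I : Type) (s : seq I) (P : pred I) (F : I -> R[i]) :
  cabs (\sum_(i <- s | P i) F i) <= \sum_(i <- s | P i) cabs (F i).
Proof.
elim/big_rec2 : _ => [|i y1 y2 _ h]; first by rewrite cabs0.
by apply: le_trans (cabsD _ _) _; rewrite lerD2l.
Qed.

End ComplexModulus.

(** * Lebesgue measure under affine maps of the line *)

Section LebesgueAffine.
Variable R : realType.
Local Notation mu := (@lebesgue_measure R).

(** Both sides are measures in [A] that agree on half-open intervals. *)
Lemma lebesgue_measure_affine (t a : R) (A : set R) : 0 < t -> measurable A ->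
  (t%:E * mu ((fun x : R => t * x + a)%R @^-1` A) = mu A)%E.
Proof.
move=> t0 mA.
pose phi := (fun x : R => t * x + a : measurableTypeR R)%R.
have mphi : measurable_fun setT phi.
  by apply: measurable_funD => //; apply: measurable_funM.
have -> : (t%:E * mu (phi @^-1` A) =
   mscale (NngNum (ltW t0)) (pushforward mu phi) A)%E.
  by [].
apply/esym/lebesgue_measure_unique => //= _ [[b c]] _ <-.
rewrite /mscale/= /pushforward/=.
have -> : phi @^-1` `]b, c] = `]((b - a) / t), ((c - a) / t)]%classic.
  apply/seteqP; split => x /=; rewrite !in_itv /phi /= ltr_pdivrMr // ler_pdivlMr //;
  rewrite (mulrC x) ltrBlDr lerBrDr //.
rewrite /mscale /= !lebesgue_measure_itv /= !lte_fin.
rewrite ltr_pM2r ?invr_gt0 // ltrD2r.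
case: ifPn => _; last by rewrite mule0.
rewrite -!EFinB -EFinM -mulrBl mulrC divfK ?gt_eqF //.
by congr EFin; ring.
Qed.

Lemma ge0_integral_affine (t a : R) (f : R -> \bar R) : 0 < t ->
  measurable_fun setT f -> (forall x, 0 <= f x)%E ->
  (\int[mu]_x f x = t%:E * \int[mu]_x f (t * x + a)%R)%E.
Proof.
move=> t0 mf f0.
pose phi := (fun x : R => t * x + a : measurableTypeR R)%R.
have mphi : measurable_fun setT phi.
  by apply: measurable_funD => //; apply: measurable_funM.
pose nu : {measure set (measurableTypeR R) -> \bar R} :=
  measure_function_pushforward__canonical__measure_function_Measure mu mphi.
transitivity (\int[mscale (NngNum (ltW t0)) nu]_x f x)%E.
  apply: eq_measure_integral => A mA _; apply/esym.
  exact: (lebesgue_measure_affine a t0 mA).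
rewrite ge0_integral_mscale //=; congr (_ * _)%E.
by rewrite ge0_integral_pushforward.
Qed.

End LebesgueAffine.

Section Integrability.
Context d (T : measurableType d) (R : realType).
Variable mu : {measure set T -> \bar R}.

Lemma integrable_bounded (D : set T) (f : T -> R) (M : R) :
  measurable D -> (mu D < +oo)%E -> measurable_fun D f ->
  (forall x, D x -> `|f x| <= M) -> mu.-integrable D (EFin \o f).
Proof.
move=> mD Doo mf fM.
apply: (@le_integrable _ _ _ mu D mD (EFin \o f) (cst M%:E)).
- exact/measurable_EFinP.
- move=> x Dx /=; rewrite lee_fin; apply: le_trans (fM _ Dx) _.
  exact: ler_norm.
- apply/integrableP; split; first exact: measurable_cst.
  rewrite [X in (X < _)%E](_ : _ = `|M|%:E * mu D)%E; last first.
    by rewrite -integral_cst.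
  by rewrite lte_mul_pinfty.
Qed.

(* No measurability is required: the integral of a nonnegative function is the
   supremum over the simple functions below it. *)
Lemma ge0_le_integral_nomeas (f g : T -> \bar R) :
  (forall x, 0 <= f x)%E -> (forall x, f x <= g x)%E ->
  (\int[mu]_x f x <= \int[mu]_x g x)%E.
Proof.
move=> f0 fg.
have g0 x : (0 <= g x)%E by exact: le_trans (fg x).
rewrite !ge0_integralTE //.
apply: le_ereal_sup => _ /= [h hf <-]; exists h => // x.
exact: le_trans (hf x) (fg x).
Qed.

End Integrability.

(** * Iterated Lebesgue integrals *)

Section BorelPreimages.
Variable R : realType.

(** Lower semicontinuity survives the extension by zero of a nonnegative continuous function from an
    open set, while continuity does not; all cut-off integrands below are of this kind. *)
Definition lsc (I : Type) (h : (I -> R) -> R) :=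
  forall a u, a < h u -> exists2 e : R, 0 < e &
    forall v, (forall i, `|v i - u i| < e) -> a < h v.

(** An open set is a countable union of boxes with rational centre and radius, enumerated through
    [pickle]; the preimage of a box is a finite intersection of measurable sets. *)
Lemma measurable_preimage_boxes (I : finType) d (T : measurableType d)
    (c : T -> I -> R) (U : set (I -> R)) :
  (forall i, measurable_fun setT (c ^~ i)) ->
  (forall u, U u -> exists2 e : R, 0 < e &
     forall v, (forall i, `|v i - u i| < e) -> U v) ->
  measurable [set t | U (c t)].
Proof.
move=> mc oU.
pose K := ({ffun I -> rat} * rat)%type.
pose box (k : K) : set T :=
  [set t | forall i, `|c t i - ratr (k.1 i)| < ratr k.2].
pose good (k : K) := `[< forall v : I -> R,
  (forall i, `|v i - ratr (k.1 i)| < ratr k.2) -> U v >].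
pose S m : set T := if @unpickle K m is Some k then
  (if good k then box k else set0) else set0.
have mbox k : measurable (box k).
  have -> : box k = \bigcap_(i in [set: I])
      (c ^~ i) @^-1` (ball (ratr (k.1 i) : R) (ratr k.2)).
    apply/seteqP; split => t /=.
      by move=> h i _; rewrite /ball /= distrC; exact: h.
    by move=> h i; have := h i Logic.I; rewrite /ball /= distrC.
  apply: fin_bigcap_measurable => [|i _]; first exact: finite_finset.
  by rewrite -[X in measurable X]setTI; apply: (mc i) => //; exact: measurable_ball.
rewrite [X in measurable X](_ : _ = \bigcup_m S m); last first.
  apply/seteqP; split => t /=.
    move=> Ut; have [e e0 he] := oU _ Ut.
    (* The centre will be within [e / 4] of the point in every coordinate; a radius between [e / 4]
       and [e / 2] then makes the box contain the point and keeps it within [e] of it. *)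
    have [r] : exists r : rat, (ratr r \in `](e / 4), (e / 2)[)%R.
      by apply: rat_in_itvoo; lra.
    rewrite in_itv /= => /andP[r1 r2].
    have hq i : exists q : rat, `|c t i - ratr q| < e / 4.
      have [q] : exists q : rat, (ratr q \in `](c t i - e / 4), (c t i + e / 4)[)%R.
        by apply: rat_in_itvoo; lra.
      rewrite in_itv /= => /andP[q1 q2]; exists q.
      by rewrite ltr_norml; apply/andP; split; lra.
    have [q hq'] := choice hq.
    pose k : K := ([ffun i => q i], r).
    exists (pickle k) => //; rewrite /S pickleK.
    have -> : good k.
      apply/asboolP => v hv; apply: he => i.
      have := hv i; rewrite /= ffunE => h1; have := hq' i.
      rewrite distrC => h2.
      have -> : v i - c t i = (v i - ratr (q i)) + (ratr (q i) - c t i) by ring.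
      apply: le_lt_trans (ler_normD _ _) _; lra.
    move=> i /=; rewrite ffunE; apply: lt_trans (hq' i) _; lra.
  move=> [m _]; rewrite /S; case: (unpickle m) => [k|//].
  case: ifPn => // /asboolP hk; exact: hk.
apply: bigcupT_measurable => m; rewrite /S; case: (unpickle m) => [k|//].
by case: ifPn.
Qed.

Lemma lsc_measurable (I : finType) d (T : measurableType d)
    (c : T -> I -> R) (h : (I -> R) -> R) :
  (forall i, measurable_fun setT (c ^~ i)) -> lsc h ->
  measurable_fun setT (fun t => h (c t)).
Proof.
move=> mc hl; apply: (measurability _ (RGenOInfty.measurableE R)) => //.
move=> /= _ [_ [a ->] <-]; rewrite setTI.
rewrite [X in measurable X](_ : _ = [set t | [set u | a < h u] (c t)]).
  apply: measurable_preimage_boxes => // u /= hu; exact: hl.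
by rewrite preimage_itvoy.
Qed.

End BorelPreimages.

Section BorelFunctions.
Variable R : realType.
Local Notation C := R[i].

Definition coord_measurable d (T : measurableType d) (c : T -> nat -> C) :=
  forall j, measurable_fun setT (fun t => complex.Re (c t j)) /\
            measurable_fun setT (fun t => complex.Im (c t j)).

(* Joint Borel measurability of a function of countably many complex variables
   and a parameter, tested along all measurable families. *)
Definition borel_fun d0 (T0 : measurableType d0) (F : T0 -> (nat -> C) -> \bar R) :=
  forall d (T : measurableType d) (s : T -> T0) (c : T -> nat -> C),
    measurable_fun setT s -> coord_measurable c ->
    measurable_fun setT (fun t => F (s t) (c t)).

Definition set_coord (k : nat) (a : C) (w : nat -> C) : nat -> C :=
  fun j => if j == k then a else w j.

Lemma iter_intS k (F : (nat -> C) -> \bar R) :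
  iter_int k.+1 F = (\int[@lebesgue_measure R]_x \int[@lebesgue_measure R]_y
    iter_int k (fun w => F (set_coord k (Complex x y) w)))%E.
Proof. by []. Qed.

Lemma iter_int_ge0 k (F : (nat -> C) -> \bar R) :
  (forall w, 0 <= F w)%E -> (0 <= iter_int k F)%E.
Proof.
elim: k F => [|k IH] F F0 //=.
by apply: integral_ge0 => x _; apply: integral_ge0 => y _; exact: IH.
Qed.

Lemma le_iter_int k (F G : (nat -> C) -> \bar R) :
  (forall w, 0 <= F w)%E -> (forall w, F w <= G w)%E ->
  (iter_int k F <= iter_int k G)%E.
Proof.
elim: k F G => [|k IH] F G F0 FG //=.
apply: ge0_le_integral_nomeas => x.
  by apply: integral_ge0 => y _; exact: iter_int_ge0.
apply: ge0_le_integral_nomeas => y; last exact: IH.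
exact: iter_int_ge0.
Qed.

Lemma eq_iter_int k (F G : (nat -> C) -> \bar R) :
  F =1 G -> iter_int k F = iter_int k G.
Proof. by move=> FG; congr iter_int; apply/funext. Qed.

Lemma borel_fun_comp d0 (T0 : measurableType d0) d1 (T1 : measurableType d1)
    (s : T1 -> T0) (F : T0 -> (nat -> C) -> \bar R) :
  measurable_fun setT s -> borel_fun F -> borel_fun (fun t => F (s t)).
Proof.
move=> ms bF d T s1 c ms1 mc.
by apply: (bF _ _ (s \o s1)) => //; exact: measurableT_comp.
Qed.

Lemma borel_fun_set_coord d0 (T0 : measurableType d0)
    (F : T0 -> (nat -> C) -> \bar R) k (a b : T0 -> R) :
  measurable_fun setT a -> measurable_fun setT b -> borel_fun F ->
  borel_fun (fun t w => F t (set_coord k (Complex (a t) (b t)) w)).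
Proof.
move=> ma mb bF d T s c ms mc.
apply: (bF _ _ s (fun t => set_coord k (Complex (a (s t)) (b (s t))) (c t))) => //.
move=> j; rewrite /set_coord; case: eqP => _ /=.
  by split; [exact: (measurableT_comp ma ms)|exact: (measurableT_comp mb ms)].
exact: mc.
Qed.

(** The induction moves the two outermost real coordinates into the parameter space, which is why
    all parameter types are quantified over; Tonelli's measurability statement is applied once for
    each of them. *)
Lemma measurable_iter_int k d0 (T0 : measurableType d0)
    (F : T0 -> (nat -> C) -> \bar R) :
  borel_fun F -> (forall t w, 0 <= F t w)%E ->
  measurable_fun setT (fun t => iter_int k (F t)).
Proof.
elim: k d0 T0 F => [|k IH] d0 T0 F bF F0.
  apply: (bF _ _ id (fun _ _ => 0)); first exact: measurable_id.
  by move=> j; split; exact: measurable_cst.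
pose G (p : (T0 * R) * R) := fun w => F p.1.1 (set_coord k (Complex p.1.2 p.2) w).
have mG : measurable_fun setT (fun p => iter_int k (G p)).
  apply: IH => [|p w]; last exact: F0.
  apply: (@borel_fun_set_coord _ _ (fun p => F p.1.1) k (fun p => p.1.2) snd).
  - exact: (measurableT_comp measurable_snd measurable_fst).
  - exact: measurable_snd.
  - apply: (borel_fun_comp _ bF).
    exact: (measurableT_comp measurable_fst measurable_fst).
have G0 p : (0 <= iter_int k (G p))%E by apply: iter_int_ge0 => w; exact: F0.
have m1 := @measurable_fun_fubini_tonelli_F _ _ _ _ R (@lebesgue_measure R) _ mG G0.
have m1' : measurable_fun setT (fun p : T0 * R => \int[@lebesgue_measure R]_y iter_int k (G (p, y)))%E.
  exact: m1.
apply: (@measurable_fun_fubini_tonelli_F _ _ _ _ R (@lebesgue_measure R) _ m1').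
by move=> p; apply: integral_ge0 => y _; exact: G0.
Qed.

Lemma iter_int_tonelli k d0 (T0 : measurableType d0)
    (m : {sigma_finite_measure set T0 -> \bar R})
    (F : T0 -> (nat -> C) -> \bar R) :
  borel_fun F -> (forall t w, 0 <= F t w)%E ->
  (\int[m]_t iter_int k (F t) = iter_int k (fun w => \int[m]_t F t w))%E.
Proof.
elim: k F => [|k IH] F bF F0 //.
pose G (p : (T0 * R) * R) := fun w => F p.1.1 (set_coord k (Complex p.1.2 p.2) w).
have mG : measurable_fun setT (fun p => iter_int k (G p)).
  apply: measurable_iter_int => [|p w]; last exact: F0.
  apply: (@borel_fun_set_coord _ _ (fun p => F p.1.1) k (fun p => p.1.2) snd).
  - exact: (measurableT_comp measurable_snd measurable_fst).
  - exact: measurable_snd.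
  - apply: (borel_fun_comp _ bF).
    exact: (measurableT_comp measurable_fst measurable_fst).
have G0 p : (0 <= iter_int k (G p))%E by apply: iter_int_ge0 => w; exact: F0.
have m1 : measurable_fun setT
    (fun p : T0 * R => \int[@lebesgue_measure R]_y iter_int k (G (p, y)))%E.
  exact: (@measurable_fun_fubini_tonelli_F _ _ _ _ R (@lebesgue_measure R) _ mG G0).
have p1 p : (0 <= \int[@lebesgue_measure R]_y iter_int k (G (p, y)))%E.
  by apply: integral_ge0 => y _; exact: G0.
transitivity (\int[@lebesgue_measure R]_x \int[m]_t
   \int[@lebesgue_measure R]_y iter_int k (G ((t, x), y)))%E.
  exact: (@fubini_tonelli _ _ _ _ R m (@lebesgue_measure R) _ m1 p1).
rewrite iter_intS; apply: eq_integral => x _ /=.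
have m2 : measurable_fun setT (fun p : T0 * R => iter_int k (G ((p.1, x), p.2))).
  apply: (measurableT_comp mG).
  apply: measurable_fun_pair; last exact: measurable_snd.
  by apply: measurable_fun_pair; [exact: measurable_fst|exact: measurable_cst].
transitivity (\int[@lebesgue_measure R]_y \int[m]_t iter_int k (G ((t, x), y)))%E.
  exact: (@fubini_tonelli _ _ _ _ R m (@lebesgue_measure R) _ m2 (fun p => G0 _)).
apply: eq_integral => y _ /=.
rewrite /G /= (IH (fun t w => F t (set_coord k (Complex x y) w))) //.
by apply: (@borel_fun_set_coord _ _ F k (fun=> x) (fun=> y)) => //;
  exact: measurable_cst.
Qed.

End BorelFunctions.

Section IteratedIntegral.
Variable R : realType.
Local Notation C := R[i].
Local Notation mu := (@lebesgue_measure R).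

Definition borel (F : (nat -> C) -> \bar R) :=
  forall d (T : measurableType d) (c : T -> nat -> C),
    coord_measurable c -> measurable_fun setT (fun t => F (c t)).

Lemma borel_borel_fun d (T : measurableType d) (F : (nat -> C) -> \bar R) :
  borel F -> borel_fun (fun _ : T => F).
Proof. by move=> bF d1 T1 s c _ mc; exact: bF. Qed.

Lemma borel_slice k (a : C) (F : (nat -> C) -> \bar R) :
  borel F -> borel (fun w => F (set_coord k a w)).
Proof.
move=> bF d T c mc; apply: bF => j; rewrite /set_coord; case: eqP => _; last exact: mc.
by split; exact: measurable_cst.
Qed.

Lemma measurable_slices k (F : (nat -> C) -> \bar R) :
  borel F -> (forall w, 0 <= F w)%E ->
  measurable_fun setT (fun p : R * R =>
    iter_int k (fun w => F (set_coord k (Complex p.1 p.2) w))).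
Proof.
move=> bF F0; apply: (@measurable_iter_int _ k _ _ (fun (p : R * R) w =>
  F (set_coord k (Complex p.1 p.2) w))) => //.
apply: (@borel_fun_set_coord _ _ _ (fun _ : R * R => F) k fst snd).
- exact: measurable_fst.
- exact: measurable_snd.
- exact: borel_borel_fun.
Qed.

Lemma measurable_slice k (F : (nat -> C) -> \bar R) x :
  borel F -> (forall w, 0 <= F w)%E ->
  measurable_fun setT (fun y : R =>
    iter_int k (fun w => F (set_coord k (Complex x y) w))).
Proof.
move=> bF F0.
apply: (measurableT_comp (measurable_slices k bF F0) (g := fun y => (x, y))).
by apply: measurable_fun_pair; [exact: measurable_cst|exact: measurable_id].
Qed.

Lemma measurable_slice_int k (F : (nat -> C) -> \bar R) :
  borel F -> (forall w, 0 <= F w)%E ->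
  measurable_fun setT (fun x : R => \int[mu]_y
    iter_int k (fun w => F (set_coord k (Complex x y) w)))%E.
Proof.
move=> bF F0; apply: (@measurable_fun_fubini_tonelli_F _ _ _ _ R mu _
  (measurable_slices k bF F0)) => p; exact: iter_int_ge0.
Qed.

Lemma iter_intZl k (c : R) (F : (nat -> C) -> \bar R) :
  0 <= c -> borel F -> (forall w, 0 <= F w)%E ->
  iter_int k (fun w => c%:E * F w)%E = (c%:E * iter_int k F)%E.
Proof.
move=> c0; elim: k F => [|k IH] F bF F0 //.
rewrite !iter_intS -ge0_integralZl_EFin //; last 2 first.
- by move=> x _; apply: integral_ge0 => y _; exact: iter_int_ge0.
- exact: measurable_slice_int.
apply: eq_integral => x _; rewrite -ge0_integralZl_EFin //; last 2 first.
- by move=> y _; exact: iter_int_ge0.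
- exact: measurable_slice.
by apply: eq_integral => y _; rewrite IH //; exact: borel_slice.
Qed.

Lemma borel_dilation (t : R) (F : (nat -> C) -> \bar R) :
  borel F -> borel (fun w => F (fun j => (t%:C)%C * w j)).
Proof.
move=> bF d T c mc; apply: bF => j; have [m1 m2] := mc j; split.
  rewrite (_ : (fun _ => _) = fun x => t * complex.Re (c x j)).
    exact: measurable_funM.
  by apply/funext => x; rewrite ReM /= mul0r subr0.
rewrite (_ : (fun _ => _) = fun x => t * complex.Im (c x j)).
  exact: measurable_funM.
by apply/funext => x; rewrite ImM /= mul0r addr0.
Qed.

(** Each of the [2 * k] real integrals contributes one factor [t]. *)
Lemma iter_int_dilation k (t : R) (F : (nat -> C) -> \bar R) :
  0 < t -> borel F -> (forall w, 0 <= F w)%E ->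
  iter_int k F =
    ((t ^+ (2 * k)%N)%:E * iter_int k (fun w => F (fun j => (t%:C)%C * w j)%R))%E.
Proof.
move=> t0; elim: k F => [|k IH] F bF F0.
  (* The empty integral evaluates [F] at the zero sequence, which every dilation fixes. *)
  rewrite muln0 expr0 mul1e /=; congr F; apply/funext => j; by rewrite mulr0.
have bFt := borel_dilation t bF.
rewrite !iter_intS (ge0_integral_affine 0 t0); last 2 first.
- exact: measurable_slice_int.
- by move=> x; apply: integral_ge0 => y _; exact: iter_int_ge0.
have -> : (2 * k.+1 = 1 + (1 + 2 * k))%N by rewrite mulnS.
rewrite exprD expr1 exprD expr1 EFinM EFinM -!muleA; congr (_ * _)%E.
rewrite muleA -EFinM -ge0_integralZl_EFin //; last 3 first.
- by move=> x _; apply: integral_ge0 => y _; exact: iter_int_ge0.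
- exact: (measurable_slice_int k bFt).
- by rewrite mulr_ge0 ?exprn_ge0 // ltW.
apply: eq_integral => x _.
rewrite (ge0_integral_affine 0 t0); last 2 first.
- exact: measurable_slice.
- by move=> y; exact: iter_int_ge0.
rewrite EFinM -muleA; congr (_ * _)%E.
rewrite -ge0_integralZl_EFin //; last 3 first.
- by move=> y _; exact: iter_int_ge0.
- exact: (measurable_slice k _ bFt).
- by rewrite exprn_ge0 // ltW.
apply: eq_integral => y _; rewrite IH //; last exact: borel_slice.
congr (_ * _)%E; apply: eq_iter_int => w; congr F; apply/funext => j.
rewrite /set_coord; case: eqP => // _.
by apply: complexP; rewrite /= ?ReM ?ImM /=; ring.
Qed.

Definition lsc_upto n (h : (nat -> C) -> R) :=
  forall a w, a < h w -> exists2 e : R, 0 < e &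
    forall v, (forall j, (j < n)%N -> cabs (v j - w j) < e) -> a < h v.

Lemma lsc_borel n (h : (nat -> C) -> R) :
  lsc_upto n h -> borel (fun w => (h w)%:E).
Proof.
move=> hl d T c mc; apply/measurable_EFinP.
(* A neighbourhood that restricts only the first [n] coordinates makes [h] a function of these
   alone: otherwise the threshold [h v] itself would give [h v < h v]. So finitely many real
   parameters describe [h]. *)
have hle w v : (forall j, (j < n)%N -> w j = v j) -> h w <= h v.
  move=> wv; rewrite leNgt; apply/negP => /hl[e e0 /(_ v)] h1.
  suff: h v < h v by rewrite ltxx.
  by apply: h1 => j jn; rewrite wv // subrr cabs0.
have hext w v : (forall j, (j < n)%N -> w j = v j) -> h w = h v.
  move=> wv; apply: le_anti; rewrite !hle // => j jn; by rewrite wv.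
pose asm (u : ('I_n * bool) -> R) : nat -> C := fun j =>
  if insub j is Some i then Complex (u (i, true)) (u (i, false)) else 0.
pose c' (t : T) (ib : 'I_n * bool) : R :=
  if ib.2 then complex.Re (c t ib.1) else complex.Im (c t ib.1).
rewrite (_ : (fun _ => _) = fun t => (h \o asm) (c' t)); last first.
  apply/funext => t /=; apply: hext => j jn.
  by rewrite /asm insubT /c' /=; apply: complexP.
apply: lsc_measurable.
  by move=> [i []]; rewrite /c' /=; have [] := mc i.
move=> a u /hl[e e0 he]; exists (e / 2); first by rewrite divr_gt0.
move=> v uv; apply: he => j jn; rewrite /asm insubT.
apply: le_lt_trans (cabs_le_ReIm _) _.
have := uv (Ordinal jn, true); have := uv (Ordinal jn, false).
by rewrite /= => h1 h2; rewrite (splitr e); apply: ltrD.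
Qed.

End IteratedIntegral.

(** * Goursat's subdivision argument *)

Section Quadrisection.
Variable R : realType.

(** If [J] were nonzero on some square, then with [e] half of its density there, one of the four
    quarters would again satisfy [|J| > e r^2], and so on. The nested squares shrink to a point,
    where the local estimate forbids this. That estimate covers all small squares containing the
    point, since the limit point may sit on their edges. *)
Lemma quadrisection (J : R -> R -> R -> R) :
  (forall x y r, 0 < r -> J x y (r + r) =
     J x y r + J (x + r) y r + J x (y + r) r + J (x + r) (y + r) r) ->
  (forall x y e, 0 < e -> exists2 dl, 0 < dl & forall u v r, 0 < r < dl ->
     u <= x <= u + r -> v <= y <= v + r -> `|J u v r| <= e * r ^+ 2) ->
  forall x y r, 0 < r -> J x y r = 0.
Proof.
move=> Jadd Jloc x0 y0 r0 r0_gt0; apply: contrapT => /eqP J0.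
pose e := `|J x0 y0 r0| / (r0 ^+ 2) / 2.
have J0_gt0 : 0 < `|J x0 y0 r0| by rewrite normr_gt0.
have e0 : 0 < e by rewrite !divr_gt0 // exprn_gt0.
pose big (q : R * R) r := e * r ^+ 2 < `|J q.1 q.2 r|.
have step (qr : (R * R) * R) : exists q' : R * R, 0 < qr.2 ->
    big qr.1 qr.2 -> [/\ big q' (qr.2 / 2),
      qr.1.1 <= q'.1 <= qr.1.1 + qr.2 / 2 & qr.1.2 <= q'.2 <= qr.1.2 + qr.2 / 2].
  case: qr => [[x y] r] /=.
  have [r_gt0|_] := ltP 0 r; last by exists (x, y).
  pose h := r / 2; have h0 : 0 < h by rewrite /h; lra.
  have -> : r / 2 = h by [].
  have rE : r = h + h by rewrite /h; lra.
  have [b1|b1] := boolP (e * h ^+ 2 < `|J x y h|).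
    by exists (x, y) => _ _; split => //=; apply/andP; split; lra.
  have [b2|b2] := boolP (e * h ^+ 2 < `|J (x + h) y h|).
    by exists (x + h, y) => _ _; split => //=; apply/andP; split; lra.
  have [b3|b3] := boolP (e * h ^+ 2 < `|J x (y + h) h|).
    by exists (x, y + h) => _ _; split => //=; apply/andP; split; lra.
  have [b4|b4] := boolP (e * h ^+ 2 < `|J (x + h) (y + h) h|).
    by exists (x + h, y + h) => _ _; split => //=; apply/andP; split; lra.
  exists (x, y) => _; rewrite /big /= rE Jadd // => hb; exfalso.
  move: b1 b2 b3 b4; rewrite -!leNgt => b1 b2 b3 b4.
  have : `|J x y h + J (x + h) y h + J x (y + h) h + J (x + h) (y + h) h|
     <= e * (h + h) ^+ 2.
    have n1 := ler_normD (J x y h + J (x + h) y h + J x (y + h) h)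
      (J (x + h) (y + h) h).
    have n2 := ler_normD (J x y h + J (x + h) y h) (J x (y + h) h).
    have n3 := ler_normD (J x y h) (J (x + h) y h).
    have -> : e * (h + h) ^+ 2 = e * h ^+ 2 + e * h ^+ 2 + e * h ^+ 2 + e * h ^+ 2.
      by ring.
    lra.
  by rewrite leNgt hb.
have [f hf] := choice step.
pose r n := r0 / 2 ^+ n.
have rS n : r n.+1 = r n / 2 by rewrite /r exprS invfM mulrA mulrAC.
have r_gt0 n : 0 < r n by rewrite divr_gt0 // exprn_gt0.
pose s := fix s n : R * R := if n is m.+1 then f (s m, r m) else (x0, y0).
have bs n : big (s n) (r n).
  elim: n => [|n IH]; last first.
    by rewrite rS; have [] := hf (s n, r n) (r_gt0 n) IH.
  rewrite /big /r expr0 divr1 /= /e.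
  have -> : `|J x0 y0 r0| / r0 ^+ 2 / 2 * r0 ^+ 2 = `|J x0 y0 r0| / 2.
    by field; rewrite gt_eqF.
  lra.
have sS n : [/\ (s n).1 <= (s n.+1).1, (s n.+1).1 + r n.+1 <= (s n).1 + r n,
   (s n).2 <= (s n.+1).2 & (s n.+1).2 + r n.+1 <= (s n).2 + r n].
  have [_ /= /andP[h1 h2] /andP[h3 h4]] := hf (s n, r n) (r_gt0 n) (bs n).
  have := rS n; move: h1 h2 h3 h4 => /=; split; lra.
have lim (u : nat -> R) : (forall n, u n <= u n.+1) ->
    (forall n, u n.+1 + r n.+1 <= u n + r n) ->
    exists z, forall n, u n <= z <= u n + r n.
  move=> uS uS'.
  have inc m n : (m <= n)%N -> u m <= u n.
    by move=> mn; rewrite -(subnK mn); elim: (n - m)%N => // k; rewrite addSn => /le_trans; apply.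
  have dec m n : (m <= n)%N -> u n + r n <= u m + r m.
    move=> mn; rewrite -(subnK mn); elim: (n - m)%N => // k IH.
    by rewrite addSn; exact: le_trans (uS' _) IH.
  have bd m n : u m <= u n + r n.
    have [mn|nm] := leqP m n.
      by apply: le_trans (inc _ _ mn) _; rewrite lerDl ltW.
    by apply: le_trans (dec _ _ (ltnW nm)); rewrite lerDl ltW.
  exists (sup (range u)) => n; apply/andP; split.
    by apply: ub_le_sup; [exists (u 0%N + r 0%N) => _ [m _ <-]|exists n].
  by apply: ge_sup; [exists (u 0%N), 0%N|move=> _ [m _ <-]].
have [x hx] := lim (fun n => (s n).1) (fun n => let: And4 a _ _ _ := sS n in a)
   (fun n => let: And4 _ a _ _ := sS n in a).
have [y hy] := lim (fun n => (s n).2) (fun n => let: And4 _ _ a _ := sS n in a)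
   (fun n => let: And4 _ _ _ a := sS n in a).
have [dl dl0 hdl] := Jloc x y e e0.
have [n rn] : exists n, r n < dl.
  have [n hn] : exists n : nat, r0 / dl < n%:R.
    exists (Num.bound (r0 / dl)); apply: archi_boundP.
    by rewrite divr_ge0 // ltW.
  exists n; rewrite /r ltr_pdivrMr ?exprn_gt0 // mulrC -ltr_pdivrMr //.
  apply: lt_trans hn _; rewrite -natrX ltr_nat; exact: ltn_expl.
have := hdl (s n).1 (s n).2 (r n); rewrite r_gt0 rn => /(_ isT (hx n) (hy n)).
by move=> h; have := bs n; rewrite /big ltNge h.
Qed.

End Quadrisection.

(** * Local boundedness on a compact box *)

Section BoxCompactness.
Variable R : realType.

(** Local bounds hold for all [M] near infinity, so the near-covering form of compactness yields a
    common one. Only local boundedness is asked of [h], which lets it be a function cut off by a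
    condition. *)
Lemma box_bounded m (a b : R) (h : ('I_m -> R) -> R) :
  (forall u, (forall i, a <= u i <= b) -> exists M e, 0 < e /\
     forall v, (forall i, a <= v i <= b) ->
       (forall i, `|v i - u i| < e) -> h v <= M) ->
  exists M, forall u, (forall i, a <= u i <= b) -> h u <= M.
Proof.
move=> loc.
have cK := @rV_compact R m (fun=> `[a, b]%classic) (fun=> @segment_compact R a b).
have /compact_near_coveringP nK := cK.
have [] := nK R (+oo)%R (fun M u => (forall i, a <= u ord0 i <= b) -> h (fun i => u ord0 i) <= M) _ _.
  move=> u /= uK; have uK' i : a <= u ord0 i <= b by have := uK i; rewrite in_itv.
  have [M [e [e0 hs]]] := loc (fun i => u ord0 i) uK'.
  have nM : \forall M' \near +oo, M <= M' by apply: nbhs_pinfty_ge; exact: num_real.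
  exists (ball u e, [set M' | M <= M']).
    by split; [exact: nbhsx_ballx|].
  move=> [v M'] [/= hv hM] vK; apply: le_trans (hs _ vK _) hM => i.
  by case: hv => _ hv; rewrite distrC; exact: (hv ord0 i).
move=> M0 [_ hM]; exists (M0 + 1) => u uK.
have uE : (fun i => (\row_i u i : 'rV_m) ord0 i) = u.
  by apply/funext => i; rewrite mxE.
rewrite -uE; apply: (hM (M0 + 1)) => [|i|i]; first by rewrite /= ltrDl.
  by rewrite /= mxE in_itv /= uK.
by rewrite mxE.
Qed.

End BoxCompactness.

(** * The divergence theorem for compactly supported fields *)

Section Divergence.
Variable R : realType.
Local Notation mu := (@lebesgue_measure R).
Local Notation mu2 := (@lebesgue_measure R \x @lebesgue_measure R)%E.
Implicit Types (P Q d : R -> R -> R) (x y r : R).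

Lemma Rintegral_near_cst dd (T : measurableType dd) (m : {measure set T -> \bar R})
    (D : set T) (f : T -> R) (c eta v : R) :
  measurable D -> m D = v%:E -> m.-integrable D (EFin \o f) ->
  (forall t, D t -> `|f t - c| <= eta) ->
  `|\int[m]_(t in D) f t - c * v| <= eta * v.
Proof.
move=> mD mDv fi hf.
have icst k : m.-integrable D (EFin \o (fun=> k)).
  apply: (integrable_bounded (M := `|k|)) => //; first by rewrite mDv ltry.
have -> : c * v = \int[m]_(t in D) c by rewrite Rintegral_cst // mDv.
have -> : eta * v = \int[m]_(t in D) eta by rewrite Rintegral_cst // mDv.
rewrite -RintegralB //.
have iB : m.-integrable D (EFin \o (fun t => f t - c)).
  by apply: (integrableB mD fi (icst c)).
apply: le_trans (le_normr_Rintegral mD iB) _; apply: le_Rintegral => //.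
exact: (integrable_norm iB).
Qed.

Lemma ler_norm_sub_add (X Y Z a b c s t u : R) : `|Y - b| <= t -> `|Z - c| <= u ->
  `|X - a| <= s -> a = b + c -> `|X - (Y + Z)| <= s + t + u.
Proof.
move=> hY hZ hX aE; rewrite aE in hX; have -> : X - (Y + Z) = X - (b + c) - (Y - b) - (Z - c) by ring.
have n1 := ler_normB (X - (b + c) - (Y - b)) (Z - c).
have n2 := ler_normB (X - (b + c)) (Y - b).
lra.
Qed.

Definition diff2 P x y p1 p2 := forall e, 0 < e -> exists2 dl, 0 < dl &
  forall h k, `|h| < dl -> `|k| < dl ->
    `|P (x + h) (y + k) - P x y - p1 * h - p2 * k| <= e * (`|h| + `|k|).

Definition cont2 d := forall x y e, 0 < e -> exists2 dl, 0 < dl &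
  forall x' y', `|x' - x| < dl -> `|y' - y| < dl -> `|d x' y' - d x y| < e.

Lemma diff2_cont2 P : (forall x y, exists p1 p2, diff2 P x y p1 p2) -> cont2 P.
Proof.
move=> hP x y e e0; have [p1 [p2 h]] := hP x y.
have [dl dl0 hdl] := h 1 ltr01.
pose K := 2 + `|p1| + `|p2|.
have K0 : 0 < K by rewrite /K; have := normr_ge0 p1; have := normr_ge0 p2; lra.
have eK : 0 < e / (2 * K) by rewrite divr_gt0 // mulr_gt0.
exists (Num.min dl (e / (2 * K))); first by rewrite lt_min dl0.
move=> x' y'; rewrite !lt_min => /andP[a1 a2] /andP[b1 b2].
have := hdl _ _ a1 b1; rewrite !subrKC.
set A := `|x' - x| in a1 a2 *; set B := `|y' - y| in b1 b2 *.
set E := _ - _ - _ - _ => hE.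
have -> : P x' y' - P x y = E + p1 * (x' - x) + p2 * (y' - y) by rewrite /E; ring.
have n1 := ler_normD (E + p1 * (x' - x)) (p2 * (y' - y)).
have n2 := ler_normD E (p1 * (x' - x)).
rewrite !normrM in n1 n2.
have m1 : `|p1| * A <= `|p1| * (e / (2 * K)) by rewrite ler_wpM2l // ltW.
have m2 : `|p2| * B <= `|p2| * (e / (2 * K)) by rewrite ler_wpM2l // ltW.
have : e / (2 * K) * K = e / 2 by field; rewrite gt_eqF.
rewrite {2}/K => eE.
rewrite -/A -/B in n1 n2; lra.
Qed.

Lemma cont2_slicel d x : cont2 d -> continuous (d x).
Proof.
move=> hd y; apply/cvgrPdist_lt => e e0; have [dl dl0 h] := hd x y e e0.
apply/nbhs_ballP; exists dl => //= y'; rewrite /ball /= => yy'.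
by rewrite distrC; apply: h; [rewrite subrr normr0|rewrite distrC].
Qed.

Lemma cont2_slicer d y : cont2 d -> continuous (d ^~ y).
Proof.
move=> hd x; apply/cvgrPdist_lt => e e0; have [dl dl0 h] := hd x y e e0.
apply/nbhs_ballP; exists dl => //= x'; rewrite /ball /= => xx'.
by rewrite distrC; apply: h; [rewrite distrC|rewrite subrr normr0].
Qed.

Lemma cont2_measurable d : cont2 d -> measurable_fun setT (fun p : R * R => d p.1 p.2).
Proof.
move=> hd.
apply: (@lsc_measurable R bool _ _ (fun p b => if b then p.1 else p.2)
   (fun u => d (u true) (u false))).
  by case; [exact: measurable_fst|exact: measurable_snd].
move=> a u au; have au0 : 0 < d (u true) (u false) - a by rewrite subr_gt0.
have [dl dl0 h] := hd (u true) (u false) _ au0.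
exists dl => // v uv; have := h _ _ (uv true) (uv false).
by rewrite ltr_norml => /andP[h1 h2]; lra.
Qed.

Lemma cont2_bounded d a b : cont2 d ->
  exists M, forall x y, a <= x <= b -> a <= y <= b -> `|d x y| <= M.
Proof.
move=> hd.
have [|M hM] := @box_bounded R 2 a b (fun u => `|d (u ord0) (u (lift ord0 ord0))|).
  move=> u _; have [dl dl0 h] := hd (u ord0) (u (lift ord0 ord0)) 1 ltr01.
  exists (`|d (u ord0) (u (lift ord0 ord0))| + 1), dl; split => // v _ uv.
  have := h _ _ (uv _) (uv _) => h1.
  have := ler_normD (d (v ord0) (v (lift ord0 ord0)) - d (u ord0) (u (lift ord0 ord0)))
    (d (u ord0) (u (lift ord0 ord0))).
  by rewrite subrK; lra.
exists M => x y hx hy; have := hM (fun i => if i == ord0 then x else y).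
by apply => i; case: ifP.
Qed.

(** Half-open, so that a square is the disjoint union of its four quarters. *)
Definition sq x y a b : set (R * R) := `[x, x + a[%classic `*` `[y, y + b[%classic.

Lemma measurable_sq x y a b : measurable (sq x y a b).
Proof. by apply: measurableX; exact: measurable_itv. Qed.

Lemma lebesgue_itvco x a : 0 <= a -> mu `[x, x + a[%classic = a%:E.
Proof.
move=> a0; rewrite lebesgue_measure_itv /= lte_fin ltrDl.
case: ifPn => [_|]; first by rewrite -EFinB addrC addKr.
by rewrite -leNgt => a0'; congr EFin; apply: le_anti; rewrite a0 a0'.
Qed.

Lemma mu2_sq x y a b : 0 <= a -> 0 <= b -> mu2 (sq x y a b) = (a * b)%:E.
Proof.
move=> a0 b0; rewrite /sq product_measure1E; [|exact: measurable_itv..].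
by rewrite EFinM; congr (_ * _)%E; exact: lebesgue_itvco.
Qed.

Lemma integrable_sq d x y a b : cont2 d -> 0 <= a -> 0 <= b ->
  mu2.-integrable (sq x y a b) (EFin \o (fun p => d p.1 p.2)).
Proof.
move=> hd a0 b0.
have [M hM] := cont2_bounded (- (`|x| + `|y| + a + b)) (`|x| + `|y| + a + b) hd.
apply: (integrable_bounded (M := M)).
- exact: measurable_sq.
- apply: (@le_lt_trans _ _ (a * b)%:E); last exact: ltry.
  by rewrite le_eqVlt; apply/orP; left; apply/eqP; exact: mu2_sq.
- by apply: measurable_funTS; exact: cont2_measurable.
move=> [u v] [/=]; rewrite !in_itv /= => /andP[h1 h2] /andP[h3 h4].
have n1 := ler_norm x; have n2 := ler_norm (- x); rewrite normrN in n2.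
have n3 := ler_norm y; have n4 := ler_norm (- y); rewrite normrN in n4.
by apply: hM; apply/andP; split; lra.
Qed.

Lemma integrable_itv f x a : continuous f -> 0 <= a ->
  mu.-integrable `[x, x + a[%classic (EFin \o f).
Proof.
move=> cf a0; have : mu.-integrable `[x, x + a]%classic (EFin \o f).
  apply: continuous_compact_integrable; first exact: segment_compact.
  exact: continuous_subspaceT.
apply: integrableS => //.
by move=> t /=; rewrite !in_itv /= => /andP[-> /ltW].
Qed.

Lemma split_itvco x a b : 0 <= a -> 0 <= b ->
  `[x, x + (a + b)[%classic = `[x, x + a[%classic `|` `[x + a, x + a + b[%classic.
Proof.
move=> a0 b0; rewrite addrA; apply/seteqP; split => t /=; rewrite !in_itv /=.
  move=> /andP[-> ->]; rewrite andbT; have [|] := ltP t (x + a); [by left|by right].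
by move=> [|] /andP[h1 h2]; apply/andP; split; lra.
Qed.

Lemma disjoint_itvco x a b : [disjoint `[x, x + a[%classic & `[x + a, x + a + b[%classic].
Proof.
rewrite disj_set2E; apply/eqP; rewrite -subset0 => t [] /=; rewrite !in_itv /=.
by move=> /andP[_ h1] /andP[h2 _]; lra.
Qed.

Lemma Rintegral_split f x a b : continuous f -> 0 <= a -> 0 <= b ->
  \int[mu]_(t in `[x, x + (a + b)[) f t =
  \int[mu]_(t in `[x, x + a[) f t + \int[mu]_(t in `[x + a, x + a + b[) f t.
Proof.
move=> cf a0 b0.
rewrite split_itvco // Rintegral_setU //; last exact: disjoint_itvco.
by rewrite -split_itvco //; apply: integrable_itv => //; exact: addr_ge0.
Qed.

Lemma Rintegral_sq_splitl d x y a a' b : cont2 d -> 0 <= a -> 0 <= a' -> 0 <= b ->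
  \int[mu2]_(p in sq x y (a + a') b) d p.1 p.2 =
  \int[mu2]_(p in sq x y a b) d p.1 p.2 + \int[mu2]_(p in sq (x + a) y a' b) d p.1 p.2.
Proof.
move=> hd a0 a0' b0.
have E : sq x y (a + a') b = sq x y a b `|` sq (x + a) y a' b.
  rewrite /sq split_itvco //; apply/seteqP; split => -[u v].
    by move=> [[h|h] k]; [left|right].
  by move=> [|] [h k]; split => //; [left|right].
rewrite E Rintegral_setU; [by []|exact: measurable_sq|exact: measurable_sq| |].
  by rewrite -E; apply: integrable_sq => //; exact: addr_ge0.
rewrite disj_set2E; apply/eqP; rewrite -subset0 => -[u v] [] [/= h1 _] [/= h2 _].
have := disjoint_itvco x a a'; rewrite disj_set2E => /eqP/seteqP[h _].
exact: (h u).
Qed.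

Lemma Rintegral_sq_splitr d x y a b b' : cont2 d -> 0 <= a -> 0 <= b -> 0 <= b' ->
  \int[mu2]_(p in sq x y a (b + b')) d p.1 p.2 =
  \int[mu2]_(p in sq x y a b) d p.1 p.2 + \int[mu2]_(p in sq x (y + b) a b') d p.1 p.2.
Proof.
move=> hd a0 b0 b0'.
have E : sq x y a (b + b') = sq x y a b `|` sq x (y + b) a b'.
  rewrite /sq split_itvco //; apply/seteqP; split => -[u v].
    by move=> [k [h|h]]; [left|right].
  by move=> [|] [h k]; split => //; [left|right].
rewrite E Rintegral_setU; [by []|exact: measurable_sq|exact: measurable_sq| |].
  by rewrite -E; apply: integrable_sq => //; exact: addr_ge0.
rewrite disj_set2E; apply/eqP; rewrite -subset0 => -[u v] [] [/= _ h1] [/= _ h2].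
have := disjoint_itvco y b b'; rewrite disj_set2E => /eqP/seteqP[h _].
exact: (h v).
Qed.

(** Opposite sides of a small square are compared through the base point, which lies on neither in
    general: each of the two expansions costs at most [e (r + r)]. *)
Lemma diff2_side P x y p1 p2 e : 0 < e -> diff2 P x y p1 p2 ->
  exists2 dl, 0 < dl & forall u v h k, `|u - x| < dl -> `|v - y| < dl ->
    `|h| < dl -> `|k| < dl -> 
    forall r, `|u - x| <= r -> `|v - y| <= r -> `|h| <= r -> `|k| <= r ->
    `|P u v - P (x + h) (y + k) - p1 * (u - x - h) - p2 * (v - y - k)| <= 4 * e * r.
Proof.
move=> e0 /(_ e e0)[dl dl0 H]; exists dl => // u v h k ux vy hh hk r rx ry rh rk.
have H1 := H _ _ ux vy; have H2 := H _ _ hh hk.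
rewrite !subrKC in H1.
set A := (X in `|X| <= _) in H1; set B := (X in `|X| <= _) in H2.
have -> : P u v - P (x + h) (y + k) - p1 * (u - x - h) - p2 * (v - y - k) = A - B.
  by rewrite /A /B; ring.
have n := ler_normB A B.
have : e * (`|u - x| + `|v - y|) <= e * (r + r) by rewrite ler_wpM2l ?(ltW e0) // lerD.
have : e * (`|h| + `|k|) <= e * (r + r) by rewrite ler_wpM2l ?(ltW e0) // lerD.
lra.
Qed.

Lemma norm_sub_itv (u x t r : R) : u <= x -> x <= u + r -> u <= t -> t <= u + r ->
  `|t - x| <= r.
Proof. by move=> *; rewrite ler_norml; apply/andP; split; lra. Qed.

(** The difference of the two sides is additive under subdivision because the integrals over inner
    edges cancel, and it is [o(r^2)] at each point by differentiability there and continuity of [d];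
    [quadrisection] makes it vanish. The single partial derivatives need not be continuous, only
    their sum [d], which is what holomorphic functions provide. *)
Lemma divergence_square P Q d :
  (forall x y, exists p1 p2 q1 q2,
     [/\ diff2 P x y p1 p2, diff2 Q x y q1 q2 & d x y = p1 + q2]) ->
  cont2 d -> forall x y r, 0 < r ->
  \int[mu2]_(p in sq x y r r) d p.1 p.2 =
  \int[mu]_(t in `[y, y + r[) P (x + r) t - \int[mu]_(t in `[y, y + r[) P x t +
  (\int[mu]_(t in `[x, x + r[) Q t (y + r) - \int[mu]_(t in `[x, x + r[) Q t y).
Proof.
move=> H cd.
have cP : cont2 P.
  by apply: diff2_cont2 => x y; have [p1 [p2 [q1 [q2 [h _ _]]]]] := H x y; exists p1, p2.
have cQ : cont2 Q.
  by apply: diff2_cont2 => x y; have [p1 [p2 [q1 [q2 [_ h _]]]]] := H x y; exists q1, q2.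
have cPx x : continuous (P x) := cont2_slicel cP (x := x).
have cQy y : continuous (Q ^~ y) := cont2_slicer cQ (y := y).
move=> x0 y0 r0 r00; apply/eqP; rewrite -subr_eq0; apply/eqP.
pose J x y r := \int[mu2]_(p in sq x y r r) d p.1 p.2 -
 (\int[mu]_(t in `[y, y + r[) P (x + r) t - \int[mu]_(t in `[y, y + r[) P x t +
  (\int[mu]_(t in `[x, x + r[) Q t (y + r) - \int[mu]_(t in `[x, x + r[) Q t y)).
rewrite -/(J x0 y0 r0); apply: quadrisection => // [x y r rgt0|x y e e0].
  have r0' := ltW rgt0.
  have rr : 0 <= r + r by exact: addr_ge0.
  rewrite /J (Rintegral_sq_splitl x y cd r0' r0' rr).
  rewrite (Rintegral_sq_splitr x y cd r0' r0' r0').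
  rewrite (Rintegral_sq_splitr (x + r) y cd r0' r0' r0').
  rewrite !(Rintegral_split _ (cPx _) r0' r0') !(Rintegral_split _ (cQy _) r0' r0').
  by rewrite !addrA; ring.
have [p1 [p2 [q1 [q2 [hP hQ dE]]]]] := H x y.
(* The two pairs of sides cost [4 e' r^2] each and the area integral costs [e' r^2]. *)
pose e' := e / 9; have e'0 : 0 < e' by rewrite divr_gt0.
have [d1 d10 hd1] := diff2_side e'0 hP.
have [d2 d20 hd2] := diff2_side e'0 hQ.
have [d3 d30 hd3] := cd x y e' e'0.
exists (Num.min d1 (Num.min d2 d3)); first by rewrite !lt_min d10 d20.
move=> u v r; rewrite !lt_min => /and4P[rgt0 r1 r2 r3] /andP[ux xu] /andP[vy yv].
have r0' := ltW rgt0.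
have ur : u <= u + r by rewrite lerDl.
have vr : v <= v + r by rewrite lerDl.
have IP z w := integrable_itv w (cPx z) r0'.
have IQ z w := integrable_itv w (cQy z) r0'.
have b1 : `|\int[mu]_(t in `[v, v + r[) (P (u + r) t - P u t) - p1 * r * r| <= 4 * e' * r * r.
  apply: Rintegral_near_cst => //; first exact: lebesgue_itvco.
    by apply: (integrableB _ (IP _ _) (IP _ _)).
  move=> t /=; rewrite in_itv /= => /andP[t1 t2].
  have := hd1 (u + r) t (u - x) (t - y); rewrite !subrKC.
  have -> : u + r - x - (u - x) = r by ring.
  have t3 := norm_sub_itv vy yv t1 (ltW t2).
  have n1 := norm_sub_itv ux xu ur (lexx _); have n2 := norm_sub_itv ux xu (lexx _) ur.
  by rewrite subrr mulr0 subr0; apply => //; apply: le_lt_trans r1.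
have b2 : `|\int[mu]_(t in `[u, u + r[) (Q t (v + r) - Q t v) - q2 * r * r| <= 4 * e' * r * r.
  apply: Rintegral_near_cst => //; first exact: lebesgue_itvco.
    by apply: (integrableB _ (IQ _ _) (IQ _ _)).
  move=> t /=; rewrite in_itv /= => /andP[t1 t2].
  have := hd2 t (v + r) (t - x) (v - y); rewrite !subrKC.
  have -> : v + r - y - (v - y) = r by ring.
  have t3 := norm_sub_itv ux xu t1 (ltW t2).
  have n1 := norm_sub_itv vy yv vr (lexx _); have n2 := norm_sub_itv vy yv (lexx _) vr.
  by rewrite subrr mulr0 subr0; apply => //; apply: le_lt_trans r2.
have b3 : `|\int[mu2]_(p in sq u v r r) d p.1 p.2 - d x y * (r * r)| <= e' * (r * r).
  apply: Rintegral_near_cst; first exact: measurable_sq.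
  - exact: mu2_sq.
  - exact: integrable_sq.
  move=> [s t] [/=]; rewrite !in_itv /= => /andP[s1 s2] /andP[t1 t2].
  apply/ltW/hd3; apply: le_lt_trans r3.
    exact: (norm_sub_itv ux xu s1 (ltW s2)).
  exact: (norm_sub_itv vy yv t1 (ltW t2)).
rewrite RintegralB // in b1; rewrite RintegralB // in b2.
apply: le_trans (ler_norm_sub_add b1 b2 b3 _) _; first by rewrite dE; ring.
by rewrite le_eqVlt; apply/orP; left; apply/eqP; rewrite /e'; field.
Qed.

Lemma cont2_compact d (a b r : R) : 0 < r -> cont2 d ->
  (forall x y, ~ (a < x < a + r /\ b < y < b + r) -> d x y = 0) ->
  mu2.-integrable setT (EFin \o (fun p => d p.1 p.2)) /\
  \int[mu2]_p d p.1 p.2 = \int[mu2]_(p in sq a b r r) d p.1 p.2.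
Proof.
move=> r0 cd out.
have r0' := ltW r0.
have dE : (EFin \o (fun p : R * R => d p.1 p.2)) =
    (EFin \o (fun p => d p.1 p.2)) \_ (sq a b r r).
  apply/funext => -[x y]; rewrite /patch; case: ifPn => //.
  rewrite notin_setE => nxy /=; rewrite out //.
  move=> [/andP[h1 h2] /andP[h3 h4]]; apply: nxy.
  by split; rewrite /= in_itv /= ?(ltW h1) ?(ltW h3).
split.
  have [h _] := @integrable_mkcond _ _ R mu2 (sq a b r r)
    (EFin \o (fun p => d p.1 p.2)) (measurable_sq a b r r).
  by rewrite dE; exact: h (integrable_sq a b cd r0' r0').
rewrite /Rintegral.
have -> : (\int[mu2]_p (d p.1 p.2)%:E)%E = (\int[mu2]_(p in sq a b r r) (d p.1 p.2)%:E)%E.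
  rewrite [RHS]integral_mkcond; apply: eq_integral => p _.
  exact: (congr1 (fun f => f p) dE).
by [].
Qed.

(** All boundary terms vanish on a square that encloses the support. *)
Lemma divergence_compact P Q d (a b r : R) :
  0 < r ->
  (forall x y, exists p1 p2 q1 q2,
     [/\ diff2 P x y p1 p2, diff2 Q x y q1 q2 & d x y = p1 + q2]) ->
  cont2 d ->
  (forall x y, ~ (a < x < a + r /\ b < y < b + r) -> [/\ P x y = 0, Q x y = 0 & d x y = 0]) ->
  mu2.-integrable setT (EFin \o (fun p => d p.1 p.2)) /\
  \int[mu2]_p d p.1 p.2 = 0.
Proof.
move=> r0 H cd out.
have [i1 E] : mu2.-integrable setT (EFin \o (fun p => d p.1 p.2)) /\
    \int[mu2]_p d p.1 p.2 = \int[mu2]_(p in sq a b r r) d p.1 p.2.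
  by apply: cont2_compact => // x y /out[].
split=> //; rewrite E.
rewrite (divergence_square H cd) //.
have z1 t : P a t = 0 by case: (out a t) => //; rewrite ltxx => -[].
have z2 t : P (a + r) t = 0 by case: (out (a + r) t) => //; rewrite ltxx andbF => -[].
have z3 t : Q t b = 0 by case: (out t b) => //; rewrite ltxx => -[].
have z4 t : Q t (b + r) = 0 by case: (out t (b + r)) => //; rewrite ltxx andbF => -[].
have R0 (D : set R) (f : R -> R) : (forall t, f t = 0) -> \int[mu]_(t in D) f t = 0.
  move=> f0; rewrite /Rintegral; under eq_integral do rewrite f0.
  by rewrite integral0.
by rewrite !R0 // ?subrr ?addr0.
Qed.

End Divergence.

(** * Functions of one complex variable *)

Section AreaMeanValue.
Variable R : realType.
Local Notation C := R[i].
Local Notation mu2 := (@lebesgue_measure R \x @lebesgue_measure R)%E.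
Implicit Types (phi A B : C -> C) (a b c l z k : C).

Definition cderiv phi c l := forall e : R, 0 < e -> exists2 dl : R, 0 < dl &
  forall k, cabs k < dl -> cabs (phi (c + k) - phi c - l * k) <= e * cabs k.

(** Real differentiability in complex notation: [a] and [b] are the derivatives of [A] with respect
    to [z] and its conjugate, and [b = 0] is complex differentiability. *)
Definition wirtinger A c a b := forall e : R, 0 < e -> exists2 dl : R, 0 < dl &
  forall k, cabs k < dl ->
    cabs (A (c + k) - A c - a * k - b * conjc k) <= e * cabs k.

Lemma cderiv_wirtinger phi c l : cderiv phi c l -> wirtinger phi c l 0.
Proof.
by move=> h e /h[dl dl0 H]; exists dl => // k /H; rewrite mul0r subr0.
Qed.

Lemma wirtinger_cont A c a b : wirtinger A c a b -> forall e : R, 0 < e ->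
  exists2 dl : R, 0 < dl & forall k, cabs k < dl -> cabs (A (c + k) - A c) < e.
Proof.
move=> h e e0; have [dl dl0 H] := h 1 ltr01.
pose K := 2 + cabs a + cabs b.
have K0 : 0 < K by rewrite /K; have := cabs_ge0 a; have := cabs_ge0 b; lra.
exists (Num.min dl (e / K)); first by rewrite lt_min dl0 divr_gt0.
move=> k; rewrite lt_min ltr_pdivlMr // => /andP[/H h1 h2].
have -> : A (c + k) - A c = (A (c + k) - A c - a * k - b * conjc k) + a * k + b * conjc k.
  by ring.
have n1 := cabsD (A (c + k) - A c - a * k - b * conjc k + a * k) (b * conjc k).
have n2 := cabsD (A (c + k) - A c - a * k - b * conjc k) (a * k).
rewrite !cabsM cabs_conj in n1 n2.
have : cabs k * K = 2 * cabs k + cabs a * cabs k + cabs b * cabs k by rewrite /K; ring.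
have := cabs_ge0 k; lra.
Qed.

Lemma wirtingerM A B c a b a' b' : wirtinger A c a b -> wirtinger B c a' b' ->
  wirtinger (fun z => A z * B z) c (a * B c + A c * a') (b * B c + A c * b').
Proof.
move=> hA hB e e0.
pose K := 1 + cabs (B c) + cabs a + cabs b + cabs (A c).
have K0 : 0 < K.
  rewrite /K; have := cabs_ge0 (B c); have := cabs_ge0 a; have := cabs_ge0 b.
  by have := cabs_ge0 (A c); lra.
have eK : 0 < e / (2 * K) by rewrite divr_gt0 // mulr_gt0.
have [d1 d10 H1] := hA _ eK; have [d2 d20 H2] := hB _ eK.
have m0 : 0 < Num.min 1 (e / (2 * K)) by rewrite lt_min ltr01.
have [d3 d30 H3] := wirtinger_cont hB m0.
exists (Num.min d1 (Num.min d2 d3)); first by rewrite !lt_min d10 d20.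
move=> k; rewrite !lt_min => /and3P[/H1 h1 /H2 h2 /H3].
rewrite lt_min => /andP[h3 h4].
set E1 := (X in cabs X <= _) in h1; set E2 := (X in cabs X <= _) in h2.
set D := (X in cabs X < _) in h3 h4.
have -> : A (c + k) * B (c + k) - A c * B c - (a * B c + A c * a') * k -
   (b * B c + A c * b') * conjc k =
   E1 * (B c + D) + (a * k + b * conjc k) * D + A c * E2.
  by rewrite /E1 /D /E2; ring.
have n1 := cabsD (E1 * (B c + D) + (a * k + b * conjc k) * D) (A c * E2).
have n2 := cabsD (E1 * (B c + D)) ((a * k + b * conjc k) * D).
have n3 := cabsD (B c) D.
have n4 := cabsD (a * k) (b * conjc k).
rewrite !cabsM ?cabs_conj in n1 n2 n4.
set q := e / (2 * K) in eK h1 h2 h4.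
have q1 : cabs E1 * cabs (B c + D) <= q * cabs k * (cabs (B c) + 1).
  by apply: ler_pM; rewrite ?cabs_ge0 //; lra.
have q2 : cabs (a * k + b * conjc k) * cabs D <= (cabs a * cabs k + cabs b * cabs k) * q.
  by apply: ler_pM; rewrite ?cabs_ge0 //; exact: ltW.
have q3 : cabs (A c) * cabs E2 <= cabs (A c) * (q * cabs k) by rewrite ler_wpM2l ?cabs_ge0.
have : q * cabs k * (cabs (B c) + 1) + (cabs a * cabs k + cabs b * cabs k) * q +
   cabs (A c) * (q * cabs k) = e / 2 * cabs k.
  have -> : e / 2 = q * K by rewrite /q; field; rewrite gt_eqF.
  by rewrite /K; ring.
have : 0 <= e / 2 * cabs k by rewrite mulr_ge0 ?cabs_ge0 // ltW ?divr_gt0.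
lra.
Qed.

Lemma wirtinger_ext A B c a b (r : R) : 0 < r ->
  (forall z, cabs (z - c) < r -> A z = B z) ->
  wirtinger A c a b -> wirtinger B c a b.
Proof.
move=> r0 AB h e /h[dl dl0 H]; exists (Num.min dl r); first by rewrite lt_min dl0.
move=> k; rewrite lt_min => /andP[/H h1 h2].
rewrite -!AB ?subrr ?cabs0 //; by rewrite addrC addKr.
Qed.

Lemma wirtinger_cst c0 c : wirtinger (fun=> c0) c 0 0.
Proof.
move=> e e0; exists 1 => // k _.
by rewrite !mul0r !subr0 subrr cabs0 mulr_ge0 ?cabs_ge0 // ltW.
Qed.

Lemma cderivV c : c != 0 -> cderiv (fun z => z^-1) c (- (c^-1 ^+ 2)).
Proof.
move=> c0 e e0; have cc0 : 0 < cabs c by rewrite cabs_gt0.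
exists (Num.min (cabs c / 2) (e * (cabs c ^+ 3 / 2))).
  by rewrite lt_min !divr_gt0 // mulr_gt0 // divr_gt0 // exprn_gt0.
move=> k; rewrite lt_min => /andP[h1 h2].
have hck : cabs c / 2 <= cabs (c + k).
  have := cabsB (c + k) k; rewrite addrK; lra.
have ck0 : c + k != 0.
  by rewrite -cabs_gt0; apply: lt_le_trans hck; rewrite divr_gt0.
have -> : (c + k)^-1 - c^-1 - - c^-1 ^+ 2 * k = k * (k * (c^-1 ^+ 2 * (c + k)^-1)).
  by field; rewrite c0 ck0.
rewrite cabsM mulrC ler_wpM2r ?cabs_ge0 // cabsM cabsM cabsV expr2 cabsM cabsV.
have ckp : 0 < cabs (c + k) by rewrite cabs_gt0.
have : ((cabs c)^-1 * (cabs c)^-1 * (cabs (c + k))^-1) <= (cabs c ^+ 3 / 2)^-1.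
  rewrite -!invfM lef_pV2 ?posrE ?divr_gt0 ?exprn_gt0 ?mulr_gt0 //.
  have -> : cabs c ^+ 3 / 2 = cabs c * cabs c * (cabs c / 2) by ring.
  by rewrite ler_wpM2l ?mulr_ge0 ?cabs_ge0.
move=> h3; apply: le_trans (_ : e * (cabs c ^+ 3 / 2) * (cabs c ^+ 3 / 2)^-1 <= _).
  by apply: ler_pM; rewrite ?cabs_ge0 ?mulr_ge0 ?invr_ge0 ?cabs_ge0 // ltW.
by rewrite mulfK // gt_eqF // divr_gt0 // exprn_gt0.
Qed.

Definition pos (s : R) := Num.max s 0.

Lemma pos_ge0 s : 0 <= pos s. Proof. by rewrite /pos le_max lexx orbT. Qed.

(** First-order Taylor estimate for the cube of the positive part, whose derivative is
    [3 * pos s ^+ 2]; the bound is uniform across the change of formula at zero. *)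
Lemma pos_cube s h : `|pos (s + h) ^+ 3 - pos s ^+ 3 - 3 * pos s ^+ 2 * h| <=
  3 * `|s| * h ^+ 2 + `|h| ^+ 3.
Proof.
rewrite /pos.
have pa : 0 <= 3 * `|s| * h ^+ 2 by apply: mulr_ge0 (sqr_ge0 _); exact: mulr_ge0.
have pb : 0 <= `|h| ^+ 3 by rewrite exprn_ge0.
have [s0|s0] := leP s 0; have [sh|sh] := leP (s + h) 0.
- have -> : (0 : R) ^+ 3 - 0 ^+ 3 - 3 * 0 ^+ 2 * h = 0 by ring.
  by rewrite normr0 addr_ge0.
- have -> : (s + h) ^+ 3 - 0 ^+ 3 - 3 * 0 ^+ 2 * h = (s + h) ^+ 3 by ring.
  have h0 : 0 <= h by lra.
  rewrite (ger0_norm h0) ger0_norm ?exprn_ge0 ?(ltW sh) //.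
  have : (s + h) ^+ 3 <= h ^+ 3 by rewrite lerXn2r ?nnegrE //; lra.
  lra.
- have -> : (0 : R) ^+ 3 - s ^+ 3 - 3 * s ^+ 2 * h = - s ^+ 3 - 3 * s ^+ 2 * h by ring.
  rewrite (gtr0_norm s0).
  have h0 : h < 0 by lra.
  have : s * (- h) * s <= s * (-h) * (-h) by rewrite ler_wpM2l ?mulr_ge0; lra.
  have : s * s * s <= s * s * (-h) by rewrite ler_wpM2l ?mulr_ge0; lra.
  have : 0 <= s * s * s by rewrite !mulr_ge0 // ltW.
  move=> a1 a2 a3; rewrite ler_norml.
  have -> : - s ^+ 3 - 3 * s ^+ 2 * h = - (s * s * s) + 3 * (s * (-h) * s) by ring.
  have -> : 3 * s * h ^+ 2 = 3 * (s * (-h) * (-h)) by ring.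
  by apply/andP; split; lra.
- rewrite (gtr0_norm s0).
  have -> : (s + h) ^+ 3 - s ^+ 3 - 3 * s ^+ 2 * h = 3 * s * h ^+ 2 + h ^+ 3 by ring.
  apply: le_trans (ler_normD _ _) _; rewrite normrX lerD2r ger0_norm //.
  by rewrite gtr0_norm in pa.
Qed.

Definition sqd c z : R := cabs (z - c) ^+ 2.

Lemma sqd_shift c z k : sqd c (z + k) = sqd c z +
  2 * complex.Re (conjc (z - c) * k) + cabs k ^+ 2.
Proof.
by rewrite /sqd !sqr_cabs; case: z k c => ? ? [? ?] [? ?] /=; ring.
Qed.

(** The conjugate derivative is [-3 (z - c)] times the squared positive part of [r - |z-c|^2]. After
    division by [z - c] this is the averaging kernel, so the cube is the potential from which the
    mean value property is read off. *)
Lemma wirtinger_pos_cube (r : R) c z : 0 < r ->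
  wirtinger (fun z => ((pos (r - sqd c z) ^+ 3)%:C)%C) z
    (((- 3 * pos (r - sqd c z) ^+ 2)%:C)%C * conjc (z - c))
    (((- 3 * pos (r - sqd c z) ^+ 2)%:C)%C * (z - c)).
Proof.
move=> r0 e e0.
pose s := r - sqd c z; pose w := cabs (z - c).
have w0 : 0 <= w := cabs_ge0 _.
pose K := 3 * `|s| * (2 * w + 1) ^+ 2 + (2 * w + 1) ^+ 3 + 3 * pos s ^+ 2.
have w1 : 0 < 2 * w + 1 by lra.
have K0 : 0 < K.
  have : 0 <= 3 * `|s| * (2 * w + 1) ^+ 2.
    by apply: mulr_ge0 (sqr_ge0 _); exact: mulr_ge0.
  have : 0 < (2 * w + 1) ^+ 3 by rewrite exprn_gt0.
  have : 0 <= 3 * pos s ^+ 2 by rewrite mulr_ge0 ?sqr_ge0.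
  rewrite /K; lra.
exists (Num.min 1 (e / K)); first by rewrite lt_min ltr01 divr_gt0.
move=> k; rewrite lt_min ltr_pdivlMr // => /andP[k1 k2].
pose h := - (2 * complex.Re (conjc (z - c) * k) + cabs k ^+ 2).
have k0 := cabs_ge0 k.
have sh : r - sqd c (z + k) = s + h by rewrite sqd_shift /s /h; ring.
rewrite sh -/s.
have -> : ((pos (s + h) ^+ 3)%:C)%C - ((pos s ^+ 3)%:C)%C -
  ((- 3 * pos s ^+ 2)%:C)%C * conjc (z - c) * k -
  ((- 3 * pos s ^+ 2)%:C)%C * (z - c) * conjc k =
  ((pos (s + h) ^+ 3 - pos s ^+ 3 - 3 * pos s ^+ 2 * h - 3 * pos s ^+ 2 * cabs k ^+ 2)%:C)%C.
  rewrite /h sqr_cabs; move: (z - c) => [z1 z2]; case: (k) => x y.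
  by apply: complexP; rewrite /=; ring.
rewrite cabs_real.
have hk : `|h| <= (2 * w + 1) * cabs k.
  rewrite normrN; apply: le_trans (ler_normD _ _) _.
  rewrite normrM (ger0_norm (ler0n _ 2)) (ger0_norm (sqr_ge0 _)).
  have -> : (2 * w + 1) * cabs k = 2 * (w * cabs k) + cabs k by ring.
  have := le_Re_cabs (conjc (z - c) * k); rewrite cabsM cabs_conj -/w => h1.
  have : cabs k ^+ 2 <= cabs k by rewrite expr2 ler_piMr // ltW.
  lra.
have kk : cabs k ^+ 2 <= cabs k by rewrite expr2 ler_piMr // ltW.
have hh2 : h ^+ 2 <= (2 * w + 1) ^+ 2 * cabs k ^+ 2.
  rewrite -exprMn -(real_normK (num_real h)) lerXn2r ?nnegrE //.
  by rewrite mulr_ge0 // ltW.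
have hh3 : `|h| ^+ 3 <= (2 * w + 1) ^+ 3 * cabs k ^+ 2.
  apply: (@le_trans _ _ (((2 * w + 1) * cabs k) ^+ 3)).
    by rewrite lerXn2r ?nnegrE // mulr_ge0 // ltW.
  rewrite exprMn ler_wpM2l ?exprn_ge0 ?(ltW w1) //.
  by rewrite (exprS _ 2) ler_piMl ?sqr_ge0 // ltW.
apply: le_trans (ler_normB _ _) _.
have := pos_cube s h.
have : 3 * `|s| * h ^+ 2 <= 3 * `|s| * ((2 * w + 1) ^+ 2 * cabs k ^+ 2).
  by rewrite ler_wpM2l // mulr_ge0.
rewrite [`|3 * _ * _|]ger0_norm; last first.
  by apply: mulr_ge0 (sqr_ge0 _); apply: mulr_ge0 (sqr_ge0 _).
have : K * cabs k ^+ 2 <= e * cabs k.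
  by rewrite expr2 mulrA ler_wpM2r // mulrC ltW.
have -> : K * cabs k ^+ 2 = 3 * `|s| * ((2 * w + 1) ^+ 2 * cabs k ^+ 2) +
   (2 * w + 1) ^+ 3 * cabs k ^+ 2 + 3 * pos s ^+ 2 * cabs k ^+ 2 by rewrite /K; ring.
lra.
Qed.

(** The field [(Re A, - Im A)] has divergence [2 Re b]: the contributions of [a] cancel. Its
    vanishing for [b = 0] is one of the Cauchy-Riemann equations. *)
Lemma wirtinger_diff2 A (x y : R) a b : wirtinger A (Complex x y) a b ->
  diff2 (fun x y => complex.Re (A (Complex x y))) x y
    (complex.Re a + complex.Re b) (complex.Im b - complex.Im a) /\
  diff2 (fun x y => - complex.Im (A (Complex x y))) x y
    (- complex.Im a - complex.Im b) (complex.Re b - complex.Re a).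
Proof.
move=> hA; split => e e0; have [dl dl0 H] := hA e e0; (exists (dl / 2);
  first by rewrite divr_gt0) => h k hh hk;
  have ck : cabs (Complex h k) <= `|h| + `|k| := cabs_le_ReIm (Complex h k);
  (have ckd : cabs (Complex h k) < dl by lra);
  have H1 := H _ ckd.
- apply: (@le_trans _ _ (e * cabs (Complex h k))); last by rewrite ler_wpM2l // ltW.
  apply: le_trans H1; apply: le_trans (le_Re_cabs _).
  rewrite !(ReD, ReN, ReM) /=.
  rewrite le_eqVlt; apply/orP; left; apply/eqP; congr (`| _ |); ring.
- apply: (@le_trans _ _ (e * cabs (Complex h k))); last by rewrite ler_wpM2l // ltW.
  apply: le_trans H1; apply: le_trans (le_Im_cabs _).
  rewrite !(ImD, ImN, ImM) /= -normrN.
  rewrite le_eqVlt; apply/orP; left; apply/eqP; congr (`| _ |); ring.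
Qed.

End AreaMeanValue.

(** * The mean value property for weighted averages over a disc *)

Section AreaMeanValueTheorem.
Variable R : realType.
Local Notation C := R[i].
Local Notation mu2 := (@lebesgue_measure R \x @lebesgue_measure R)%E.
Implicit Types (phi : C -> C) (w v : C -> R) (c l z k : C) (r s : R).

Definition cont_at w z := forall e : R, 0 < e -> exists2 dl : R, 0 < dl &
  forall k, cabs k < dl -> `|w (z + k) - w z| < e.

Lemma cont_at_cont2 w : (forall z, cont_at w z) -> cont2 (fun x y => w (Complex x y)).
Proof.
move=> cw x y e e0; have [dl dl0 H] := cw (Complex x y) e e0.
exists (dl / 2); first by rewrite divr_gt0.
move=> x' y' hx hy.
have ck : cabs (Complex (x' - x) (y' - y)) <= `|x' - x| + `|y' - y| := cabs_le_ReIm _.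
have := H (Complex (x' - x) (y' - y)); rewrite (_ : _ + _ = Complex x' y').
  by apply; lra.
by apply: complexP => /=; rewrite subrKC.
Qed.

Lemma cont_atM w v z : cont_at w z -> cont_at v z -> cont_at (fun z => w z * v z) z.
Proof.
move=> hw hv e e0.
pose K := 1 + `|w z| + `|v z|.
have K0 : 0 < K by rewrite /K; have := normr_ge0 (w z); have := normr_ge0 (v z); lra.
have m0 : 0 < Num.min 1 (e / (2 * K)) by rewrite lt_min ltr01 divr_gt0 // mulr_gt0.
have [d1 d10 H1] := hw _ m0; have [d2 d20 H2] := hv _ m0.
exists (Num.min d1 d2); first by rewrite lt_min d10.
move=> k; rewrite lt_min => /andP[/H1 + /H2]; rewrite !lt_min => /andP[a1 a2] /andP[b1 b2].
set a := w (z + k) - w z in a1 a2; set b := v (z + k) - v z in b1 b2.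
have -> : w (z + k) * v (z + k) - w z * v z = a * b + a * v z + w z * b.
  by rewrite /a /b; ring.
have n1 := ler_normD (a * b + a * v z) (w z * b).
have n2 := ler_normD (a * b) (a * v z).
rewrite !normrM in n1 n2.
set q := e / (2 * K) in m0 a2 b2.
have q1 : `|a| * `|b| <= 1 * q by apply: ler_pM => //; exact: ltW.
have q2 : `|a| * `|v z| <= q * `|v z| by rewrite ler_wpM2r // ltW.
have q3 : `|w z| * `|b| <= `|w z| * q by rewrite ler_wpM2l // ltW.
have : 1 * q + q * `|v z| + `|w z| * q = e / 2.
  by rewrite /q /K; field; rewrite gt_eqF.
lra.
Qed.

Lemma cont_atD w v z : cont_at w z -> cont_at v z -> cont_at (fun z => w z + v z) z.
Proof.
move=> hw hv e e0; have e2 : 0 < e / 2 by rewrite divr_gt0.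
have [d1 d10 H1] := hw _ e2; have [d2 d20 H2] := hv _ e2.
exists (Num.min d1 d2); first by rewrite lt_min d10.
move=> k; rewrite lt_min => /andP[/H1 a /H2 b].
have -> : w (z + k) + v (z + k) - (w z + v z) = (w (z + k) - w z) + (v (z + k) - v z).
  by ring.
have := ler_normD (w (z + k) - w z) (v (z + k) - v z); lra.
Qed.

Lemma cont_at_cst (x : R) z : cont_at (fun=> x) z.
Proof. by move=> e e0; exists 1 => // k _; rewrite subrr normr0. Qed.

Lemma cont_at_ext w v z (dl : R) : 0 < dl ->
  (forall k, cabs k < dl -> w (z + k) = v (z + k)) -> cont_at w z -> cont_at v z.
Proof.
move=> dl0 wv hw e /hw[d d0 H]; exists (Num.min d dl); first by rewrite lt_min d0.
move=> k; rewrite lt_min => /andP[/H h1 h2]; rewrite -wv //.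
have := wv 0; rewrite addr0 => <- //; by rewrite cabs0.
Qed.

Lemma cont_at_Re phi z a b : wirtinger phi z a b ->
  cont_at (fun z => complex.Re (phi z)) z.
Proof.
move=> /wirtinger_cont h e /h[dl dl0 H]; exists dl => // k /H.
by rewrite -ReN -ReD; apply: le_lt_trans (le_Re_cabs _).
Qed.

Lemma cont_at_cabs phi z a b : wirtinger phi z a b ->
  cont_at (fun z => cabs (phi z)) z.
Proof.
move=> /wirtinger_cont h e /h[dl dl0 H]; exists dl => // k /H.
apply: le_lt_trans; have := cabsD (phi (z + k) - phi z) (phi z).
have := cabsD (phi z - phi (z + k)) (phi (z + k)).
rewrite !subrK (cabs_distC (phi z)) => h1 h2.
by rewrite ler_norml; apply/andP; split; lra.
Qed.

Lemma sqd_cont c z : cont_at (sqd c) z.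
Proof.
have h : cont_at (fun z => cabs (z - c)) z.
  apply: (@cont_at_cabs (fun z => z - c) z 1 0) => e e0; exists 1 => // k _.
  rewrite mul1r mul0r subr0 (_ : _ - _ = 0); last by ring.
  by rewrite cabs0 mulr_ge0 ?cabs_ge0 // ltW.
rewrite (_ : sqd c = fun z => cabs (z - c) * cabs (z - c)); first exact: cont_atM.
by apply/funext => u; rewrite /sqd expr2.
Qed.

Lemma pos_lip s t : `|pos s - pos t| <= `|s - t|.
Proof.
rewrite /pos; have [s0|s0] := leP s 0; have [t0|t0] := leP t 0; rewrite ?subrr ?normr0 //.
- by rewrite sub0r normrN gtr0_norm // ler0_norm; lra.
- by rewrite subr0 gtr0_norm // ger0_norm; lra.
Qed.

Lemma cont_at_pos w z : cont_at w z -> cont_at (fun z => pos (w z)) z.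
Proof.
by move=> hw e /hw[dl dl0 H]; exists dl => // k /H; apply: le_lt_trans (pos_lip _ _).
Qed.

(** The averaging kernel. Here, as in [hol_disc] and [cut_pow], [r] is the square of a radius. *)
Definition kap r c z : R := pos (r - sqd c z) ^+ 2.

Lemma kap_ge0 r c z : 0 <= kap r c z. Proof. exact: sqr_ge0. Qed.

Lemma kap_eq0 r c z : r <= sqd c z -> kap r c z = 0.
Proof.
by move=> h; rewrite /kap /pos max_r ?subr_le0 // expr0n.
Qed.

Lemma cont_at_bump r c z : cont_at (fun z => pos (r - sqd c z)) z.
Proof.
apply: cont_at_pos; apply: cont_atD; first exact: cont_at_cst.
rewrite (_ : (fun _ => _) = fun z => -1 * sqd c z); last first.
  by apply/funext => u; rewrite mulN1r.
by apply: cont_atM; [exact: cont_at_cst|exact: sqd_cont].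
Qed.

Lemma cont_at_kap r c z : cont_at (kap r c) z.
Proof.
rewrite (_ : kap r c = fun z => pos (r - sqd c z) * pos (r - sqd c z)); last first.
  by apply/funext => u; rewrite /kap expr2.
by apply: cont_atM; exact: cont_at_bump.
Qed.

Lemma sqd_ge0 c z : 0 <= sqd c z. Proof. exact: sqr_ge0. Qed.

Lemma sqd_xy c x y : sqd c (Complex x y) =
  (x - complex.Re c) ^+ 2 + (y - complex.Im c) ^+ 2.
Proof. by rewrite /sqd sqr_cabs; case: c. Qed.

Lemma outside_square c (x y a : R) : 0 < a ->
  ~ (complex.Re c - a < x < complex.Re c - a + 2 * a /\
     complex.Im c - a < y < complex.Im c - a + 2 * a) ->
  a ^+ 2 <= sqd c (Complex x y).
Proof.
move=> a0 h; rewrite leNgt; apply/negP; rewrite sqd_xy => h1; apply: h.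
have key (u v : R) : (u - v) ^+ 2 < a ^+ 2 -> v - a < u < v - a + 2 * a.
  rewrite -(real_normK (num_real (u - v))) ltr_pXn2r ?nnegrE ?(ltW a0) //.
  by rewrite ltr_norml => /andP[? ?]; apply/andP; split; lra.
split; apply: key; apply: le_lt_trans h1; [rewrite lerDl|rewrite lerDr]; exact: sqr_ge0.
Qed.

Lemma disc_cont w v c r r' : r < r' ->
  (forall z, sqd c z < r' -> cont_at w z) ->
  (forall z, cont_at v z) -> (forall z, r <= sqd c z -> v z = 0) ->
  forall z, cont_at (fun z => w z * v z) z.
Proof.
move=> rr' hw hv v0 z.
have [zr|zr] := ltP (sqd c z) r'; first by apply: cont_atM; [exact: hw|exact: hv].
have e0 : 0 < r' - r by rewrite subr_gt0.
have [dl dl0 H] := sqd_cont c z e0.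
apply: (@cont_at_ext (fun=> 0) _ _ dl) => //; last exact: cont_at_cst.
move=> k /H; rewrite ltr_norml => /andP[h _]; rewrite v0 ?mulr0 //; lra.
Qed.

Lemma disc_integral w v c r r' (a : R) : 0 < a -> r < r' -> r <= a ^+ 2 ->
  (forall z, sqd c z < r' -> cont_at w z) ->
  (forall z, cont_at v z) -> (forall z, r <= sqd c z -> v z = 0) ->
  mu2.-integrable setT (EFin \o (fun p => w (Complex p.1 p.2) * v (Complex p.1 p.2))) /\
  \int[mu2]_p (w (Complex p.1 p.2) * v (Complex p.1 p.2)) =
  \int[mu2]_(p in sq (complex.Re c - a) (complex.Im c - a) (2 * a) (2 * a))
    (w (Complex p.1 p.2) * v (Complex p.1 p.2)).
Proof.
move=> a0 rr' ra hw hv v0.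
apply: (@cont2_compact R (fun x y => w (Complex x y) * v (Complex x y))
  (complex.Re c - a) (complex.Im c - a) (2 * a)).
- by rewrite mulr_gt0.
- apply: (@cont_at_cont2 (fun z => w z * v z)).
  exact: (disc_cont rr' hw hv v0).
- by move=> x y /outside_square - /(_ a0) h; rewrite v0 ?mulr0 //; exact: le_trans h.
Qed.

Definition hol_disc phi c r := forall z, sqd c z < r -> exists l, cderiv phi z l.

Lemma wirtingerB A B c a b a' b' : wirtinger A c a b -> @wirtinger R B c a' b' ->
  wirtinger (fun z => A z - B z) c (a - a') (b - b').
Proof.
move=> hA hB e e0; have e2 : 0 < e / 2 by rewrite divr_gt0.
have [d1 d10 H1] := hA _ e2; have [d2 d20 H2] := hB _ e2.
exists (Num.min d1 d2); first by rewrite lt_min d10.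
move=> k; rewrite lt_min => /andP[/H1 h1 /H2 h2].
set X := (Y in cabs Y <= _) in h1; set Z := (Y in cabs Y <= _) in h2.
have -> : A (c + k) - B (c + k) - (A c - B c) - (a - a') * k - (b - b') * conjc k = X - Z.
  by rewrite /X /Z; ring.
have := cabsB X Z; lra.
Qed.

(** The natural field is [(phi - phi c) / (z - c)] times the cubed bump, with a possible defect of
    differentiability at [c]. Taking the difference [M] of the bumps for [s] and [r], each
    normalized to [1] at [c], removes it: [M] vanishes at [c] to second order and outside the larger
    disc. The divergence of the field is then the difference of the two normalized integrands, up to
    the common factor [6]. *)
Lemma Rintegral_kap_cmp phi c r s r' : 0 < s < r -> r < r' -> hol_disc phi c r' ->
  let F t := \int[mu2]_p (complex.Re (phi (Complex p.1 p.2) - phi c) * kap t c (Complex p.1 p.2)) in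
  F r / r ^+ 3 = F s / s ^+ 3.
Proof.
move=> /andP[s0 sr] rr' hol.
have r0 : 0 < r := lt_trans s0 sr.
have r'0 : 0 < r' := lt_trans r0 rr'.
have s3 : 0 < s ^+ 3 by rewrite exprn_gt0.
have r3 : 0 < r ^+ 3 by rewrite exprn_gt0.
pose cub t z : C := ((pos (t - sqd c z) ^+ 3)%:C)%C.
pose i3 t : C := ((t ^- 3)%:C)%C.
pose M z := i3 s * cub s z - i3 r * cub r z.
pose K t z : R := - 3 * kap t c z / t ^+ 3.
have cc : sqd c c = 0 by rewrite /sqd subrr cabs0 expr0n.
have wM z : wirtinger M z (((K s z - K r z)%:C)%C * conjc (z - c))
    (((K s z - K r z)%:C)%C * (z - c)).
  have h t : 0 < t -> wirtinger (fun z => i3 t * cub t z) z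
      (((K t z)%:C)%C * conjc (z - c)) (((K t z)%:C)%C * (z - c)).
    move=> t0; have := wirtingerM (wirtinger_cst (i3 t) z) (wirtinger_pos_cube c z t0).
    rewrite !mul0r !add0r.
    have E u : i3 t * (((- 3 * pos (t - sqd c z) ^+ 2)%:C)%C * u) = ((K t z)%:C)%C * u.
      rewrite mulrA /i3 -rmorphM /K /kap; congr ((_%:C)%C * _); ring.
    by rewrite !E.
  have := wirtingerB (h s s0) (h r r0).
  by rewrite -!mulrBl -rmorphB.
have Mc : M c = 0.
  rewrite /M /cub cc !subr0 /pos !max_l ?(ltW s0) ?(ltW r0) //.
  by rewrite /i3 -!rmorphM !mulVf ?gt_eqF // subrr.
have Mfar z : r <= sqd c z -> M z = 0.
  move=> h; rewrite /M /cub /pos !max_r ?subr_le0 //; last exact: le_trans (ltW sr) h.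
  by rewrite expr0n /= !mulr0 subrr.
pose A z := (phi z - phi c) * ((z - c)^-1 * M z).
pose b z := (phi z - phi c) * ((K s z - K r z)%:C)%C.
have wA z : exists a, wirtinger A z a (b z).
  have [zr|zr] := ltP (sqd c z) r'; last first.
    exists 0; have -> : b z = 0.
      rewrite /b /K !kap_eq0 ?(le_trans _ zr) ?(ltW rr') //; last first.
        by apply: ltW; apply: lt_trans rr'.
      by rewrite mulr0 !mul0r subrr mulr0.
    have e0 : 0 < r' - r by rewrite subr_gt0.
    have [dl dl0 H] := sqd_cont c z e0.
    apply: (@wirtinger_ext _ (fun=> 0) _ _ _ _ dl dl0); last exact: wirtinger_cst.
    move=> u /H; rewrite subrKC ltr_norml => /andP[h _].
    by rewrite /A Mfar ?mulr0 //; lra.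
  have [l hl] := hol z zr.
  have wphi : wirtinger (fun z => phi z - phi c) z l 0.
    have := wirtingerB (cderiv_wirtinger hl) (wirtinger_cst (phi c) z).
    by rewrite !subr0.
  have [zc|zc] := eqVneq z c; last first.
    have zc0 : z - c != 0 by rewrite subr_eq0.
    have hV : wirtinger (fun z => (z - c)^-1) z (- ((z - c)^-1 ^+ 2)) 0.
      apply: cderiv_wirtinger => e /(cderivV zc0)[dl dl0 H]; exists dl => // k /H.
      by rewrite (_ : z + k - c = z - c + k); last by ring.
    have := wirtingerM wphi (wirtingerM hV (wM z)).
    set a := (X in wirtinger _ _ X _); exists a.
    have -> : b z = 0 * ((z - c)^-1 * M z) + (phi z - phi c) *
        (0 * M z + (z - c)^-1 * (((K s z - K r z)%:C)%C * (z - c))).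
      by rewrite /b !mul0r !add0r; congr (_ * _); field.
    by [].
  subst z; exists 0; have -> : b c = 0 by rewrite /b subrr mul0r.
  have [d1 d10 H1] := wirtinger_cont (wM c) ltr01.
  move=> e e0.
  (* [M] vanishes to second order at [c], so [A] is [o(k)] there *)
  pose L := 3 / s + 3 / s ^+ 2 + s ^- 3 + (3 / r + 3 / r ^+ 2 + r ^- 3).
  have Lp : 0 < L.
    by rewrite /L !addr_gt0 ?divr_gt0 ?invr_gt0 ?exprn_gt0.
  have hM k : cabs k < 1 -> cabs (M (c + k)) <= L * cabs k ^+ 2.
    move=> k1.
    have tau : sqd c (c + k) = cabs k ^+ 2 by rewrite /sqd (addrC c) addrK.
    set t := cabs k ^+ 2 in tau *.
    have t0 : 0 <= t by rewrite sqr_ge0.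
    have t1 : t <= 1 by rewrite expr_le1 ?cabs_ge0 // ltW.
    have h q : 0 < q -> cabs (i3 q * cub q (c + k) - 1) <= (3 / q + 3 / q ^+ 2 + q ^- 3) * t.
      move=> q0; have q3 : 0 < q ^+ 3 by rewrite exprn_gt0.
      have -> : i3 q * cub q (c + k) - 1 =
          (((pos (q - t) ^+ 3 - q ^+ 3) * q ^- 3)%:C)%C.
        have -> : (pos (q - t) ^+ 3 - q ^+ 3) * q ^- 3 = q ^- 3 * pos (q - t) ^+ 3 - 1.
          by field; rewrite gt_eqF.
        by rewrite rmorphB rmorphM rmorph1 /i3 /cub tau.
      rewrite cabs_real normrM (gtr0_norm (x := q ^- 3)) ?invr_gt0 //.
      have := pos_cube q (- t); rewrite normrN (ger0_norm t0) (gtr0_norm q0).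
      have -> : pos q = q by rewrite /pos max_l // ltW.
      rewrite sqrrN => h1.
      have h2 : `|pos (q - t) ^+ 3 - q ^+ 3| <= (3 * q ^+ 2 + 3 * q + 1) * t.
        have := ler_normD (pos (q - t) ^+ 3 - q ^+ 3 - 3 * q ^+ 2 * (- t)) (3 * q ^+ 2 * (- t)).
        rewrite subrK normrM normrN (ger0_norm t0) ger0_norm; last first.
          by apply: mulr_ge0 (sqr_ge0 _).
        have tt : t ^+ 2 <= t by rewrite expr2 ler_piMr.
        have ttt : t ^+ 3 <= t.
          by rewrite exprS ler_piMr // expr_le1.
        have : 3 * q * t ^+ 2 <= 3 * q * t by rewrite ler_wpM2l // mulr_ge0 // ltW.
        lra.
      apply: le_trans (_ : (3 * q ^+ 2 + 3 * q + 1) * t * q ^- 3 <= _).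
        by rewrite ler_wpM2r // invr_ge0 ltW.
      rewrite le_eqVlt; apply/orP; left; apply/eqP; field; by rewrite gt_eqF.
    have -> : M (c + k) = (i3 s * cub s (c + k) - 1) - (i3 r * cub r (c + k) - 1).
      by rewrite /M; ring.
    apply: le_trans (cabsB _ _) _; rewrite /L mulrDl; apply: lerD; exact: h.
  have eL : 0 < e / L by rewrite divr_gt0.
  have [d2 d20 H2] := wirtinger_cont wphi eL.
  exists (Num.min 1 d2); first by rewrite lt_min ltr01.
  move=> k; rewrite lt_min => /andP[/hM h1 /H2 h2].
  have -> : A c = 0 by rewrite /A subrr mul0r.
  rewrite !mul0r !subr0 /A !cabsM cabsV addrAC subrr add0r.
  have -> : phi (c + k) - phi c = phi (c + k) - phi c - (phi c - phi c) by rewrite subrr subr0.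
  have [k0|k0] := eqVneq (cabs k) 0; first by rewrite k0 invr0 mul0r !mulr0.
  have kp : 0 < cabs k by rewrite lt_def k0 cabs_ge0.
  have h3 : (cabs k)^-1 * cabs (M (c + k)) <= L * cabs k.
    by rewrite mulrC ler_pdivrMr // -mulrA -expr2.
  apply: le_trans (_ : e / L * (L * cabs k) <= _).
    by apply: ler_pM; rewrite ?mulr_ge0 ?invr_ge0 ?cabs_ge0 //; exact: ltW.
  by rewrite mulrA divfK // gt_eqF.
have re_cont z : sqd c z < r' -> cont_at (fun z => complex.Re (phi z - phi c)) z.
  move=> zr; have [l hl] := hol z zr.
  apply: (cont_at_Re (a := l) (b := 0)).
  have := wirtingerB (cderiv_wirtinger hl) (wirtinger_cst (phi c) z).
  by rewrite !subr0.
pose a := 1 + r.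
have a0 : 0 < a by rewrite /a; lra.
have ra : r <= a ^+ 2 by rewrite /a expr2; nra.
have Ir := disc_integral a0 rr' ra re_cont (cont_at_kap r c) (@kap_eq0 r c).
have sr' : s < r' := lt_trans sr rr'.
have sa : s <= a ^+ 2 := le_trans (ltW sr) ra.
have Is := disc_integral a0 sr' sa re_cont (cont_at_kap s c) (@kap_eq0 s c).
pose d z : R := complex.Re (phi z - phi c) * kap r c z * (6 / r ^+ 3) -
  complex.Re (phi z - phi c) * kap s c z * (6 / s ^+ 3).
have dE z : d z = 2 * complex.Re (b z).
  rewrite /d /b ReM /= mulr0 subr0 /K; ring.
have [|||id0 D0] := @divergence_compact R (fun x y => complex.Re (A (Complex x y)))
  (fun x y => - complex.Im (A (Complex x y))) (fun x y => d (Complex x y))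
  (complex.Re c - a) (complex.Im c - a) (2 * a) (mulr_gt0 (ltr0n R 2) a0).
- move=> x y; have [a' h] := wA (Complex x y).
  have [h1 h2] := wirtinger_diff2 h.
  exists (complex.Re a' + complex.Re (b (Complex x y))), (complex.Im (b (Complex x y)) - complex.Im a').
  exists (- complex.Im a' - complex.Im (b (Complex x y))), (complex.Re (b (Complex x y)) - complex.Re a').
  by split => //; rewrite dE; ring.
- apply: (@cont_at_cont2 d) => z.
  pose v z := kap r c z * (6 / r ^+ 3) + - (6 / s ^+ 3) * kap s c z.
  have -> : d = fun z => complex.Re (phi z - phi c) * v z.
    by apply/funext => u; rewrite /d /v; ring.
  apply: (disc_cont rr' re_cont) => [u|u ru].
    apply: cont_atD; apply: cont_atM; try exact: cont_at_kap; exact: cont_at_cst.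
  by rewrite /v !kap_eq0 ?mulr0 ?mul0r ?addr0 //; exact: le_trans (ltW sr) ru.
- move=> x y h; have hs := outside_square a0 h.
  have hr : r <= sqd c (Complex x y) := le_trans ra hs.
  rewrite /A Mfar // !mulr0 /= oppr0 /d !kap_eq0 ?mulr0 ?mul0r ?subrr //.
  exact: le_trans (ltW sr) hr.
move: D0; rewrite /d.
have mZ t (q : R) : mu2.-integrable setT (EFin \o (fun p : R * R =>
    complex.Re (phi (Complex p.1 p.2) - phi c) * kap t c (Complex p.1 p.2))) ->
    mu2.-integrable setT (EFin \o (fun p : R * R =>
    complex.Re (phi (Complex p.1 p.2) - phi c) * kap t c (Complex p.1 p.2) * q)).
  by move=> h; apply: (integrableZr measurableT q h).
rewrite RintegralB //; [|exact: mZ Ir.1|exact: mZ Is.1].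
rewrite (RintegralZr _ measurableT Ir.1) (RintegralZr _ measurableT Is.1).
move=> /eqP; rewrite subr_eq0 => /eqP h.
rewrite /=; apply: (@mulfI _ 6); first by rewrite pnatr_eq0.
by rewrite -[LHS]mulrCA -[RHS]mulrCA.
Qed.

(** By the comparison of radii the normalized integral equals that for an arbitrarily small disc,
    where [phi - phi c] is below [e], the kernel is at most [q^2] and the enclosing square has area
    [4 q]. *)
Lemma area_mean_zero phi c r r' : 0 < r -> r < r' -> hol_disc phi c r' ->
  \int[mu2]_p (complex.Re (phi (Complex p.1 p.2) - phi c) * kap r c (Complex p.1 p.2)) = 0.
Proof.
move=> r0 rr' hol.
have r'0 : 0 < r' := lt_trans r0 rr'.
set I := (X in X = 0).
have cc : sqd c c = 0 by rewrite /sqd subrr cabs0 expr0n.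
have [l hl] := hol c ltac:(by rewrite cc).
suff H e : 0 < e -> `|I / r ^+ 3| <= 4 * e.
  have : `|I / r ^+ 3| <= 0.
    apply/ler_addgt0Pl => e e0; have e4 : 0 < e / 4 by lra.
    by have := H _ e4; lra.
  rewrite normr_le0 mulf_eq0 invr_eq0 expf_eq0 /= (gt_eqF r0) orbF.
  by move/eqP.
move=> e0.
have [dl dl0 H] := wirtinger_cont (cderiv_wirtinger hl) e0.
(* [q] is a squared radius: [q < dl ^+ 2] puts the disc within [dl] of [c]. *)
pose q := Num.min (dl ^+ 2 / 4) (r / 2).
have q0 : 0 < q by rewrite lt_min !divr_gt0 // exprn_gt0.
have qr : q < r by rewrite gt_min; apply/orP; right; lra.
have qdl : q < dl ^+ 2.
  have dl2 : 0 < dl ^+ 2 by rewrite exprn_gt0.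
  by rewrite gt_min; apply/orP; left; lra.
rewrite (Rintegral_kap_cmp (s := q) _ rr' hol) ?q0 //.
have re_cont z : sqd c z < r' -> cont_at (fun z => complex.Re (phi z - phi c)) z.
  move=> zr; have [l' hl'] := hol z zr.
  apply: (cont_at_Re (a := l') (b := 0)).
  have := wirtingerB (cderiv_wirtinger hl') (wirtinger_cst (phi c) z).
  by rewrite !subr0.
pose a := Num.sqrt q; have a0 : 0 < a by rewrite sqrtr_gt0.
have aq : a ^+ 2 = q by rewrite sqr_sqrtr // ltW.
have qa : q <= a ^+ 2 by rewrite aq.
have [int1 ->] := disc_integral a0 (lt_trans qr rr') qa re_cont (cont_at_kap q c) (@kap_eq0 q c).
rewrite normrM (gtr0_norm (x := (q ^+ 3)^-1)) ?invr_gt0 ?exprn_gt0 //.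
rewrite ler_pdivrMr ?exprn_gt0 //.
have a20 : 0 <= 2 * a by rewrite mulr_ge0 // ltW.
have := @Rintegral_near_cst R _ _ mu2 (sq (complex.Re c - a) (complex.Im c - a) (2 * a) (2 * a))
  (fun p => complex.Re (phi (Complex p.1 p.2) - phi c) * kap q c (Complex p.1 p.2)) 0
  (e * q ^+ 2) (2 * a * (2 * a)) (measurable_sq _ _ _ _) (mu2_sq _ _ a20 a20).
rewrite mul0r subr0 => h; apply: le_trans (h _ _) _.
- by apply: integrableS int1 => //; exact: measurable_sq.
- move=> -[x y] _ /=; rewrite subr0 normrM.
  have [qs|qs] := leP q (sqd c (Complex x y)).
    by rewrite kap_eq0 // normr0 mulr0 mulr_ge0 ?sqr_ge0 // ltW.
  apply: ler_pM => //.
    apply: le_trans (le_Re_cabs _) _.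
    rewrite -[Complex x y](subrKC c); apply/ltW/H.
    rewrite -(@ltr_pXn2r _ 2) ?nnegrE ?cabs_ge0 ?(ltW dl0) //.
    exact: lt_trans qs qdl.
  rewrite ger0_norm ?kap_ge0 // /kap lerXn2r ?nnegrE ?pos_ge0 ?(ltW q0) //.
  by rewrite /pos ge_max (ltW q0) andbT lerBlDr lerDl sqd_ge0.
- have -> : 2 * a * (2 * a) = 4 * q by rewrite -aq; ring.
  by rewrite le_eqVlt; apply/orP; left; apply/eqP; ring.
Qed.

End AreaMeanValueTheorem.

(** * The sub-mean value inequality for powers of the modulus *)

Section SubMeanValue.
Variable R : realType.
Local Notation C := R[i].
Local Notation mu := (@lebesgue_measure R).
Local Notation mu2 := (@lebesgue_measure R \x @lebesgue_measure R)%E.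
Implicit Types (phi : C -> C) (c l z k : C) (r s p : R).

Lemma Re_realM (x : R) z : complex.Re ((x%:C)%C * z) = x * complex.Re z.
Proof. by rewrite ReM /= mul0r subr0. Qed.

(** Young's inequality for [x] and [1] with the exponents [p] and [p / (p - 1)]. *)
Lemma bernoulli_powR p (x : R) : 1 <= p -> 0 <= x -> 1 + p * (x - 1) <= x `^ p.
Proof.
move=> p1 x0; have [p1'|p1'] := eqVneq p 1; first by rewrite p1' powRr1 //; lra.
have pp : 1 < p by rewrite lt_def p1' p1.
have p0 : 0 < p by apply: lt_trans pp.
have q0 : 0 < p / (p - 1) by rewrite divr_gt0 // subr_gt0.
have := @conjugate_powR R x 1 p (p / (p - 1)) x0 ler01 p0 q0.
rewrite powR1 mulr1 => h.
have pn0 : p != 0 by rewrite gt_eqF.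
have pm0 : p - 1 != 0 by rewrite subr_eq0.
have := h _; rewrite (_ : p^-1 + (p / (p - 1))^-1 = 1); last by field; rewrite pn0 pm0.
move=> /(_ erefl); rewrite div1r (_ : (p / (p - 1))^-1 = 1 - p^-1); last by field; rewrite pn0 pm0.
move=> h1; have := ler_wpM2l (ltW p0) h1.
rewrite mulrDr mulrCA mulfV // mulr1 mulrBr mulfV // mulr1; lra.
Qed.

Lemma powR_tangent p (s t : R) : 1 <= p -> 0 < s -> 0 <= t ->
  s `^ p * (1 + p * (t / s - 1)) <= t `^ p.
Proof.
move=> p1 s0 t0; have ts : 0 <= t / s by rewrite divr_ge0 // ltW.
have sn : s != 0 by rewrite gt_eqF.
rewrite -[X in _ <= X `^ p](divfK sn t) [X in _ <= X]powRM ?(ltW s0) // [X in _ <= X]mulrC ler_wpM2l ?powR_ge0 //.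
exact: bernoulli_powR.
Qed.

Lemma kap_cont2 r c : cont2 (fun x y => kap r c (Complex x y)).
Proof. by apply: cont_at_cont2 => z; exact: cont_at_kap. Qed.

Lemma integrable_kap r c : 0 < r ->
  mu2.-integrable setT (EFin \o (fun q => kap r c (Complex q.1 q.2))).
Proof.
move=> r0; have a0 : 0 < 1 + r by lra.
have ra : r <= (1 + r) ^+ 2 by rewrite expr2; nra.
have rr : r < r + 1 by lra.
have [] := @disc_integral R (fun=> 1) (kap r c) c r (r + 1) (1 + r) a0 rr ra
  (fun z _ => cont_at_cst 1 z) (cont_at_kap r c) (@kap_eq0 R r c).
by under [EFin \o _]funext => q do rewrite /= mul1r.
Qed.

Definition kap_mass r c := \int[mu2]_q kap r c (Complex q.1 q.2).

Lemma kap_mass_translate r c : 0 < r -> kap_mass r c = kap_mass r 0.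
Proof.
move=> r0; rewrite /kap_mass /Rintegral.
have mk c' : measurable_fun setT (fun q : R * R => (kap r c' (Complex q.1 q.2))%:E).
  by apply/measurable_EFinP; exact: cont2_measurable (kap_cont2 r c').
have k0 c' (q : R * R) : (0 <= (kap r c' (Complex q.1 q.2))%:E)%E by rewrite lee_fin kap_ge0.
have E c' := @fubini_tonelli1 _ _ _ _ R mu mu _ (mk c') (k0 c').
rewrite (E c) (E 0); apply: (congr1 fine); rewrite /fubini_F.
have m1 := @measurable_fun_fubini_tonelli_F _ _ _ _ R mu _ (mk c) (k0 c).
rewrite /fubini_F in m1.
rewrite (ge0_integral_affine (complex.Re c) (@ltr01 R) m1); last first.
  by move=> x; apply: integral_ge0 => y _; exact: k0.
rewrite mul1e; apply: eq_integral => x _ /=.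
have m2 : measurable_fun setT (fun y : R => (kap r c (Complex (1 * x + complex.Re c) y))%:E).
  apply/measurable_EFinP; apply: continuous_measurable_fun.
  exact: (cont2_slicel (kap_cont2 r c)).
rewrite (ge0_integral_affine (complex.Im c) (@ltr01 R) m2) => [|y]; last first.
  by rewrite lee_fin kap_ge0.
rewrite mul1e; apply: eq_integral => y _; congr EFin.
by rewrite /kap !sqd_xy !mul1r !addrK !subr0.
Qed.

(** The square of side [Num.sqrt r] about [c] lies in [|z-c|^2 <= r / 2], where the kernel is at
    least [r^2 / 4]; its area is [r]. *)
Lemma kap_mass_ge r c : 0 < r -> r ^+ 3 / 4 <= kap_mass r c.
Proof.
move=> r0; pose a := Num.sqrt r / 2.
have s0 : 0 < Num.sqrt r by rewrite sqrtr_gt0.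
have a0 : 0 < a by rewrite divr_gt0.
have a2 : a ^+ 2 = r / 4 by rewrite exprMn sqr_sqrtr ?(ltW r0) // expr2 -invfM; field.
pose S := sq (complex.Re c - a) (complex.Im c - a) (2 * a) (2 * a).
have a20 : 0 <= 2 * a by rewrite mulr_ge0 // ltW.
have mS : measurable S by exact: measurable_sq.
have muS : mu2 S = r%:E.
  rewrite mu2_sq //; congr EFin; have -> : 2 * a * (2 * a) = 4 * a ^+ 2 by ring.
  by rewrite a2; field.
have ik := integrable_kap c r0.
have iS : mu2.-integrable S (EFin \o (fun q => kap r c (Complex q.1 q.2))).
  by apply: integrableS ik.
have E q : kap r c (Complex q.1 q.2) = (kap r c (Complex q.1 q.2)) by [].
apply: (@le_trans _ _ (\int[mu2]_(q in S) kap r c (Complex q.1 q.2))); last first.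
  apply: fine_le; [exact: integrable_fin_num|exact: integrable_fin_num|].
  apply: ge0_subset_integral => //.
    exact: measurable_int ik.
  by move=> q _ /=; rewrite lee_fin kap_ge0.
have ic : mu2.-integrable S (EFin \o (fun=> r ^+ 2 / 4)).
  apply: (integrable_bounded (M := `|r ^+ 2 / 4|)) => //.
  by apply: (@le_lt_trans _ _ r%:E); rewrite ?ltry // le_eqVlt; apply/orP; left; apply/eqP.
have -> : r ^+ 3 / 4 = \int[mu2]_(q in S) (r ^+ 2 / 4).
  by rewrite Rintegral_cst // (_ : fine _ = r) ?(congr1 fine muS) //; ring.
apply: le_Rintegral => // -[x y] [/=]; rewrite !in_itv /= => /andP[h1 h2] /andP[h3 h4].
have -> : r ^+ 2 / 4 = (r / 2) ^+ 2 by rewrite exprMn expr2; field.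
have sr : sqd c (Complex x y) <= r / 2.
  rewrite sqd_xy.
  have key (u v : R) : v - a <= u -> u < v - a + 2 * a -> (u - v) ^+ 2 <= a ^+ 2.
    move=> g1 g2; rewrite -(real_normK (num_real (u - v))) lerXn2r ?nnegrE ?(ltW a0) //.
    by rewrite ler_norml; apply/andP; split; lra.
  have k1 := key _ _ h1 h2; have k2 := key _ _ h3 h4.
  by rewrite a2 in k1 k2; lra.
rewrite /kap lerXn2r ?nnegrE ?pos_ge0 //; first by lra.
by rewrite /pos le_max; apply/orP; left; lra.
Qed.

Definition cut_pow p r c phi z : R := if sqd c z < r then cabs (phi z) `^ p else 0.

Lemma cut_pow_ge0 p r c phi z : 0 <= cut_pow p r c phi z.
Proof. by rewrite /cut_pow; case: ifP => // _; exact: powR_ge0. Qed.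

Lemma powR_gt_near p (a : R) phi z : 0 < p -> (exists l, cderiv phi z l) ->
  a < cabs (phi z) `^ p -> exists2 dl : R, 0 < dl &
  forall k, cabs k < dl -> a < cabs (phi (z + k)) `^ p.
Proof.
move=> p0 [l hl]; have [a0 _|a0 h] := ltP a 0.
  by exists 1 => // k _; apply: lt_le_trans a0 (powR_ge0 _ _).
pose s := a `^ p^-1.
have sp : s `^ p = a by rewrite /s -powRrM mulVf ?gt_eqF // powRr1.
have s0 : 0 <= s by exact: powR_ge0.
have hs : s < cabs (phi z).
  rewrite ltNge; apply/negP => h1; move: h; rewrite ltNge => /negP; apply.
  by rewrite -sp ge0_ler_powR ?nnegrE ?cabs_ge0 // ltW.
have e0 : 0 < cabs (phi z) - s by rewrite subr_gt0.
have [dl dl0 H] := cont_at_cabs (cderiv_wirtinger hl) e0.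
exists dl => // k /H; rewrite ltr_norml => /andP[h1 _].
by rewrite -sp gt0_ltr_powR ?nnegrE ?cabs_ge0 //; lra.
Qed.

Lemma measurable_cut_pow p r c phi : 0 < p -> hol_disc phi c r ->
  measurable_fun setT (fun q : R * R => cut_pow p r c phi (Complex q.1 q.2)).
Proof.
move=> p0 hol.
apply: (@lsc_measurable R bool _ _ (fun q b => if b then q.1 else q.2)
   (fun u => cut_pow p r c phi (Complex (u true) (u false)))).
  by case; [exact: measurable_fst|exact: measurable_snd].
move=> a u; set z := Complex _ _.
have near (P : C -> Prop) : (exists2 dl : R, 0 < dl & forall k, cabs k < dl -> P (z + k)) ->
    exists2 e : R, 0 < e & forall v : bool -> R, (forall i, `|v i - u i| < e) ->
      P (Complex (v true) (v false)).
  move=> [dl dl0 H]; exists (dl / 2); first by rewrite divr_gt0.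
  move=> v uv; have := H (Complex (v true - u true) (v false - u false)).
  rewrite (_ : z + _ = Complex (v true) (v false)); last by apply: complexP => /=; rewrite subrKC.
  apply; have ck : cabs (Complex (v true - u true) (v false - u false)) <=
    `|v true - u true| + `|v false - u false| := cabs_le_ReIm _.
  have := uv true; have := uv false; lra.
move=> h; apply: (near (fun z => a < cut_pow p r c phi z)).
have [a0|a0] := ltP a 0.
  by exists 1 => // k _; apply: lt_le_trans a0 (cut_pow_ge0 _ _ _ _ _).
move: h; rewrite {1}/cut_pow; case: ifPn => [zr h|_]; last by rewrite ltNge a0.
have [d1 d10 H1] := powR_gt_near p0 (hol _ zr) h.
have e0 : 0 < r - sqd c z by rewrite subr_gt0.
have [d2 d20 H2] := sqd_cont c z e0.
exists (Num.min d1 d2); first by rewrite lt_min d10.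
move=> k; rewrite lt_min => /andP[/H1 h1 /H2]; rewrite ltr_norml => /andP[_ h2].
by rewrite /cut_pow (_ : sqd c (z + k) < r) //; lra.
Qed.

Lemma hol_disc_le phi c r r' : r <= r' -> hol_disc phi c r' -> hol_disc phi c r.
Proof. by move=> rr' h z zr; apply: h; exact: lt_le_trans rr'. Qed.

Lemma cderivZ (u : C) phi z l : cderiv phi z l -> cderiv (fun z => u * phi z) z (u * l).
Proof.
move=> h e e0.
have u0 : 0 < cabs u + 1 by rewrite ltr_wpDl ?cabs_ge0.
have eu : 0 < e / (cabs u + 1) by rewrite divr_gt0.
have [dl dl0 H] := h _ eu; exists dl => // k /H h1.
rewrite -mulrA -!mulrBr cabsM.
apply: (@le_trans _ _ (cabs u * (e / (cabs u + 1) * cabs k))).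
  by rewrite ler_wpM2l ?cabs_ge0.
have -> : cabs u * (e / (cabs u + 1) * cabs k) = (cabs u / (cabs u + 1)) * (e * cabs k) by ring.
rewrite ler_piMl ?mulr_ge0 ?cabs_ge0 ?(ltW e0) //.
by rewrite ler_pdivrMr // mul1r lerDl.
Qed.

Lemma hol_discZ (u : C) phi c r : hol_disc phi c r -> hol_disc (fun z => u * phi z) c r.
Proof. by move=> h z /h[l hl]; exists (u * l); exact: cderivZ. Qed.

(** Convexity replaces subharmonicity. The tangent line of [x ^ p] at [|phi c|], followed by the
    projection of [phi] onto the direction of [phi c], bounds [|phi|^p] below by [|phi c|^p] plus
    the real part of a multiple of [phi - phi c]. That real part has zero kernel average. The kernel
    is at most [r^2] and has mass at least [r^3 / 4], whence the factor [r / 4]. *)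
Lemma submean_mu2 phi c r r' p : 1 <= p -> 0 < r -> r < r' -> hol_disc phi c r' ->
  ((cabs (phi c) `^ p * (r / 4))%:E <=
   \int[mu2]_q (cut_pow p r c phi (Complex q.1 q.2))%:E)%E.
Proof.
move=> p1 r0 rr' hol; have p0 : 0 < p by apply: lt_le_trans p1.
set G := fun q : R * R => cut_pow p r c phi (Complex q.1 q.2).
have G0 q : 0 <= G q by exact: cut_pow_ge0.
have mG : measurable_fun setT G.
  by apply: measurable_cut_pow => //; exact: hol_disc_le (ltW rr') hol.
have I0 : (0 <= \int[mu2]_q (G q)%:E)%E by apply: integral_ge0 => q _; rewrite lee_fin.
have [s0|s0] := eqVneq (cabs (phi c)) 0.
  by rewrite s0 powR0 ?gt_eqF // mul0r.
have sp : 0 < cabs (phi c) by rewrite lt_def s0 cabs_ge0.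
have [->|Ioo] := eqVneq (\int[mu2]_q (G q)%:E)%E +oo%E; first by rewrite leey.
have iG : mu2.-integrable setT (EFin \o G).
  apply/integrableP; split; first exact/measurable_EFinP.
  under eq_integral do rewrite /= ger0_norm //.
  by rewrite ltey.
set V := cabs (phi c) `^ p; set s := cabs (phi c) in s0 sp V *.
have V0 : 0 <= V by exact: powR_ge0.
(* With this factor the real part of [u * phi] has slope [p V / s], that of the tangent line, along
   the direction of [phi c]. *)
pose u : C := ((p * V / s ^+ 2)%:C)%C * conjc (phi c).
have hu := hol_discZ u hol.
have D0 := area_mean_zero r0 rr' hu.
have a0 : 0 < 1 + r by lra.
have ra : r <= (1 + r) ^+ 2 by rewrite expr2; nra.
have re_cont z : sqd c z < r' -> cont_at (fun z => complex.Re (u * phi z - u * phi c)) z.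
  move=> zr; have [l' hl'] := hu z zr.
  apply: (cont_at_Re (a := l') (b := 0)).
  have := wirtingerB (cderiv_wirtinger hl') (wirtinger_cst (u * phi c) z).
  by rewrite !subr0.
have [iD _] := disc_integral a0 rr' ra re_cont (cont_at_kap r c) (@kap_eq0 R r c).
have iK := integrable_kap c r0.
have iV : mu2.-integrable setT (EFin \o (fun q => V * kap r c (Complex q.1 q.2))).
  exact: (integrableZl measurableT V iK).
have iGr : mu2.-integrable setT (EFin \o (fun q => r ^+ 2 * G q)).
  exact: (integrableZl measurableT (r ^+ 2) iG).
have : \int[mu2]_q (V * kap r c (Complex q.1 q.2) +
    complex.Re (u * phi (Complex q.1 q.2) - u * phi c) * kap r c (Complex q.1 q.2)) <=
    \int[mu2]_q (r ^+ 2 * G q).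
  apply: le_Rintegral => //; first exact: (integrableD measurableT iV iD).
  move=> -[x y] _ /=; rewrite /G /=; set z := Complex x y.
  rewrite /cut_pow; case: ifPn => [zr|]; last first.
    by rewrite -leNgt => zr; rewrite kap_eq0 // !mulr0 addr0.
  rewrite -mulrDl mulrC; apply: (@le_trans _ _ (kap r c z * cabs (phi z) `^ p)).
    rewrite ler_wpM2l ?kap_ge0 //.
    apply: le_trans (powR_tangent p1 sp (cabs_ge0 (phi z))).
    rewrite -/s -/V mulrDr mulr1 lerD2l -mulrBr /u.
    rewrite -[X in complex.Re X]mulrA Re_realM.
    have -> : V * (p * (cabs (phi z) / s - 1)) =
       p * V / s ^+ 2 * (s * cabs (phi z) - s ^+ 2) by field; rewrite gt_eqF.
    rewrite ler_wpM2l //.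
      by rewrite divr_ge0 ?sqr_ge0 // mulr_ge0 // ltW.
    rewrite mulrBr ReD ReN lerB //.
      by apply: le_trans (Re_le_cabs _) _; rewrite cabsM cabs_conj.
    by rewrite /s sqr_cabs ReM; case: (phi c) => ? ? /=; lra.
  rewrite ler_wpM2r ?powR_ge0 // /kap lerXn2r ?nnegrE ?pos_ge0 ?(ltW r0) //.
  by rewrite /pos ge_max (ltW r0) andbT lerBlDr lerDl sqd_ge0.
rewrite (RintegralD measurableT iV iD) D0 addr0.
rewrite (RintegralZl V measurableT iK) (RintegralZl _ measurableT iG).
have := kap_mass_ge c r0; rewrite /kap_mass => h1 h2.
have fG : \int[mu2]_q G q = fine (\int[mu2]_q (G q)%:E)%E by [].
rewrite -[X in (_ <= X)%E]fineK; last by rewrite ge0_fin_numE // ltey.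
rewrite lee_fin -fG.
have h3 : V * (r ^+ 3 / 4) <= r ^+ 2 * \int[mu2]_q G q.
  by apply: le_trans h2; rewrite ler_wpM2l.
have r2 : 0 < r ^+ 2 by rewrite exprn_gt0.
rewrite -(ler_pM2l r2); apply: le_trans h3.
by rewrite le_eqVlt; apply/orP; left; apply/eqP; ring.
Qed.

Lemma submean phi c r r' p : 1 <= p -> 0 < r -> r < r' -> hol_disc phi c r' ->
  ((cabs (phi c) `^ p * (r / 4))%:E <=
   \int[mu]_x \int[mu]_y (cut_pow p r c phi (Complex x y))%:E)%E.
Proof.
move=> p1 r0 rr' hol; have p0 : 0 < p by apply: lt_le_trans p1.
have mG : measurable_fun setT (fun q : R * R => (cut_pow p r c phi (Complex q.1 q.2))%:E).
  apply/measurable_EFinP.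
  by apply: measurable_cut_pow => //; exact: hol_disc_le (ltW rr') hol.
have := submean_mu2 p1 r0 rr' hol.
by rewrite (@fubini_tonelli1 _ _ _ _ R mu mu _ mG) // => q; rewrite lee_fin cut_pow_ge0.
Qed.

End SubMeanValue.

(** * Taylor's formula and Cauchy's estimate from moving averages *)

Section TaylorBound.
Variable R : realType.
Local Notation C := R[i].
Local Notation mu2 := (@lebesgue_measure R \x @lebesgue_measure R)%E.
Implicit Types (phi : C -> C) (c l z k u : C) (r s : R).

Lemma pos_sqr s h : `|pos (s + h) ^+ 2 - pos s ^+ 2 - 2 * h * pos s| <= h ^+ 2.
Proof.
rewrite /pos.
have [s0|s0] := leP s 0; have [sh|sh] := leP (s + h) 0.
- have -> : (0 : R) ^+ 2 - 0 ^+ 2 - 2 * h * 0 = 0 by ring.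
  by rewrite normr0 sqr_ge0.
- have -> : (s + h) ^+ 2 - 0 ^+ 2 - 2 * h * 0 = (s + h) ^+ 2 by ring.
  rewrite ger0_norm ?sqr_ge0 // lerXn2r ?nnegrE //; lra.
- have -> : (0 : R) ^+ 2 - s ^+ 2 - 2 * h * s = s * (- h - h - s) by ring.
  have h0 : 0 <= - h - h - s by lra.
  rewrite ger0_norm; last by rewrite mulr_ge0 // ltW.
  have -> : h ^+ 2 = s * (- h - h - s) + (h + s) ^+ 2 by ring.
  by rewrite lerDl sqr_ge0.
- have -> : (s + h) ^+ 2 - s ^+ 2 - 2 * h * s = h ^+ 2 by ring.
  by rewrite ger0_norm // sqr_ge0.
Qed.

(** The derivative at [m = 0] of the kernel of squared radius [1 / 4] when its centre moves to the
    real number [m]. *)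
Definition kap_slope z : R := 4 * complex.Re z * pos (4^-1 - sqd 0 z).

Lemma kap_expansion (m : R) z : `|m| <= 4^-1 -> `|complex.Re z| <= 1 ->
  `|kap 4^-1 ((m%:C)%C) z - kap 4^-1 0 z - m * kap_slope z| <= 10 * m ^+ 2.
Proof.
move=> m4 z1.
pose s := 4^-1 - sqd 0 z; pose h := 2 * m * complex.Re z - m ^+ 2.
have sh : 4^-1 - sqd ((m%:C)%C) z = s + h.
  by rewrite /s /h /sqd !sqr_cabs; case: (z) => x y /=; ring.
rewrite /kap /kap_slope sh -/s.
have -> : pos (s + h) ^+ 2 - pos s ^+ 2 - m * (4 * complex.Re z * pos s) =
  (pos (s + h) ^+ 2 - pos s ^+ 2 - 2 * h * pos s) - 2 * m ^+ 2 * pos s.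
  by rewrite /h; ring.
apply: le_trans (ler_normB _ _) _.
have ps : pos s <= 4^-1.
  by rewrite /pos ge_max invr_ge0 ler0n andbT /s lerBlDr lerDl sqd_ge0.
have m2 : m ^+ 2 = `|m| ^+ 2 by rewrite real_normK ?num_real.
have hh : `|h| <= 3 * `|m|.
  apply: le_trans (ler_normB _ _) _; rewrite normrX !normrM (ger0_norm (ler0n R 2)).
  have : 2 * `|m| * `|complex.Re z| <= 2 * `|m| * 1 by rewrite ler_wpM2l // mulr_ge0.
  have : `|m| ^+ 2 <= `|m| * 4^-1 by rewrite expr2 ler_wpM2l.
  by have := normr_ge0 m; lra.
have h2 : h ^+ 2 <= 9 * m ^+ 2.
  have -> : 9 * m ^+ 2 = (3 * `|m|) ^+ 2 by rewrite m2; ring.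
  by rewrite -(real_normK (num_real h)) lerXn2r ?nnegrE // mulr_ge0.
have := pos_sqr s h.
have p0 := pos_ge0 s.
rewrite [`|2 * _ * _|]ger0_norm; last by apply: mulr_ge0 => //; rewrite mulr_ge0 ?sqr_ge0.
have : m ^+ 2 * pos s <= m ^+ 2 * 4^-1 by rewrite ler_wpM2l ?sqr_ge0.
have := sqr_ge0 m; lra.
Qed.

Lemma abs_le1_itv (x : R) : -1 <= x -> x < -1 + 2 -> `|x| <= 1.
Proof. by move=> h1 h2; rewrite ler_norml; apply/andP; split; lra. Qed.

Lemma sqd_mono (a b : R) z : 0 <= a -> a + `|b| <= 1 -> sqd ((b%:C)%C) z < a ^+ 2 -> sqd 0 z < 1.
Proof.
move=> a0 ab; rewrite /sqd ltr_pXn2r ?nnegrE ?cabs_ge0 // subr0 => h.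
rewrite expr_lt1 ?cabs_ge0 //.
have := cabsD (z - (b%:C)%C) ((b%:C)%C); rewrite subrK cabs_real; lra.
Qed.

(** [40] is the error [10] of [kap_expansion] times the area [4] of the square that contains the
    disc; the division by the mass normalizes the average. *)
Definition taylorK : R := 40 / kap_mass 4^-1 0.

Lemma kap_mass4_gt0 : 0 < kap_mass (4^-1 : R) 0.
Proof.
have q0 : 0 < (4^-1 : R) by rewrite invr_gt0.
by apply: lt_le_trans (kap_mass_ge 0 q0); rewrite divr_gt0 // exprn_gt0.
Qed.

Lemma taylorK_gt0 : 0 < taylorK.
Proof. by rewrite /taylorK divr_gt0 // kap_mass4_gt0. Qed.

Section UnitDisc.
Variables (phi : C -> C) (M : R).
Hypothesis hol : hol_disc phi 0 1.
Hypothesis bnd : forall z, sqd 0 z < 1 -> cabs (phi z) <= M.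

Let N := kap_mass (4^-1 : R) 0.

Let T u := \int[mu2]_q (complex.Re (u * phi (Complex q.1 q.2)) * kap_slope (Complex q.1 q.2)).

(** The values at [m] and at [0] are averages of the same function against two translates of one
    kernel. Expanding the kernel in [m], rather than [phi], gives a quadratic error that depends on
    the bound [M] alone. [T u] is a candidate for the first derivative. *)
Lemma unit_disc_expansion u (m : R) : cabs u <= 1 -> `|m| <= 4^-1 ->
  `|complex.Re (u * phi ((m%:C)%C) - u * phi 0) * N - m * T u| <= 40 * M * m ^+ 2.
Proof.
move=> u1 m4.
have q0 : 0 < (4^-1 : R) by rewrite invr_gt0.
have q1 : (4^-1 : R) < 2^-1 by lra.
have hu := hol_discZ u hol.
pose w z := complex.Re (u * phi z).
have cw z : sqd 0 z < 1 -> cont_at w z.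
  by move=> /hu[l' hl']; apply: (cont_at_Re (cderiv_wirtinger hl')).
(* A kernel of radius [1 / 2] with centre at distance at most [1 / 4] from the origin lives in
   [|z| <= 3 / 4]. *)
have r1 : (9 / 16 : R) < 1 by lra.
have r2 : (9 / 16 : R) <= 1 ^+ 2 by rewrite expr1n; lra.
have kv (b : R) z : `|b| <= 4^-1 -> 9 / 16 <= sqd 0 z -> kap 4^-1 ((b%:C)%C) z = 0.
  move=> b4 zr; apply: kap_eq0.
  have zc : 3 / 4 <= cabs z.
    have a34 : 0 <= (3 / 4 : R) by lra.
    rewrite -(@ler_pXn2r _ 2) ?nnegrE ?cabs_ge0 //.
    by move: zr; rewrite /sqd subr0; have -> : (3 / 4 : R) ^+ 2 = 9 / 16 by field.
  have : 2^-1 <= cabs (z - (b%:C)%C).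
    by have := cabsD (z - (b%:C)%C) ((b%:C)%C); rewrite subrK cabs_real; lra.
  rewrite /sqd => h; have -> : (4^-1 : R) = 2^-1 ^+ 2 by rewrite expr2 -invfM; congr (_^-1); ring.
  by rewrite lerXn2r ?nnegrE ?cabs_ge0.
have v0 z : 9 / 16 <= sqd 0 z -> kap_slope z = 0.
  by move=> zr; rewrite /kap_slope /pos max_r ?mulr0 //; lra.
have vc z : cont_at kap_slope z.
  apply: cont_atM; last exact: cont_at_bump.
  apply: cont_atM; first exact: cont_at_cst.
  apply: (@cont_at_Re _ id z 1 0) => e e0; exists 1 => // k _.
  rewrite mul1r mul0r subr0 (_ : _ - _ = 0); last by ring.
  by rewrite cabs0 mulr_ge0 ?cabs_ge0 // ltW.
have a1 := @ltr01 R.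
have [iT _] := disc_integral a1 r1 r2 cw vc v0.
have iK (b : R) (hb : `|b| <= 4^-1) :
    mu2.-integrable setT (EFin \o (fun q => w (Complex q.1 q.2) * kap 4^-1 ((b%:C)%C) (Complex q.1 q.2))).
  have [] // := disc_integral a1 r1 r2 cw (cont_at_kap 4^-1 ((b%:C)%C)) _.
  by move=> z; exact: kv.
have mean (b : R) (hb : `|b| <= 4^-1) :
    \int[mu2]_q (w (Complex q.1 q.2) * kap 4^-1 ((b%:C)%C) (Complex q.1 q.2)) =
    w ((b%:C)%C) * N.
  have hb' : hol_disc (fun z => u * phi z) ((b%:C)%C) 2^-1.
    move=> z zr; apply: hu.
    have a34 : 0 <= (3 / 4 : R) by lra.
    have ab : 3 / 4 + `|b| <= 1 by lra.
    apply: (sqd_mono a34 ab).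
    apply: lt_trans zr _; have -> : (3 / 4 : R) ^+ 2 = 9 / 16 by field.
    lra.
  have := area_mean_zero q0 q1 hb'.
  set I := (X in X = 0) => I0.
  have iN : mu2.-integrable setT (EFin \o (fun q => w ((b%:C)%C) * kap 4^-1 ((b%:C)%C) (Complex q.1 q.2))).
    by apply: (integrableZl measurableT _ (integrable_kap _ q0)).
  rewrite /N -(kap_mass_translate ((b%:C)%C) q0) /kap_mass.
  rewrite -(RintegralZl _ measurableT (integrable_kap ((b%:C)%C) q0)).
  apply/eqP; rewrite -subr_eq0 -(RintegralB measurableT (iK b hb) iN).
  rewrite -I0 /I; apply/eqP; apply: eq_Rintegral => q _.
  by rewrite -mulrBl /w -ReN -ReD.
have z4 : `|0 : R| <= 4^-1 by rewrite normr0 invr_ge0.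
have E : complex.Re (u * phi ((m%:C)%C) - u * phi 0) * N - m * T u =
   \int[mu2]_q (w (Complex q.1 q.2) * (kap 4^-1 ((m%:C)%C) (Complex q.1 q.2) -
     kap 4^-1 0 (Complex q.1 q.2) - m * kap_slope (Complex q.1 q.2))).
  rewrite ReD ReN mulrBl -/(w ((m%:C)%C)) -/(w 0) -(mean m m4) -(mean 0 z4).
  rewrite /T -(RintegralZl _ measurableT iT).
  have iTm := integrableZl measurableT m iT.
  rewrite -(RintegralB measurableT (iK m m4) (iK 0 z4)).
  rewrite -(RintegralB measurableT (integrableB measurableT (iK m m4) (iK 0 z4)) iTm).
  by apply: eq_Rintegral => q _; rewrite /w; ring.
rewrite E.
pose v z := kap 4^-1 ((m%:C)%C) z - kap 4^-1 0 z - m * kap_slope z.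
have cv z : cont_at v z.
  rewrite (_ : v = fun z => kap 4^-1 ((m%:C)%C) z + -1 * kap 4^-1 0 z + (- m) * kap_slope z).
    apply: cont_atD; last by apply: cont_atM; [exact: cont_at_cst|].
    apply: cont_atD; first exact: cont_at_kap.
    by apply: cont_atM; [exact: cont_at_cst|exact: cont_at_kap].
  by apply/funext => z'; rewrite /v; ring.
have v00 z : 9 / 16 <= sqd 0 z -> v z = 0.
  by move=> zr; rewrite /v v0 // (kv m) // (kv 0) // mulr0 !subrr.
have [iv ->] := disc_integral a1 r1 r2 cw cv v00.
rewrite /= !sub0r !mulr1.
have two0 : 0 <= (2 : R) by [].
have M0 : 0 <= M.
  by apply: le_trans (cabs_ge0 (phi 0)) (bnd _); rewrite /sqd subrr cabs0 expr0n.
have := @Rintegral_near_cst R _ _ mu2 (sq (-1) (-1) 2 2)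
  (fun q => w (Complex q.1 q.2) * v (Complex q.1 q.2)) 0
  (M * (10 * m ^+ 2)) (2 * 2) (measurable_sq _ _ _ _) (mu2_sq _ _ two0 two0).
rewrite mul0r subr0 => h; apply: le_trans (h _ _) _.
- by apply: integrableS iv => //; exact: measurable_sq.
- move=> -[x y] [] /=; rewrite !in_itv /= => /andP[x1 x2] _; rewrite subr0 normrM.
  have [zr|zr] := ltP (sqd 0 (Complex x y)) (9 / 16); last first.
    rewrite v00 // normr0 mulr0; apply: mulr_ge0 => //; apply: mulr_ge0 => //.
    exact: sqr_ge0.
  apply: ler_pM => //.
    apply: le_trans (le_Re_cabs _) _; rewrite cabsM.
    have := bnd (lt_trans zr r1) => h1.
    apply: le_trans h1; rewrite ler_piMl ?cabs_ge0 //.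
  by apply: kap_expansion => //=; apply: abs_le1_itv.
- by rewrite le_eqVlt; apply/orP; left; apply/eqP; ring.
Qed.

(** The expansion at parameters tending to zero identifies [T u] with the real part of [u l] times
    the mass. Then [u] is chosen to turn the remainder into its modulus. *)
Lemma unit_disc_taylor l (m : R) : cderiv phi 0 l -> `|m| <= 4^-1 ->
  cabs (phi ((m%:C)%C) - phi 0 - (m%:C)%C * l) <= taylorK * M * m ^+ 2.
Proof.
move=> hl m4.
have q0 : 0 < (4^-1 : R) by rewrite invr_gt0.
have N0 : 0 < N := kap_mass4_gt0.
have M0 : 0 <= M.
  by apply: le_trans (cabs_ge0 (phi 0)) (bnd _); rewrite /sqd subrr cabs0 expr0n.
have TE u : cabs u <= 1 -> T u = complex.Re (u * l) * N.
  move=> u1; apply/eqP; rewrite -subr_eq0 -normr_le0; apply/ler_addgt0Pl => e e0.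
  have e1 : 0 < e / (2 * N) by rewrite divr_gt0 // mulr_gt0.
  have [dl dl0 H] := cderivZ u hl e1.
  (* The three bounds admit the expansion, the definition of the derivative, and
     [40 M t <= e / 2]. *)
  pose t := Num.min (4^-1) (Num.min (dl / 2) (e / (80 * (M + 1)))).
  have M1 : 0 < M + 1 by lra.
  have t0 : 0 < t by rewrite !lt_min q0 !divr_gt0 // mulr_gt0.
  have tdl : t < dl.
    by rewrite !gt_min; apply/orP; right; apply/orP; left; lra.
  have t4 : `|t| <= 4^-1 by rewrite gtr0_norm // ge_min lexx.
  have te : t <= e / (80 * (M + 1)) by rewrite !ge_min lexx !orbT.
  have h1 := unit_disc_expansion u1 t4.
  have ct : cabs ((t%:C)%C) < dl by rewrite cabs_real gtr0_norm.
  have := H _ ct; rewrite add0r cabs_real (gtr0_norm t0) => h2.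
  have h3 := le_trans (le_Re_cabs _) h2.
  have Rl : complex.Re (u * l * (t%:C)%C) = t * complex.Re (u * l).
    by rewrite mulrC Re_realM.
  rewrite ReD ReN Rl in h3.
  set a := complex.Re (u * phi _ - _) in h1 h3.
  have h4 : `|a * N - t * complex.Re (u * l) * N| <= e / 2 * t.
    rewrite -mulrBl normrM (gtr0_norm N0).
    have -> : e / 2 * t = e / (2 * N) * t * N by field; rewrite gt_eqF.
    by rewrite ler_wpM2r // ltW.
  have h5 : `|t * (T u - complex.Re (u * l) * N)| <= 40 * M * t ^+ 2 + e / 2 * t.
    have -> : t * (T u - complex.Re (u * l) * N) =
       (a * N - t * complex.Re (u * l) * N) - (a * N - t * T u) by ring.
    apply: le_trans (ler_normB _ _) _; lra.
  rewrite normrM (gtr0_norm t0) in h5.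
  have h6 : `|T u - complex.Re (u * l) * N| <= 40 * M * t + e / 2.
    by rewrite -(ler_pM2l t0); apply: le_trans h5 _; rewrite le_eqVlt; apply/orP; left; apply/eqP; ring.
  have h7 : 40 * M * t <= e / 2.
    have : 40 * M * t <= 40 * (M + 1) * (e / (80 * (M + 1))).
      by apply: ler_pM => //; [exact: mulr_ge0|exact: ltW|lra].
    have -> : 40 * (M + 1) * (e / (80 * (M + 1))) = e / 2 by field; rewrite gt_eqF.
    by [].
  rewrite addr0; lra.
set E := phi _ - _ - _.
have [E0|E0] := eqVneq E 0.
  rewrite E0 cabs0; apply: mulr_ge0; last exact: sqr_ge0.
  by apply: mulr_ge0 => //; exact: ltW taylorK_gt0.
have cE : 0 < cabs E by rewrite cabs_gt0.
(* The unimodular factor for which [u * E = cabs E]. *)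
pose u := conjc E * (((cabs E)^-1)%:C)%C.
have u1 : cabs u <= 1.
  by rewrite cabsM cabs_conj cabs_real ger0_norm ?invr_ge0 ?cabs_ge0 // mulfV // gt_eqF.
have := unit_disc_expansion u1 m4; rewrite TE //.
have ER : complex.Re (u * E) = cabs E.
  have -> : u * E = (((cabs E)^-1)%:C)%C * (conjc E * E) by rewrite /u; ring.
  rewrite Re_realM (_ : complex.Re _ = cabs E ^+ 2); last first.
    by rewrite sqr_cabs; case: (E) => ? ? /=; ring.
  by rewrite expr2 mulKf // gt_eqF.
have -> : complex.Re (u * phi ((m%:C)%C) - u * phi 0) * N - m * (complex.Re (u * l) * N) =
    cabs E * N.
  rewrite -ER mulrA -mulrBl -Re_realM -ReN -ReD /E; congr (complex.Re _ * _); ring.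
rewrite (ger0_norm (mulr_ge0 (cabs_ge0 _) (ltW N0))) => h.
rewrite -(ler_pM2r N0); apply: le_trans h _.
rewrite /taylorK -/N le_eqVlt; apply/orP; left; apply/eqP; field.
by rewrite gt_eqF.
Qed.

End UnitDisc.

Lemma cderiv_affine phi c (a : C) z l : cderiv phi (c + a * z) l ->
  cderiv (fun z => phi (c + a * z)) z (l * a).
Proof.
move=> h e e0.
have a0 : 0 < cabs a + 1 by rewrite ltr_wpDl ?cabs_ge0.
have ea : 0 < e / (cabs a + 1) by rewrite divr_gt0.
have [dl dl0 H] := h _ ea; exists (dl / (cabs a + 1)); first by rewrite divr_gt0.
move=> k; rewrite ltr_pdivlMr // => hk.
have hak : cabs (a * k) < dl.
  apply: le_lt_trans hk; rewrite cabsM mulrC ler_wpM2l ?cabs_ge0 //; by rewrite lerDl.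
rewrite (_ : c + a * (z + k) = c + a * z + a * k); last by ring.
rewrite -(mulrA l a k); apply: le_trans (H _ hak) _.
rewrite cabsM [X in _ <= X](_ : _ = e / (cabs a + 1) * ((cabs a + 1) * cabs k)); last first.
  by field; rewrite gt_eqF.
by rewrite ler_wpM2l ?(ltW ea) // ler_wpM2r ?cabs_ge0 // lerDl.
Qed.

Lemma taylor_bound phi c l (rho M m : R) : 0 < rho ->
  hol_disc phi c (rho ^+ 2) -> (forall z, sqd c z < rho ^+ 2 -> cabs (phi z) <= M) ->
  cderiv phi c l -> `|m| <= 4^-1 ->
  cabs (phi (c + ((rho * m)%:C)%C) - phi c - ((rho * m)%:C)%C * l) <= taylorK * M * m ^+ 2.
Proof.
move=> rho0 hol bnd hl m4.
pose psi z := phi (c + (rho%:C)%C * z).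
have inD z : sqd 0 z < 1 -> sqd c (c + (rho%:C)%C * z) < rho ^+ 2.
  rewrite /sqd subr0 (addrC c) addrK cabsM cabs_real gtr0_norm // exprMn => h.
  by rewrite gtr_pMr // exprn_gt0.
have hp : hol_disc psi 0 1.
  by move=> z /inD /hol[l' hl']; exists (l' * (rho%:C)%C); exact: cderiv_affine.
have hl' : cderiv psi 0 (l * (rho%:C)%C).
  by apply: cderiv_affine; rewrite mulr0 addr0.
have := unit_disc_taylor hp (fun z zr => bnd _ (inD z zr)) hl' m4.
rewrite /psi mulr0 addr0 -rmorphM.
by have -> : ((m%:C)%C) * (l * (rho%:C)%C) = (((rho * m)%:C)%C) * l by rewrite rmorphM; ring.
Qed.

(** Taylor's formula with the step [rho / 8]: two values of [phi] cost [2 M], which becomes [16 M]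
    after division by [1 / 8]. *)
Lemma cauchy_estimate phi c l (rho M : R) : 0 < rho ->
  hol_disc phi c (rho ^+ 2) -> (forall z, sqd c z < rho ^+ 2 -> cabs (phi z) <= M) ->
  cderiv phi c l -> cabs l * rho <= (16 + taylorK) * M.
Proof.
move=> rho0 hol bnd hl.
pose m : R := 8^-1.
have m0 : 0 < m by rewrite invr_gt0.
have m4 : `|m| <= 4^-1 by rewrite gtr0_norm // /m; lra.
have := taylor_bound rho0 hol bnd hl m4; set E := _ - _ - _ => hE.
have cc : sqd c c < rho ^+ 2 by rewrite /sqd subrr cabs0 expr0n /= exprn_gt0.
have rm : 0 < rho * m by rewrite mulr_gt0.
have cm : sqd c (c + ((rho * m)%:C)%C) < rho ^+ 2.
  rewrite /sqd (addrC c) addrK cabs_real (gtr0_norm rm) ltr_pXn2r ?nnegrE ?(ltW rm) ?(ltW rho0) //.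
  rewrite gtr_pMr // /m; lra.
have b1 := bnd _ cc; have b2 := bnd _ cm.
have : cabs (((rho * m)%:C)%C * l) <= cabs (phi (c + ((rho * m)%:C)%C)) + cabs (phi c) + cabs E.
  have -> : ((rho * m)%:C)%C * l = phi (c + ((rho * m)%:C)%C) - phi c - E by rewrite /E; ring.
  apply: le_trans (cabsB _ _) _; rewrite lerD2r; exact: cabsB.
rewrite cabsM cabs_real (gtr0_norm rm).
have M0 : 0 <= M := le_trans (cabs_ge0 _) b1.
have -> : rho * m * cabs l = m * (cabs l * rho) by ring.
move=> h; have : m * (cabs l * rho) <= 2 * M + taylorK * M * m ^+ 2 by lra.
move=> {}h.
have m2 : m ^+ 2 <= m / 8 by rewrite expr2 /m.
have K0 := taylorK_gt0.
have h2 : taylorK * M * m ^+ 2 <= taylorK * M * (m / 8).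
  by rewrite ler_wpM2l // mulr_ge0 // ltW.
rewrite -(ler_pM2l m0); apply: le_trans h _.
have KM : 0 <= taylorK * M by rewrite mulr_ge0 // ltW.
rewrite /m in h2 *; lra.
Qed.

End TaylorBound.

(** * Holomorphic functions on the ball *)

Section SeveralVariables.
Variable R : realType.
Local Notation C := R[i].
Variable n : nat.
Implicit Types (z w k : Cn R n) (g f : Cn R n -> R[i]^o) (l : 'I_n -> C).

(** A real-valued norm, in place of the norm of [Cn R n] with values in [R[i]]; being a sum over
    coordinates it pairs directly with bounds on partial derivatives. *)
Definition l1 k : R := \sum_(j < n) cabs (k ord0 j).

Lemma l1_ge0 k : 0 <= l1 k.
Proof. by apply: sumr_ge0 => j _; exact: cabs_ge0. Qed.

Lemma cabs_le_l1 k j : cabs (k ord0 j) <= l1 k.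
Proof.
by rewrite /l1 (bigD1 j) //= lerDl; apply: sumr_ge0 => i _; exact: cabs_ge0.
Qed.

Lemma l1Z (a : C) k : l1 (a *: k) = cabs a * l1 k.
Proof. by rewrite /l1 mulr_sumr; apply: eq_bigr => j _; rewrite mxE cabsM. Qed.

Lemma l1D k w : l1 (k + w) <= l1 k + l1 w.
Proof.
rewrite /l1 -big_split /=; apply: ler_sum => j _; rewrite mxE; exact: cabsD.
Qed.

Lemma l1_0 : l1 0 = 0.
Proof. by rewrite /l1 big1 // => j _; rewrite mxE cabs0. Qed.

Lemma l1_eq0 k : l1 k = 0 -> k = 0.
Proof.
move=> h; apply/rowP => j; rewrite mxE; apply/eqP; rewrite -cabs_eq0 eq_le cabs_ge0 andbT.
by rewrite -h cabs_le_l1.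
Qed.

Lemma l1_delta j : l1 'e_j = 1.
Proof.
rewrite /l1 (bigD1 j) //= (_ : delta_mx _ _ _ _ = 1); last by rewrite mxE !eqxx.
rewrite cabs1 big1 ?addr0 // => i ij.
by rewrite (_ : delta_mx _ _ _ _ = 0) ?cabs0 // mxE (negbTE ij) andbF.
Qed.

Lemma norm_coord_le k j : `|k ord0 j| <= `|k|.
Proof.
have -> : `|k| = mx_norm k by [].
rewrite mx_normE -[leLHS]nngE num_le.
exact: (@le_bigmax _ _ _ 0%:nng (fun i : 'I_1 * 'I_n => `|k i.1 i.2|%:nng) (ord0, j)).
Qed.

Lemma norm_le_l1 k : `|k| <= ((l1 k)%:C)%C.
Proof.
have [->|k0] := eqVneq `|k| 0; first by rewrite lecR l1_ge0.
have [[i j] /= kE] := mx_norm_neq0 k0.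
by rewrite [X in X <= _]kE ord1 normE_cabs lecR cabs_le_l1.
Qed.

Lemma l1_le_norm k : ((l1 k)%:C)%C <= n%:R * `|k|.
Proof.
rewrite /l1 rmorph_sum /= (_ : n%:R * `|k| = \sum_(j < n) `|k|); last first.
  by rewrite sumr_const card_ord mulr_natl.
by apply: ler_sum => j _; rewrite -normE_cabs norm_coord_le.
Qed.

Definition cdiff g z l := forall e : R, 0 < e -> exists2 dl : R, 0 < dl &
  forall k, l1 k < dl ->
    cabs (g (z + k) - g z - \sum_(j < n) l j * k ord0 j) <= e * l1 k.

Lemma posc_real (a : C) : 0 < a -> exists2 r : R, 0 < r & a = ((r)%:C)%C.
Proof.
by case: a => x y; rewrite ltcE /= => /andP[/eqP -> x0]; exists x.
Qed.

Lemma differentiable_cdiff g z : differentiable g z -> cdiff g z (fun j => 'D_('e_j) g z).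
Proof.
move=> dg e e0; have /eqaddoP dgo := diff_locally dg.
have n0 : 0 < n%:R + 1 :> R by rewrite ltr_wpDl.
have e1 : 0 < ((e)%:C)%C :> C by rewrite ltcR.
have /nbhs_ballP[a /= a0 H] := dgo _ e1.
have [r r0 aE] := posc_real a0.
exists r => // k kr.
have := H k; rewrite -ball_normE /= sub0r normrN aE => /(_ (le_lt_trans (norm_le_l1 k) _)).
rewrite ltcR => /(_ kr); rewrite !fctE /= opprD addrA (addrC k) => h.
have dE : 'd g z k = \sum_(j < n) ('D_('e_j) g z : C) * k ord0 j.
  rewrite {1}(row_sum_delta k) linear_sum; apply: eq_bigr => j _.
  by rewrite linearZ /= deriveE // mulrC.
rewrite -dE -lecR -normE_cabs; apply: le_trans h _.
by rewrite rmorphM /= ler_pM2l // norm_le_l1.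
Qed.

Lemma cdiff_differentiable g z l : cdiff g z l -> differentiable g z.
Proof.
move=> H.
pose D k : R[i]^o := \sum_(j < n) l j * k ord0 j.
have linD : linear D.
  move=> a x y; rewrite /D scaler_sumr -big_split; apply: eq_bigr => j _ /=.
  by rewrite !mxE /GRing.scale /=; ring.
pose df : {linear Cn R n -> R[i]^o} := HB.pack D (GRing.isLinear.Build _ _ _ _ _ linD).
have cdf : continuous df.
  apply/bounded_linear_continuous/linear_boundedP.
  pose L : C := \sum_(j < n) `|l j|.
  have Lr : L \is Num.real by apply: ger0_real; apply: sumr_ge0.
  exists L; split => // r Lr' x; rewrite /= /D.
  apply: le_trans (ler_norm_sum _ _ _) _.
  apply: (@le_trans _ _ (L * `|x|)); last by rewrite ler_wpM2r // ltW.
  by rewrite /L mulr_suml; apply: ler_sum => j _; rewrite normrM ler_wpM2l // norm_coord_le.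
have E : g \o shift z = cst (g z) + df +o_ 0 id.
  apply/eqaddoP => e e0; have [r r0 eE] := posc_real e0.
  have n0 : 0 < n%:R + 1 :> R by rewrite ltr_wpDl.
  have rn : 0 < r / (n%:R + 1) by rewrite divr_gt0.
  have [dl dl0 hd] := H _ rn.
  have dn : 0 < dl / (n%:R + 1) by rewrite divr_gt0.
  have l1n k : ((l1 k)%:C)%C <= (((n%:R + 1)%:C)%C * `|k| : C).
    apply: le_trans (l1_le_norm k) _; rewrite ler_wpM2r // rmorphD rmorph_nat rmorph1.
    by rewrite lerDl.
  apply/nbhs_ballP; exists ((dl / (n%:R + 1))%:C)%C; first by rewrite /= ltcR.
  move=> k; rewrite -ball_normE /= sub0r normrN => hk.
  have kd : l1 k < dl.
    rewrite -ltcR; apply: le_lt_trans (l1n k) _.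
    rewrite -(ltr_pM2l (_ : 0 < ((n%:R + 1)%:C)%C)) ?ltcR // in hk.
    have E2 : (((n%:R + 1)%:C)%C * ((dl / (n%:R + 1))%:C)%C : C) = ((dl)%:C)%C.
      by rewrite -rmorphM /= mulrC divfK // gt_eqF.
    by rewrite E2 in hk.
  have := hd k kd; rewrite !fctE /= opprD addrA (addrC k) -lecR -normE_cabs => h.
  apply: le_trans h _; rewrite eE rmorphM /= mulrC.
  have -> : ((r)%:C)%C = (((n%:R + 1)%:C)%C * ((r / (n%:R + 1))%:C)%C : C).
    by rewrite -rmorphM /= mulrC divfK // gt_eqF.
  rewrite mulrAC ler_pM2r ?ltcR //; exact: l1n.
apply/diff_locallyP; have dE := diff_unique cdf E; rewrite dE; split => //.
Qed.

Lemma cdiff_cont g z l : cdiff g z l -> forall e : R, 0 < e ->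
  exists2 dl : R, 0 < dl & forall k, l1 k < dl -> cabs (g (z + k) - g z) < e.
Proof.
move=> h e e0; have [dl dl0 H] := h 1 ltr01.
pose L := \sum_(j < n) cabs (l j).
have L0 : 0 <= L by apply: sumr_ge0 => j _; exact: cabs_ge0.
have L1 : 0 < L + 1 by lra.
exists (Num.min dl (e / (L + 1))); first by rewrite lt_min dl0 divr_gt0.
move=> k; rewrite lt_min ltr_pdivlMr // => /andP[/H h1 h2].
set S := \sum_(j < n) _ in h1.
have hS : cabs S <= L * l1 k.
  apply: le_trans (cabs_sum _ _ _) _; rewrite /L mulr_suml; apply: ler_sum => j _.
  by rewrite cabsM ler_wpM2l ?cabs_ge0 ?cabs_le_l1.
have -> : g (z + k) - g z = (g (z + k) - g z - S) + S by rewrite subrK.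
by apply: le_lt_trans (cabsD _ _) _; lra.
Qed.

Lemma cdiff_line g z k (a : C) l : cdiff g (z + a *: k) l ->
  cderiv (fun b => g (z + b *: k)) a (\sum_(j < n) l j * k ord0 j).
Proof.
move=> h e e0.
have k0 : 0 < l1 k + 1 by rewrite ltr_wpDl ?l1_ge0.
have ek : 0 < e / (l1 k + 1) by rewrite divr_gt0.
have [dl dl0 H] := h _ ek; exists (dl / (l1 k + 1)); first by rewrite divr_gt0.
move=> b; rewrite ltr_pdivlMr // => hb.
have hbk : l1 (b *: k) < dl.
  rewrite l1Z; apply: le_lt_trans hb; rewrite ler_wpM2l ?cabs_ge0 //; by rewrite lerDl.
have := H _ hbk; rewrite scalerDl addrA.
have -> : \sum_(j < n) l j * (b *: k) ord0 j = (\sum_(j < n) l j * k ord0 j) * b.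
  by rewrite mulr_suml; apply: eq_bigr => j _; rewrite mxE mulrCA mulrC.
move=> h1; apply: le_trans h1 _; rewrite l1Z.
rewrite [X in _ <= X](_ : _ = e / (l1 k + 1) * (cabs b * (l1 k + 1))); last first.
  by field; rewrite gt_eqF.
by rewrite ler_wpM2l ?(ltW ek) // ler_wpM2l ?cabs_ge0 // lerDl.
Qed.

(** The one-variable formula on the complex line through [z] in the direction of [k], rescaled so
    that the unit disc has [l1] radius [rho]. *)
Lemma taylor_l1 g z (rho M : R) l k : 0 < rho ->
  (forall w, l1 (w - z) < rho -> differentiable g w) ->
  (forall w, l1 (w - z) < rho -> cabs (g w) <= M) ->
  cdiff g z l -> l1 k <= rho / 4 ->
  cabs (g (z + k) - g z - \sum_(j < n) l j * k ord0 j) <=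
    taylorK R * M * (l1 k / rho) ^+ 2.
Proof.
move=> rho0 dg bg hl kr.
have M0 : 0 <= M.
  by apply: le_trans (cabs_ge0 (g z)) (bg _ _); rewrite subrr l1_0.
have [k0|k0] := eqVneq (l1 k) 0.
  rewrite (l1_eq0 k0) addr0 subrr sub0r cabsN big1 => [|j _]; last by rewrite mxE mulr0.
  rewrite cabs0; apply: mulr_ge0 (sqr_ge0 _); apply: mulr_ge0 => //.
  exact: ltW (taylorK_gt0 R).
have kp : 0 < l1 k by rewrite lt_def k0 l1_ge0.
pose q : R := rho / l1 k; have q0 : 0 < q by rewrite divr_gt0.
pose k' := ((q)%:C)%C *: k.
have lk' : l1 k' = rho by rewrite l1Z cabs_real gtr0_norm // divfK.
have inD (b : C) : sqd 0 b < 1 ^+ 2 -> l1 (z + b *: k' - z) < rho.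
  rewrite /sqd subr0 ltr_pXn2r ?nnegrE ?cabs_ge0 // => hb.
  by rewrite (addrC z) addrK l1Z lk' gtr_pMl.
pose phi (b : C) : C := g (z + b *: k').
have hp : hol_disc phi 0 (1 ^+ 2).
  move=> b /inD /dg /differentiable_cdiff /cdiff_line h; by eexists; exact: h.
have bp (b : C) : sqd 0 b < 1 ^+ 2 -> cabs (phi b) <= M by move=> /inD /bg.
have hl' : cderiv phi 0 (\sum_(j < n) l j * k' ord0 j).
  by apply: cdiff_line; rewrite scale0r addr0.
have m4 : `|l1 k / rho| <= 4^-1.
  by rewrite gtr0_norm ?divr_gt0 // ler_pdivrMr //; lra.
have := taylor_bound ltr01 hp bp hl' m4; rewrite mul1r add0r /phi scale0r addr0.
have -> : (((l1 k / rho)%:C)%C) *: k' = k.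
  rewrite /k' scalerA -rmorphM /= (_ : l1 k / rho * q = 1) ?scale1r //.
  by rewrite /q; field; rewrite !gt_eqF.
have -> : ((l1 k / rho)%:C)%C * (\sum_(j < n) l j * k' ord0 j) = \sum_(j < n) l j * k ord0 j.
  rewrite mulr_sumr; apply: eq_bigr => j _; rewrite /k' mxE.
  have E3 : ((l1 k / rho)%:C)%C * ((q)%:C)%C = 1 :> C.
    by rewrite -rmorphM /= (_ : l1 k / rho * q = 1) // /q; field; rewrite !gt_eqF.
  by rewrite mulrCA (mulrA _ _ (k ord0 j)) E3 mul1r.
by [].
Qed.

End SeveralVariables.

(** * Limits of holomorphic functions and holomorphy of the derivatives *)

Section HolomorphicLimits.
Variable R : realType.
Local Notation C := R[i].

Lemma real_cauchy_limit (u : nat -> R) :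
  (forall e : R, 0 < e -> exists N, forall m q, (N <= m)%N -> (N <= q)%N ->
     `|u m - u q| <= e) ->
  exists a, forall e : R, 0 < e -> exists N, forall m, (N <= m)%N -> `|u m - a| <= e.
Proof.
move=> H; have cu : cauchy (u @ \oo).
  apply: cauchy_exP => e e0; have e2 : 0 < e / 2 by rewrite divr_gt0.
  have [N HN] := H _ e2; exists (u N); exists N => // m /= Nm.
  rewrite /ball /=; apply: le_lt_trans (HN _ _ (leqnn N) Nm) _; lra.
have cvu : cvgn u by exact: (@cauchy_cvg R _ _ cu).
have ha : forall e : R, 0 < e -> \forall m \near \oo, `|limn u - u m| <= e.
  by apply/cvgrPdist_le.
exists (limn u) => e e0; have [N _ HN] := ha e e0; exists N => m Nm.
by rewrite distrC; exact: HN.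
Qed.

Lemma complex_cauchy_limit (u : nat -> C) :
  (forall e : R, 0 < e -> exists N, forall m q, (N <= m)%N -> (N <= q)%N ->
     cabs (u m - u q) <= e) ->
  exists a, forall e : R, 0 < e -> exists N, forall m, (N <= m)%N -> cabs (u m - a) <= e.
Proof.
move=> H.
have [|a ha] := @real_cauchy_limit (fun m => complex.Re (u m)).
  move=> e /H[N HN]; exists N => m q Nm Nq.
  by rewrite -ReN -ReD; apply: le_trans (le_Re_cabs _) (HN _ _ Nm Nq).
have [|b hb] := @real_cauchy_limit (fun m => complex.Im (u m)).
  move=> e /H[N HN]; exists N => m q Nm Nq.
  by rewrite -ImN -ImD; apply: le_trans (le_Im_cabs _) (HN _ _ Nm Nq).
exists (Complex a b) => e e0; have e2 : 0 < e / 2 by rewrite divr_gt0.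
have [N1 h1] := ha _ e2; have [N2 h2] := hb _ e2.
exists (maxn N1 N2) => m; rewrite geq_max => /andP[/h1 m1 /h2 m2].
apply: le_trans (cabs_le_ReIm _) _; rewrite ReD ImD ReN ImN /=; lra.
Qed.

Variable n : nat.
Implicit Types (z w k : Cn R n) (g f : Cn R n -> R[i]^o) (l : 'I_n -> C).

Definition tends (u : nat -> C) (a : C) :=
  forall e : R, 0 < e -> exists N, forall m, (N <= m)%N -> cabs (u m - a) <= e.

(** A common bound gives all [f_ m] the same quadratic Taylor error. Hence pointwise convergence
    forces the partial derivatives to converge, and Taylor's formula passes to the limit with the
    same error. *)
Lemma hol_limit (f_ : nat -> Cn R n -> R[i]^o) f z (rho M : R) : 0 < rho ->
  (forall m w, l1 (w - z) < rho -> differentiable (f_ m) w) ->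
  (forall m w, l1 (w - z) < rho -> cabs (f_ m w) <= M) ->
  (forall w, l1 (w - z) < rho -> tends (fun m => f_ m w) (f w)) ->
  differentiable f z.
Proof.
move=> rho0 df bf lf.
have zz : l1 (z - z) < rho by rewrite subrr l1_0.
have M0 : 0 <= M := le_trans (cabs_ge0 (f_ 0%N z)) (bf _ _ zz).
have K0 := taylorK_gt0 R.
pose B := taylorK R * M / rho ^+ 2.
have B0 : 0 <= B by rewrite divr_ge0 ?sqr_ge0 // mulr_ge0 // ltW.
have [L key] : exists L : nat -> 'I_n -> C, forall m k, l1 k <= rho / 4 ->
    cabs (f_ m (z + k) - f_ m z - \sum_(j < n) L m j * k ord0 j) <= B * l1 k ^+ 2.
  exists (fun m j => 'D_('e_j) (f_ m) z) => m k kr; apply: le_trans (taylor_l1 rho0 (df m) (bf m) (differentiable_cdiff (df m z zz)) kr) _.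
  by rewrite /B exprMn exprVn le_eqVlt; apply/orP; left; apply/eqP; ring.
have small k : l1 k <= rho / 4 -> l1 (z + k - z) < rho.
  by move=> kr; rewrite (addrC z) addrK; lra.
have cauL j : exists a, tends (fun m => L m j) a.
  apply: complex_cauchy_limit => e e0.
  (* After division by [t] the two Taylor errors are at most [2 B t <= e / 2], and the four errors
     of pointwise convergence, each at most [e t / 16], add [e / 4]. *)
  pose t := Num.min (rho / 4) (e / (4 * (B + 1))).
  have B1 : 0 < 4 * (B + 1) by lra.
  have t0 : 0 < t by rewrite lt_min !divr_gt0.
  have [k [lk SL]] : exists k : Cn R n, l1 k = t /\
      forall m, \sum_(i < n) L m i * k ord0 i = ((t)%:C)%C * L m j.
    exists (((t)%:C)%C *: 'e_j); split => [|m].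
      by rewrite l1Z l1_delta mulr1 cabs_real gtr0_norm.
    rewrite (bigD1 j) //= big1 ?addr0 => [|i ij].
      by rewrite mxE mxE !eqxx mulr1 mulrC.
    by rewrite mxE mxE (negbTE ij) andbF !mulr0.
  have kr : l1 k <= rho / 4 by rewrite lk ge_min lexx.
  have te : B * t <= e / 4.
    apply: le_trans (_ : (B + 1) * (e / (4 * (B + 1))) <= _).
      apply: ler_pM => //; [exact: ltW|lra|by rewrite ge_min lexx orbT].
    rewrite le_eqVlt; apply/orP; left; apply/eqP; field; lra.
  have et : 0 < e * t / 16 by rewrite divr_gt0 // mulr_gt0.
  have [N1 h1] := lf _ (small k kr) _ et; have [N2 h2] := lf _ zz _ et.
  exists (maxn N1 N2) => m q; rewrite !geq_max => /andP[m1 m2] /andP[q1 q2].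
  have a1 := h1 _ m1; have a2 := h2 _ m2; have b1 := h1 _ q1; have b2 := h2 _ q2.
  have km := key m k kr; have kq := key q k kr; rewrite !SL lk in km kq.
  rewrite -(ler_pM2l t0) -[t in t * cabs _](gtr0_norm t0) -cabs_real -cabsM.
  set Em := (X in cabs X) in km; set Eq := (X in cabs X) in kq.
  have -> : ((t)%:C)%C * (L m j - L q j) =
     (f_ m (z + k) - f (z + k)) - (f_ q (z + k) - f (z + k)) - (f_ m z - f z) +
     (f_ q z - f z) - Em + Eq by rewrite /Em /Eq; ring.
  have n1 := cabsD ((f_ m (z + k) - f (z + k)) - (f_ q (z + k) - f (z + k)) - (f_ m z - f z) +
     (f_ q z - f z) - Em) Eq.
  have n2 := cabsB ((f_ m (z + k) - f (z + k)) - (f_ q (z + k) - f (z + k)) - (f_ m z - f z) +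
     (f_ q z - f z)) Em.
  have n3 := cabsD ((f_ m (z + k) - f (z + k)) - (f_ q (z + k) - f (z + k)) - (f_ m z - f z))
     (f_ q z - f z).
  have n4 := cabsB ((f_ m (z + k) - f (z + k)) - (f_ q (z + k) - f (z + k))) (f_ m z - f z).
  have n5 := cabsB (f_ m (z + k) - f (z + k)) (f_ q (z + k) - f (z + k)).
  have : B * t * t <= e / 4 * t by rewrite ler_wpM2r // ltW.
  have et' : 0 < e * t by rewrite mulr_gt0.
  clear - a1 a2 b1 b2 km kq n1 n2 n3 n4 n5 et'.
  rewrite (_ : B * t ^+ 2 = B * t * t) in km; last by ring.
  rewrite (_ : B * t ^+ 2 = B * t * t) in kq; last by ring.
  move=> h; lra.
have [l hl] := choice cauL.
apply: (@cdiff_differentiable _ _ _ _ l) => e e0.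
have B1 : 0 < B + 1 by lra.
exists (Num.min (rho / 4) (e / (B + 1))); first by rewrite lt_min !divr_gt0.
move=> k; rewrite lt_min => /andP[/ltW kr]; rewrite ltr_pdivlMr // => ke.
have k0 := l1_ge0 k.
apply: (@le_trans _ _ (B * l1 k ^+ 2)); last first.
  rewrite expr2 mulrA ler_wpM2r //; move: ke; rewrite mulrDr mulr1 (mulrC B); lra.
apply/ler_addgt0Pl => d d0.
have d1 : 0 < d / (2 + l1 k) by rewrite divr_gt0 //; lra.
pose c := d / (2 + l1 k).
have [N1 h1] := lf _ (small k kr) _ d1; have [N2 h2] := lf _ zz _ d1.
have hN : exists N3, forall j m, (N3 <= m)%N -> cabs (L m j - l j) <= c.
  have [N3_ hN3] := choice (fun j => hl j _ d1).
  exists (\max_(j < n) N3_ j) => j m hm; apply: hN3; apply: leq_trans hm.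
  exact: (leq_bigmax j).
have [N3 h3] := hN.
pose m := maxn N1 (maxn N2 N3).
have a1 := h1 m (leq_maxl _ _).
have a2 : cabs (f_ m z - f z) <= c by apply: h2; rewrite /m maxnCA leq_maxl.
have a3 j : cabs (L m j - l j) <= c by apply: h3; rewrite /m !leq_max leqnn !orbT.
have km := key m k kr; set Em := (X in cabs X) in km.
pose S := \sum_(j < n) (L m j - l j) * k ord0 j.
have hS : cabs S <= c * l1 k.
  apply: le_trans (cabs_sum _ _ _) _; rewrite /l1 mulr_sumr; apply: ler_sum => j _.
  by rewrite cabsM ler_wpM2r ?cabs_ge0.
have -> : f (z + k) - f z - \sum_(j < n) l j * k ord0 j =
    Em - (f_ m (z + k) - f (z + k)) + (f_ m z - f z) + S.
  have -> : S = \sum_(j < n) L m j * k ord0 j - \sum_(j < n) l j * k ord0 j.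
    by rewrite /S -sumrB; apply: eq_bigr => j _; rewrite mulrBl.
  by rewrite /Em; ring.
have n1 := cabsD (Em - (f_ m (z + k) - f (z + k)) + (f_ m z - f z)) S.
have n2 := cabsD (Em - (f_ m (z + k) - f (z + k))) (f_ m z - f z).
have n3 := cabsB Em (f_ m (z + k) - f (z + k)).
have cd : c * (2 + l1 k) = d by rewrite /c divfK // gt_eqF //; lra.
rewrite -/c in a1; rewrite mulrDr in cd.
clear - a1 a2 km hS n1 n2 n3 cd; lra.
Qed.

Lemma cdiff_shift g z w l : cdiff g (z + w) l -> cdiff (fun x => g (x + w)) z l.
Proof.
move=> h e /h[dl dl0 H]; exists dl => // k /H.
by rewrite (addrAC z k w).
Qed.

Lemma differentiable_coordinate z j : differentiable (fun w : Cn R n => w ord0 j : R[i]^o) z.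
Proof.
apply: (@cdiff_differentiable _ _ _ _ (fun i => (i == j)%:R)) => e e0; exists 1 => // k _.
rewrite mxE (bigD1 j) //= eqxx mul1r big1 => [|i ij]; last by rewrite (negbTE ij) mul0r.
by rewrite addr0 (addrC (z _ _)) addrK subrr cabs0 mulr_ge0 ?l1_ge0 // ltW.
Qed.

(** The difference quotients [F m] with real steps [T m] are differentiable, uniformly bounded, and
    converge to the partial derivative by Taylor's formula; [hol_limit] applies. Thus second
    derivatives need no integral formula. *)
Lemma partial_differentiable g z (rho M : R) j : 0 < rho ->
  (forall w, l1 (w - z) < rho -> differentiable g w) ->
  (forall w, l1 (w - z) < rho -> cabs (g w) <= M) ->
  differentiable (fun w => 'D_('e_j) g w : R[i]^o) z.
Proof.
move=> rho0 dg bg.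
have zz : l1 (z - z) < rho by rewrite subrr l1_0.
have M0 : 0 <= M := le_trans (cabs_ge0 (g z)) (bg _ zz).
have K0 := taylorK_gt0 R.
pose r := rho / 2; have r0 : 0 < r by rewrite divr_gt0.
have sub w w' : l1 (w - z) < r -> l1 (w' - w) < r -> l1 (w' - z) < rho.
  move=> h1 h2; have := l1D (w' - w) (w - z); rewrite addrA subrK.
  have rE : rho = r + r by rewrite /r; lra.
  by rewrite rE; lra.
have key w (t : R) : l1 (w - z) < r -> 0 < t <= r / 4 ->
    cabs (g (w + ((t)%:C)%C *: 'e_j) - g w - ((t)%:C)%C * ('D_('e_j) g w : C)) <=
    taylorK R * M * (t / r) ^+ 2.
  move=> wz /andP[t0 tr].
  have lk : l1 (((t)%:C)%C *: 'e_j : Cn R n) = t.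
    by rewrite l1Z l1_delta mulr1 cabs_real gtr0_norm.
  have dw : differentiable g w by apply: dg; apply: lt_trans wz _; rewrite /r; lra.
  have := @taylor_l1 R n g w r M _ (((t)%:C)%C *: 'e_j) r0 (fun w' h => dg w' (sub _ _ wz h))
    (fun w' h => bg w' (sub _ _ wz h)) (differentiable_cdiff dw).
  rewrite lk => /(_ tr).
  rewrite (bigD1 j) //= big1 ?addr0 => [|i ij]; last first.
    by rewrite mxE mxE (negbTE ij) andbF !mulr0.
  by rewrite mxE mxE !eqxx mulr1 (mulrC ('D_ _ g w)).
pose T m : R := r / 4 / m.+1%:R.
have T0 m : 0 < T m by rewrite !divr_gt0.
have T4 m : 0 < T m <= r / 4.
  by rewrite T0 ler_pdivrMr // ler_peMr ?ler1n // ltW // divr_gt0.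
pose B := taylorK R * M / r ^+ 2.
have B0 : 0 <= B by rewrite divr_ge0 ?sqr_ge0 // mulr_ge0 // ltW.
pose F m w : R[i]^o := (((T m)^-1)%:C)%C *: (g (w + ((T m)%:C)%C *: 'e_j) - g w).
have FD m w : l1 (w - z) < r -> cabs (F m w - 'D_('e_j) g w) <= B * T m.
  move=> wz; have h := key w _ wz (T4 m).
  have -> : F m w - 'D_('e_j) g w = (((T m)^-1)%:C)%C *
    (g (w + ((T m)%:C)%C *: 'e_j) - g w - ((T m)%:C)%C * ('D_('e_j) g w : C)).
    rewrite [RHS]mulrBr mulrA -rmorphM /= mulVf ?gt_eqF // ?mul1r //.
  rewrite cabsM cabs_real gtr0_norm ?invr_gt0 // mulrC ler_pdivrMr //.
  apply: le_trans h _; rewrite /B exprMn exprVn.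
  by rewrite le_eqVlt; apply/orP; left; apply/eqP; ring.
have r4 : 0 < r / 4 <= r / 4 by rewrite lexx divr_gt0.
pose D := (2 * M + taylorK R * M * (4^-1) ^+ 2) / (r / 4).
have bD w : l1 (w - z) < r -> cabs ('D_('e_j) g w) <= D.
  move=> wz; have := key w _ wz r4; set E := (X in cabs X) => hE.
  have r40 : 0 < r / 4 by rewrite divr_gt0.
  rewrite /D ler_pdivlMr // mulrC -[X in X * cabs _](gtr0_norm r40) -cabs_real -cabsM.
  have -> : ((r / 4)%:C)%C * ('D_('e_j) g w : C) = g (w + ((r / 4)%:C)%C *: 'e_j) - g w - E.
    by rewrite /E; ring.
  apply: le_trans (cabsB _ _) _; apply: lerD.
    apply: le_trans (cabsB _ _) _; rewrite mulr2n mulrDl mul1r; apply: lerD; apply: bg.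
      apply: (sub w) => //; rewrite (addrC w) addrK l1Z l1_delta mulr1 cabs_real gtr0_norm //.
      by lra.
    by apply: lt_trans wz _; rewrite /r; lra.
  apply: le_trans hE _; rewrite (_ : r / 4 / r = 4^-1) //; field; rewrite gt_eqF //.
apply: (@hol_limit F _ z r (B * (r / 4) + D) r0).
- move=> m w wz.
  have dw : differentiable g w by apply: dg; apply: lt_trans wz _; rewrite /r; lra.
  have dw' : differentiable g (w + ((T m)%:C)%C *: 'e_j).
    apply: dg; apply: (sub w) => //.
    rewrite (addrC w) addrK l1Z l1_delta mulr1 cabs_real gtr0_norm //.
    by have /andP[_] := T4 m; lra.
  apply: (@differentiableZ _ _ _ (fun w => g (w + ((T m)%:C)%C *: 'e_j) - g w)).
  apply: (@differentiableB _ _ _ (fun w => g (w + ((T m)%:C)%C *: 'e_j)) g w _ dw).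
  exact: (cdiff_differentiable (cdiff_shift (differentiable_cdiff dw'))).
- move=> m w wz; have h1 := FD m w wz; have h2 := bD w wz.
  have -> : F m w = (F m w - 'D_('e_j) g w) + 'D_('e_j) g w by rewrite subrK.
  apply: le_trans (cabsD _ _) _; apply: lerD => //; apply: le_trans h1 _.
  by rewrite ler_wpM2l //; have /andP[] := T4 m.
- move=> w wz e e0.
  pose q := B * (r / 4) / e.
  have q0 : 0 <= q by rewrite divr_ge0 ?(ltW e0) // mulr_ge0 // ltW // divr_gt0.
  exists (Num.bound q) => m hm; apply: le_trans (FD m w wz) _.
  have hq : q <= m.+1%:R.
    apply: le_trans (ltW (archi_boundP q0)) _; rewrite ler_nat; exact: leqW.
  by rewrite /T mulrA ler_pdivrMr // [X in _ <= X]mulrC -ler_pdivrMr.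
Qed.

Lemma sqnorm_ge0 z : 0 <= sqnorm z.
Proof. by apply: sumr_ge0 => j _; exact: sqr_ge0. Qed.

Lemma cabs_le_sqnorm z j : cabs (z ord0 j) ^+ 2 <= sqnorm z.
Proof.
by rewrite /sqnorm (bigD1 j) //= lerDl; apply: sumr_ge0 => i _; exact: sqr_ge0.
Qed.

Lemma sqnormD_le z k : sqnorm z <= 1 -> sqnorm (z + k) <= sqnorm z + 2 * l1 k + l1 k ^+ 2.
Proof.
move=> z1.
have zj j : cabs (z ord0 j) <= 1.
  rewrite -(@ler_pXn2r _ 2) ?nnegrE ?cabs_ge0 // expr1n.
  exact: le_trans (cabs_le_sqnorm z j) z1.
have -> : sqnorm z + 2 * l1 k + l1 k ^+ 2 =
    \sum_(j < n) (cabs (z ord0 j) ^+ 2 + 2 * cabs (k ord0 j) + l1 k * cabs (k ord0 j)).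
  by rewrite !big_split /= -!mulr_sumr expr2.
apply: ler_sum => j _; rewrite mxE.
apply: (@le_trans _ _ ((cabs (z ord0 j) + cabs (k ord0 j)) ^+ 2)).
  by rewrite lerXn2r ?nnegrE ?addr_ge0 ?cabs_ge0 // cabsD.
rewrite sqrrD -addrA -[X in _ <= X]addrA lerD2l.
have kj := cabs_ge0 (k ord0 j).
apply: lerD.
  by rewrite -mulrnAl -mulr_natl -mulrA ler_wpM2l // ler_piMl.
by rewrite expr2 ler_wpM2r // cabs_le_l1.
Qed.

Lemma ball_open z : ball_n n z -> exists2 rho : R, 0 < rho &
  forall w, l1 (w - z) < rho -> ball_n n w.
Proof.
rewrite /ball_n /= => z1; pose d := 1 - sqnorm z.
have d0 : 0 < d by rewrite subr_gt0.
have d1 : d <= 1 by rewrite /d; have := sqnorm_ge0 z; lra.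
exists (d / 4); first by rewrite divr_gt0.
move=> w wz; have := sqnormD_le (w - z) (ltW z1); rewrite subrKC.
have := l1_ge0 (w - z); move: wz; set t := l1 _ => td t0.
have : t ^+ 2 <= d / 4 * 1 by rewrite expr2; apply: ler_pM => //; lra.
rewrite /d in td *; lra.
Qed.

Lemma hol_local_bound g z : holomorphic_on_ball g -> ball_n n z ->
  exists rho M : R, [/\ 0 < rho, forall w, l1 (w - z) < rho -> ball_n n w &
    forall w, l1 (w - z) < rho -> cabs (g w) <= M].
Proof.
move=> hg zb; have [r r0 hr] := ball_open zb.
have [dl dl0 H] := cdiff_cont (differentiable_cdiff (hg z zb)) ltr01.
exists (Num.min r dl), (cabs (g z) + 1); rewrite lt_min r0; split => //.
  by move=> w; rewrite lt_min => /andP[/hr].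
move=> w; rewrite lt_min => /andP[_ /H]; rewrite subrKC => h.
by have := cabsD (g w - g z) (g z); rewrite subrK; lra.
Qed.

Lemma partial_hol g j : holomorphic_on_ball g ->
  holomorphic_on_ball (fun w : Cn R n => 'D_('e_j) g w : R[i]^o).
Proof.
move=> hg z zb; have [rho [M [rho0 hb bg]]] := hol_local_bound hg zb.
by apply: (partial_differentiable j rho0 _ bg) => w /hb; exact: hg.
Qed.

Lemma radial_deriv_hol g : holomorphic_on_ball g ->
  holomorphic_on_ball (radial_deriv g : Cn R n -> R[i]^o).
Proof.
move=> hg z zb; rewrite /radial_deriv.
have -> : (fun z : Cn R n => \sum_(j < n) z ord0 j * ('D_('e_j) g z : C) : R[i]^o) =
    \sum_(j < n) ((fun z : Cn R n => z ord0 j : R[i]^o) * (fun z => 'D_('e_j) g z : R[i]^o)).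
  by apply/funext => w; rewrite fct_sumE.
apply: differentiable_sum => j; apply: differentiableM.
  exact: differentiable_coordinate.
exact: partial_hol.
Qed.

End HolomorphicLimits.

(** * Integrals over the ball and ellipsoids *)

Section BallMeasurability.
Variable R : realType.
Local Notation C := R[i].
Variable n : nat.
Implicit Types (z k : Cn R n) (phi psi : Cn R n -> R).

Definition bmeas phi := forall d (T : measurableType d) (c : T -> nat -> C),
  coord_measurable c -> measurable_fun setT (fun t => phi (\row_(i < n) c t i)).

Lemma bmeas_borel phi : bmeas phi -> borel (fun w => (phi (\row_(i < n) w i))%:E).
Proof. by move=> h d T c mc; apply/measurable_EFinP; exact: h. Qed.

Lemma bmeas_lsc phi :
  (forall z a, a < phi z -> exists2 dl : R, 0 < dl & forall k, l1 k < dl -> a < phi (z + k)) ->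
  bmeas phi.
Proof.
move=> H d T c mc.
have hl : lsc_upto n (fun w : nat -> C => phi (\row_(i < n) w i)).
  move=> a w /H[dl dl0 h]; have n0 : 0 < n%:R + 1 :> R by rewrite ltr_wpDl.
  exists (dl / (n%:R + 1)); first by rewrite divr_gt0.
  move=> v hv; pose k : Cn R n := \row_(i < n) (v i - w i).
  have -> : \row_(i < n) v i = (\row_(i < n) w i) + k by apply/rowP => i; rewrite !mxE subrKC.
  apply: h; rewrite /l1; apply: (@le_lt_trans _ _ (\sum_(j < n) dl / (n%:R + 1))).
    by apply: ler_sum => j _; rewrite mxE; apply/ltW/hv.
  have -> : \sum_(j < n) dl / (n%:R + 1) = dl * (n%:R / (n%:R + 1)).
    by rewrite sumr_const card_ord -[LHS]mulr_natr mulrAC mulrA.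
  by rewrite gtr_pMr // ltr_pdivrMr // mul1r ltrDl.
by have /measurable_EFinP := lsc_borel hl mc.
Qed.

Lemma bmeasM phi psi : bmeas phi -> bmeas psi -> bmeas (fun z => phi z * psi z).
Proof. by move=> h1 h2 d T c mc; apply: measurable_funM; [exact: h1|exact: h2]. Qed.

Lemma bmeas_powR phi (p : R) : bmeas phi -> bmeas (fun z => phi z `^ p).
Proof. by move=> h d T c mc; apply: (measurableT_comp (measurable_powR p)); exact: h. Qed.

Lemma bmeas_cst (a : R) : bmeas (fun=> a).
Proof. by move=> d T c mc; exact: measurable_cst. Qed.

Definition cutb phi z := if sqnorm z < 1 then phi z else 0.

Definition contn phi z := forall e : R, 0 < e -> exists2 dl : R, 0 < dl &
  forall k, l1 k < dl -> `|phi (z + k) - phi z| < e.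

(** Such a cut-off is lower semicontinuous: a positive threshold is only exceeded inside the open
    ball, a negative one everywhere. *)
Lemma bmeas_cutb phi : (forall z, ball_n n z -> 0 <= phi z) ->
  (forall z, ball_n n z -> contn phi z) -> bmeas (cutb phi).
Proof.
move=> p0 pc; apply: bmeas_lsc => z a.
have c0 w : 0 <= cutb phi w by rewrite /cutb; case: ifPn => // /p0.
have [a0 _|a0] := ltP a 0.
  by exists 1 => // k _; apply: lt_le_trans a0 (c0 _).
rewrite {1}/cutb; case: ifPn => [zb h|_]; last by rewrite ltNge a0.
have [r r0 hr] := ball_open (zb : ball_n n z).
have e0 : 0 < phi z - a by rewrite subr_gt0.
have [dl dl0 H] := pc z zb _ e0.
exists (Num.min r dl); first by rewrite lt_min r0.
move=> k; rewrite lt_min => /andP[kr /H]; rewrite ltr_norml => /andP[h1 _].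
have kb : sqnorm (z + k) < 1 by apply: hr; rewrite (addrC z) addrK.
by rewrite /cutb kb; lra.
Qed.

Lemma contn_cabs (f : Cn R n -> R[i]^o) z : differentiable f z -> contn (fun z => cabs (f z)) z.
Proof.
move=> /differentiable_cdiff /cdiff_cont h e /h[dl dl0 H]; exists dl => // k /H.
apply: le_lt_trans; have := cabsD (f (z + k) - f z) (f z).
have := cabsD (f z - f (z + k)) (f (z + k)).
rewrite !subrK (cabs_distC (f z)) => h1 h2.
by rewrite ler_norml; apply/andP; split; lra.
Qed.

Lemma contn_comp (psi : R -> R) phi z : contn phi z -> {for phi z, continuous psi} ->
  contn (fun z => psi (phi z)) z.
Proof.
move=> hp /cvgrPdist_lt hc e e0; have /nbhs_ballP[d /= d0 H] := hc e e0.
have [dl dl0 h] := hp _ d0; exists dl => // k /h hk.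
by rewrite distrC; apply: H; rewrite /ball /= distrC.
Qed.

Lemma contn_sum (I : Type) (s : seq I) (F : I -> Cn R n -> R) z :
  (forall i, contn (F i) z) -> contn (fun z => \sum_(i <- s) F i z) z.
Proof.
move=> hF; elim: s => [|i s IH] e e0.
  by exists 1 => // k _; rewrite !big_nil subrr normr0.
have e2 : 0 < e / 2 by rewrite divr_gt0.
have [d1 d10 h1] := hF i _ e2; have [d2 d20 h2] := IH _ e2.
exists (Num.min d1 d2); first by rewrite lt_min d10.
move=> k; rewrite lt_min !big_cons => /andP[/h1 a1 /h2 a2].
rewrite opprD addrACA; apply: le_lt_trans (ler_normD _ _) _; lra.
Qed.

Lemma contn_sqnorm z : contn (fun z => sqnorm z) z.
Proof.
apply: contn_sum => j; apply: (@contn_comp (fun x => x ^+ 2)); last exact: exprn_continuous.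
by apply: contn_cabs; exact: differentiable_coordinate.
Qed.

Lemma bmeas_sqnorm : bmeas (fun z => sqnorm z).
Proof.
apply: bmeas_lsc => z a az; have e0 : 0 < sqnorm z - a by rewrite subr_gt0.
have [dl dl0 h] := @contn_sqnorm z _ e0; exists dl => // k /h.
by rewrite ltr_norml => /andP[h1 _]; lra.
Qed.

Lemma bmeas_weight : bmeas (cutb (fun z => weight z)).
Proof.
apply: bmeas_cutb => [z _|z zb]; first exact: expR_ge0.
have s1 : 1 - sqnorm z != 0 by rewrite gt_eqF // subr_gt0.
apply: (@contn_comp expR (fun z => - (1 - sqnorm z)^-1)); last exact: continuous_expR.
apply: (@contn_comp -%R (fun z => (1 - sqnorm z)^-1)); last exact: opp_continuous.
apply: (@contn_comp GRing.inv (fun z => 1 - sqnorm z)); last exact: inv_continuous.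
move=> e /(@contn_sqnorm z)[dl dl0 h]; exists dl => // k /h.
have -> : 1 - sqnorm (z + k) - (1 - sqnorm z) = - (sqnorm (z + k) - sqnorm z) by ring.
by rewrite normrN.
Qed.

Lemma bmeas_cut_cabs (f : Cn R n -> R[i]^o) : holomorphic_on_ball f ->
  bmeas (cutb (fun z => cabs (f z))).
Proof.
move=> hf; apply: bmeas_cutb => z zb; first exact: cabs_ge0.
by apply: contn_cabs; exact: hf.
Qed.

(** The cut-off is distributed over the factors so that each is Borel on the whole space; outside
    the ball the integrand vanishes because [p] is positive, while [0] to the power [0] would be
    [1]. *)
Lemma ball_intE (p : R) (w : Cn R n -> R) (f : Cn R n -> R[i]^o) : 0 < p ->
  ball_int p w f = iter_int n (fun u => let z := \row_(i < n) u i in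
    (cutb (fun z => cabs (f z)) z `^ p * cutb (fun z => weight z) z * w z)%:E).
Proof.
move=> p0; rewrite /ball_int /vol_int; apply: eq_iter_int => u /=.
rewrite /cutb; case: ifPn => // _; by rewrite powR0 ?gt_eqF // !mul0r.
Qed.

Lemma borel_ball_int (p : R) (w : Cn R n -> R) (f : Cn R n -> R[i]^o) :
  holomorphic_on_ball f -> bmeas w ->
  borel (fun u => let z := \row_(i < n) u i in
    (cutb (fun z => cabs (f z)) z `^ p * cutb (fun z => weight z) z * w z)%:E).
Proof.
move=> hf bw; apply: (@bmeas_borel (fun z => cutb (fun z => cabs (f z)) z `^ p *
  cutb (fun z => weight z) z * w z)).
apply: bmeasM => //; apply: bmeasM; last exact: bmeas_weight.
by apply: bmeas_powR; exact: bmeas_cut_cabs.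
Qed.

End BallMeasurability.

(** * Lower bounds in triangular coordinates *)

Section TriangularCoordinates.
Variable R : realType.
Local Notation C := R[i].
Local Notation mu := (@lebesgue_measure R).

(* The coordinates are [w_k - c_k + s_k L_(k+1)], where
   [L_k = \sum_(j >= k) b_j (w_j - c_j)]; the argument [L] below is [L_k]. *)
Variables (b s c : nat -> C).

(** The point whose triangular coordinates below [k] all vanish, when the coordinates already fixed
    contribute [L]. *)
Fixpoint tri_center (k : nat) (L : C) : nat -> C :=
  if k is k'.+1 then set_coord k' (c k' - s k' * L) (tri_center k' (L + b k' * (- (s k' * L))))
  else fun=> 0.

Fixpoint tri_region (r : nat -> R) (k : nat) (L : C) (w : nat -> C) : Prop :=
  if k is k'.+1 then cabs (w k' - c k' + s k' * L) ^+ 2 < r k' /\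
    tri_region r k' (L + b k' * (w k' - c k')) w
  else True.

Lemma tri_region_set_coord r k m L a w : (k <= m)%N ->
  tri_region r k L (set_coord m a w) <-> tri_region r k L w.
Proof.
elim: k L => [|k IH] L //= km.
have -> : set_coord m a w k = w k by rewrite /set_coord ltn_eqF.
by split=> -[h1 h2]; split => //; apply/IH => //; exact: ltnW.
Qed.

Lemma tri_region_center r k L : (forall i, 0 < r i) -> tri_region r k L (tri_center k L).
Proof.
move=> r0; elim: k L => [|k IH] L //=; rewrite /set_coord eqxx; split.
  by rewrite (_ : _ + _ = 0) ?cabs0 ?expr0n //; ring.
apply/(@tri_region_set_coord _ _ k) => //.
by rewrite (_ : c k - s k * L - c k = - (s k * L)); [exact: IH|ring].
Qed.

(** Since the centre of the inner coordinates moves affinely with the outer one, the value of [h] at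
    that centre is a holomorphic function of the outer coordinate. *)
Lemma tri_center_affine k : exists A B : nat -> C, forall L j,
  tri_center k L j = A j + L * B j.
Proof.
elim: k => [|k [A [B H]]]; first by exists (fun=> 0), (fun=> 0) => L j; rewrite mulr0 addr0.
exists (set_coord k (c k) A), (set_coord k (- s k) (fun j => (1 - b k * s k) * B j)) => L j.
rewrite /= /set_coord; case: eqP => _; first by ring.
by rewrite H; ring.
Qed.

(** Holomorphy along affine lines is inherited when one coordinate is frozen or when the inner
    coordinates follow an affine curve, the two operations of the induction below. *)
Definition line_hol (h : (nat -> C) -> C) (U : (nat -> C) -> Prop) := forall (A B : nat -> C) a,
  U (fun j => A j + a * B j) -> exists l, cderiv (fun x => h (fun j => A j + x * B j)) a l.

Lemma measurable_cut_scaled (P p r : R) (c0 : C) phi : 0 < p -> 0 <= P -> hol_disc phi c0 r ->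
  (\int[mu]_x \int[mu]_y (P * cut_pow p r c0 phi (Complex x y))%:E =
   P%:E * \int[mu]_x \int[mu]_y (cut_pow p r c0 phi (Complex x y))%:E)%E.
Proof.
move=> p0 P0 hol.
have m : measurable_fun setT (fun q : R * R => (cut_pow p r c0 phi (Complex q.1 q.2))%:E).
  by apply/measurable_EFinP; exact: measurable_cut_pow.
have g0 x y : (0 <= (cut_pow p r c0 phi (Complex x y))%:E)%E by rewrite lee_fin cut_pow_ge0.
rewrite -ge0_integralZl_EFin //; last 2 first.
- by move=> x _; apply: integral_ge0 => y _; exact: g0.
- by apply: (@measurable_fun_fubini_tonelli_F _ _ _ _ R mu _ m) => q; exact: g0.
apply: eq_integral => x _; rewrite -ge0_integralZl_EFin //.
apply: (measurableT_comp m (g := fun y => (x, y))).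
by apply: measurable_fun_pair; [exact: measurable_cst|exact: measurable_id].
Qed.

(** For a fixed outer coordinate [z] the inner integral dominates [|phi z|^p], where [phi] evaluates
    [h] at the moving centre; the one-variable inequality in [z] finishes the step. The disc is
    halved to [r / 2] to leave room for the larger disc of holomorphy, so the factor [r / 4] becomes
    [r / 8]. *)
Lemma tri_submean (p : R) (r : nat -> R) k L (h : (nat -> C) -> C) (F : (nat -> C) -> \bar R) :
  1 <= p -> (forall i, 0 < r i) -> line_hol h (tri_region r k L) ->
  (forall w, 0 <= F w)%E ->
  (forall w, tri_region r k L w -> ((cabs (h w) `^ p)%:E <= F w)%E) ->
  ((\prod_(i < k) (r i / 8) * cabs (h (tri_center k L)) `^ p)%:E <= iter_int k F)%E.
Proof.
move=> p1 r0; have p0 : 0 < p by apply: lt_le_trans p1.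
elim: k L h F => [|k IH] L h F hh F0 hF.
  by rewrite big_ord0 mul1r; exact: hF.
pose Lz z := L + b k * (z - c k).
pose pt z := set_coord k z (tri_center k (Lz z)).
pose phi z := h (pt z).
pose c0 := c k - s k * L.
have c0E z : z - c0 = z - c k + s k * L by rewrite /c0; ring.
have [A [B AB]] := tri_center_affine k.
have ptE : pt = fun z j => set_coord k 0 (fun j => A j + (L - b k * c k) * B j) j +
    z * set_coord k 1 (fun j => b k * B j) j.
  apply/funext => z; apply/funext => j; rewrite /pt /set_coord; case: eqP => _.
    by ring.
  by rewrite AB /Lz; ring.
have hol : hol_disc phi c0 (r k).
  move=> z; rewrite /sqd c0E => zr; rewrite /phi ptE; apply: hh.
  rewrite (_ : (fun j => _) = pt z); last by rewrite ptE.
  rewrite /= /pt {1 2}/set_coord eqxx; split => //.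
  by apply/(@tri_region_set_coord _ _ k) => //; exact: tri_region_center.
have r2 : r k / 2 < r k by have := r0 k; lra.
have r20 : 0 < r k / 2 by rewrite divr_gt0.
set P := \prod_(i < k) (r i / 8).
have P0 : 0 <= P by apply: prodr_ge0 => i _; rewrite divr_ge0 // ltW.
have := submean p1 r20 r2 hol; set I := (X in (_ <= X)%E) => hI.
apply: (@le_trans _ _ (P%:E * I)%E).
  rewrite big_ord_recr /= -/P.
  have -> : h (set_coord k (c k - s k * L) (tri_center k (L + b k * - (s k * L)))) = phi c0.
    by rewrite /phi /pt /Lz /c0; congr (h (set_coord _ _ (tri_center _ _))); ring.
  apply: le_trans (lee_wpmul2l _ hI); last by rewrite lee_fin.
  by rewrite -EFinM lee_fin le_eqVlt; apply/orP; left; apply/eqP; field.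
rewrite /I -measurable_cut_scaled //; last exact: hol_disc_le (ltW r2) hol.
rewrite iter_intS; apply: ge0_le_integral_nomeas => x.
  by apply: integral_ge0 => y _; rewrite lee_fin mulr_ge0 // cut_pow_ge0.
apply: ge0_le_integral_nomeas => y.
  by rewrite lee_fin mulr_ge0 // cut_pow_ge0.
set z := Complex x y.
rewrite /cut_pow; case: ifPn => [zr|_]; last first.
  by rewrite mulr0; apply: iter_int_ge0 => w; exact: F0.
have zrk : cabs (z - c k + s k * L) ^+ 2 < r k.
  by move: zr; rewrite /sqd c0E => zr; apply: lt_trans zr r2.
apply: (IH (Lz z) (fun w => h (set_coord k z w)) (fun w => F (set_coord k z w))).
- move=> A' B' a ha.
  have E x' : set_coord k z (fun j => A' j + x' * B' j) =
      fun j => set_coord k z A' j + x' * set_coord k 0 B' j.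
    by apply/funext => j; rewrite /set_coord; case: eqP => // _; rewrite mulr0 addr0.
  under [fun x => h _]funext => x' do rewrite E.
  apply: hh; rewrite -E /= {1 2}/set_coord eqxx; split => //.
  by apply/(@tri_region_set_coord _ _ k).
- by move=> w; exact: F0.
- move=> w hw; apply: hF; rewrite /= {1 2}/set_coord eqxx; split => //.
  by apply/(@tri_region_set_coord _ _ k).
Qed.

End TriangularCoordinates.

(** * Upper bounds by products of Cauchy densities *)

Section TriangularUpperBound.
Variable R : realType.
Local Notation C := R[i].
Local Notation mu := (@lebesgue_measure R).

Lemma integral_oneDsqrV_le : (\int[mu]_x ((oneDsqr x)^-1)%:E <= (pi)%:E)%E.
Proof.
have mf : measurable_fun setT (fun x : R => ((oneDsqr x)^-1)%:E).
  by apply/measurable_EFinP; apply: continuous_measurable_fun; exact: continuous_oneDsqrV.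
have f0 x : (0 <= ((oneDsqr x)^-1)%:E :> \bar R)%E by rewrite lee_fin invr_ge0 (le_trans ler01) // oneDsqr_ge1.
have E : [set: R] = `]-oo, 0] `|` `]0, +oo[.
  by apply/esym/seteqP; split => // x _ /=; rewrite !in_itv /= andbT; have [|] := leP x 0; [left|right].
rewrite E ge0_integral_setU //=; last 2 first.
- by rewrite -E.
- rewrite disj_set2E; apply/eqP; rewrite -subset0 => x [] /=; rewrite !in_itv /= andbT.
  by move=> h1 h2; move: h1; rewrite leNgt h2.
have h0 := @integral0y_oneDsqr R.
have -> : (pi)%:E = ((pi / 2)%:E + (pi / 2)%:E)%E :> \bar R by rewrite -EFinD -splitr.
apply: leeD.
  rewrite -h0 ge0_integration_by_substitution0 //.
  by rewrite le_eqVlt; apply/orP; left; apply/eqP/eq_integral => x _; rewrite /oneDsqr sqrrN.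
rewrite -h0; apply: ge0_subset_integral => //=.
  exact: measurable_funTS.
by move=> x /=; rewrite !in_itv /= !andbT => /ltW.
Qed.

Lemma integral_cauchy_density (g m : R) : 0 < g ->
  (\int[mu]_x ((1 + g * (x - m) ^+ 2)^-1)%:E <= (pi / Num.sqrt g)%:E)%E.
Proof.
move=> g0; have s0 : 0 < Num.sqrt g by rewrite sqrtr_gt0.
have mf : measurable_fun setT (fun x : R => ((oneDsqr x)^-1)%:E).
  by apply/measurable_EFinP; apply: continuous_measurable_fun; exact: continuous_oneDsqrV.
have f0 x : (0 <= ((oneDsqr x)^-1)%:E :> \bar R)%E by rewrite lee_fin invr_ge0 (le_trans ler01) // oneDsqr_ge1.
have := integral_oneDsqrV_le; rewrite (ge0_integral_affine (- (Num.sqrt g * m)) s0 mf f0).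
have -> : (fun x : R => ((1 + g * (x - m) ^+ 2)^-1)%:E) =
    (fun x => ((oneDsqr (Num.sqrt g * x + - (Num.sqrt g * m)))^-1)%:E).
  apply/funext => x; congr ((_^-1)%:E); rewrite /oneDsqr -mulrBr exprMn sqr_sqrtr //; exact: ltW.
set I := (\int[_]_x _)%E => h.
have -> : I = (((Num.sqrt g)^-1)%:E * ((Num.sqrt g)%:E * I))%E.
  by rewrite muleA -EFinM mulVf ?gt_eqF // mul1e.
by rewrite mulrC EFinM; apply: lee_wpmul2l => //; rewrite lee_fin invr_ge0 ltW.
Qed.

Lemma measurable_cauchy_density (g m : R) : 0 < g ->
  measurable_fun setT (fun x : R => ((1 + g * (x - m) ^+ 2)^-1)%:E).
Proof.
move=> g0; apply/measurable_EFinP.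
have -> : (fun x => (1 + g * (x - m) ^+ 2)^-1) =
    (fun x => (oneDsqr x)^-1) \o (fun x => Num.sqrt g * x + - (Num.sqrt g * m)).
  apply/funext => x; rewrite /oneDsqr /= -mulrBr exprMn sqr_sqrtr //; exact: ltW.
apply: measurableT_comp.
  by apply: continuous_measurable_fun; exact: continuous_oneDsqrV.
by apply: measurable_funD => //; apply: measurable_funM.
Qed.

(** [(1 + g X) (1 + g Y) <= (1 + g (X + Y))^2] separates the real and imaginary parts into two
    Cauchy densities. *)
Lemma integral_square_density (B g : R) (m : C) : 0 <= B -> 0 < g ->
  (\int[mu]_x \int[mu]_y (B * (1 + g * cabs (Complex x y - m) ^+ 2) ^- 2)%:E <=
   (B * (pi ^+ 2 / g))%:E)%E.
Proof.
move=> B0 g0; have s0 : 0 < Num.sqrt g by rewrite sqrtr_gt0.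
pose f (t x : R) : R := (1 + g * (x - t) ^+ 2)^-1.
have d0 t x : 0 < 1 + g * (x - t) ^+ 2 :> R.
  by rewrite ltr_wpDr // mulr_ge0 ?sqr_ge0 // ltW.
have f0 t x : 0 <= f t x by rewrite invr_ge0 ltW.
have mf t : measurable_fun setT (fun x => (f t x)%:E) by exact: measurable_cauchy_density.
have pg0 : 0 <= pi / Num.sqrt g :> R by rewrite divr_ge0 ?pi_ge0 // ltW.
pose m1 := complex.Re m; pose m2 := complex.Im m.
apply: (@le_trans _ _ (\int[mu]_x ((B * (pi / Num.sqrt g))%:E * (f m1 x)%:E))%E).
  apply: ge0_le_integral_nomeas => x.
    apply: integral_ge0 => y _; rewrite lee_fin mulr_ge0 // invr_ge0 sqr_ge0 //.
  apply: (@le_trans _ _ (\int[mu]_y ((B * f m1 x)%:E * (f m2 y)%:E))%E).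
    apply: ge0_le_integral_nomeas => y.
      by rewrite lee_fin mulr_ge0 // invr_ge0 sqr_ge0.
    rewrite -EFinM lee_fin -mulrA ler_wpM2l // /f -invfM lef_pV2 ?posrE ?exprn_gt0 ?mulr_gt0 //.
      rewrite sqr_cabs ReD ReN ImD ImN /= -/m1 -/m2.
      have := sqr_ge0 (x - m1); have := sqr_ge0 (y - m2).
      move: ((x - m1) ^+ 2) ((y - m2) ^+ 2) => X Y Y0 X0.
      have : 0 <= g * X by rewrite mulr_ge0 // ltW.
      have : 0 <= g * Y by rewrite mulr_ge0 // ltW.
      rewrite (mulrDr g); move: (g * X) (g * Y) => U V V0 U0.
      have := mulr_ge0 U0 V0; have := sqr_ge0 U; have := sqr_ge0 V; rewrite !expr2; lra.
    by rewrite ltr_wpDr // mulr_ge0 ?sqr_ge0 // ltW.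
  have fe2 y : setT y -> (0 <= (f m2 y)%:E)%E by rewrite lee_fin.
  rewrite (ge0_integralZl_EFin mu measurableT fe2 (mf m2) (mulr_ge0 B0 (f0 m1 x))).
  apply: (@le_trans _ _ ((B * f m1 x)%:E * (pi / Num.sqrt g)%:E)%E).
    by apply: lee_wpmul2l; [rewrite lee_fin mulr_ge0|exact: integral_cauchy_density].
  by rewrite -!EFinM lee_fin mulrAC.
have fe0 x : setT x -> (0 <= (f m1 x)%:E)%E by rewrite lee_fin.
rewrite (ge0_integralZl_EFin mu measurableT fe0 (mf m1) (mulr_ge0 B0 pg0)).
apply: (@le_trans _ _ ((B * (pi / Num.sqrt g))%:E * (pi / Num.sqrt g)%:E)%E).
  by apply: lee_wpmul2l; [rewrite lee_fin mulr_ge0|exact: integral_cauchy_density].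
rewrite -EFinM lee_fin le_eqVlt; apply/orP; left; apply/eqP.
have sg : Num.sqrt g * Num.sqrt g = g by rewrite -expr2 sqr_sqrtr // ltW.
by rewrite -[in RHS]sg; field; rewrite gt_eqF.
Qed.

Variables (b s c : nat -> C) (gam : nat -> R).

Fixpoint tri_prod (k : nat) (L : C) (w : nat -> C) : R :=
  if k is k'.+1 then (1 + gam k' * cabs (w k' - c k' + s k' * L) ^+ 2) ^- 2 *
    tri_prod k' (L + b k' * (w k' - c k')) w
  else 1.

Fixpoint tri_sum (k : nat) (L : C) (w : nat -> C) : R :=
  if k is k'.+1 then gam k' * cabs (w k' - c k' + s k' * L) ^+ 2 +
    tri_sum k' (L + b k' * (w k' - c k')) w
  else 0.

Lemma tri_prod_set_coord k m L a w : (k <= m)%N ->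
  tri_prod k L (set_coord m a w) = tri_prod k L w.
Proof.
elim: k L => [|k IH] L //= km.
have -> : set_coord m a w k = w k by rewrite /set_coord ltn_eqF.
by rewrite IH // ltnW.
Qed.

Lemma tri_upper k L (A : R) (F : (nat -> C) -> \bar R) : (forall i, 0 < gam i) -> 0 <= A ->
  (forall w, 0 <= F w)%E -> (forall w, (F w <= (A * tri_prod k L w)%:E)%E) ->
  (iter_int k F <= (A * \prod_(i < k) (pi ^+ 2 / gam i))%:E)%E.
Proof.
move=> g0; elim: k L A F => [|k IH] L A F A0 F0 hF.
  by rewrite big_ord0 mulr1 /=; apply: le_trans (hF _) _; rewrite mulr1.
rewrite iter_intS big_ord_recr /=.
set P := \prod_(i < k) _.
have P0 : 0 <= P by apply: prodr_ge0 => i _; rewrite divr_ge0 ?sqr_ge0 // ltW.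
have -> : A * (P * (pi ^+ 2 / gam k)) = A * P * (pi ^+ 2 / gam k) by rewrite mulrA.
apply: le_trans (integral_square_density (c k - s k * L) (mulr_ge0 A0 P0) (g0 k)).
apply: ge0_le_integral_nomeas => x.
  by apply: integral_ge0 => y _; exact: iter_int_ge0.
apply: ge0_le_integral_nomeas => y; first exact: iter_int_ge0.
set z := Complex x y.
pose q := (1 + gam k * cabs (z - c k + s k * L) ^+ 2) ^- 2.
have -> : z - (c k - s k * L) = z - c k + s k * L by ring.
rewrite -/q mulrAC; apply: (IH (L + b k * (z - c k)) (A * q)).
- by rewrite mulr_ge0 // invr_ge0 sqr_ge0.
- by move=> w; exact: F0.
- move=> w; apply: le_trans (hF _) _; rewrite lee_fin -mulrA /=.
  by rewrite tri_prod_set_coord // {1 2}/set_coord eqxx.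
Qed.

Lemma tri_sum_ge0 k L w : (forall i, 0 < gam i) -> 0 <= tri_sum k L w.
Proof.
move=> g0; elim: k L => [|k IH] L //=; rewrite addr_ge0 // mulr_ge0 ?sqr_ge0 //; exact: ltW.
Qed.

(** Each of the [k] factors is at least the squared inverse of [1] plus the whole sum. So decay of
    order [2 k] in the quadratic form is enough for integrability. *)
Lemma tri_prod_ge k L w : (forall i, 0 < gam i) ->
  (1 + tri_sum k L w) ^- (2 * k) <= tri_prod k L w.
Proof.
move=> g0; elim: k L => [|k IH] L; first by rewrite muln0 expr0 invr1.
rewrite /=; set q := gam k * _; set L' := L + _.
have q0 : 0 <= q by rewrite mulr_ge0 ?sqr_ge0 // ltW.
have S0 := tri_sum_ge0 k L' w g0; have := IH L'.
set S := tri_sum k L' w in S0 *; move=> h.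
have e1 : 0 < 1 + q by lra.
have e2 : 0 < 1 + S by lra.
have e3 : 0 < 1 + (q + S) by lra.
apply: (@le_trans _ _ ((1 + q) ^- 2 * (1 + S) ^- (2 * k))); last first.
  by rewrite ler_wpM2l // invr_ge0 sqr_ge0.
rewrite -invfM lef_pV2 ?posrE ?mulr_gt0 ?exprn_gt0 //.
have -> : (2 * k.+1 = 2 + 2 * k)%N by rewrite mulnS.
rewrite exprD; apply: ler_pM; rewrite ?exprn_ge0 ?(ltW e1) ?(ltW e2) //.
  by rewrite lerXn2r ?nnegrE ?(ltW e1) ?(ltW e3) //; lra.
by rewrite lerXn2r ?nnegrE ?(ltW e2) ?(ltW e3) //; lra.
Qed.

Lemma tri_region_sum (d : R) k L w : (forall i, 0 < gam i) -> 
  tri_region b s c (fun i => d / gam i) k L w -> tri_sum k L w <= k%:R * d.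
Proof.
move=> g0; elim: k L => [|k IH] L /=; first by rewrite mul0r.
move=> [h1 /IH h2]; rewrite -natr1 mulrDl mul1r addrC; apply: lerD => //.
by rewrite ltW // mulrC -ltr_pdivlMr.
Qed.

End TriangularUpperBound.

(** * Reduction of the anisotropic form to a sum of squares *)

Section CompletingSquares.
Variable R : realType.
Local Notation C := R[i].
Variables (al be : R) (a c : nat -> C).
Hypotheses (al0 : 0 < al) (be0 : 0 <= be).

(** The coefficient of the squared linear form that remains after the squares in the coordinates
    below [i] have been completed. It starts from [be], and one step replaces
    [be |L + b z|^2 + al |z|^2] by a square in [z] plus a smaller multiple of [|L|^2]. *)
Fixpoint sq_beta (i : nat) : R :=
  if i is j.+1 then al * sq_beta j / (al + sq_beta j * cabs (a j) ^+ 2) else be.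

Definition sq_gamma i := al + sq_beta i * cabs (a i) ^+ 2.

Lemma sq_beta_ge0 i : 0 <= sq_beta i.
Proof.
elim: i => [|i IH] //=; apply: divr_ge0; first by apply: mulr_ge0 => //; exact: ltW.
by apply: addr_ge0; [exact: ltW|apply: mulr_ge0 => //; exact: sqr_ge0].
Qed.

Lemma sq_gamma_gt0 i : 0 < sq_gamma i.
Proof. by rewrite /sq_gamma ltr_wpDr // mulr_ge0 ?sqr_ge0 ?sq_beta_ge0. Qed.

Definition sq_b i : C := conjc (a i).
Definition sq_s i : C := ((sq_beta i / sq_gamma i)%:C)%C * a i.

Lemma complete_square i (z L : C) :
  al * cabs z ^+ 2 + sq_beta i * cabs (L + sq_b i * z) ^+ 2 =
  sq_gamma i * cabs (z + sq_s i * L) ^+ 2 + sq_beta i.+1 * cabs L ^+ 2.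
Proof.
have g0 := sq_gamma_gt0 i.
rewrite /= -/(sq_gamma i) /sq_s /sq_b.
have gE : al = sq_gamma i - sq_beta i * cabs (a i) ^+ 2 by rewrite /sq_gamma addrK.
rewrite [in LHS]gE [X in X * sq_beta i / _]gE.
move: (sq_gamma i) (sq_beta i) g0 => g be' g0.
rewrite !sqr_cabs; case: (a i) z L => [a1 a2] [z1 z2] [L1 L2] /=.
by field; rewrite gt_eqF.
Qed.

Lemma tri_sumE k L (w : nat -> C) :
  tri_sum sq_b sq_s c sq_gamma k L w + sq_beta k * cabs L ^+ 2 =
  al * (\sum_(i < k) cabs (w i - c i) ^+ 2) +
  be * cabs (L + \sum_(i < k) sq_b i * (w i - c i)) ^+ 2.
Proof.
elim: k L => [|k IH] L; first by rewrite !big_ord0 mulr0 addr0 !add0r.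
rewrite [tri_sum _ _ _ _ _ _ _]/= addrAC.
rewrite -(complete_square k (w k - c k) L) -addrA (addrC (_ * cabs (L + _) ^+ 2)) IH.
by rewrite !big_ord_recr /= -addrA (addrC (sq_b k * _)); ring.
Qed.

End CompletingSquares.

(** * Test functions *)

Section RealGeometry.
Variable R : realType.
Implicit Types (x y u v : R).

(* In terms of [x = 1 - |z|^2], [y = 1 - |a|^2] and [u + i v = 1 - <z, a>], the test
   function below satisfies [|f_a|^p e^(-psi) = e^(-gapD)], while [gapQ] is the
   anisotropic distance [|z - a|^2 / y^2 + |<z - a, a>|^2 / y^3]. *)
Definition gapD x y u v := x^-1 + y^-1 - 2 * u / (u ^+ 2 + v ^+ 2).

Definition gapQ x y u v := (2 * u - x - y) / y ^+ 2 + ((u - y) ^+ 2 + v ^+ 2) / y ^+ 3.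

(** In the application [2 u - x - y] is [|z - a|^2], so all three terms are nonnegative. They
    control the difference of the defects, the distance, and the tangential part [v], one each. *)
Lemma gapD_split x y u v : 0 < x -> 0 < y -> 0 < u ->
  gapD x y u v = (x - y) ^+ 2 / (x * y * (x + y)) +
    2 * (2 * u - x - y) / ((x + y) * u) + 2 * v ^+ 2 / (u * (u ^+ 2 + v ^+ 2)).
Proof.
move=> x0 y0 u0; rewrite /gapD.
have q0 : 0 < u ^+ 2 + v ^+ 2 by rewrite ltr_wpDr ?sqr_ge0 ?exprn_gt0.
by field; rewrite !gt_eqF // addr_gt0.
Qed.

Lemma gap_u_gt0 x y u : 0 < x -> 0 < y -> x + y <= 2 * u -> 0 < u.
Proof. by move=> *; lra. Qed.

Lemma gapD_parts x y u v : 0 < x -> 0 < y -> x + y <= 2 * u -> [/\ 0 <= gapD x y u v,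
  (x - y) ^+ 2 <= gapD x y u v * (x * y * (x + y)),
  2 * (2 * u - x - y) <= gapD x y u v * ((x + y) * u) &
  2 * v ^+ 2 <= gapD x y u v * (u * (u ^+ 2 + v ^+ 2))].
Proof.
move=> x0 y0 xy2u; have u0 := gap_u_gt0 x0 y0 xy2u.
have q0 : 0 < u ^+ 2 + v ^+ 2 by rewrite ltr_wpDr ?sqr_ge0 ?exprn_gt0.
have a0 : 0 < x * y * (x + y) by rewrite !mulr_gt0 // addr_gt0.
have b0 : 0 < (x + y) * u by rewrite mulr_gt0 // addr_gt0.
have c0 : 0 < u * (u ^+ 2 + v ^+ 2) by rewrite mulr_gt0.
have n1 : 0 <= (x - y) ^+ 2 / (x * y * (x + y)) by rewrite divr_ge0 ?sqr_ge0 // ltW.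
have n2 : 0 <= 2 * (2 * u - x - y) / ((x + y) * u).
  by apply: divr_ge0; [apply: mulr_ge0 => //; lra|exact: ltW].
have n3 : 0 <= 2 * v ^+ 2 / (u * (u ^+ 2 + v ^+ 2)).
  by apply: divr_ge0; [apply: mulr_ge0 => //; exact: sqr_ge0|exact: ltW].
have E := gapD_split v x0 y0 u0.
move: E n1 n2 n3; set T1 := _ / (x * y * _); set T2 := _ / (_ * u); set T3 := _ / (u * _).
move=> E n1 n2 n3; rewrite E; split; first by lra.
- by rewrite -ler_pdivrMr // -/T1; lra.
- by rewrite -ler_pdivrMr // -/T2; lra.
- by rewrite -ler_pdivrMr // -/T3; lra.
Qed.

(** With [S = 1 + D], the three parts of [D] bound [x] by [S y], then [u] by [S^2 y], and after that
    each term of [Q] by a power of [S]. The largest power, [9], comes from [v^2]. *)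
Lemma gap_comparison x y u v : 0 < x -> 0 < y -> x + y <= 2 * u ->
  x <= 1 -> y <= 1 -> u <= 2 -> v ^+ 2 <= 1 ->
  1 + gapQ x y u v <= 1100 * (1 + gapD x y u v) ^+ 9.
Proof.
move=> x0 y0 xy2u x1 y1 u2 v1.
have u0 := gap_u_gt0 x0 y0 xy2u; have [D0 h1 h2 h3] := gapD_parts v x0 y0 xy2u.
set S := 1 + gapD x y u v.
have S1 : 1 <= S by rewrite /S; lra.
have S0 : 0 < S by lra.
have DS : gapD x y u v <= S by rewrite /S; lra.
have Sp i j : (i <= j)%N -> S ^+ i <= S ^+ j by move=> ij; apply: ler_weXn2l.
(* Beyond [x = 2 y] the difference [x - y] exceeds [x / 2], and the first part of [D] compares its
   square with [x y (x + y)]. *)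
have xS : x <= 6 * (S * y).
  have [xy|xy] := leP x (2 * y).
    have : 1 * y <= S * y by rewrite ler_pM2r.
    lra.
  have g1 : x ^+ 2 / 4 <= (x - y) ^+ 2.
    have -> : (x - y) ^+ 2 = x ^+ 2 / 4 + (x / 2 - y) * (3 / 2 * x - y) by field.
    by rewrite lerDl mulr_ge0 //; lra.
  have g2 : gapD x y u v * (x * y * (x + y)) <= S * (x * y * (3 / 2 * x)).
    apply: ler_pM => //; first by rewrite !mulr_ge0 // ltW // addr_gt0.
    by rewrite ler_wpM2l //; [rewrite mulr_ge0 // ltW|lra].
  have g3 : x ^+ 2 * 1 <= x ^+ 2 * (6 * (S * y)).
    have -> : x ^+ 2 * (6 * (S * y)) = 4 * (S * (x * y * (3 / 2 * x))) by field.
    lra.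
  rewrite ler_pM2l ?exprn_gt0 // in g3; lra.
have mS : x + y <= 7 * (S * y).
  have : 1 * y <= S * y by rewrite ler_pM2r.
  lra.
have Sy0 : 0 < S * y by rewrite mulr_gt0.
have uS : u <= 8 * (S ^+ 2 * y).
  have SSy : S * y <= S ^+ 2 * y by rewrite ler_pM2r // -[X in X <= _]expr1; apply: Sp.
  (* If [u] exceeds [x + y], then [2 u - x - y] exceeds [u], so the second part of [D] gives
     [2 <= S (x + y)]; the bound [u <= 2] turns this into a bound for [u]. *)
  have [um|um] := leP u (x + y); first by lra.
  have g1 : u * 2 <= u * (S * (x + y)).
    apply: le_trans (_ : gapD x y u v * ((x + y) * u) <= _); first by lra.
    have -> : u * (S * (x + y)) = S * ((x + y) * u) by ring.
    by rewrite ler_wpM2r // mulr_ge0 ?addr_ge0 ?ltW.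
  rewrite ler_pM2l // in g1.
  have g2 : S * (x + y) <= S * (7 * (S * y)) by rewrite ler_pM2l.
  have E2 : S * (7 * (S * y)) = 7 * (S ^+ 2 * y) by ring.
  lra.
have yS0 : 0 <= S ^+ 2 * y by rewrite mulr_ge0 ?ltW ?exprn_gt0.
have y2 : 0 < y ^+ 2 by rewrite exprn_gt0.
have y3 : 0 < y ^+ 3 by rewrite exprn_gt0.
have q1 : 2 * u - x - y <= 28 * (S ^+ 4 * y ^+ 2).
  have g1 : gapD x y u v * ((x + y) * u) <= S * (7 * (S * y) * (8 * (S ^+ 2 * y))).
    apply: ler_pM => //; first by rewrite mulr_ge0 ?addr_ge0 ?ltW.
    by apply: ler_pM => //; [rewrite addr_ge0 ?ltW|exact: ltW].
  have E2 : S * (7 * (S * y) * (8 * (S ^+ 2 * y))) = 56 * (S ^+ 4 * y ^+ 2) by ring.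
  lra.
have S3u : u ^+ 3 <= 512 * (S ^+ 6 * y ^+ 3).
  have -> : 512 * (S ^+ 6 * y ^+ 3) = (8 * (S ^+ 2 * y)) ^+ 3 by ring.
  by rewrite lerXn2r ?nnegrE ?(ltW u0) // mulr_ge0.
have q2 : v ^+ 2 <= 512 * (S ^+ 9 * y ^+ 3).
  have [vu|vu] := leP (v ^+ 2) (u ^+ 2).
    have g1 : gapD x y u v * (u * (u ^+ 2 + v ^+ 2)) <= S * (u * (u ^+ 2 + u ^+ 2)).
      apply: ler_pM => //.
        by apply: mulr_ge0; [exact: ltW|apply: addr_ge0; exact: sqr_ge0].
      by rewrite ler_pM2l // lerD2l.
    have E2 : S * (u * (u ^+ 2 + u ^+ 2)) = 2 * (S * u ^+ 3) by ring.
    have g2 : S * u ^+ 3 <= S * (512 * (S ^+ 6 * y ^+ 3)) by rewrite ler_pM2l.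
    have E3 : S * (512 * (S ^+ 6 * y ^+ 3)) = 512 * (S ^+ 7 * y ^+ 3) by ring.
    have g3 : S ^+ 7 * y ^+ 3 <= S ^+ 9 * y ^+ 3 by rewrite ler_pM2r //; apply: Sp.
    lra.
  (* When [v] dominates [u], the factor [v^2] cancels and leaves [1 <= S u]. Its cube, with
     [v^2 <= 1] and the bound on [u], supplies [y^3]. *)
  have v0 : 0 < v ^+ 2 by apply: le_lt_trans vu; exact: sqr_ge0.
  have g1 : v ^+ 2 * 1 <= v ^+ 2 * (S * u).
    apply: (@le_trans _ _ (gapD x y u v * (u * (u ^+ 2 + v ^+ 2)) / 2)); first by lra.
    have g0 : gapD x y u v * (u * (u ^+ 2 + v ^+ 2)) <= S * (u * (v ^+ 2 + v ^+ 2)).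
      apply: ler_pM => //.
        by apply: mulr_ge0; [exact: ltW|apply: addr_ge0; exact: sqr_ge0].
      by rewrite ler_pM2l // lerD2r ltW.
    have -> : v ^+ 2 * (S * u) = S * (u * (v ^+ 2 + v ^+ 2)) / 2 by field.
    by rewrite ler_pM2r ?invr_gt0.
  rewrite ler_pM2l // in g1.
  have g2 : 1 <= (S * u) ^+ 3 by rewrite exprn_ege1.
  have E2 : (S * u) ^+ 3 = S ^+ 3 * u ^+ 3 by rewrite exprMn.
  have g3 : S ^+ 3 * u ^+ 3 <= S ^+ 3 * (512 * (S ^+ 6 * y ^+ 3)).
    by rewrite ler_pM2l // exprn_gt0.
  have E3 : S ^+ 3 * (512 * (S ^+ 6 * y ^+ 3)) = 512 * (S ^+ 9 * y ^+ 3) by ring.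
  lra.
have q3 : (x - y) ^+ 2 <= 42 * (S ^+ 9 * y ^+ 3).
  have g1 : gapD x y u v * (x * y * (x + y)) <= S * (6 * (S * y) * y * (7 * (S * y))).
    apply: ler_pM => //; first by apply: mulr_ge0; [apply: mulr_ge0; exact: ltW|apply: addr_ge0; exact: ltW].
    apply: ler_pM => //; first by apply: mulr_ge0; exact: ltW.
      by apply: addr_ge0; exact: ltW.
    by rewrite ler_pM2r.
  have E2 : S * (6 * (S * y) * y * (7 * (S * y))) = 42 * (S ^+ 3 * y ^+ 3) by ring.
  have g3 : S ^+ 3 * y ^+ 3 <= S ^+ 9 * y ^+ 3 by rewrite ler_pM2r //; apply: Sp.
  lra.
have q4 : (2 * u - x - y) ^+ 2 <= 784 * (S ^+ 9 * y ^+ 3).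
  have g1 : (2 * u - x - y) ^+ 2 <= (28 * (S ^+ 4 * y ^+ 2)) ^+ 2.
    rewrite lerXn2r ?nnegrE //; first by lra.
    by apply: mulr_ge0 => //; apply: mulr_ge0; apply: exprn_ge0; exact: ltW.
  have E2 : (28 * (S ^+ 4 * y ^+ 2)) ^+ 2 = 784 * (S ^+ 8 * y ^+ 4) by ring.
  have g3 : S ^+ 8 * y ^+ 4 <= S ^+ 9 * y ^+ 3.
    apply: ler_pM; [by apply: exprn_ge0; exact: ltW|by apply: exprn_ge0; exact: ltW|exact: Sp|].
    by rewrite exprS ler_piMl // ltW.
  lra.
have q5 : (u - y) ^+ 2 <= 413 * (S ^+ 9 * y ^+ 3).
  (* [2 (u - y)] is the sum of [2 u - x - y] and [x - y]; the parallelogram identity gives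
     [413 = (784 + 42) / 2]. *)
  have E2 : (u - y) ^+ 2 = ((2 * u - x - y) ^+ 2 + (x - y) ^+ 2) / 2 -
    ((2 * u - x - y) - (x - y)) ^+ 2 / 4 by field.
  have := sqr_ge0 ((2 * u - x - y) - (x - y)); lra.
have Q1 : (2 * u - x - y) / y ^+ 2 <= 28 * S ^+ 9.
  rewrite ler_pdivrMr //.
  have g3 : S ^+ 4 * y ^+ 2 <= S ^+ 9 * y ^+ 2 by rewrite ler_pM2r //; apply: Sp.
  lra.
have Q2 : ((u - y) ^+ 2 + v ^+ 2) / y ^+ 3 <= 925 * S ^+ 9 by rewrite ler_pdivrMr //; lra.
have Q3 : 1 <= S ^+ 9 by rewrite exprn_ege1.
rewrite /gapQ; lra.
Qed.

(** A small [Q] keeps [u] within [y / 4] of [y] and [2 u - x - y] below [y^2 / 16], hence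
    [x >= y / 4]. The three terms of [gapD_split] are then at most [4], [1] and [1]. *)
Lemma gap_near (x y u v : R) : 0 < y -> y <= 1 -> x + y <= 2 * u -> gapQ x y u v <= 16^-1 ->
  y / 4 <= x /\ gapD x y u v <= 6.
Proof.
move=> y0 y1 xyu; rewrite /gapQ => hQ.
have y2 : 0 < y ^+ 2 by rewrite exprn_gt0.
have y3 : 0 < y ^+ 3 by rewrite exprn_gt0.
have a0 : 0 <= (2 * u - x - y) / y ^+ 2 by rewrite divr_ge0 ?(ltW y2) //; lra.
have b0 : 0 <= ((u - y) ^+ 2 + v ^+ 2) / y ^+ 3.
  by apply: divr_ge0; [apply: addr_ge0; exact: sqr_ge0|exact: ltW].
have a1 : 2 * u - x - y <= y ^+ 2 / 16.
  have : (2 * u - x - y) / y ^+ 2 <= 16^-1 by lra.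
  by rewrite ler_pdivrMr //; lra.
have b1 : (u - y) ^+ 2 + v ^+ 2 <= y ^+ 3 / 16.
  have : ((u - y) ^+ 2 + v ^+ 2) / y ^+ 3 <= 16^-1 by lra.
  by rewrite ler_pdivrMr //; lra.
have yy : y ^+ 2 <= y by rewrite expr2 ler_piMl // ltW.
have yyy : y ^+ 3 <= y ^+ 2 by rewrite exprS ler_piMl // ltW.
have v2 : 0 <= v ^+ 2 by exact: sqr_ge0.
have uy2 : 0 <= (u - y) ^+ 2 by exact: sqr_ge0.
have uy : `|u - y| <= y / 4.
  rewrite -(@ler_pXn2r _ 2) ?nnegrE ?divr_ge0 ?(ltW y0) // real_normK ?num_real //.
  have -> : (y / 4) ^+ 2 = y ^+ 2 / 16 by field.
  lra.
have [u1 u2] : 3 / 4 * y <= u /\ u <= 5 / 4 * y by move: uy; rewrite ler_norml => /andP[]; split; lra.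
have xlow : y / 4 <= x by lra.
have x0 : 0 < x by lra.
have u0 : 0 < u by lra.
split => //; rewrite gapD_split //.
have t1 : (x - y) ^+ 2 / (x * y * (x + y)) <= 4.
  rewrite ler_pdivrMr; last by apply: mulr_gt0; [exact: mulr_gt0|exact: addr_gt0].
  have d1 : (x - y) ^+ 2 <= y ^+ 3.
    have E : (x - y) ^+ 2 = 8 * (u - y) ^+ 2 + 2 * (2 * u - x - y) ^+ 2 -
      (2 * (u - y) + (2 * u - x - y)) ^+ 2 by ring.
    have e1 := sqr_ge0 (2 * (u - y) + (2 * u - x - y)).
    have e2 : (2 * u - x - y) ^+ 2 <= y ^+ 2 / 16 * (y / 16).
      by rewrite expr2; apply: ler_pM; lra.
    have E3 : y ^+ 2 / 16 * (y / 16) = y ^+ 3 / 256 by field.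
    lra.
  have d2 : y / 4 * y * y <= x * y * (x + y).
    apply: ler_pM; [by apply: mulr_ge0; lra|lra| |lra].
    by rewrite ler_pM2r.
  have E3 : y / 4 * y * y = y ^+ 3 / 4 by field.
  lra.
have t2 : 2 * (2 * u - x - y) / ((x + y) * u) <= 1.
  rewrite ler_pdivrMr; last by apply: mulr_gt0; [exact: addr_gt0|].
  have d2 : y * (3 / 4 * y) <= (x + y) * u by apply: ler_pM; lra.
  have E3 : y * (3 / 4 * y) = 3 / 4 * y ^+ 2 by field.
  lra.
have t3 : 2 * v ^+ 2 / (u * (u ^+ 2 + v ^+ 2)) <= 1.
  rewrite ler_pdivrMr; last first.
    by apply: mulr_gt0 => //; rewrite ltr_wpDr // exprn_gt0.
  have d2 : (3 / 4 * y) ^+ 3 <= u ^+ 3 by rewrite lerXn2r ?nnegrE //; lra.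
  have E2 : u * (u ^+ 2 + v ^+ 2) = u ^+ 3 + u * v ^+ 2 by ring.
  have E3 : (3 / 4 * y) ^+ 3 = 27 / 64 * y ^+ 3 by field.
  have : 0 <= u * v ^+ 2 by apply: mulr_ge0 => //; exact: ltW.
  lra.
lra.
Qed.

(** The [N]-th power of [t / N <= expR (t / N)]. *)
Lemma exprn_le_expR (N : nat) (t : R) : 0 <= t -> t ^+ N <= N%:R ^+ N * expR t.
Proof.
case: N => [|N] t0; first by rewrite !expr0 mul1r -expR0 ler_expR.
have h : t / N.+1%:R <= expR (t / N.+1%:R).
  by apply: le_trans (expR_ge1Dx _); rewrite lerDr.
have h2 : (t / N.+1%:R) ^+ N.+1 <= expR (t / N.+1%:R) ^+ N.+1.
  by rewrite lerXn2r ?nnegrE ?divr_ge0 ?expR_ge0.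
have E : expR (t / N.+1%:R) ^+ N.+1 = expR t.
  by rewrite -expRM_natl -mulr_natl mulrCA mulfV ?mulr1 // pnatr_eq0.
rewrite E exprMn exprVn in h2.
by rewrite mulrC -ler_pdivrMr // exprn_gt0.
Qed.

(** Origin: [(1 + Q)^N <= 1100^N (1 + D)^(9 N)], and the power of [1 + D] is at most
    [(9 N)^(9 N) e^(1 + D)]. *)
Definition gapK (N : nat) : R := expR 1 * (9 * N)%:R ^+ (9 * N) * 1100 ^+ N.

Lemma gapK_gt0 N : 0 < gapK N.
Proof.
rewrite /gapK; apply: mulr_gt0; last by apply: exprn_gt0; rewrite ltr0n.
apply: mulr_gt0; first exact: expR_gt0.
case: N => [|N]; first by rewrite muln0 expr0 ltr01.
by apply: exprn_gt0; rewrite ltr0n.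
Qed.

Lemma gap_decay x y u v N : 0 < x -> 0 < y -> x + y <= 2 * u -> x <= 1 -> y <= 1 ->
  u <= 2 -> v ^+ 2 <= 1 ->
  expR (- gapD x y u v) <= gapK N * (1 + gapQ x y u v) ^- N.
Proof.
move=> x0 y0 xyu x1 y1 u2 v1.
have h := gap_comparison x0 y0 xyu x1 y1 u2 v1.
have [D0 _ _ _] := gapD_parts v x0 y0 xyu.
have Q0 : 0 <= gapQ x y u v.
  apply: addr_ge0; apply: divr_ge0; rewrite ?exprn_ge0 ?(ltW y0) //; first by lra.
  by apply: addr_ge0; exact: sqr_ge0.
have Q1 : 0 < 1 + gapQ x y u v by lra.
set D := gapD x y u v in h D0 *; set Q := gapQ x y u v in h Q0 Q1 *.
rewrite ler_pdivlMr ?exprn_gt0 // expRN mulrC ler_pdivrMr ?expR_gt0 //.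
have D1 : 0 <= 1 + D by lra.
apply: (@le_trans _ _ ((1100 * (1 + D) ^+ 9) ^+ N)).
  have c0 : 0 <= 1100 * (1 + D) ^+ 9 by apply: mulr_ge0; [rewrite ler0n|exact: exprn_ge0].
  by apply: lerXn2r; rewrite ?nnegrE ?(ltW Q1) ?c0.
rewrite exprMn -exprM /gapK.
have g := exprn_le_expR (9 * N) D1; rewrite expRD in g.
have -> : expR 1 * (9 * N)%:R ^+ (9 * N) * 1100 ^+ N * expR D =
  1100 ^+ N * ((9 * N)%:R ^+ (9 * N) * (expR 1 * expR D)) by ring.
by apply: ler_wpM2l; first (by apply: exprn_ge0; rewrite ler0n).
Qed.

End RealGeometry.

(** * The complex exponential and chain rules *)

Section ComplexExponential.
Variable R : realType.
Local Notation C := R[i].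
Implicit Types (z k c l : C) (x y : R).

Lemma derive_eps (f : R -> R) x (df : R) : is_derive x 1 f df ->
  forall e : R, 0 < e -> exists2 dl : R, 0 < dl &
    forall h, `|h| < dl -> `|f (x + h) - f x - df * h| <= e * `|h|.
Proof.
move=> Hd e e0; have dv : derivable f x 1 by exact: ex_derive.
have /eqaddoP/(_ e e0)/nbhs_ballP[d /= d0 H] := derivable_nbhs dv.
exists d => // h hd; have := H h; rewrite /ball /= sub0r normrN => /(_ hd).
rewrite !fctE /= (derive_val (f := f)) /GRing.scale /= mulr1 opprD addrA.
by rewrite (addrC h x) (mulrC h).
Qed.

Definition cexp z : C :=
  Complex (expR (complex.Re z) * cos (complex.Im z)) (expR (complex.Re z) * sin (complex.Im z)).

Lemma cexpD z k : cexp (z + k) = cexp z * cexp k.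
Proof.
rewrite /cexp; apply: complexP; rewrite ?ReM ?ImM /= ReD ImD expRD ?cosD ?sinD; ring.
Qed.

Lemma cexp0 : cexp 0 = 1.
Proof. by rewrite /cexp /= expR0 cos0 sin0 mul1r mulr0. Qed.

Lemma cabs_cexp z : cabs (cexp z) = expR (complex.Re z).
Proof.
apply/eqP; rewrite -(eqrXn2 (n := 2)) ?cabs_ge0 ?expR_ge0 //; apply/eqP.
rewrite sqr_cabs /= !exprMn -mulrDr cos2Dsin2; exact: mulr1.
Qed.

(** Derivatives at zero of the real exponential, cosine and sine; the cross term
    [(expR x - 1) * sin y] is quadratic and is absorbed by [cabs k < q / 2]. *)
Lemma cexp_near0 (e : R) : 0 < e -> exists2 dl : R, 0 < dl &
  forall k, cabs k < dl -> cabs (cexp k - 1 - k) <= e * cabs k.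
Proof.
move=> e0; pose q := Num.min 1 (e / 8); have q0 : 0 < q by rewrite lt_min ltr01 divr_gt0.
have [d1 d10 h1] := derive_eps (is_derive_expR (0 : R)) q0.
have [d2 d20 h2] := derive_eps (is_derive_cos (0 : R)) q0.
have [d3 d30 h3] := derive_eps (is_derive_sin (0 : R)) q0.
exists (Num.min (Num.min 1 (q / 2)) (Num.min d1 (Num.min d2 d3))).
  by rewrite !lt_min ltr01 divr_gt0 // d10 d20.
move=> k; rewrite !lt_min => /andP[/andP[k1 kq] /and3P[kd1 kd2 kd3]].
set x := complex.Re k; set y := complex.Im k.
have xk : `|x| <= cabs k := le_Re_cabs k; have yk : `|y| <= cabs k := le_Im_cabs k.
have := h1 x (le_lt_trans xk kd1); have := h2 y (le_lt_trans yk kd2).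
have := h3 y (le_lt_trans yk kd3).
rewrite !add0r expR0 cos0 sin0 !oppr0 !mul0r !subr0 ?addr0 !mul1r => s3 s2 s1.
have x0 := normr_ge0 x; have y0 := normr_ge0 y.
have q1 : q <= 1 by rewrite ge_min lexx.
have qe : q <= e / 8 by rewrite ge_min lexx orbT.
have qk : 0 <= q * cabs k by rewrite mulr_ge0 ?cabs_ge0 // ltW.
have sx : q * `|x| <= q * cabs k by rewrite ler_wpM2l // ltW.
have sy : q * `|y| <= q * cabs k by rewrite ler_wpM2l // ltW.
have cy : `|cos y| <= 1 by rewrite ler_norml cos_geN1 cos_le1.
have qk1 : q * cabs k <= cabs k by rewrite ler_piMl ?cabs_ge0.
have ex1 : `|expR x - 1| <= 2 * cabs k.
  have := ler_normD (expR x - 1 - x) x; rewrite subrK; lra.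
have siny : `|sin y| <= 2 * cabs k.
  have := ler_normD (sin y - y) y; rewrite subrK; lra.
have rE : complex.Re (cexp k - 1 - k) = (expR x - 1 - x) * cos y + (1 + x) * (cos y - 1).
  by rewrite !ReD !ReN /= -/x -/y; ring.
have iE : complex.Im (cexp k - 1 - k) = (expR x - 1) * sin y + (sin y - y).
  by rewrite !ImD !ImN /= -/x -/y; ring.
have r1 : `|(expR x - 1 - x) * cos y| <= q * cabs k.
  rewrite normrM; apply: le_trans (_ : q * cabs k * 1 <= _); last by rewrite mulr1.
  by apply: ler_pM => //; lra.
have r2 : `|(1 + x) * (cos y - 1)| <= 2 * (q * cabs k).
  rewrite normrM; apply: ler_pM => //; last by lra.
  by have := ler_normD 1 x; rewrite normr1; lra.
have r3 : `|(expR x - 1) * sin y| <= 2 * cabs k * (2 * cabs k) by rewrite normrM; apply: ler_pM.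
have r4 : 2 * cabs k * (2 * cabs k) <= 2 * (q * cabs k).
  have -> : 2 * (q * cabs k) = 2 * cabs k * q by ring.
  by rewrite ler_wpM2l ?mulr_ge0 ?cabs_ge0 //; lra.
apply: le_trans (cabs_le_ReIm _) _; rewrite rE iE.
have n1 := ler_normD ((expR x - 1 - x) * cos y) ((1 + x) * (cos y - 1)).
have n2 := ler_normD ((expR x - 1) * sin y) (sin y - y).
have : q * cabs k <= e / 8 * cabs k by rewrite ler_wpM2r ?cabs_ge0.
lra.
Qed.

Lemma cderiv_cexp z : cderiv cexp z (cexp z).
Proof.
move=> e e0; have cz : 0 < cabs (cexp z) by rewrite cabs_cexp expR_gt0.
have e1 : 0 < e / cabs (cexp z) by rewrite divr_gt0.
have [dl dl0 H] := cexp_near0 e1; exists dl => // k /H h.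
rewrite cexpD; have -> : cexp z * cexp k - cexp z - cexp z * k = cexp z * (cexp k - 1 - k) by ring.
rewrite cabsM mulrC -ler_pdivlMr // mulrAC; exact: h.
Qed.

Lemma cderiv_comp (phi psi : C -> C) z a c : cderiv psi z a -> cderiv phi (psi z) c ->
  cderiv (fun z => phi (psi z)) z (c * a).
Proof.
move=> h1 h2 e e0.
pose K := 1 + cabs a + cabs c.
have K0 : 0 < K by rewrite /K; have := cabs_ge0 a; have := cabs_ge0 c; lra.
have q0 : 0 < Num.min 1 (e / (2 * K)) by rewrite lt_min ltr01 divr_gt0 // mulr_gt0.
set q := Num.min _ _ in q0.
have [d2 d20 H2] := h2 _ q0; have [d1 d10 H1] := h1 _ q0.
have [d3 d30 H3] := wirtinger_cont (cderiv_wirtinger h1) d20.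
exists (Num.min d1 d3); first by rewrite lt_min d10.
move=> k; rewrite lt_min => /andP[/H1 k1 /H3 k3].
set E := psi (z + k) - psi z - a * k in k1.
pose dp := psi (z + k) - psi z.
have dE : psi (z + k) = psi z + dp by rewrite /dp; ring.
have := H2 dp k3; rewrite -dE; set E2 := (X in cabs X <= _) => k2.
have -> : phi (psi (z + k)) - phi (psi z) - c * a * k = E2 + c * E.
  by rewrite /E2 /E /dp; ring.
have q1 : q <= 1 by rewrite ge_min lexx.
have qe : q <= e / (2 * K) by rewrite ge_min lexx orbT.
have dpk : cabs dp <= (1 + cabs a) * cabs k.
  have -> : dp = E + a * k by rewrite /E /dp; ring.
  apply: le_trans (cabsD _ _) _; rewrite cabsM mulrDl mul1r lerD2r.
  by apply: le_trans k1 _; rewrite ler_piMl ?cabs_ge0.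
apply: le_trans (cabsD _ _) _; rewrite cabsM.
have m1 : q * cabs dp <= q * ((1 + cabs a) * cabs k) by rewrite ler_wpM2l // ltW.
have m2 : cabs c * cabs E <= cabs c * (q * cabs k) by rewrite ler_wpM2l ?cabs_ge0.
have m3 : q * (K * cabs k) <= e / (2 * K) * (K * cabs k).
  by rewrite ler_wpM2r // mulr_ge0 ?cabs_ge0 // ltW.
have m4 : e / (2 * K) * (K * cabs k) = e / 2 * cabs k by field; rewrite gt_eqF.
have m5 : q * (K * cabs k) = q * ((1 + cabs a) * cabs k) + cabs c * (q * cabs k).
  by rewrite /K; ring.
have : 0 <= e / 2 * cabs k by rewrite mulr_ge0 ?cabs_ge0 // ltW // divr_gt0.
lra.
Qed.

Lemma cdiff_comp n (g : Cn R n -> R[i]^o) (phi : C -> C) (z : Cn R n) (l : 'I_n -> C) (c : C) : cdiff g z l ->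
  cderiv phi (g z) c -> cdiff (fun w => phi (g w)) z (fun j => c * l j).
Proof.
move=> h1 h2 e e0.
pose L := \sum_(j < n) cabs (l j).
have L0 : 0 <= L by apply: sumr_ge0 => j _; exact: cabs_ge0.
pose K := 1 + L + cabs c.
have K0 : 0 < K by rewrite /K; have := cabs_ge0 c; lra.
have q0 : 0 < Num.min 1 (e / (2 * K)) by rewrite lt_min ltr01 divr_gt0 // mulr_gt0.
set q := Num.min _ _ in q0.
have [d2 d20 H2] := h2 _ q0; have [d1 d10 H1] := h1 _ q0.
have [d3 d30 H3] := cdiff_cont h1 d20.
exists (Num.min d1 d3); first by rewrite lt_min d10.
move=> k; rewrite lt_min => /andP[/H1 k1 /H3 k3].
set S := \sum_(j < n) _ in k1; set E := _ - S in k1.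
pose dp : C := g (z + k) - g z.
have dE : g (z + k) = g z + dp by rewrite /dp subrKC.
have := H2 dp k3; rewrite -dE; set E2 := (X in cabs X <= _) => k2.
have -> : \sum_(j < n) c * l j * k ord0 j = c * S.
  by rewrite /S mulr_sumr; apply: eq_bigr => j _; rewrite mulrA.
have -> : phi (g (z + k)) - phi (g z) - c * S = E2 + c * E.
  by rewrite /E2 /E -/dp; ring.
have q1 : q <= 1 by rewrite ge_min lexx.
have qe : q <= e / (2 * K) by rewrite ge_min lexx orbT.
have hS : cabs S <= L * l1 k.
  apply: le_trans (cabs_sum _ _ _) _; rewrite /L mulr_suml; apply: ler_sum => j _.
  by rewrite cabsM ler_wpM2l ?cabs_ge0 ?cabs_le_l1.
have k0 := l1_ge0 k.
have dpk : cabs dp <= (1 + L) * l1 k.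
  have -> : dp = E + S by rewrite /E /dp; ring.
  apply: le_trans (cabsD _ _) _; rewrite mulrDl mul1r; apply: lerD => //.
  by apply: le_trans k1 _; rewrite ler_piMl.
apply: le_trans (cabsD _ _) _; rewrite cabsM.
have m1 : q * cabs dp <= q * ((1 + L) * l1 k) by rewrite ler_wpM2l // ltW.
have m2 : cabs c * cabs E <= cabs c * (q * l1 k) by rewrite ler_wpM2l ?cabs_ge0.
have m3 : q * (K * l1 k) <= e / (2 * K) * (K * l1 k).
  by rewrite ler_wpM2r // mulr_ge0 // ltW.
have m4 : e / (2 * K) * (K * l1 k) = e / 2 * l1 k by field; rewrite gt_eqF.
have m5 : q * (K * l1 k) = q * ((1 + L) * l1 k) + cabs c * (q * l1 k).
  by rewrite /K; ring.
have : 0 <= e / 2 * l1 k by rewrite mulr_ge0 // ltW // divr_gt0.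
lra.
Qed.

End ComplexExponential.

Lemma ReV (R : realType) (w : R[i]) : complex.Re w^-1 =
  complex.Re w / (complex.Re w ^+ 2 + complex.Im w ^+ 2).
Proof. by case: w. Qed.

Section TestFunctions.
Variable R : realType.
Local Notation C := R[i].
Variable n : nat.
Implicit Types (a z k : Cn R n).

Definition inner z a : C := \sum_(j < n) z ord0 j * conjc (a ord0 j).

Definition defect z : R := 1 - sqnorm z.

Lemma innerD z k a : inner (z + k) a = inner z a + inner k a.
Proof.
by rewrite /inner -big_split; apply: eq_bigr => j _; rewrite mxE /= mulrDl.
Qed.

Lemma innerZ (b : C) z a : inner (b *: z) a = b * inner z a.
Proof. by rewrite /inner mulr_sumr; apply: eq_bigr => j _; rewrite mxE mulrA. Qed.

Lemma sqnormZ (b : C) z : sqnorm (b *: z) = cabs b ^+ 2 * sqnorm z.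
Proof. by rewrite /sqnorm mulr_sumr; apply: eq_bigr => j _; rewrite mxE cabsM exprMn. Qed.

Lemma inner_self a : inner a a = ((sqnorm a)%:C)%C.
Proof.
rewrite /inner /sqnorm rmorph_sum; apply: eq_bigr => j _ /=.
by rewrite sqr_cabs; case: (a ord0 j) => x y; apply: complexP => /=; ring.
Qed.

Lemma sqnormB z a : sqnorm (z - a) = sqnorm z + sqnorm a - 2 * complex.Re (inner z a).
Proof.
have -> : complex.Re (inner z a) = \sum_(j < n) complex.Re (z ord0 j * conjc (a ord0 j)).
  by rewrite /inner; elim/big_rec2 : _ => // j x y _ <-; rewrite ReD.
rewrite mulr_sumr /sqnorm -big_split -sumrB; apply: eq_bigr => j _ /=.
rewrite !mxE !sqr_cabs; case: (z ord0 j) => z1 z2; case: (a ord0 j) => a1 a2 /=; ring.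
Qed.

Lemma cabs_inner_le z a : cabs (inner z a) <= (sqnorm z + sqnorm a) / 2.
Proof.
apply: le_trans (cabs_sum _ _ _) _.
rewrite /sqnorm -big_split /= mulr_suml; apply: ler_sum => j _.
rewrite cabsM cabs_conj.
have := sqr_ge0 (cabs (z ord0 j) - cabs (a ord0 j)); rewrite sqrrB; lra.
Qed.

(* [s = 1] gives the test function [f_a] and [s = -1] its reciprocal. *)
Definition test_fun (p s : R) a z : C :=
  cexp (((s * (2 / p))%:C)%C * (1 - inner z a)^-1 - ((s / (p * defect a))%:C)%C).

Section InBall.
Variables (a z : Cn R n).
Hypotheses (ab : ball_n n a) (zb : ball_n n z).

Let x := defect z.
Let y := defect a.
Let u := complex.Re (1 - inner z a).
Let v := complex.Im (1 - inner z a).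

Lemma defect_facts : [/\ 0 < x, 0 < y, x <= 1, y <= 1 & [/\ x + y <= 2 * u, u <= 2, v ^+ 2 <= 1 & 0 < u]].
Proof.
have x0 : 0 < x by rewrite subr_gt0; exact: zb.
have y0 : 0 < y by rewrite subr_gt0; exact: ab.
have x1 : x <= 1 by rewrite /x /defect lerBlDr lerDl sqnorm_ge0.
have y1 : y <= 1 by rewrite /y /defect lerBlDr lerDl sqnorm_ge0.
have h := cabs_inner_le z a.
have h1 := le_Re_cabs (inner z a); have h2 := le_Im_cabs (inner z a).
have s : (sqnorm z + sqnorm a) / 2 = 1 - (x + y) / 2 by rewrite /x /y /defect; field.
rewrite s in h.
have uE : u = 1 - complex.Re (inner z a) by rewrite /u ReD ReN.
have vE : v = - complex.Im (inner z a) by rewrite /v ImD ImN /= sub0r.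
have r1 : `|complex.Re (inner z a)| <= 1 - (x + y) / 2 by exact: le_trans h1 h.
have r2 : `|complex.Im (inner z a)| <= 1 by apply: le_trans h2 _; lra.
move: r1; rewrite ler_norml => /andP[r1 r1'].
split => //; split; rewrite ?uE; try lra.
rewrite vE sqrrN -(real_normK (num_real _)) expr_le1 //.
Qed.

Lemma inner_neq1 : 1 - inner z a != 0.
Proof.
apply/eqP => h; have [_ _ _ _ [_ _ _]] := defect_facts.
by rewrite /u h /= ltxx.
Qed.

Lemma test_fun_cabs (p s : R) : 
  cabs (test_fun p s a z) = expR (s * (2 / p) * (u / (u ^+ 2 + v ^+ 2)) - s / (p * y)).
Proof.
by rewrite cabs_cexp ReD ReN Re_realM ReV.
Qed.

Lemma test_fun_weight (p : R) : 0 < p ->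
  cabs (test_fun p 1 a z) `^ p * weight z = expR (- gapD x y u v).
Proof.
move=> p0; have [x0 y0 _ _ [_ _ _ u0]] := defect_facts.
rewrite test_fun_cabs // /weight -expRM -expRD; congr expR.
rewrite -/(defect z) -/x /gapD !mul1r.
rewrite -(mulrA 2 u); move: (u / _) => t.
have pn : p != 0 by rewrite gt_eqF.
have yn : y != 0 by rewrite gt_eqF.
have xn : x != 0 by rewrite gt_eqF.
by field; rewrite pn yn xn.
Qed.

Lemma test_fun_inv (p : R) : test_fun p 1 a z * test_fun p (-1) a z = 1.
Proof.
rewrite /test_fun -cexpD -cexp0; congr cexp.
have -> : (((-1 * (2 / p)))%:C)%C = - (((1 * (2 / p)))%:C)%C :> C by rewrite mulNr rmorphN.
have -> : ((-1 / (p * defect a))%:C)%C = - ((1 / (p * defect a))%:C)%C :> C.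
  by rewrite mulNr rmorphN.
ring.
Qed.

Lemma test_fun_diff (p s : R) : differentiable (test_fun p s a : Cn R n -> R[i]^o) z.
Proof.
have cw : cdiff (fun z => 1 - inner z a : R[i]^o) z (fun j => - conjc (a ord0 j)).
  move=> e e0; exists 1 => // k _; rewrite innerD.
  have -> : \sum_(j < n) - conjc (a ord0 j) * k ord0 j = - inner k a.
    by rewrite /inner -sumrN; apply: eq_bigr => j _; rewrite mulNr mulrC.
  rewrite (_ : _ - _ = 0); last by ring.
  by rewrite cabs0 mulr_ge0 ?l1_ge0 // ltW.
pose A : C := ((s * (2 / p))%:C)%C; pose B : C := ((s / (p * defect a))%:C)%C.
have h1 : cderiv (fun w => A * w^-1 - B) (1 - inner z a) (A * (- ((1 - inner z a)^-1 ^+ 2))).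
  have h := cderivZ A (cderivV inner_neq1).
  move=> e /h[dl dl0 H]; exists dl => // k /H.
  by rewrite (_ : forall b c d : C, b - B - (c - B) - d = b - c - d) //; move=> *; ring.
have h2 := cderiv_comp h1 (cderiv_cexp _).
exact: (cdiff_differentiable (cdiff_comp cw h2)).
Qed.

Definition Qform (k : Cn R n) : R := sqnorm k / y ^+ 2 + cabs (inner k a) ^+ 2 / y ^+ 3.

Lemma Qform_gap : Qform (z - a) = gapQ x y u v.
Proof.
rewrite /Qform /gapQ sqnormB.
have uE : u = 1 - complex.Re (inner z a) by rewrite /u ReD ReN.
have -> : sqnorm z + sqnorm a - 2 * complex.Re (inner z a) = 2 * u - x - y.
  by rewrite uE /x /y /defect; ring.
have -> : inner (z - a) a = ((y)%:C)%C - (1 - inner z a).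
  rewrite -[- a]scaleN1r innerD innerZ inner_self mulN1r /y /defect rmorphB rmorph1; ring.
congr (_ + _ / _); rewrite sqr_cabs ReD ImD ReN ImN -/u -/v /=; ring.
Qed.

End InBall.

End TestFunctions.

Lemma powR_le_root (R : realType) (p x K : R) : 0 < p -> 0 <= x -> x `^ p <= K -> x <= K `^ p^-1.
Proof.
move=> p0 x0 h.
rewrite (_ : x = (x `^ p) `^ p^-1); last by rewrite -powRrM mulfV ?powRr1 ?gt_eqF.
apply: ge0_ler_powR; rewrite ?nnegrE ?powR_ge0 ?invr_ge0 ?(ltW p0) //.
exact: le_trans (powR_ge0 _ _) h.
Qed.

(** * Norms of test functions and sub-mean values on ellipsoids *)

Section BallIntegralBounds.
Variable R : realType.
Local Notation C := R[i].
Variable n : nat.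
Implicit Types (a b z : Cn R n) (w : nat -> C).

(** Extension by zero to a sequence indexed by [nat], the form in which iterated integrals take
    their points. *)
Definition vcoord (a : Cn R n) (i : nat) : C := if insub i is Some j then a ord0 j else 0.

Lemma vcoordE a (i : 'I_n) : vcoord a i = a ord0 i.
Proof. by rewrite /vcoord valK. Qed.

Local Notation al a := ((defect a) ^- 2).
Local Notation be a := ((defect a) ^- 3).
Local Notation gam a := (sq_gamma (al a) (be a) (vcoord a)).
Local Notation qb a := (sq_b (vcoord a)).
Local Notation qs a := (sq_s (al a) (be a) (vcoord a)).

Lemma row_sub w b (i : 'I_n) : ((\row_(i < n) w i) - b : Cn R n) ord0 i = w i - vcoord b i.
Proof. by rewrite !mxE vcoordE. Qed.

Lemma al_gt0 a : ball_n n a -> 0 < al a.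
Proof. by move=> h; rewrite invr_gt0 exprn_gt0 // subr_gt0. Qed.

Lemma be_ge0 a : ball_n n a -> 0 <= be a.
Proof. by move=> h; rewrite invr_ge0 exprn_ge0 // ltW // subr_gt0. Qed.

Lemma gam_gt0 a : ball_n n a -> forall i, 0 < gam a i.
Proof. by move=> h i; apply: sq_gamma_gt0; [exact: al_gt0|exact: be_ge0]. Qed.

Lemma tri_sum_Qform a b w : ball_n n a ->
  tri_sum (qb a) (qs a) (vcoord b) (gam a) n 0 w = Qform a ((\row_(i < n) w i) - b).
Proof.
move=> ab.
have := tri_sumE (vcoord a) (vcoord b) (al_gt0 ab) (be_ge0 ab) n 0 w.
rewrite cabs0 expr0n mulr0 addr0 add0r => ->; rewrite /Qform mulrC (mulrC (be a)).
congr (_ * _ + _ ^+ 2 * _).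
  by rewrite /sqnorm; apply: eq_bigr => i _; rewrite row_sub.
by congr cabs; rewrite /inner; apply: eq_bigr => i _; rewrite row_sub /sq_b vcoordE mulrC.
Qed.

(** Up to a factor depending on [n], the volume of the ellipsoid [Q < 1]. The square of [pi] comes
    from the pair of Cauchy densities; [lowK] divides it out in the lower bound. *)
Definition ell_vol a : R := \prod_(i < n) (pi ^+ 2 / gam a i).

Lemma ell_vol_gt0 a : ball_n n a -> 0 < ell_vol a.
Proof.
by move=> ab; apply: prodr_gt0 => i _; rewrite divr_gt0 ?exprn_gt0 ?pi_gt0 // gam_gt0.
Qed.

Lemma test_fun_hol (p s : R) a : ball_n n a -> holomorphic_on_ball (test_fun p s a : Cn R n -> R[i]^o).
Proof. by move=> ab z zb; exact: test_fun_diff. Qed.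

Lemma test_fun_int (p : R) a : 0 < p -> ball_n n a ->
  (ball_int p (fun _ => 1%R) (test_fun p 1 a : Cn R n -> R[i]^o) <= (gapK R (2 * n) * ell_vol a)%:E)%E.
Proof.
move=> p0 ab; rewrite /ball_int /vol_int.
apply: (@tri_upper R (qb a) (qs a) (vcoord a) (gam a) n 0 (gapK R (2 * n))).
- exact: gam_gt0.
- exact: ltW (gapK_gt0 R _).
- move=> w; case: ifP => // _; rewrite lee_fin mulr_ge0 // mulr_ge0 ?powR_ge0 //.
  exact: expR_ge0.
move=> w; set z := \row_(i < n) w i.
have tp := tri_prod_ge (qb a) (qs a) (vcoord a) n 0 w (gam_gt0 ab).
rewrite tri_sum_Qform // -/z in tp.
have K0 := gapK_gt0 R (2 * n).
case: ifPn => [zb|_]; last first.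
  rewrite lee_fin mulr_ge0 ?(ltW K0) //; apply: le_trans tp.
  rewrite invr_ge0 exprn_ge0 // addr_ge0 // /Qform.
  have y0 : 0 < defect a by rewrite subr_gt0.
  by apply: addr_ge0; apply: divr_ge0; rewrite ?sqnorm_ge0 ?sqr_ge0 ?exprn_ge0 ?ltW.
rewrite mulr1 lee_fin test_fun_weight //.
have [x0 y0 x1 y1 [xyu u2 v2 _]] := defect_facts ab zb.
apply: le_trans (gap_decay (2 * n) x0 y0 xyu x1 y1 u2 v2) _.
by rewrite ler_pM2l // -Qform_gap.
Qed.

Lemma test_fun_Apsi (p : R) a : 0 < p -> ball_n n a ->
  in_Apsi p (test_fun p 1 a : Cn R n -> R[i]^o).
Proof.
move=> p0 ab; split; first exact: test_fun_hol.
by apply: le_lt_trans (test_fun_int p0 ab) _; rewrite ltry.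
Qed.

(** The sum of [n] squares below [small_d] stays under [1 / 64]. With [Q(b - a) <= 1 / 64] and the
    constant [2] in [QformD], the whole region around [b] satisfies [Q(z - a) <= 1 / 16], as
    [gap_near] requires. *)
Definition small_d : R := 64^-1 / (n%:R + 1).

Lemma small_d_gt0 : 0 < small_d.
Proof. by rewrite divr_gt0 // ltr_wpDl. Qed.

Definition lowK : R := (small_d / 8 / pi ^+ 2) ^+ n.

Lemma lowK_gt0 : 0 < lowK.
Proof. by rewrite exprn_gt0 // !divr_gt0 ?small_d_gt0 // exprn_gt0 // pi_gt0. Qed.

Lemma tri_center0 (bb ss c : nat -> C) k j :
  tri_center bb ss c k 0 j = if (j < k)%N then c j else 0.
Proof.
elim: k => [|k IH] //=; rewrite !(mulr0, subr0, oppr0, addr0) /set_coord ltnS leq_eqVlt.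
by case: eqP => [->|].
Qed.

Lemma QformD a (k k' : Cn R n) : ball_n n a -> Qform a (k + k') <= 2 * Qform a k + 2 * Qform a k'.
Proof.
move=> ab; have y0 : 0 < defect a by rewrite subr_gt0.
rewrite /Qform innerD.
have h1 : sqnorm (k + k') <= 2 * sqnorm k + 2 * sqnorm k'.
  rewrite /sqnorm !mulr_sumr -big_split /=; apply: ler_sum => j _; rewrite mxE.
  rewrite !sqr_cabs; case: (k ord0 j) => k1 k2; case: (k' ord0 j) => k3 k4 /=.
  have := sqr_ge0 (k1 - k3); have := sqr_ge0 (k2 - k4).
  rewrite !sqrrB !sqrrD; lra.
have h2 : cabs (inner k a + inner k' a) ^+ 2 <= 2 * cabs (inner k a) ^+ 2 + 2 * cabs (inner k' a) ^+ 2.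
  rewrite !sqr_cabs; case: (inner k a) => k1 k2; case: (inner k' a) => k3 k4 /=.
  have := sqr_ge0 (k1 - k3); have := sqr_ge0 (k2 - k4).
  rewrite !sqrrB !sqrrD; lra.
have i2 : 0 <= (defect a) ^- 2 by rewrite invr_ge0 exprn_ge0 // ltW.
have i3 : 0 <= (defect a) ^- 3 by rewrite invr_ge0 exprn_ge0 // ltW.
have := ler_wpM2r i2 h1; have := ler_wpM2r i3 h2; rewrite !mulrDl -!mulrA; lra.
Qed.

Lemma near_in_ball a z : ball_n n a -> Qform a (z - a) <= 16^-1 ->
  [/\ ball_n n z, defect a / 4 <= defect z &
   gapD (defect z) (defect a) (complex.Re (1 - inner z a)) (complex.Im (1 - inner z a)) <= 6].
Proof.
move=> ab hQ; have y0 : 0 < defect a by rewrite subr_gt0.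
have y1 : defect a <= 1 by rewrite /defect lerBlDr lerDl sqnorm_ge0.
rewrite Qform_gap in hQ.
have xyu : defect z + defect a <= 2 * complex.Re (1 - inner z a).
  have := sqnorm_ge0 (z - a); rewrite sqnormB ReD ReN /= /defect; lra.
have [h1 h2] := gap_near y0 y1 xyu hQ; split => //.
have : 0 < defect z by lra.
by rewrite subr_gt0.
Qed.

(** The centre [b] may differ from the point [a] that shapes the ellipsoid: Cauchy's estimate needs
    values on a whole disc around [a] with one and the same [Q]. The hypothesis on [F] is imposed
    only where the defect is comparable to that of [a] and [D <= 6]. *)
Lemma ellipsoid_submean (p W0 : R) a b (h : Cn R n -> R[i]^o) (F : Cn R n -> \bar R) :
  1 <= p -> 0 <= W0 -> ball_n n a -> Qform a (b - a) <= 64^-1 -> holomorphic_on_ball h ->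
  (forall z, 0 <= F z)%E ->
  (forall z, ball_n n z -> defect a / 4 <= defect z ->
    gapD (defect z) (defect a) (complex.Re (1 - inner z a)) (complex.Im (1 - inner z a)) <= 6 ->
    ((W0 * cabs (h z) `^ p)%:E <= F z)%E) ->
  ((W0 * lowK * ell_vol a * cabs (h b) `^ p)%:E <= vol_int F)%E.
Proof.
move=> p1 W00 ab hb hol F0 hF; have p0 : 0 < p by apply: lt_le_trans p1.
(* The constant weight is absorbed into the holomorphic function as its [p]-th root. *)
pose q : R := W0 `^ p^-1.
pose h' (w : nat -> C) : C := ((q)%:C)%C * h (\row_(i < n) w i).
have q0 : 0 <= q by exact: powR_ge0.
have h'E w : cabs (h' w) `^ p = W0 * cabs (h (\row_(i < n) w i)) `^ p.
  rewrite /h' cabsM cabs_real ger0_norm // powRM ?cabs_ge0 //; congr (_ * _).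
  by rewrite /q -powRrM mulVf ?gt_eqF // powRr1.
pose r i : R := small_d / gam a i.
have r0 i : 0 < r i by rewrite divr_gt0 ?small_d_gt0 // gam_gt0.
have reg w : tri_region (qb a) (qs a) (vcoord b) r n 0 w ->
    Qform a ((\row_(i < n) w i) - a) <= 16^-1.
  move=> /(tri_region_sum (gam_gt0 ab)); rewrite tri_sum_Qform // => h1.
  have hd : n%:R * small_d <= 64^-1.
    have n1 : 0 < n%:R + 1 :> R by rewrite ltr_wpDl.
    rewrite /small_d mulrCA; apply: ler_piMr; first by rewrite invr_ge0.
    by rewrite ler_pdivrMr // mul1r lerDl.
  have -> : (\row_(i < n) w i) - a = ((\row_(i < n) w i) - b) + (b - a) by rewrite addrA subrK.
  by apply: le_trans (QformD _ _ ab) _; lra.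
have cb : \row_(i < n) tri_center (qb a) (qs a) (vcoord b) n 0 i = b.
  by apply/rowP => i; rewrite mxE tri_center0 ltn_ord vcoordE.
have := @tri_submean R (qb a) (qs a) (vcoord b) p r n 0 h'
  (fun w => F (\row_(i < n) w i)) p1 r0.
rewrite h'E cb.
have -> : \prod_(i < n) (r i / 8) = lowK * ell_vol a.
  rewrite /lowK /ell_vol -[X in _ ^+ X * _](card_ord n) -prodr_const -big_split /=.
  apply: eq_bigr => i _; rewrite /r.
  have pi0 : pi != 0 :> R by rewrite gt_eqF // pi_gt0.
  have g0 : gam a i != 0 by rewrite gt_eqF // gam_gt0.
  by move: pi0 g0; move: (pi : R) (gam a i) => P G P0 G0; field; rewrite P0 G0.
move=> H; have -> : W0 * lowK * ell_vol a * cabs (h b) `^ p =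
  lowK * ell_vol a * (W0 * cabs (h b) `^ p) by ring.
apply: H => [A B x hx|w|w hw].
- have [zb _ _] := near_in_ball ab (reg _ hx).
  pose vA : Cn R n := \row_(i < n) A i; pose vB : Cn R n := \row_(i < n) B i.
  have E x' : \row_(i < n) (A i + x' * B i) = vA + x' *: vB.
    by apply/rowP => i; rewrite !mxE.
  have := cderivZ ((q)%:C)%C (cdiff_line (differentiable_cdiff (hol (vA + x *: vB) _))).
  rewrite -E => /(_ zb) hd; eexists.
  rewrite (_ : (fun x => h' _) = fun x => ((q)%:C)%C * h (vA + x *: vB)); first exact: hd.
  by apply/funext => x'; rewrite /h' E.
- exact: F0.
- rewrite h'E; have [zb h1 h2] := near_in_ball ab (reg _ hw); exact: hF.
Qed.

Lemma carleson_radial_bound (p : R) (g : Cn R n -> R[i]^o) : 1 <= p -> holomorphic_on_ball g ->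
  carleson_density p (fun z => cabs (radial_deriv g z) `^ p * (1 - sqnorm z) `^ (2 * p)) ->
  exists M : R, forall z, ball_n n z -> cabs (radial_deriv g z) * (1 - sqnorm z) ^+ 2 <= M.
Proof.
move=> p1 hg [c [c0 hc]]; have p0 : 0 < p by apply: lt_le_trans p1.
pose K := c * gapK R (2 * n) * expR 6 / lowK.
have lk := lowK_gt0.
have gk := gapK_gt0 R (2 * n).
have K0 : 0 <= K by exact: divr_ge0 (mulr_ge0 (mulr_ge0 (ltW c0) (ltW gk)) (expR_ge0 _)) (ltW lk).
(* The defect on the ellipsoid is bounded below by a quarter of the defect of [a]; squaring the
   quarter costs [16]. *)
exists (16 * K `^ p^-1) => a ab.
have y0 : 0 < defect a by rewrite subr_gt0.
have := hc _ (test_fun_Apsi p0 ab) => hle.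
have c0e : (0 <= c%:E :> \bar R)%E by rewrite lee_fin ltW.
have {}hle := le_trans hle (lee_wpmul2l c0e (test_fun_int p0 ab)).
(* Lower bound on the ellipsoid for [|f_a|^p e^(-psi)] times the power of the defect: [D <= 6] and
   defect at least [(1 - |a|^2) / 4]. *)
pose W0 : R := expR (-6) * (defect a / 4) `^ (2 * p).
have W00 : 0 <= W0 by rewrite mulr_ge0 ?expR_ge0 ?powR_ge0.
have Qa : Qform a (a - a) <= 64^-1.
  rewrite /Qform subrr /sqnorm /inner !big1 => [|j _|j _]; rewrite ?mxE ?mul0r ?cabs0 ?expr0n //.
  by rewrite !mul0r addr0 invr_ge0.
have := @ellipsoid_submean p W0 a a (radial_deriv g : Cn R n -> R[i]^o) _ p1 W00 ab Qa
  (radial_deriv_hol hg) _ _.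
move=> /(_ (fun z => if sqnorm z < 1 then
  ((cabs (test_fun p 1 a z) `^ p) * weight z * (cabs (radial_deriv g z) `^ p * (1 - sqnorm z) `^ (2 * p)))%:E
  else 0%E)) H.
have {}H := le_trans (H _ _) hle.
have vol0 := ell_vol_gt0 ab.
have {H} : W0 * lowK * ell_vol a * cabs (radial_deriv g a) `^ p <= c * (gapK R (2 * n) * ell_vol a).
  rewrite -lee_fin; apply: H => [z|z zb xy gD].
    by case: ifP => // _; rewrite lee_fin !mulr_ge0 ?powR_ge0 ?expR_ge0.
  rewrite (zb : sqnorm z < 1) lee_fin test_fun_weight //.
  set G := _ `^ p; set V := _ `^ (2 * p); set T := expR (- _).
  have -> : T * (G * V) = T * V * G by rewrite -mulrA (mulrC V).
  apply: ler_wpM2r; first exact: powR_ge0.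
  apply: ler_pM; rewrite ?expR_ge0 ?powR_ge0 //; first by rewrite ler_expR lerN2.
  have xz : 0 < 1 - sqnorm z by rewrite subr_gt0.
  by apply: ge0_ler_powR; rewrite ?nnegrE //; [exact: mulr_ge0 (ltW p0)|exact: divr_ge0 (ltW y0) _|exact: ltW].
move=> H.
have E4 : (defect a / 4) `^ (2 * p) = ((defect a / 4) ^+ 2) `^ p.
  by rewrite powRrM powR_mulrn //; exact: divr_ge0 (ltW y0) _.
have d40 : 0 <= (defect a / 4) ^+ 2 by exact: sqr_ge0.
have H2 : (cabs (radial_deriv g a) * (defect a / 4) ^+ 2) `^ p <= K.
  rewrite powRM ?cabs_ge0 // -E4 /K ler_pdivlMr // -ler_pdivrMr ?expR_gt0 // -expRN.
  rewrite -(ler_pM2r vol0) -[X in _ <= X]mulrA; apply: le_trans H; rewrite /W0.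
  set e := expR _; set d := _ `^ (2 * p); set r := cabs _ `^ p.
  by rewrite le_eqVlt; apply/orP; left; apply/eqP; ring.
have H3 : cabs (radial_deriv g a) * (defect a / 4) ^+ 2 <= K `^ p^-1.
  have h0 : 0 <= cabs (radial_deriv g a) * (defect a / 4) ^+ 2 by rewrite mulr_ge0 ?cabs_ge0.
  exact: powR_le_root.
have -> : (1 - sqnorm a) ^+ 2 = 16 * (defect a / 4) ^+ 2 by rewrite /defect; field.
by rewrite mulrCA ler_pM2l.
Qed.

End BallIntegralBounds.

(** * The extended Cesaro operator *)

Section PrimitiveScaling.
Variable R : realType.
Local Notation mu := (@lebesgue_measure R).
Implicit Types (k G : R -> R) (s t : R).

(** Integration starts at [-1], so that [0] is an interior point and the primitive has a two-sided
    derivative there. *)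
Lemma continuous_primitive k : continuous k ->
  exists2 G, G 0 = 0 & forall s, -1 < s -> is_derive s 1 G (k s).
Proof.
move=> ck.
have ki a b : mu.-integrable `[a, b] (EFin \o k).
  apply: continuous_compact_integrable; first exact: segment_compact.
  by apply: continuous_subspaceT => x; exact: ck.
pose H s := \int[mu]_(t in `[-1, s]) k t.
have dH s : -1 < s -> is_derive s 1 H (k s).
  move=> s1; have [|d1 d2] := @continuous_FTC1_closed R k (-1) s (s + 1) _ (ki _ _) s1 (ck s).
    by rewrite ltrDl.
  by apply: (DeriveDef d1); rewrite -derive1E; exact: d2.
exists (fun s => H s - H 0) => [|s s1]; first by rewrite subrr.
by rewrite -[k s]subr0; apply: is_deriveB; exact: dH.
Qed.

Lemma Rintegral_dilated k G s : continuous k -> G 0 = 0 ->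
  (forall t, -1 < t -> is_derive t 1 G (k t)) -> 0 < s ->
  \int[mu]_(t in `]0, 1]) (s * k (t * s)) = G s.
Proof.
move=> ck G0 dG s0.
have cks : continuous (fun t : R => s * k (t * s)).
  move=> t; apply: cvgM; first exact: cvg_cst.
  by apply: continuous_comp; [exact: mulrr_continuous|exact: ck].
have dGs t : - s^-1 < t -> is_derive t 1 (G \o (fun t => t * s)) (s * k (t * s)).
  move=> ts; have h1 : -1 < t * s.
    by have := ts; rewrite -(ltr_pM2r s0) mulNr mulVf ?gt_eqF.
  rewrite mulrC; apply: is_derive1_comp; first exact: dG.
  have := @is_deriveZ R R^o R^o id s t 1 1 (is_derive_id _ _).
  rewrite /GRing.scale /= mulr1.
  by congr (is_derive _ _ _ _); apply/funext => x; rewrite /= mulrC.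
have si : 0 < s^-1 by rewrite invr_gt0.
have cGs t : 0 <= t -> {for t, continuous (G \o (fun t => t * s))}.
  move=> t0; have tl : - s^-1 < t by rewrite (lt_le_trans _ t0) // oppr_lt0.
  by have [d _] := dGs t tl; apply: differentiable_continuous; apply/derivable1_diffP.
have i01 : mu.-integrable `[0, 1] (EFin \o (fun t : R => s * k (t * s))).
  apply: continuous_compact_integrable; first exact: segment_compact.
  exact: continuous_subspaceT.
have i01' : mu.-integrable `]0, 1] (EFin \o (fun t : R => s * k (t * s))).
  by apply: integrableS i01 => // x /=; rewrite !in_itv /= => /andP[/ltW -> ->].
rewrite (Rintegral_itv_obnd_cbnd i01').
rewrite /Rintegral (@continuous_FTC2 R _ (G \o (fun t => t * s))) //=.
- by rewrite mul0r G0 mul1r subr0.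
- exact: continuous_subspaceT.
- split.
  + by move=> x; rewrite in_itv => /andP[x0 _]; case: (dGs x) => //; rewrite (lt_trans _ x0) // oppr_lt0.
  + exact/cvg_at_right_filter/cGs.
  + exact/cvg_at_left_filter/cGs.
- move=> x; rewrite in_itv => /andP[x0 _]; rewrite derive1E.
  by case: (dGs x) => //; rewrite (lt_trans _ x0) // oppr_lt0.
Qed.

End PrimitiveScaling.

Section CesaroPath.
Variables (R : realType) (n : nat).
Local Notation C := R[i].
Variables f g : Cn R n -> R[i]^o.
Hypotheses (hf : holomorphic_on_ball f) (hg : holomorphic_on_ball g).
Implicit Types (z w : Cn R n) (s t : R).

(** The integrand of the operator with [1 / t] cancelled against the factor [t] in the radial
    derivative at [t z]; it extends continuously to [t = 0]. *)
Definition radial_kernel z t : C :=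
  f ((t%:C)%C *: z) * \sum_(j < n) z ord0 j * ('D_('e_j) g ((t%:C)%C *: z) : C).

Lemma radial_kernelE z t : t != 0 ->
  f ((t%:C)%C *: z) * radial_deriv g ((t%:C)%C *: z) / (t%:C)%C = radial_kernel z t.
Proof.
move=> t0; have tc : (t%:C)%C != 0 :> C by rewrite -cabs_eq0 cabs_real normr_eq0.
rewrite /radial_kernel -mulrA; congr (_ * _); rewrite /radial_deriv mulr_suml.
apply: eq_bigr => j _; by rewrite mxE -!mulrA [LHS]mulrC -!mulrA mulVf // mulr1.
Qed.

Lemma radial_kernelZ z s t : radial_kernel ((s%:C)%C *: z) t = (s%:C)%C * radial_kernel z (t * s).
Proof.
rewrite /radial_kernel scalerA -rmorphM /= mulrCA; congr (_ * _); rewrite mulr_sumr.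
by apply: eq_bigr => j _; rewrite mxE mulrA.
Qed.

Lemma cesaro_kernel z : Defs.cesaro g f z =
  Complex (\int[@lebesgue_measure R]_(t in `]0, 1]) complex.Re (radial_kernel z t))
    (\int[@lebesgue_measure R]_(t in `]0, 1]) complex.Im (radial_kernel z t)).
Proof.
have E t : t \in (`]0, 1]%classic : set R) -> f ((t%:C)%C *: z) * radial_deriv g ((t%:C)%C *: z) / (t%:C)%C
    = radial_kernel z t.
  by rewrite inE /= in_itv /= => /andP[t0 _]; rewrite radial_kernelE // gt_eqF.
by rewrite /Defs.cesaro; congr Complex; apply: eq_Rintegral => t /E ->.
Qed.

Lemma radial_kernel_cont z t : ball_n n ((t%:C)%C *: z) -> forall e : R, 0 < e ->
  exists2 dl : R, 0 < dl & forall s, `|s - t| < dl ->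
    cabs (radial_kernel z s - radial_kernel z t) < e.
Proof.
move=> tb e e0.
pose P : Cn R n -> R[i]^o := fun w => f w * \sum_(j < n) z ord0 j * ('D_('e_j) g w : C).
have dP : differentiable P ((t%:C)%C *: z).
  apply: differentiableM; first exact: hf.
  have -> : (fun w : Cn R n => \sum_(j < n) z ord0 j * ('D_('e_j) g w : C) : R[i]^o) =
      \sum_(j < n) (fun w => z ord0 j * ('D_('e_j) g w : C) : R[i]^o).
    by apply/funext => w; rewrite fct_sumE.
  apply: differentiable_sum => j; apply: differentiableM; first exact: differentiable_cst.
  exact: partial_hol.
have [dl dl0 H] := cdiff_cont (differentiable_cdiff dP) e0.
have z1 : 0 < l1 z + 1 by rewrite ltr_wpDl ?l1_ge0.
exists (dl / (l1 z + 1)) => [|s st]; first by rewrite divr_gt0.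
have E : (s%:C)%C *: z = (t%:C)%C *: z + ((s - t)%:C)%C *: z.
  by rewrite -scalerDl -rmorphD /= addrC subrK.
have := H (((s - t)%:C)%C *: z); rewrite -E; apply.
rewrite l1Z cabs_real; apply: le_lt_trans (_ : `|s - t| * (l1 z + 1) < dl).
  by rewrite ler_wpM2l // lerDl.
by rewrite -ltr_pdivlMr.
Qed.

(** Freezing the parameter outside [[0, T]] turns the kernel into a continuous function on the whole
    line, to which primitives and Riemann sums apply. *)
Definition clamp (T t : R) := Num.max 0 (Num.min T t).

Lemma clamp_id T t : 0 <= t -> t <= T -> clamp T t = t.
Proof. by move=> t0 tT; rewrite /clamp min_r // max_r. Qed.

Lemma clamp_bound T t : 0 <= T -> 0 <= clamp T t <= T.
Proof. by move=> T0; rewrite /clamp le_max lexx ge_max T0 ge_min lexx. Qed.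

Lemma clamp_lipschitz T t s : 0 <= T -> `|clamp T s - clamp T t| <= `|s - t|.
Proof.
move=> T0; have a1 := ler_norm (s - t); have a2 := ler_norm (t - s); rewrite distrC in a2.
rewrite /clamp ler_norml.
by case: (leP T s) => h1; case: (leP T t) => h2; rewrite ?(max_r T0);
  try case: (leP 0 s) => h3; try case: (leP 0 t) => h4; apply/andP; split; lra.
Qed.

(** With [d = 1 - |z|^2] and [T = 1 + d / 2], the value [(1 + d / 2)^2 (1 - d)] is below [1]. Having
    [T > 1] lets the ray be followed past [z]. *)
Lemma ball_stretch z : ball_n n z -> exists2 T : R, 1 < T &
  forall t, 0 <= t -> t <= T -> ball_n n ((t%:C)%C *: z).
Proof.
move=> zb; have q0 := sqnorm_ge0 z.
exists (1 + (1 - sqnorm z) / 2) => [|t t0 tT]; first by move: zb; rewrite /ball_n /=; lra.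
rewrite /ball_n /= sqnormZ cabs_real ger0_norm //.
have d0 : 0 < 1 - sqnorm z by rewrite subr_gt0.
apply: le_lt_trans (_ : (1 + (1 - sqnorm z) / 2) ^+ 2 * sqnorm z < 1).
  by rewrite ler_wpM2r // lerXn2r ?nnegrE // (le_trans t0).
have -> : sqnorm z = 1 - (1 - sqnorm z) by ring.
move: (1 - sqnorm z) d0 => d d0; rewrite opprB addrCA subrr addr0.
have := exprn_gt0 2 d0; have := exprn_gt0 3 d0.
have -> : (1 + d / 2) ^+ 2 * (1 - d) = 1 - 3 / 4 * d ^+ 2 - d ^+ 3 / 4 by field.
lra.
Qed.

(** The substitution [t s] for [t] turns the operator at [s z] into the integral of one fixed kernel
    over [[0, s]], hence into a primitive of it. *)
Lemma cesaro_path z : ball_n n z -> exists T : R, exists G1 G2 : R -> R,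
  [/\ 1 < T, [/\ G1 0 = 0, G2 0 = 0,
      continuous (fun t => complex.Re (radial_kernel z (clamp T t))) &
      continuous (fun t => complex.Im (radial_kernel z (clamp T t)))],
    forall t, -1 < t -> is_derive t 1 G1 (complex.Re (radial_kernel z (clamp T t))),
    forall t, -1 < t -> is_derive t 1 G2 (complex.Im (radial_kernel z (clamp T t))) &
    forall s, 0 < s -> s <= T -> Defs.cesaro g f ((s%:C)%C *: z) = Complex (G1 s) (G2 s)].
Proof.
move=> zb; have [T T1 hT] := ball_stretch zb; have T0 : 0 <= T by lra.
have cc t (e : R) : 0 < e -> exists2 dl : R, 0 < dl & forall s, `|s - t| < dl ->
    cabs (radial_kernel z (clamp T s) - radial_kernel z (clamp T t)) < e.
  move=> e0; have /andP[c0 cT] := clamp_bound t T0.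
  have [dl dl0 H] := radial_kernel_cont (hT _ c0 cT) e0; exists dl => // s st.
  by apply: H; exact: le_lt_trans (clamp_lipschitz _ _ T0) st.
have c1 : continuous (fun t => complex.Re (radial_kernel z (clamp T t))).
  move=> t; apply/cvgrPdist_lt => e e0; have [dl dl0 H] := cc t e e0.
  apply/nbhs_ballP; exists dl => //= s; rewrite /ball /= distrC => /H.
  apply: le_lt_trans; rewrite distrC; apply: le_trans (le_Re_cabs _).
  by rewrite ReD ReN.
have c2 : continuous (fun t => complex.Im (radial_kernel z (clamp T t))).
  move=> t; apply/cvgrPdist_lt => e e0; have [dl dl0 H] := cc t e e0.
  apply/nbhs_ballP; exists dl => //= s; rewrite /ball /= distrC => /H.
  apply: le_lt_trans; rewrite distrC; apply: le_trans (le_Im_cabs _).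
  by rewrite ImD ImN.
have [G1 G10 dG1] := continuous_primitive c1.
have [G2 G20 dG2] := continuous_primitive c2.
exists T, G1, G2; split => // s s0 sT; rewrite cesaro_kernel.
have E t : t \in (`]0, 1]%classic : set R) ->
    radial_kernel ((s%:C)%C *: z) t = (s%:C)%C * radial_kernel z (clamp T (t * s)).
  rewrite inE /= in_itv /= => /andP[t0 t1]; rewrite radial_kernelZ clamp_id //.
    by rewrite mulr_ge0 // ltW.
  by apply: le_trans sT; rewrite ler_piMl // ltW.
rewrite -(Rintegral_dilated c1 G10 dG1 s0) -(Rintegral_dilated c2 G20 dG2 s0).
by congr Complex; apply: eq_Rintegral => t /E ->; rewrite ?Re_realM ?ImM /=; ring.
Qed.

Lemma Im_realM (x : R) (w : C) : complex.Im ((x%:C)%C * w) = x * complex.Im w.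
Proof. by rewrite ImM /= mul0r addr0. Qed.

Lemma radial_kernel1 z : radial_kernel z 1 = f z * radial_deriv g z.
Proof. by rewrite /radial_kernel scale1r. Qed.

(** The radial derivative is the derivative of [s] to [F(s z)] at [s = 1], and [cesaro_path]
    computes it as the value of the kernel at [1]. Both expansions are compared for one small step
    [h]. *)
Lemma radial_deriv_cesaro z : ball_n n z -> differentiable (Defs.cesaro g f) z ->
  radial_deriv (Defs.cesaro g f) z = f z * radial_deriv g z.
Proof.
move=> zb /differentiable_cdiff; set F := Defs.cesaro g f => dF.
have [T [G1 [G2 [T1 _ dG1 dG2 FG]]]] := cesaro_path zb.
have h1 : -1 < 1 :> R by lra.
have c1 : clamp T 1 = 1 by rewrite clamp_id // ltW.
have := dG1 1 h1; have := dG2 1 h1; rewrite c1 radial_kernel1.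
set L := f z * _ => d2 d1; set D := radial_deriv F z.
suff : cabs (D - L) <= 0.
  move=> h; apply/eqP; rewrite -subr_eq0 -cabs_eq0 eq_le h; exact: cabs_ge0.
apply/ler_addgt0Pr => e e0; rewrite add0r.
have z1 : 0 < l1 z + 1 by rewrite ltr_wpDl ?l1_ge0.
(* The real and imaginary primitives cost [2 q h], the expansion of [F] costs [q h l1 z]; the sum
   stays below [h e]. *)
have q0 : 0 < e / (l1 z + 1 + 2) by rewrite divr_gt0 // addr_gt0.
set q := _ / _ in q0.
have [a1 a10 H1] := derive_eps d1 q0; have [a2 a20 H2] := derive_eps d2 q0.
have [a3 a30 H3] := dF q q0.
pose h : R := Num.min (Num.min (a1 / 2) (a2 / 2)) (Num.min (a3 / (l1 z + 1) / 2) ((T - 1) / 2)).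
have h0 : 0 < h by rewrite !lt_min !divr_gt0 // subr_gt0.
have /andP[/andP[ha1 ha2] /andP[ha3 ha4]] : ((h <= a1 / 2) && (h <= a2 / 2)) &&
  ((h <= a3 / (l1 z + 1) / 2) && (h <= (T - 1) / 2)) by rewrite -!le_min.
have hh : `|h| = h by rewrite ger0_norm // ltW.
have := H1 h; have := H2 h; rewrite hh => b2 b1.
have {}b1 := b1 ltac:(lra); have {}b2 := b2 ltac:(lra).
have lk : l1 ((h%:C)%C *: z) = h * l1 z by rewrite l1Z cabs_real hh.
have hz : h * (l1 z + 1) < a3.
  rewrite -ltr_pdivlMr //; have : 0 < a3 / (l1 z + 1) by rewrite divr_gt0.
  lra.
have b3 := H3 ((h%:C)%C *: z) _; rewrite lk in b3.
have {}b3 : cabs (F (z + (h%:C)%C *: z) - F z - (h%:C)%C * D) <= q * (h * l1 z).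
  have -> : (h%:C)%C * D = \sum_(j < n) ('D_('e_j) F z : C) * ((h%:C)%C *: z) ord0 j.
    rewrite /D /radial_deriv mulr_sumr; apply: eq_bigr => j _.
    by rewrite mxE mulrA mulrC.
  by apply: b3; apply: le_lt_trans hz; rewrite ler_pM2l // lerDl.
have E : F (z + (h%:C)%C *: z) = Complex (G1 (1 + h)) (G2 (1 + h)).
  have -> : z + (h%:C)%C *: z = ((1 + h)%:C)%C *: z by rewrite rmorphD scalerDl scale1r.
  by apply: FG; lra.
have E1 : F z = Complex (G1 1) (G2 1) by rewrite -FG ?scale1r // ltW.
have b4 : cabs (F (z + (h%:C)%C *: z) - F z - (h%:C)%C * L) <= 2 * (q * h).
  apply: le_trans (cabs_le_ReIm _) _; rewrite E E1 !ReD !ReN !ImD !ImN Re_realM Im_realM.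
  rewrite (mulrC h (complex.Re L)) (mulrC h (complex.Im L)).
  by have := lerD b1 b2; rewrite (_ : q * h + q * h = 2 * (q * h)) //; ring.
have b5 : h * cabs (D - L) <= h * e.
  have -> : h * cabs (D - L) = cabs ((F (z + (h%:C)%C *: z) - F z - (h%:C)%C * L) -
      (F (z + (h%:C)%C *: z) - F z - (h%:C)%C * D)).
    rewrite -{1}hh -cabs_real -cabsM.
    have RR (A B c d l : C) : c * (d - l) = (A - B - c * l) - (A - B - c * d) by ring.
    by congr cabs; exact: RR.
  apply: le_trans (cabsB _ _) _; apply: le_trans (lerD b4 b3) _.
  have -> : h * e = q * h * (l1 z + 1 + 2) by rewrite /q; field; rewrite gt_eqF // addr_gt0.
  have : 0 <= q * h by rewrite mulr_ge0 // ltW.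
  have -> : q * h * (l1 z + 1 + 2) = 2 * (q * h) + q * (h * l1 z) + q * h by ring.
  lra.
by move: b5; rewrite ler_pM2l.
Qed.

End CesaroPath.

(** * Boundedness of the operator implies the radial bound *)

Section BoundedCesaro.
Variables (R : realType) (n : nat).
Local Notation C := R[i].
Implicit Types (a z : Cn R n).

(** In the direction of [a] both terms of [Q] are at most [1 / 144] once [|b| <= (1-|a|^2)^2 / 12];
    the second, with the cube in its denominator, has a factor [1-|a|^2] to spare. *)
Lemma Qform_dilation a (b : C) : ball_n n a -> cabs b <= defect a ^+ 2 / 12 ->
  Qform a (b *: a) <= 64^-1.
Proof.
move=> ab hb; have y0 : 0 < defect a by rewrite subr_gt0.
have q0 := sqnorm_ge0 a; have y1 : defect a <= 1 by rewrite /defect lerBlDr lerDl.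
have qy : sqnorm a = 1 - defect a by rewrite /defect; ring.
rewrite /Qform sqnormZ innerZ inner_self cabsM cabs_real (ger0_norm q0) exprMn.
have y2 : 0 < defect a ^+ 2 by rewrite exprn_gt0.
have y3 : 0 < defect a ^+ 3 by rewrite exprn_gt0.
have b2 : cabs b ^+ 2 <= (defect a ^+ 2 / 12) ^+ 2.
  by rewrite lerXn2r ?nnegrE ?cabs_ge0 // divr_ge0 ?(ltW y2).
have s1 : sqnorm a <= 1 by rewrite qy; lra.
have s2 : sqnorm a ^+ 2 <= 1 by rewrite -(expr1n _ 2) lerXn2r ?nnegrE.
have t1 : cabs b ^+ 2 * sqnorm a / defect a ^+ 2 <= 144^-1.
  rewrite ler_pdivrMr //; apply: (@le_trans _ _ ((defect a ^+ 2 / 12) ^+ 2 * 1)).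
    by apply: ler_pM; rewrite ?sqr_ge0.
  have -> : (defect a ^+ 2 / 12) ^+ 2 * 1 = 144^-1 * (defect a ^+ 2 * defect a ^+ 2) by field.
  by rewrite ler_pM2l ?invr_gt0 // ler_piMr ?(ltW y2) // expr_le1 // ltW.
have t2 : cabs b ^+ 2 * sqnorm a ^+ 2 / defect a ^+ 3 <= 144^-1.
  rewrite ler_pdivrMr //; apply: (@le_trans _ _ ((defect a ^+ 2 / 12) ^+ 2 * 1)).
    by apply: ler_pM; rewrite ?sqr_ge0.
  have -> : (defect a ^+ 2 / 12) ^+ 2 * 1 = 144^-1 * (defect a ^+ 3 * defect a) by field.
  by rewrite ler_pM2l ?invr_gt0 // ler_piMr ?(ltW y3).
lra.
Qed.

(** Along this disc [u >= y - y^2 / 12 >= 11 y / 12], so [1 / u] exceeds [1 / y] by at most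
    [1 / 11]. The exponent thus grows by at most [2 / 11]. *)
Lemma test_fun_dilation (p : R) a (b : C) : 1 <= p -> ball_n n a ->
  cabs b <= defect a ^+ 2 / 12 ->
  cabs (test_fun p 1 a (a + b *: a)) <= expR 1 * cabs (test_fun p 1 a a).
Proof.
move=> p1 ab hb; have y0 : 0 < defect a by rewrite subr_gt0.
have q0 := sqnorm_ge0 a; have y1 : defect a <= 1 by rewrite /defect lerBlDr lerDl.
rewrite !test_fun_cabs -expRD ler_expR innerD innerZ inner_self.
set y := defect a in hb y0 y1 *.
have -> : 1 - (((sqnorm a)%:C)%C + b * ((sqnorm a)%:C)%C) = ((y)%:C)%C - b * ((sqnorm a)%:C)%C :> C.
  by rewrite /y /defect rmorphB rmorph1; ring.
have -> : 1 - ((sqnorm a)%:C)%C = ((y)%:C)%C :> C by rewrite /y /defect rmorphB rmorph1.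
rewrite !(mulrC b) ReD ReN Re_realM ImD ImN Im_realM /=.
have s1 : sqnorm a <= 1 by move: y0; rewrite /y /defect; lra.
have hr := le_Re_cabs b.
set u := y - _; set v := 0 - _.
have u0 : y * (11 / 12) <= u.
  have h1 : sqnorm a * complex.Re b <= y ^+ 2 / 12.
    apply: le_trans (ler_norm _) _; rewrite normrM ger0_norm //.
    apply: le_trans hb; apply: le_trans hr; exact: ler_piMl.
  have h2 : y ^+ 2 <= y by rewrite expr2 ler_piMl // ltW.
  by rewrite /u; lra.
have u1 : y - y ^+ 2 / 12 <= u.
  have h1 : sqnorm a * complex.Re b <= y ^+ 2 / 12.
    apply: le_trans (ler_norm _) _; rewrite normrM ger0_norm //.
    apply: le_trans hb; apply: le_trans hr; exact: ler_piMl.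
  by rewrite /u; lra.
have up : 0 < u by apply: lt_le_trans u0; rewrite mulr_gt0.
have h3 : u / (u ^+ 2 + v ^+ 2) <= y^-1 + 11^-1.
  apply: (@le_trans _ _ u^-1).
    rewrite ler_pdivrMr ?ltr_wpDr ?sqr_ge0 ?exprn_gt0 // mulrDr expr2 mulKf ?gt_eqF //.
    by rewrite lerDl mulr_ge0 ?sqr_ge0 // invr_ge0 ltW.
  rewrite -[u^-1]mul1r ler_pdivrMr // mulrDl.
  apply: (@le_trans _ _ (y^-1 * (y - y ^+ 2 / 12) + 11^-1 * (y * (11 / 12)))).
    by rewrite le_eqVlt; apply/orP; left; apply/eqP; field; rewrite gt_eqF.
  by apply: lerD; rewrite ler_pM2l ?invr_gt0.
have E0 : y / (y ^+ 2 + (0 : R) ^+ 2) = y^-1 by rewrite expr0n addr0; field; rewrite gt_eqF.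
rewrite E0 mul1r; have p2 : 2 / p <= 2 by rewrite ler_piMr // invf_le1 // (lt_le_trans _ p1).
have p3 : 0 <= 2 / p by rewrite divr_ge0 // (le_trans _ p1).
have h4 : 2 / p * (u / (u ^+ 2 + v ^+ 2)) <= 2 / p * (y^-1 + 11^-1) by rewrite ler_wpM2l.
rewrite mulrDr in h4; lra.
Qed.

Lemma cesaro_radial_bound (p : R) (g : Cn R n -> R[i]^o) : 1 <= p -> holomorphic_on_ball g ->
  cesaro_bounded p g ->
  exists M : R, forall z, ball_n n z -> cabs (radial_deriv g z) * (1 - sqnorm z) ^+ 2 <= M.
Proof.
move=> p1 hg [c [c0 hc]]; have p0 : 0 < p by apply: lt_le_trans p1.
pose K1 := (c * gapK R (2 * n) * expR 6 / lowK R n) `^ p^-1.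
exists (12 * ((16 + taylorK R) * (K1 * expR 1))) => a ab.
have y0 : 0 < defect a by rewrite subr_gt0.
have [] := hc _ (test_fun_Apsi p0 ab); set f := test_fun p 1 a.
have hf : holomorphic_on_ball (f : Cn R n -> R[i]^o) by exact: test_fun_hol.
move=> [hF _] hle.
have radF := radial_deriv_cesaro hf hg ab (hF _ ab).
move: hF hle radF; move: (Defs.cesaro g f) => F hF hle radF.
have c0e : (0 <= c%:E :> \bar R)%E by rewrite lee_fin ltW.
have {}hle := le_trans hle (lee_wpmul2l c0e (test_fun_int p0 ab)).
(* Division by [f_a] is multiplication by the test function of opposite sign, which keeps holomorphy
   visible. As [|f_a|^p e^(-psi) >= e^(-6)] near [a], the norm of [F] controls the plain average of
   [|h|^p]. *)
pose h : Cn R n -> R[i]^o := fun z => F z * test_fun p (-1) a z.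
have hh : holomorphic_on_ball h.
  by move=> z zb; apply: differentiableM; [exact: hF|exact: test_fun_diff].
have hK b : Qform a (b - a) <= 64^-1 -> cabs (h b) <= K1.
  move=> Qb; apply: powR_le_root => //; first exact: cabs_ge0.
  have := @ellipsoid_submean R n p (expR (-6)) a b h _ p1 (expR_ge0 _) ab Qb hh _ _.
  move=> /(_ (fun z => if sqnorm z < 1 then ((cabs (F z) `^ p) * weight z * 1)%:E else 0%E)) H.
  have {}H := le_trans (H _ _) hle.
  have vol0 := ell_vol_gt0 ab.
  have {}H : expR (-6) * lowK R n * ell_vol a * cabs (h b) `^ p <= c * (gapK R (2 * n) * ell_vol a).
    rewrite -lee_fin; apply: H => [z|z zb xy gD].
      by case: ifP => // _; rewrite mulr1 lee_fin mulr_ge0 ?powR_ge0 ?expR_ge0.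
    rewrite (zb : sqnorm z < 1) lee_fin mulr1.
    have -> : F z = h z * f z.
      by rewrite /h -mulrA (mulrC (test_fun _ _ _ _)) test_fun_inv // mulr1.
    have tw : cabs (f z) `^ p * weight z = _ := test_fun_weight ab zb p0.
    rewrite (cabsM (h z) (f z)) (powRM _ (cabs_ge0 _) (cabs_ge0 _)) -mulrA tw mulrC.
    by rewrite ler_wpM2l ?powR_ge0 // ler_expR lerN2.
  rewrite ler_pdivlMr ?lowK_gt0 // -ler_pdivrMr ?expR_gt0 // -expRN.
  rewrite -(ler_pM2r vol0) -[X in _ <= X]mulrA; apply: le_trans H.
  set e := expR _; set r := cabs _ `^ p.
  by rewrite le_eqVlt; apply/orP; left; apply/eqP; ring.
pose rho := defect a ^+ 2 / 12.
have rho0 : 0 < rho by rewrite divr_gt0 // exprn_gt0.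
have rb (b : C) : sqd 0 b < rho ^+ 2 -> cabs b <= rho.
  rewrite /sqd subr0 => /ltW.
  by rewrite ler_pXn2r ?nnegrE ?cabs_ge0 // ltW.
have nb (b : C) : cabs b <= rho -> Qform a ((a + b *: a) - a) <= 64^-1.
  by move=> hb; rewrite addrAC subrr add0r; exact: Qform_dilation.
have ib (b : C) : cabs b <= rho -> ball_n n (a + b *: a).
  move=> /nb Qb; have [] // := near_in_ball ab (le_trans Qb _).
  by rewrite lef_pV2 ?posrE // ler_nat.
have f0 : 0 < cabs (f a) by rewrite cabs_cexp expR_gt0.
have cl (b : C) : cabs b <= rho -> cderiv (fun b => F (a + b *: a)) b
    (\sum_(j < n) ('D_('e_j) F (a + b *: a) : C) * a ord0 j).
  by move=> hb; apply: cdiff_line; apply: differentiable_cdiff; apply: hF; exact: ib.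
have b0 : cabs (0 : C) <= rho by rewrite cabs0 ltW.
have := @cauchy_estimate R (fun b => F (a + b *: a)) 0 _ rho (K1 * (expR 1 * cabs (f a)))
  rho0 _ _ (cl 0 b0).
rewrite scale0r addr0.
have -> : \sum_(j < n) ('D_('e_j) F a : C) * a ord0 j = radial_deriv F a.
  by apply: eq_bigr => j _; rewrite mulrC.
(* The identity brings in [|f_a(a)|], which then cancels against the same factor in the bound for
   [F] on the disc. *)
rewrite radF cabsM => H; rewrite -(ler_pM2l f0).
have -> : 1 - sqnorm a = defect a by [].
have -> : cabs (f a) * (cabs (radial_deriv g a) * defect a ^+ 2) =
  12 * (cabs (f a) * cabs (radial_deriv g a) * rho) by rewrite /rho; field.
have -> : cabs (f a) * (12 * ((16 + taylorK R) * (K1 * expR 1))) =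
  12 * ((16 + taylorK R) * (K1 * (expR 1 * cabs (f a)))) by ring.
rewrite ler_pM2l //; apply: H => [b /rb hb|b /rb hb]; first by eexists; exact: cl.
have -> : F (a + b *: a) = h (a + b *: a) * f (a + b *: a).
  by rewrite /h -mulrA (mulrC (test_fun _ _ _ _)) test_fun_inv ?mulr1 //; exact: ib.
rewrite cabsM; apply: ler_pM; rewrite ?cabs_ge0 //; first by apply: hK; exact: nb.
exact: test_fun_dilation.
Qed.

End BoundedCesaro.

(** * Riemann sums *)

Section RiemannSums.
Variable R : realType.
Implicit Types k G : R -> R.

Lemma uniform_continuity k (a b : R) : continuous k -> forall e : R, 0 < e -> exists2 dl : R, 0 < dl &
  forall t, a <= t <= b -> forall s, `|s - t| < dl -> `|k s - k t| < e.
Proof.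
move=> ck e e0; have /compact_near_coveringP nK := @segment_compact R a b.
have [] := nK R (0^'+) (fun d t => forall s, `|s - t| < d -> `|k s - k t| < e) _ _.
  move=> t /= _; have e2 : 0 < e / 2 by rewrite divr_gt0.
  have /cvgrPdist_lt/(_ _ e2)/nbhs_ballP[d /= d0 hd] := ck t.
  have d2 : 0 < d / 2 by rewrite divr_gt0.
  exists (ball t (d / 2), [set d' | d' < d / 2]).
    by split; [exact: nbhsx_ballx|exact: nbhs_right_lt].
  move=> [t' d'] [/= ht hd'] s hs.
  have h1 : ball t d t' by apply: le_ball ht; lra.
  have h2 : ball t d s.
    move: ht; rewrite /ball /= => ht.
    have -> : t - s = (t - t') - (s - t') by ring.
    by apply: le_lt_trans (ler_normB _ _) _; lra.
  have := hd _ h1; have := hd _ h2 => n2 n1.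
  have -> : k s - k t' = (k t - k t') - (k t - k s) by ring.
  by apply: le_lt_trans (ler_normB _ _) _; lra.
move=> d /= d0 H; exists (d / 2) => [|t tab s]; first by rewrite divr_gt0.
apply: (H (d / 2)); last by rewrite /= in_itv.
- by rewrite /ball /= sub0r normrN gtr0_norm ?divr_gt0 //; lra.
- by rewrite divr_gt0.
Qed.

(** On each subinterval the mean value theorem writes the increment of [G] as a value of [k] times
    the length, within [e / N] of the term of the sum by uniform continuity. *)
Lemma riemann_sum k G : continuous k -> (forall t : R, -1 < t -> is_derive t 1 G (k t)) ->
  forall e : R, 0 < e -> exists N0 : nat, forall N, (N0 <= N)%N ->
    `|\sum_(i < N.+1) k (i%:R / N.+1%:R) / N.+1%:R - (G 1 - G 0)| <= e.
Proof.
move=> ck dG e e0.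
have [dl dl0 hdl] := uniform_continuity 0 1 ck e0.
exists (Num.truncn (dl^-1)) => N hN.
have N0 : 0 < N.+1%:R :> R by rewrite ltr0n.
have hN' : N.+1%:R^-1 < dl.
  rewrite -[ltRHS]invrK ltf_pV2 ?posrE ?invr_gt0 //.
  apply: lt_le_trans (truncnS_gt _) _; by rewrite ler_nat ltnS.
have -> : G 1 - G 0 = \sum_(i < N.+1) (G (i.+1%:R / N.+1%:R) - G (i%:R / N.+1%:R)).
  rewrite -(big_mkord xpredT (fun i => G (i.+1%:R / N.+1%:R) - G (i%:R / N.+1%:R))).
  by rewrite (telescope_sumr (fun i => G (i%:R / N.+1%:R))) // mul0r divff.
rewrite -sumrB; apply: le_trans (ler_norm_sum _ _ _) _.
apply: (@le_trans _ _ (\sum_(i < N.+1) e / N.+1%:R)); last first.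
  by rewrite sumr_const card_ord -[leLHS]mulr_natl mulrCA mulfV ?mulr1 // gt_eqF.
apply: ler_sum => i _.
have ab : i%:R / N.+1%:R < i.+1%:R / N.+1%:R :> R by rewrite ltr_pM2r ?invr_gt0 // ltr_nat.
have i0 : 0 <= i%:R / N.+1%:R :> R by rewrite divr_ge0 // ltW.
have n1 (x : R) : i%:R / N.+1%:R <= x -> -1 < x.
  by move=> ix; have x0 : 0 <= x := le_trans i0 ix; lra.
have cG : {within `[i%:R / N.+1%:R, i.+1%:R / N.+1%:R], continuous G}.
  apply: derivable_within_continuous => x; rewrite in_itv => /andP[/n1 x1 _].
  by case: (dG _ x1).
have dG' (x : R) : x \in `]i%:R / N.+1%:R, i.+1%:R / N.+1%:R[%R -> is_derive x 1 G (k x).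
  by rewrite in_itv => /andP[/ltW/n1 x1 _]; exact: dG.
have [c cab ->] := MVT ab dG' cG.
have -> : i.+1%:R / N.+1%:R - i%:R / N.+1%:R = N.+1%:R^-1 :> R.
  by rewrite -mulrBl -natrB // subSnn mul1r.
rewrite -mulrBl normrM (ger0_norm (_ : 0 <= _^-1)) ?invr_ge0 ?(ltW N0) //.
rewrite ler_pM2r ?invr_gt0 // distrC; apply: ltW; apply: hdl.
  rewrite i0 ler_pdivrMr // mul1r ler_nat; exact: ltnW (ltn_ord i).
move: cab; rewrite in_itv => /andP[c1 c2]; rewrite ger0_norm ?subr_ge0 ?(ltW c1) //.
apply: lt_trans hN'; rewrite ltrBlDr; apply: lt_le_trans c2 _.
by rewrite -[X in _ <= X + _]mul1r -mulrDl addrC natr1.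
Qed.

End RiemannSums.

(** * Holomorphy of the image of the operator *)

Section CesaroHolomorphic.
Variables (R : realType) (n : nat).
Local Notation C := R[i].
Implicit Types (z w : Cn R n) (f g h : Cn R n -> R[i]^o).

(** The closed ball sits in the cube [[-1, 1]^(2n)]. On the cube the modulus, put to zero where
    [|z|^2 > r], is locally bounded, so [box_bounded] applies. *)
Lemma hol_bounded f (r : R) : holomorphic_on_ball f -> r < 1 ->
  exists2 M : R, 0 <= M & forall z, sqnorm z <= r -> cabs (f z) <= M.
Proof.
move=> hf r1.
pose V (u : 'I_(n + n) -> R) : Cn R n := \row_j Complex (u (lshift n j)) (u (rshift n j)).
have Vd u v (e : R) : 0 < e -> (forall i, `|v i - u i| < e) -> l1 (V v - V u) <= n%:R * (2 * e).
  move=> e0 h; rewrite mulr_natl -[X in _ *+ X](card_ord n) -sumr_const; apply: ler_sum => j _.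
  rewrite !mxE; apply: le_trans (cabs_le_ReIm _) _; rewrite /=.
  by have := h (lshift n j); have := h (rshift n j); lra.
have n1 : 0 < 2 * n%:R + 1 :> R by rewrite ltr_wpDl // mulr_ge0.
have Vd' u v (rho : R) : 0 < rho -> (forall i, `|v i - u i| < rho / (2 * n%:R + 1)) ->
    l1 (V v - V u) < rho.
  move=> rho0 /Vd h; apply: le_lt_trans (h _) _; first by rewrite divr_gt0.
  rewrite mulrA mulrCA -[ltRHS]mulr1 ltr_pM2l // ltr_pdivrMr // mul1r mulrC; lra.
have [|M hM] := @box_bounded R (n + n) (-1) 1
    (fun u => if sqnorm (V u) <= r then cabs (f (V u)) else 0).
  move=> u _; have [u1|u1] := ltP (sqnorm (V u)) 1.
    have [rho [M [rho0 hb bM]]] := hol_local_bound hf u1.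
    exists (Num.max M 0), (rho / (2 * n%:R + 1)); split; first by rewrite divr_gt0.
    move=> v _ hv; rewrite le_max; case: ifP => _; last by rewrite lexx orbT.
    by rewrite bM //; exact: Vd'.
  (* Around a point outside the open ball [|z|^2] stays above [r], so the cut-off function is zero
     there. *)
  have r0 : 0 < 1 - r by rewrite subr_gt0.
  have [dl dl0 H] := contn_sqnorm (V u) r0.
  exists 0, (dl / (2 * n%:R + 1)); split; first by rewrite divr_gt0.
  move=> v _ hv; have := H _ (Vd' _ _ _ dl0 hv); rewrite subrKC => h.
  case: ifP => // vr; exfalso; move: h; rewrite ltr_norml => /andP[h _]; lra.
exists (Num.max M 0) => [|z zr]; first by rewrite le_max lexx orbT.
pose u (i : 'I_(n + n)) : R := match fintype.split i with inl j => complex.Re (z ord0 j)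
  | inr j => complex.Im (z ord0 j) end.
have uz : V u = z.
  apply/rowP => j; rewrite mxE /u (unsplitK (inl j)) (unsplitK (inr j)).
  by case: (z _ _).
have zj j : cabs (z ord0 j) <= 1.
  rewrite -(@ler_pXn2r _ 2) ?nnegrE ?cabs_ge0 // expr1n.
  by apply: le_trans (cabs_le_sqnorm z j) _; exact: le_trans zr (ltW r1).
have := hM u; rewrite uz zr le_max => -> // i; rewrite -ler_norml /u.
by case: (fintype.split i) => j; apply: le_trans (zj j); [exact: le_Re_cabs|exact: le_Im_cabs].
Qed.

Lemma hol_dilation h (t : R) w : holomorphic_on_ball h -> ball_n n ((t%:C)%C *: w) -> `|t| <= 1 ->
  differentiable (fun w => h ((t%:C)%C *: w) : R[i]^o) w.
Proof.
move=> hh wb t1; have dh := differentiable_cdiff (hh _ wb).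
apply: (@cdiff_differentiable _ _ _ _ (fun j => (t%:C)%C * ('D_('e_j) h ((t%:C)%C *: w) : C))).
move=> e e0; have [dl dl0 H] := dh e e0; exists dl => // k kd.
have tk : l1 ((t%:C)%C *: k) <= l1 k by rewrite l1Z cabs_real ler_piMl ?l1_ge0.
rewrite scalerDr; apply: le_trans (_ : e * l1 ((t%:C)%C *: k) <= _); last by rewrite ler_pM2l.
apply: le_trans (H _ (le_lt_trans tk kd)); rewrite le_eqVlt; apply/orP; left; apply/eqP.
congr (cabs (_ - _)); apply: eq_bigr => j _; rewrite mxE mulrA; congr (_ * _); exact: mulrC.
Qed.

Lemma sqnorm_dilation (t r : R) w : 0 <= t <= 1 -> sqnorm w <= r -> sqnorm ((t%:C)%C *: w) <= r.
Proof.
move=> /andP[t0 t1] wr; rewrite sqnormZ cabs_real ger0_norm //.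
by apply: le_trans wr; rewrite ler_piMl ?sqnorm_ge0 // expr_le1.
Qed.

Lemma radial_kernel_bounded f g (r : R) : holomorphic_on_ball f -> holomorphic_on_ball g -> r < 1 ->
  exists2 M : R, 0 <= M & forall z t, sqnorm z <= r -> 0 <= t <= 1 ->
    cabs (radial_kernel f g z t) <= M.
Proof.
move=> hf hg r1; have [Mf Mf0 bf] := hol_bounded hf r1.
have hD j : exists M : R, 0 <= M /\ forall z, sqnorm z <= r -> cabs ('D_('e_j) g z) <= M.
  by have [M M0 H] := hol_bounded (partial_hol j hg) r1; exists M.
have [Mg hMg] := choice hD.
exists (Mf * \sum_(j < n) Mg j) => [|z t zr t01].
  by rewrite mulr_ge0 // sumr_ge0 // => j _; case: (hMg j).
have tr := sqnorm_dilation t01 zr.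
rewrite /radial_kernel cabsM; apply: ler_pM; rewrite ?cabs_ge0 //; first exact: bf.
apply: le_trans (cabs_sum _ _ _) _; apply: ler_sum => j _; rewrite cabsM.
have [M0 H] := hMg j; apply: (@le_trans _ _ (1 * Mg j)); last by rewrite mul1r.
apply: ler_pM; rewrite ?cabs_ge0 //; last exact: H.
rewrite -(@ler_pXn2r _ 2) ?nnegrE ?cabs_ge0 // expr1n.
by apply: le_trans (cabs_le_sqnorm z j) _; exact: le_trans zr (ltW r1).
Qed.

Lemma radial_kernel_hol f g (t : R) z : holomorphic_on_ball f -> holomorphic_on_ball g ->
  0 <= t <= 1 -> ball_n n z -> differentiable (fun w => radial_kernel f g w t : R[i]^o) z.
Proof.
move=> hf hg t01 zb.
have tb : ball_n n ((t%:C)%C *: z) by apply: le_lt_trans zb; exact: sqnorm_dilation.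
have t1 : `|t| <= 1 by case/andP: t01 => t0 t1; rewrite ger0_norm.
apply: differentiableM; first exact: hol_dilation.
have -> : (fun w : Cn R n => \sum_(j < n) w ord0 j * ('D_('e_j) g ((t%:C)%C *: w) : C) : R[i]^o) =
    \sum_(j < n) ((fun w : Cn R n => w ord0 j : R[i]^o) *
      (fun w => 'D_('e_j) g ((t%:C)%C *: w) : R[i]^o)).
  by apply/funext => w; rewrite fct_sumE.
apply: differentiable_sum => j; apply: differentiableM; first exact: differentiable_coordinate.
exact: (hol_dilation (partial_hol j hg)).
Qed.

Lemma complex_realM (x : R) (b : C) : b * ((x)%:C)%C = Complex (complex.Re b * x) (complex.Im b * x).
Proof. by rewrite mulrC; apply: complexP; rewrite ?Re_realM ?Im_realM mulrC. Qed.

(** On a smaller ball the operator is the pointwise limit of the Riemann sums of the kernel in [t].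
    These are holomorphic in the point and share the bound [M] of the kernel, so [hol_limit]
    applies. *)
Lemma cesaro_hol f g : holomorphic_on_ball f -> holomorphic_on_ball g ->
  holomorphic_on_ball (Defs.cesaro g f).
Proof.
move=> hf hg z zb; have r0 : 0 < (1 - sqnorm z) / 2 by rewrite divr_gt0 // subr_gt0.
pose r := (1 + sqnorm z) / 2; have r1 : r < 1 by move: r0; rewrite /r; lra.
have [rho rho0 H] := contn_sqnorm z r0.
have wr w : l1 (w - z) < rho -> sqnorm w <= r.
  by move=> /H; rewrite subrKC ltr_norml /r => /andP[_ ?]; lra.
have [M M0 bM] := radial_kernel_bounded hf hg r1.
pose f_ (m : nat) w : R[i]^o := \sum_(i < m.+1)
  radial_kernel f g w (i%:R / m.+1%:R) * (((m.+1%:R)^-1)%:C)%C.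
have i01 m (i : 'I_m.+1) : 0 <= (i%:R / m.+1%:R : R) <= 1.
  by rewrite divr_ge0 //= ler_pdivrMr ?ltr0n // mul1r ler_nat ltnW.
apply: (@hol_limit R n f_ _ z rho M rho0) => [m w wz|m w wz|w wz].
- have wb : ball_n n w by apply: le_lt_trans r1; exact: wr.
  have -> : f_ m = \sum_(i < m.+1) (fun w => radial_kernel f g w (i%:R / m.+1%:R) *
      (((m.+1%:R)^-1)%:C)%C : R[i]^o) by apply/funext => x; rewrite fct_sumE.
  apply: differentiable_sum => i; apply: differentiableM; last exact: differentiable_cst.
  exact: radial_kernel_hol.
- apply: le_trans (cabs_sum _ _ _) _.
  apply: (@le_trans _ _ (\sum_(i < m.+1) M * (m.+1%:R)^-1)).
    apply: ler_sum => i _; rewrite cabsM cabs_real ger0_norm ?invr_ge0 //.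
    by rewrite ler_wpM2r ?invr_ge0 // bM //; exact: wr.
  by rewrite sumr_const card_ord -[leLHS]mulr_natl mulrCA mulfV ?mulr1 // pnatr_eq0.
have wb : ball_n n w by apply: le_lt_trans r1; exact: wr.
have [T [G1 [G2 [T1 [G10 G20 c1 c2] dG1 dG2 FG]]]] := cesaro_path hf hg wb.
pose rk t := radial_kernel f g w (clamp T t).
have ck (i : nat) m : (i < m.+1)%N -> radial_kernel f g w (i%:R / m.+1%:R) = rk (i%:R / m.+1%:R).
  move=> im; have /andP[a1 a2] := i01 m (Ordinal im).
  by rewrite /rk (clamp_id a1) //; exact: le_trans a2 (ltW T1).
move=> e e0; have e2 : 0 < e / 2 by rewrite divr_gt0.
have [N1 h1] := riemann_sum c1 dG1 e2; have [N2 h2] := riemann_sum c2 dG2 e2.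
exists (maxn N1 N2) => m; rewrite geq_max => /andP[/h1 m1 /h2 m2].
have FE : Defs.cesaro g f w = Complex (G1 1) (G2 1).
  by rewrite -[w in LHS]scale1r; apply: FG => //; exact: ltW.
have fE : f_ m w = Complex (\sum_(i < m.+1) complex.Re (rk (i%:R / m.+1%:R)) / m.+1%:R)
    (\sum_(i < m.+1) complex.Im (rk (i%:R / m.+1%:R)) / m.+1%:R).
  rewrite /f_; under eq_bigr => i _ do rewrite complex_realM ck //.
  by elim/big_rec3 : _ => // i x y b _ ->.
rewrite G10 subr0 in m1; rewrite G20 subr0 in m2.
rewrite fE FE; apply: le_trans (cabs_le_ReIm _) _; rewrite ReD ReN ImD ImN.
by have := lerD m1 m2; rewrite -splitr.
Qed.

End CesaroHolomorphic.

(** * Hardy-type estimates *)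

Section HardyKernels.
Variable R : realType.
Local Notation mu := (@lebesgue_measure R).
Implicit Types (s t x y : R).

(** The square of [1 + x / 2 <= expR (x / 2)]. *)
Lemma expR_quadratic x : 0 <= x -> 1 + x ^+ 2 / 4 <= expR x.
Proof.
move=> x0; have h : 1 + x / 2 <= expR (x / 2) by exact: expR_ge1Dx.
have -> : expR x = expR (x / 2) ^+ 2 by rewrite expr2 -expRD -splitr.
apply: (@le_trans _ _ ((1 + x / 2) ^+ 2)).
  have -> : (1 + x / 2) ^+ 2 = 1 + x ^+ 2 / 4 + x by field.
  lra.
by rewrite lerXn2r ?nnegrE ?expR_ge0 // addr_ge0 // divr_ge0.
Qed.

Definition hardyK sig : R := 2 * (1 + 4 / sig ^+ 2).

(** Put [d = 1 - s], [D = 1 - t^2 s] and [y = 1/d - 1/D]. The left side is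
    [e^(sig/d) e^(-sig y) / D^2], and [e^(-sig y) (1 + y^2)] is bounded by [1 + 4 / sig^2]. What
    remains is to bound [D^2 (1 + y^2)] below by a Cauchy profile in [t] of width [d^2] at
    [t = 1]. *)
Lemma hardy_weight sig s t : 0 < sig -> 0 <= s -> s < 1 -> 2^-1 <= t -> t <= 1 ->
  expR (sig / (1 - t ^+ 2 * s)) / (1 - t ^+ 2 * s) ^+ 2 <=
  hardyK sig * expR (sig / (1 - s)) * (1 - s) ^- 2 *
    (1 + 64^-1 * (1 - s) ^- 4 * (t - 1) ^+ 2)^-1.
Proof.
move=> sig0 s0 s1 t0 t1; pose d := 1 - s; pose x := s * (1 - t ^+ 2); pose D := d + x.
have d0 : 0 < d by rewrite subr_gt0.
have t2 : t ^+ 2 <= t by rewrite expr2 ler_piMl //; lra.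
have x0 : s * (1 - t) <= x by rewrite /x ler_wpM2l //; lra.
have xt : 0 <= s * (1 - t) by rewrite mulr_ge0 //; lra.
have D0 : 0 < D by rewrite /D; lra.
have -> : 1 - t ^+ 2 * s = D by rewrite /D /d /x; ring.
rewrite -/d; pose y := x / (d * D).
have y0 : 0 <= y.
  by apply: divr_ge0; [lra|apply: mulr_ge0; exact: ltW].
have -> : sig / D = sig / d - sig * y by rewrite /y /D; field; rewrite -/D !gt_eqF.
have sy : 0 <= sig * y by rewrite mulr_ge0 // ltW.
have eq1 : expR (- (sig * y)) * (1 + y ^+ 2) <= 1 + 4 / sig ^+ 2.
  rewrite expRN mulrC ler_pdivrMr ?expR_gt0 //.
  apply: (@le_trans _ _ ((1 + 4 / sig ^+ 2) * (1 + (sig * y) ^+ 2 / 4))).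
    have -> : (1 + 4 / sig ^+ 2) * (1 + (sig * y) ^+ 2 / 4) =
      1 + y ^+ 2 + (4 / sig ^+ 2 + (sig * y) ^+ 2 / 4) by field; rewrite gt_eqF.
    by rewrite lerDl addr_ge0 // divr_ge0 ?sqr_ge0.
  apply: ler_wpM2l; last exact: expR_quadratic.
  by apply: addr_ge0 => //; exact: divr_ge0 (sqr_ge0 _).
have low : d ^+ 2 * (1 + 64^-1 * d ^- 4 * (t - 1) ^+ 2) <= 2 * (D ^+ 2 * (1 + y ^+ 2)).
  have -> : D ^+ 2 * (1 + y ^+ 2) = D ^+ 2 + x ^+ 2 / d ^+ 2.
    by rewrite /y; field; rewrite !gt_eqF.
  have -> : d ^+ 2 * (1 + 64^-1 * d ^- 4 * (t - 1) ^+ 2) =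
      d ^+ 2 + ((1 - t) / 8) ^+ 2 / d ^+ 2 by field; rewrite gt_eqF.
  have dD : d ^+ 2 <= D ^+ 2 by rewrite lerXn2r ?nnegrE ?(ltW d0) ?(ltW D0) // /D; lra.
  have xd : 0 <= x ^+ 2 / d ^+ 2 by rewrite divr_ge0 ?sqr_ge0.
  have d2 : 0 < d ^+ 2 by rewrite exprn_gt0.
  have [s8|s8] := leP 8^-1 s.
    have : ((1 - t) / 8) ^+ 2 / d ^+ 2 <= x ^+ 2 / d ^+ 2.
      rewrite ler_pM2r ?invr_gt0 //; apply: lerXn2r; rewrite ?nnegrE; try lra.
      apply: le_trans x0; rewrite mulrC ler_wpM2r //; lra.
    lra.
  suff : ((1 - t) / 8) ^+ 2 / d ^+ 2 <= d ^+ 2 by lra.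
  rewrite ler_pdivrMr //; apply: (@le_trans _ _ ((16^-1) ^+ 2)).
    by apply: lerXn2r; rewrite ?nnegrE //; lra.
  apply: (@le_trans _ _ (4^-1 * 4^-1)); first by rewrite expr2; lra.
  have d4 : 4^-1 <= d ^+ 2.
    apply: (@le_trans _ _ (2^-1 ^+ 2)); first by rewrite expr2; lra.
    by apply: lerXn2r; rewrite ?nnegrE /d; lra.
  by apply: ler_pM.
have g0 : 0 <= 64^-1 * d ^- 4 * (t - 1) ^+ 2.
  by apply: mulr_ge0 (sqr_ge0 _); rewrite mulr_ge0 // invr_ge0 exprn_ge0 // ltW.
have q0 : 0 < d ^+ 2 * (1 + 64^-1 * d ^- 4 * (t - 1) ^+ 2).
  by apply: mulr_gt0; [rewrite exprn_gt0|lra].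
have hK : 2 * (expR (- (sig * y)) * (1 + y ^+ 2)) <= hardyK sig by rewrite /hardyK ler_pM2l.
rewrite expRD; move: (hardyK sig) hK => H hK.
move: low q0; set Q := _ * (1 + _) => low q0.
have -> : H * expR (sig / d) * d ^- 2 * (1 + 64^-1 * d ^- 4 * (t - 1) ^+ 2)^-1 =
  expR (sig / d) * (H / Q) by rewrite -mulrA -invfM mulrAC mulrC mulrA.
rewrite -mulrA ler_pM2l ?expR_gt0 // ler_pdivlMr // mulrAC ler_pdivrMr ?exprn_gt0 //.
have e1 : expR (- (sig * y)) * Q <= expR (- (sig * y)) * (2 * (D ^+ 2 * (1 + y ^+ 2))).
  by rewrite ler_wpM2l ?expR_ge0.
apply: le_trans e1 _.
have -> : expR (- (sig * y)) * (2 * (D ^+ 2 * (1 + y ^+ 2))) =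
  2 * (expR (- (sig * y)) * (1 + y ^+ 2)) * D ^+ 2 by ring.
by rewrite ler_wpM2r ?sqr_ge0.
Qed.

Lemma cauchy_density_dominates (D : set R) (f : R -> R) (K g : R) : measurable D -> 0 <= K -> 0 < g ->
  (forall t, D t -> 0 <= f t) -> (forall t, D t -> f t <= K * (1 + g * (t - 1) ^+ 2)^-1) ->
  (\int[mu]_(t in D) (f t)%:E <= (K * (pi / Num.sqrt g))%:E)%E.
Proof.
move=> mD K0 g0 f0 fg; rewrite integral_mkcond.
have c0 t : 0 <= (1 + g * (t - 1) ^+ 2)^-1.
  by rewrite invr_ge0 addr_ge0 // mulr_ge0 ?sqr_ge0 // ltW.
apply: (@le_trans _ _ (\int[mu]_t (K%:E * ((1 + g * (t - 1) ^+ 2)^-1)%:E))%E).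
  apply: ge0_le_integral_nomeas => t; rewrite /patch; case: ifPn => //.
  - by rewrite inE lee_fin => /f0.
  - by rewrite inE -EFinM lee_fin => /fg.
  - by move=> _; rewrite -EFinM lee_fin mulr_ge0.
have fe t : setT t -> (0 <= ((1 + g * (t - 1) ^+ 2)^-1)%:E)%E by rewrite lee_fin.
rewrite (ge0_integralZl_EFin mu measurableT fe (measurable_cauchy_density 1 g0) K0).
rewrite EFinM; apply: lee_wpmul2l; first by rewrite lee_fin.
exact: integral_cauchy_density.
Qed.

(** The width [8 (1 - s)^2] of the profile cancels [(1 - s)^(-2)], so the mass is the exponential
    alone. *)
Lemma hardy_weight_integral sig s : 0 < sig -> 0 <= s -> s < 1 ->
  (\int[mu]_(t in `[(2^-1)%R, 1%R]) (expR (sig / (1 - t ^+ 2 * s)) / (1 - t ^+ 2 * s) ^+ 2)%:E <=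
   (8 * pi * hardyK sig * expR (sig / (1 - s)))%:E)%E.
Proof.
move=> sig0 s0 s1; have d0 : 0 < 1 - s by rewrite subr_gt0.
have d4 : 0 < 64^-1 * (1 - s) ^- 4 by rewrite mulr_gt0 // invr_gt0 exprn_gt0.
have k0 : 0 <= hardyK sig by rewrite mulr_ge0 // addr_ge0 // divr_ge0 // sqr_ge0.
have -> : 8 * pi * hardyK sig * expR (sig / (1 - s)) =
    hardyK sig * expR (sig / (1 - s)) * (1 - s) ^- 2 * (pi / Num.sqrt (64^-1 * (1 - s) ^- 4)).
  have -> : 64^-1 * (1 - s) ^- 4 = (8^-1 * (1 - s) ^- 2) ^+ 2 by field; rewrite gt_eqF.
  rewrite sqrtr_sqr ger0_norm; last by rewrite mulr_ge0 // invr_ge0 sqr_ge0.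
  by field; rewrite gt_eqF.
apply: cauchy_density_dominates => //.
- by rewrite mulr_ge0 ?invr_ge0 ?sqr_ge0 // mulr_ge0 // expR_ge0.
- by move=> t _; rewrite divr_ge0 ?expR_ge0 ?sqr_ge0.
- by move=> t /=; rewrite in_itv /= => /andP[t0 t1]; exact: hardy_weight.
Qed.

(** Passing from [s] to [s / t^2] raises [tau / (1 - s)] by at least [c (1 - t)] with
    [c = tau s / (1 - s)^2]. For [s >= 1/8] this exponential decay beats the Cauchy profile; for
    smaller [s] the profile varies by a factor [2] at most. *)
Lemma dilation_kernel tau s t : 0 < tau -> tau <= 1 -> 0 <= s -> s < t ^+ 2 -> 2^-1 <= t -> t <= 1 ->
  expR (- (tau / (1 - s / t ^+ 2))) <=
  2 * expR (- (tau / (1 - s))) * (1 + (tau / (16 * (1 - s) ^+ 2)) ^+ 2 * (t - 1) ^+ 2)^-1.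
Proof.
move=> tau0 tau1 s0 st t0 t1.
have t2 : t ^+ 2 <= t by rewrite expr2 ler_piMl //; lra.
have tp : 0 < t ^+ 2 by rewrite exprn_gt0 //; lra.
have d0 : 0 < 1 - s by lra.
pose d := 1 - s; pose c := tau * s / d ^+ 2; rewrite -/d in d0 *.
have d2 : 0 < d ^+ 2 by rewrite exprn_gt0.
have c0 : 0 <= c by rewrite divr_ge0 ?(ltW d2) // mulr_ge0 // ltW.
have ts : 0 < t ^+ 2 - s by lra.
have h1 : tau / d + c * (1 - t) <= tau / (1 - s / t ^+ 2).
  have -> : tau / (1 - s / t ^+ 2) = tau / d + tau * s * (1 - t ^+ 2) / ((t ^+ 2 - s) * d).
    have tn : t != 0 by rewrite gt_eqF //; lra.
    have dn : 1 - s != 0 by rewrite gt_eqF.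
    have un : t ^+ 2 - s != 0 by rewrite gt_eqF.
    by rewrite /d; field; rewrite tn dn un.
  rewrite lerD2l /c mulrAC ler_pdivrMr // [X in _ <= X]mulrAC ler_pdivlMr ?mulr_gt0 //.
  apply: ler_pM.
  - by apply: mulr_ge0; [apply: mulr_ge0 => //; exact: ltW|lra].
  - by apply: mulr_ge0; exact: ltW.
  - by apply: ler_wpM2l; [apply: mulr_ge0 => //; exact: ltW|lra].
  - by rewrite expr2 ler_pM2r // /d; lra.
apply: (@le_trans _ _ (expR (- (tau / d)) * expR (- (c * (1 - t))))).
  by rewrite -expRD ler_expR; lra.
set g := tau / (16 * d ^+ 2).
have g0 : 0 <= g by rewrite divr_ge0 ?mulr_ge0 ?(ltW tau0) // ltW.
have gt0 : 0 <= g ^+ 2 * (t - 1) ^+ 2 by rewrite mulr_ge0 ?sqr_ge0.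
have ct : 0 <= c * (1 - t) by rewrite mulr_ge0 //; lra.
rewrite (mulrC 2) -[X in _ <= X]mulrA ler_pM2l ?expR_gt0 // ler_pdivlMr ?ltr_wpDr //.
have [s8|s8] := leP 8^-1 s.
  rewrite expRN mulrC ler_pdivrMr ?expR_gt0 //.
  have e1 := expR_quadratic ct.
  have e2 : g ^+ 2 * (t - 1) ^+ 2 <= (c * (1 - t)) ^+ 2 / 4.
    have -> : g ^+ 2 * (t - 1) ^+ 2 = (g * (1 - t)) ^+ 2 by ring.
    have -> : (c * (1 - t)) ^+ 2 / 4 = (c / 2 * (1 - t)) ^+ 2 by field.
    have t1' : 0 <= 1 - t by lra.
    apply: lerXn2r; [by rewrite nnegrE; exact: mulr_ge0| |].
      by rewrite nnegrE; apply: mulr_ge0 => //; exact: divr_ge0.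
    rewrite ler_wpM2r // /c /g.
    have -> : tau / (16 * d ^+ 2) = tau * (8^-1) / d ^+ 2 / 2 by field; rewrite gt_eqF.
    by rewrite ler_pM2r // ler_pM2r ?invr_gt0 // ler_pM2l.
  lra.
have e1 : expR (- (c * (1 - t))) <= 1 by rewrite -[leRHS]expR0 ler_expR; lra.
have d4 : 4^-1 <= d ^+ 2.
  apply: (@le_trans _ _ (2^-1 ^+ 2)); first by rewrite expr2; lra.
  by apply: lerXn2r; rewrite ?nnegrE /d; lra.
have g1 : g <= 1 by rewrite /g ler_pdivrMr; lra.
have e2 : g ^+ 2 * (t - 1) ^+ 2 <= 1.
  have -> : g ^+ 2 * (t - 1) ^+ 2 = (g * (1 - t)) ^+ 2 by ring.
  apply: exprn_ile1; first by rewrite mulr_ge0 //; lra.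
  by rewrite mulr_ile1 //; lra.
apply: (@le_trans _ _ (1 * 2)); last by rewrite mul1r.
by apply: ler_pM; rewrite ?expR_ge0 //; lra.
Qed.

(** Integrating the profile gains its width, of order [(1 - s)^2 / tau]. This gain pays for the
    denominator of Jensen's density later on. *)
Lemma dilation_kernel_integral tau s c : 0 < tau -> tau <= 1 -> 0 <= s -> s < 1 -> 0 <= c ->
  (\int[mu]_(t in `[(2^-1)%R, 1%R])
     (c * if s < t ^+ 2 then expR (- (tau / (1 - s / t ^+ 2))) else 0)%:E <=
   (32 * pi / tau * (c * (1 - s) ^+ 2 * expR (- (tau / (1 - s)))))%:E)%E.
Proof.
move=> tau0 tau1 s0 s1 c0; have d0 : 0 < 1 - s by rewrite subr_gt0.
have g0 : 0 < tau / (16 * (1 - s) ^+ 2) by rewrite divr_gt0 // mulr_gt0 // exprn_gt0.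
have e0 : 0 <= 2 * expR (- (tau / (1 - s))) by exact: mulr_ge0 (expR_ge0 _).
have -> : 32 * pi / tau * (c * (1 - s) ^+ 2 * expR (- (tau / (1 - s)))) =
    c * (2 * expR (- (tau / (1 - s)))) * (pi / Num.sqrt ((tau / (16 * (1 - s) ^+ 2)) ^+ 2)).
  by rewrite sqrtr_sqr gtr0_norm //; field; rewrite !gt_eqF.
apply: cauchy_density_dominates => //.
- exact: mulr_ge0.
- by rewrite exprn_gt0.
- by move=> t _; apply: mulr_ge0 => //; case: ifP => // _; exact: expR_ge0.
- move=> t /=; rewrite in_itv /= => /andP[t0 t1]; rewrite -mulrA; apply: ler_wpM2l => //.
  case: ifPn => [st|_]; first exact: dilation_kernel.
  apply: mulr_ge0 => //; rewrite invr_ge0 addr_ge0 // mulr_ge0 ?sqr_ge0 //.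
Qed.

End HardyKernels.

(** * Jensen's inequality for a density of bounded mass *)

Section JensenInequality.
Variable R : realType.
Local Notation mu := (@lebesgue_measure R).

Lemma ge0_le_integral_nomeas_in (D : set R) (f g : R -> \bar R) :
  (forall x, D x -> 0 <= f x)%E -> (forall x, D x -> f x <= g x)%E ->
  (\int[mu]_(x in D) f x <= \int[mu]_(x in D) g x)%E.
Proof.
move=> f0 fg; rewrite integral_mkcond [leRHS]integral_mkcond.
by apply: ge0_le_integral_nomeas => x; rewrite /patch; case: ifPn => //; rewrite inE;
  [exact: f0|exact: fg].
Qed.

(* Integrating the tangent line of [x `^ p] at [I / N]. *)
Lemma jensen_powR (D : set R) (phi e : R -> R) (p N I : R) : measurable D ->
  measurable_fun D phi -> measurable_fun D e ->
  (forall t, D t -> 0 <= phi t) -> (forall t, D t -> 0 <= e t) -> 1 <= p -> 0 < N -> 0 <= I ->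
  (\int[mu]_(t in D) (e t)%:E <= N%:E)%E ->
  (I%:E <= \int[mu]_(t in D) (phi t * e t)%:E)%E ->
  ((I `^ p)%:E <= (N `^ (p - 1))%:E * \int[mu]_(t in D) (phi t `^ p * e t)%:E)%E.
Proof.
move=> mD mphi me phi0 e0 p1 N0 I0 heN hI; have p0 : 0 < p by apply: lt_le_trans p1.
have J0 : (0 <= \int[mu]_(t in D) (phi t `^ p * e t)%:E)%E.
  by apply: integral_ge0 => t tD; rewrite lee_fin mulr_ge0 ?powR_ge0 // e0.
have [I00|In0] := eqVneq I 0.
  rewrite I00 powR0 ?gt_eqF //; apply: mule_ge0 => //; rewrite lee_fin; exact: powR_ge0.
have Ip : 0 < I by rewrite lt_def In0 I0.
pose a := I / N; have a0 : 0 < a by rewrite divr_gt0.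
pose A := a `^ p; have A0 : 0 < A by rewrite powR_gt0.
have tangent t : D t -> p * A / a * (phi t * e t) <= phi t `^ p * e t + (p - 1) * A * e t.
  move=> tD; have := @bernoulli_powR R p (phi t / a) p1 (divr_ge0 (phi0 t tD) (ltW a0)).
  have E : A * (phi t / a) `^ p = phi t `^ p.
    have q0 : 0 <= phi t / a by exact: divr_ge0 (phi0 t tD) (ltW a0).
    by rewrite -(powRM _ (ltW a0) q0); congr (_ `^ _); field; rewrite gt_eqF.
  have E2 : A * (1 + p * (phi t / a - 1)) = p * A / a * phi t - (p - 1) * A.
    by field; rewrite gt_eqF.
  move=> /(ler_wpM2l (ltW A0)); rewrite E E2 lerBlDr => /(ler_wpM2r (e0 t tD)).
  by rewrite mulrDl mulrA.
have mphip : measurable_fun D (fun t => phi t `^ p).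
  exact: (measurableT_comp (measurable_powR p) mphi).
have key : ((p * A / a)%:E * \int[mu]_(t in D) (phi t * e t)%:E <=
    \int[mu]_(t in D) (phi t `^ p * e t)%:E + ((p - 1) * A)%:E * \int[mu]_(t in D) (e t)%:E)%E.
  rewrite -ge0_integralZl_EFin //; last 3 first.
  - by move=> ? ?; rewrite lee_fin mulr_ge0 ?phi0 ?e0.
  - by apply/measurable_EFinP; apply: measurable_funM.
  - by rewrite divr_ge0 ?(ltW a0) // mulr_ge0 // ltW.
  rewrite -ge0_integralZl_EFin //; last 2 first.
  - exact/measurable_EFinP.
  - by rewrite mulr_ge0 ?subr_ge0 // ltW.
  rewrite -ge0_integralD //; last 4 first.
  - by move=> ? ?; rewrite lee_fin mulr_ge0 ?powR_ge0 // e0.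
  - by apply/measurable_EFinP; apply: measurable_funM.
  - by move=> ? ?; rewrite -EFinM lee_fin mulr_ge0 ?e0 // mulr_ge0 ?subr_ge0 // ltW.
  - by apply/measurable_EFinP; apply: measurable_funM => //; exact: measurable_cst.
  apply: ge0_le_integral_nomeas_in => x xD.
    by rewrite -EFinM lee_fin mulr_ge0 ?divr_ge0 ?mulr_ge0 ?phi0 ?e0 ?ltW.
  by rewrite -!EFinM -EFinD lee_fin tangent.
have pA : 0 <= p * A / a by rewrite divr_ge0 ?(ltW a0) // mulr_ge0 // ltW.
have pA1 : 0 <= (p - 1) * A by rewrite mulr_ge0 ?subr_ge0 // ltW.
have {}key : ((p * A / a * I)%:E <= \int[mu]_(t in D) (phi t `^ p * e t)%:E + ((p - 1) * A * N)%:E)%E.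
  apply: (@le_trans _ _ ((p * A / a)%:E * \int[mu]_(t in D) (phi t * e t)%:E)%E).
    have pAe : (0 <= (p * A / a)%:E :> \bar R)%E by rewrite lee_fin.
    by have := lee_wpmul2l pAe hI; rewrite -EFinM.
  apply: le_trans key _; apply: leeD => //.
  have pA1e : (0 <= ((p - 1) * A)%:E :> \bar R)%E by rewrite lee_fin.
  by have := lee_wpmul2l pA1e heN; rewrite -EFinM.
have E1 : p * A / a * I = p * A * N by rewrite /a; field; rewrite In0 gt_eqF.
rewrite E1 in key.
have AN : ((A * N)%:E <= \int[mu]_(t in D) (phi t `^ p * e t)%:E)%E.
  have -> : (A * N)%:E = ((p * A * N)%:E - ((p - 1) * A * N)%:E)%E.
    by rewrite -EFinB; congr EFin; ring.
  by rewrite leeBlDr.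
have -> : I `^ p = N `^ (p - 1) * (A * N).
  rewrite -[I](_ : N * a = I); last by rewrite /a mulrCA mulfV ?mulr1 // gt_eqF.
  rewrite powRM ?(ltW N0) ?(ltW a0) // -/A mulrCA mulrC; congr (_ * _).
  rewrite -{3}[N]powRr1 ?(ltW N0) // -powRD ?subrK //; apply/implyP => _; exact: lt0r_neq0.
by rewrite EFinM; apply: lee_wpmul2l => //; rewrite lee_fin powR_ge0.
Qed.

End JensenInequality.

Section IteratedIntegralSum.
Variable R : realType.
Local Notation C := R[i].

Lemma iter_intD k (F G : (nat -> C) -> \bar R) : borel F -> borel G ->
  (forall w, 0 <= F w)%E -> (forall w, 0 <= G w)%E ->
  iter_int k (fun w => F w + G w)%E = (iter_int k F + iter_int k G)%E.
Proof.
elim: k F G => [|k IH] F G bF bG F0 G0 //.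
rewrite !iter_intS -ge0_integralD //; last 4 first.
- by move=> x _; apply: integral_ge0 => y _; exact: iter_int_ge0.
- exact: measurable_slice_int.
- by move=> x _; apply: integral_ge0 => y _; exact: iter_int_ge0.
- exact: measurable_slice_int.
apply: eq_integral => x _; rewrite -ge0_integralD //; last 4 first.
- by move=> y _; exact: iter_int_ge0.
- exact: measurable_slice.
- by move=> y _; exact: iter_int_ge0.
- exact: measurable_slice.
by apply: eq_integral => y _; rewrite IH //; exact: borel_slice.
Qed.

End IteratedIntegralSum.

(** * Sup bound on the ball of radius one half *)

Section HalfBall.
Variables (R : realType) (n : nat).
Local Notation C := R[i].

Lemma sq_beta_le (al be : R) (a : nat -> C) i : 0 < al -> 0 <= be -> sq_beta al be a i <= be.
Proof.
move=> al0 be0; elim: i => [|i IH] //=; apply: le_trans IH.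
have b0 := sq_beta_ge0 a al0 be0 i.
have bc : 0 <= sq_beta al be a i * cabs (a i) ^+ 2 by rewrite mulr_ge0 ?sqr_ge0.
rewrite ler_pdivrMr; last by lra.
by rewrite mulrDr (mulrC al) lerDl mulr_ge0.
Qed.

(** For [|a|^2 <= 1/4] each [gam a i] is at most [2 + 3], and [pi ^+ 2 >= 1]. *)
Lemma ell_vol_lower (a : Cn R n) : sqnorm a <= 4^-1 -> (5^-1) ^+ n <= ell_vol a.
Proof.
move=> a4; have y34 : 3 / 4 <= defect a by rewrite /defect; lra.
have y0 : 0 < defect a by lra.
have ab : ball_n n a by move: y0; rewrite /defect subr_gt0.
rewrite -[X in _ ^+ X](card_ord n) -prodr_const; apply: ler_prod => i _.
rewrite invr_ge0 ler0n /= -[5^-1]mul1r; have g0 := gam_gt0 ab i.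
apply: ler_pM => //.
  by rewrite exprn_ege1 //; have := @pi_ge2 R; lra.
rewrite lef_pV2 ?posrE // /sq_gamma.
have al2 : (defect a) ^- 2 <= 2.
  rewrite -[leRHS]invrK lef_pV2 ?posrE ?exprn_gt0 ?invr_gt0 //.
  by apply: (@le_trans _ _ ((3 / 4) ^+ 2)); [rewrite expr2; lra|rewrite lerXn2r ?nnegrE //; lra].
have be3 : (defect a) ^- 3 <= 3.
  rewrite -[leRHS]invrK lef_pV2 ?posrE ?exprn_gt0 ?invr_gt0 //.
  by apply: (@le_trans _ _ ((3 / 4) ^+ 3)); [rewrite !exprS expr0; lra|rewrite lerXn2r ?nnegrE //; lra].
have h := sq_beta_le (vcoord a) i (al_gt0 ab) (be_ge0 ab).
have c1 : cabs (vcoord a i) ^+ 2 <= 1 by rewrite vcoordE; apply: le_trans (cabs_le_sqnorm a i) _; lra.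
have : sq_beta (defect a ^- 2) (defect a ^- 3) (vcoord a) i * cabs (vcoord a i) ^+ 2 <= 3 * 1.
  apply: ler_pM; rewrite ?sqr_ge0 //; last exact: le_trans h be3.
  by apply: sq_beta_ge0; [exact: al_gt0|exact: be_ge0].
lra.
Qed.

Definition half_ballK : R := expR (-6) * lowK R n * 5^-1 ^+ n.

Lemma half_ballK_gt0 : 0 < half_ballK.
Proof. by rewrite !mulr_gt0 ?expR_gt0 ?lowK_gt0 ?exprn_gt0 // invr_gt0. Qed.

(** The ellipsoid inequality centred at [w] has constants independent of [w] here, since the defect
    of [w] is at least [3 / 4]. *)
Lemma half_ball_sup (p : R) (f : Cn R n -> R[i]^o) w : 1 <= p -> holomorphic_on_ball f ->
  sqnorm w <= 4^-1 ->
  ((half_ballK * cabs (f w) `^ p)%:E <= ball_int p (fun=> 1%R) f)%E.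
Proof.
move=> p1 hf w4; have y34 : 3 / 4 <= defect w by rewrite /defect; lra.
have y0 : 0 < defect w by lra.
have wb : ball_n n w by move: y0; rewrite /defect subr_gt0.
have Qw : Qform w (w - w) <= 64^-1.
  rewrite /Qform subrr /sqnorm /inner !big1 => [|j _|j _]; rewrite ?mxE ?mul0r ?cabs0 ?expr0n //.
  by rewrite !mul0r addr0 invr_ge0.
have H := @ellipsoid_submean R n p (expR (-6)) w w f
  (fun z => if sqnorm z < 1 then ((cabs (f z) `^ p) * weight z * 1)%:E else 0%E)
  p1 (expR_ge0 _) wb Qw hf.
apply: le_trans (H _ _) => [|z|z zb xy _].
- rewrite lee_fin; apply: ler_wpM2r; first exact: powR_ge0.
  apply: ler_wpM2l; last exact: ell_vol_lower.
  by rewrite mulr_ge0 ?expR_ge0 // ltW // lowK_gt0.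
- by case: ifP => // _; rewrite mulr1 lee_fin mulr_ge0 ?powR_ge0 ?expR_ge0.
rewrite (zb : sqnorm z < 1) lee_fin mulr1 mulrC; apply: ler_wpM2l; first exact: powR_ge0.
(* The defect of [z] is at least a quarter of [3 / 4], that is [3 / 16], which exceeds [1 / 6]. *)
rewrite ler_expR lerN2 -/(defect z) -[6]invrK lef_pV2 ?posrE //; try lra.
Qed.

End HalfBall.

Section MeasurableInverse.
Variable R : realType.
Local Notation mu := (@lebesgue_measure R).

(** The identity [x^-1 = x (x^2)^(-1)] reduces inversion to the power function, defined for
    nonnegative bases; at [x = 0] both sides are zero. *)
Lemma measurable_inv d (T : measurableType d) (f : T -> R) :
  measurable_fun setT f -> measurable_fun setT (fun x => (f x)^-1).
Proof.
move=> mf; have -> : (fun x => (f x)^-1) = fun x => f x * (f x ^+ 2) `^ (-1).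
  apply/funext => x; rewrite powR_inv1 ?sqr_ge0 //.
  by have [->|x0] := eqVneq (f x) 0; [rewrite mul0r invr0|field].
apply: measurable_funM => //.
by apply: (measurableT_comp (measurable_powR (-1))); exact: measurable_funX.
Qed.

Lemma Rintegral_abs_le (A : set R) (k : R -> R) (h : R -> \bar R) : measurable A ->
  measurable_fun A k -> (forall t, A t -> (`|k t|%:E <= h t)%E) ->
  ((`|\int[mu]_(t in A) k t|)%:E <= \int[mu]_(t in A) h t)%E.
Proof.
move=> mA mk kh; rewrite /Rintegral.
(* [fine] sends an infinite integral to [0], so passing to the extended integral loses nothing. *)
apply: (@le_trans _ _ (`|\int[mu]_(t in A) (k t)%:E|)%E).
  by case: (\int[mu]_(t in A) (k t)%:E)%E => [r| |] //=; rewrite normr0 leey.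
have mk' : measurable_fun A (EFin \o k) by exact/measurable_EFinP.
apply: le_trans (@le_abse_integral _ _ R mu A _ mA mk') _.
by apply: ge0_le_integral_nomeas_in => t tA; [rewrite lee_fin|exact: kh].
Qed.

End MeasurableInverse.

(** * Pointwise bound for the operator *)

Section CesaroPointwise.
Variables (R : realType) (n : nat).
Local Notation C := R[i].
Local Notation mu := (@lebesgue_measure R).
Implicit Types (z w : Cn R n) (f g : Cn R n -> R[i]^o).

Local Notation upper := (`[(2^-1)%R, 1%R]%classic : set R).

Definition arc f z (t : R) : R := cutb (fun z => cabs (f z)) ((t%:C)%C *: z).

Lemma arc_ge0 f z t : 0 <= arc f z t.
Proof. by rewrite /arc /cutb; case: ifP => // _; exact: cabs_ge0. Qed.

Lemma measurable_arc f z : holomorphic_on_ball f -> measurable_fun setT (arc f z).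
Proof.
move=> hf; pose c (t : R) (j : nat) : C := (t%:C)%C * vcoord z j.
have mc : coord_measurable c.
  move=> j; split.
    rewrite (_ : (fun _ => _) = fun t => t * complex.Re (vcoord z j)).
      exact: measurable_funM.
    by apply/funext => t; rewrite Re_realM.
  rewrite (_ : (fun _ => _) = fun t => t * complex.Im (vcoord z j)).
    exact: measurable_funM.
  by apply/funext => t; rewrite Im_realM.
have := bmeas_cut_cabs hf mc.
rewrite (_ : (fun t => cutb _ (\row_i c t i)) = arc f z) //.
apply/funext => t; rewrite /arc; congr cutb.
by apply/rowP => i; rewrite !mxE /c vcoordE.
Qed.

Lemma measurable_dilated_defect (s : R) : measurable_fun setT (fun t : R => 1 - t ^+ 2 * s).
Proof.
apply: measurable_funB; first exact: measurable_cst.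
by apply: measurable_funM => //; apply: measurable_funX.
Qed.

Lemma dilation_in_ball z (t : R) : ball_n n z -> 0 <= t <= 1 -> ball_n n ((t%:C)%C *: z).
Proof. by move=> zb t01; apply: le_lt_trans zb; exact: sqnorm_dilation. Qed.

(** For [t < 1/2] the point [t z] lies in the half ball, where [f] and the partials of [g] are
    bounded. For [t >= 1/2] the radial bound on [g] applies at [t z] and [1 / t <= 2]. *)
Lemma kernel_bound f g (S B M : R) z (t : R) : 0 <= S -> 0 <= M ->
  (forall w, sqnorm w <= 4^-1 -> cabs (f w) <= S) ->
  (forall w, sqnorm w <= 4^-1 -> \sum_(j < n) cabs ('D_('e_j) g w) <= B) ->
  (forall w, ball_n n w -> cabs (radial_deriv g w) * (1 - sqnorm w) ^+ 2 <= M) ->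
  ball_n n z -> 0 < t -> t <= 1 ->
  cabs (radial_kernel f g z t) <= S * B +
    (if t < 2^-1 then 0 else 2 * M * (arc f z t / (1 - t ^+ 2 * sqnorm z) ^+ 2)).
Proof.
move=> S0 M0 hS hB hM zb t0 t1.
have tb : ball_n n ((t%:C)%C *: z) by apply: dilation_in_ball; rewrite // (ltW t0).
have q0 := sqnorm_ge0 z.
have qt : sqnorm ((t%:C)%C *: z) = t ^+ 2 * sqnorm z.
  by rewrite sqnormZ cabs_real ger0_norm // ltW.
have B0 : 0 <= B.
  apply: le_trans (hB 0 _); first by apply: sumr_ge0 => j _; exact: cabs_ge0.
  by rewrite /sqnorm big1 ?invr_ge0 // => j _; rewrite mxE cabs0 expr0n.
case: ifPn => [th|th].
  rewrite addr0 /radial_kernel cabsM.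
  have w4 : sqnorm ((t%:C)%C *: z) <= 4^-1.
    rewrite qt; apply: (@le_trans _ _ (2^-1 ^+ 2 * 1)); last by rewrite mulr1 expr2; lra.
    apply: ler_pM; rewrite ?sqr_ge0 //; last exact: ltW.
    by apply: lerXn2r; rewrite ?nnegrE ?invr_ge0 // ltW.
  apply: ler_pM; rewrite ?cabs_ge0 //; first exact: hS.
  apply: le_trans (cabs_sum _ _ _) _; apply: le_trans (hB _ w4); apply: ler_sum => j _.
  rewrite cabsM ler_piMl ?cabs_ge0 //.
  rewrite -(@ler_pXn2r _ 2) ?nnegrE ?cabs_ge0 // expr1n.
  by apply: le_trans (cabs_le_sqnorm z j) _; exact: ltW.
have tn : t != 0 by rewrite gt_eqF.
rewrite -radial_kernelE // !cabsM cabsV cabs_real (gtr0_norm t0).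
have -> : arc f z t = cabs (f ((t%:C)%C *: z)) by rewrite /arc /cutb (tb : sqnorm _ < 1).
apply: le_trans (_ : 2 * M * (cabs (f ((t%:C)%C *: z)) / (1 - t ^+ 2 * sqnorm z) ^+ 2) <= _); last first.
  by rewrite lerDr mulr_ge0.
have d0 : 0 < (1 - t ^+ 2 * sqnorm z) ^+ 2 by rewrite exprn_gt0 // -qt subr_gt0.
have r1 : cabs (radial_deriv g ((t%:C)%C *: z)) <= M / (1 - t ^+ 2 * sqnorm z) ^+ 2.
  by rewrite ler_pdivlMr // -qt hM.
have ti : t^-1 <= 2 by rewrite -[2]invrK lef_pV2 ?posrE ?invr_gt0 // leNgt.
have -> : 2 * M * (cabs (f ((t%:C)%C *: z)) / (1 - t ^+ 2 * sqnorm z) ^+ 2) =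
  cabs (f ((t%:C)%C *: z)) * (M / (1 - t ^+ 2 * sqnorm z) ^+ 2) * 2 by ring.
apply: ler_pM => //; rewrite ?mulr_ge0 ?cabs_ge0 ?invr_ge0 ?(ltW t0) //.
by rewrite ler_wpM2l ?cabs_ge0.
Qed.

Lemma cesaro_pointwise f g (S B M : R) z : holomorphic_on_ball f -> holomorphic_on_ball g ->
  0 <= S -> 0 <= M ->
  (forall w, sqnorm w <= 4^-1 -> cabs (f w) <= S) ->
  (forall w, sqnorm w <= 4^-1 -> \sum_(j < n) cabs ('D_('e_j) g w) <= B) ->
  (forall w, ball_n n w -> cabs (radial_deriv g w) * (1 - sqnorm w) ^+ 2 <= M) ->
  ball_n n z ->
  ((cabs (Defs.cesaro g f z))%:E <= (2 * (S * B))%:E + (4 * M)%:E *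
    \int[mu]_(t in upper) (arc f z t / (1 - t ^+ 2 * sqnorm z) ^+ 2)%:E)%E.
Proof.
move=> hf hg S0 M0 hS hB hM zb.
have B0 : 0 <= B.
  apply: le_trans (hB 0 _); first by apply: sumr_ge0 => j _; exact: cabs_ge0.
  by rewrite /sqnorm big1 ?invr_ge0 // => j _; rewrite mxE cabs0 expr0n.
pose G (t : R) := arc f z t / (1 - t ^+ 2 * sqnorm z) ^+ 2.
have G0 t : 0 <= G t by rewrite divr_ge0 ?arc_ge0 ?sqr_ge0.
have mG : measurable_fun setT G.
  apply: measurable_funM; first exact: measurable_arc.
  by apply: measurable_inv; apply: measurable_funX; exact: measurable_dilated_defect.
set J := (\int[mu]_(t in upper) _)%E.
have mitv : measurable (`]0, 1]%classic : set R) by exact: measurable_itv.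
have m2 : measurable upper by exact: measurable_itv.
have m01 : mu (`]0, 1]%classic : set R) = 1%E.
  by rewrite lebesgue_measure_itv /= lte_fin ltr01 oppr0 adde0.
have bound : (\int[mu]_(t in `]0%R, 1%R]) ((S * B)%:E + (2 * M)%:E * ((EFin \o G) \_ upper) t) =
    (S * B)%:E + (2 * M)%:E * J)%E.
  have SB0 : 0 <= S * B by rewrite mulr_ge0.
  have P0 t : (0 <= ((EFin \o G) \_ upper) t)%E by rewrite /patch; case: ifP => // _; rewrite lee_fin.
  have mP : measurable_fun (`]0, 1]%classic : set R) ((EFin \o G) \_ upper).
    apply: measurable_funTS; apply/(measurable_restrictT _ m2); apply: measurable_funTS.
    exact/measurable_EFinP.
  have M20 : 0 <= 2 * M by rewrite mulr_ge0.
  rewrite ge0_integralD //=; last 2 first.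
  - by move=> t _; rewrite mule_ge0.
  - exact: measurable_funeM.
  rewrite integral_cst // [X in (_ * X + _)%E](_ : _ = 1%E) ?mule1; last exact: m01.
  congr (_ + _)%E.
  rewrite ge0_integralZl_EFin //; congr (_ * _)%E; rewrite -integral_mkcondr; congr integral.
  apply/seteqP; split => t /=; first by case.
  by rewrite !in_itv /= => /andP[h1 h2]; split; apply/andP; split => //; apply: lt_le_trans h1.
have dom t : t \in (`]0, 1]%classic : set R) ->
    ((cabs (radial_kernel f g z t))%:E <= (S * B)%:E + (2 * M)%:E * ((EFin \o G) \_ upper) t)%E.
  rewrite inE /= in_itv /= => /andP[t0 t1].
  have := kernel_bound S0 M0 hS hB hM zb t0 t1; rewrite -lee_fin => h; apply: le_trans h _.
  rewrite EFinD; apply: leeD => //; rewrite /patch; case: (ltP t 2^-1) => th.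
    rewrite memNset; first by rewrite mule_ge0 // lee_fin mulr_ge0.
    by rewrite /= in_itv /= => /andP[]; rewrite leNgt th.
  by rewrite mem_set //= in_itv /= th.
have [T [G1 [G2 [T1 [_ _ c1 c2] _ _ _]]]] := cesaro_path hf hg zb.
have clampE t : t \in (`]0, 1]%classic : set R) -> radial_kernel f g z t = radial_kernel f g z (clamp T t).
  rewrite inE /= in_itv /= => /andP[t0 t1]; rewrite clamp_id // ?(ltW t0) //.
  exact: le_trans t1 (ltW T1).
have mRe : measurable_fun (`]0, 1]%classic : set R) (fun t => complex.Re (radial_kernel f g z t)).
  apply: (eq_measurable_fun (fun t => complex.Re (radial_kernel f g z (clamp T t)))).
    by move=> t /clampE ->.
  by apply: measurable_funTS; exact: continuous_measurable_fun.
have mIm : measurable_fun (`]0, 1]%classic : set R) (fun t => complex.Im (radial_kernel f g z t)).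
  apply: (eq_measurable_fun (fun t => complex.Im (radial_kernel f g z (clamp T t)))).
    by move=> t /clampE ->.
  by apply: measurable_funTS; exact: continuous_measurable_fun.
have abs_le (k : R -> R) : measurable_fun (`]0, 1]%classic : set R) k ->
    (forall t, `|k t| <= cabs (radial_kernel f g z t)) ->
    ((`|\int[mu]_(t in `]0%R, 1%R]) k t|)%:E <= (S * B)%:E + (2 * M)%:E * J)%E.
  move=> mk kc; rewrite -bound; apply: Rintegral_abs_le => // t /mem_set tA.
  by apply: le_trans (dom t tA); rewrite lee_fin.
have hRe := abs_le _ mRe (fun t => le_Re_cabs _).
have hIm := abs_le _ mIm (fun t => le_Im_cabs _).
(* The modulus is bounded by the sum of the real and imaginary parts, which doubles both
   constants. *)
apply: (@le_trans _ _ (((S * B)%:E + (2 * M)%:E * J) + ((S * B)%:E + (2 * M)%:E * J))%E).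
  apply: le_trans (leeD hRe hIm); rewrite -EFinD lee_fin cesaro_kernel.
  exact: cabs_le_ReIm.
have J0 : (0 <= J)%E by apply: integral_ge0 => t _; rewrite lee_fin; exact: G0.
rewrite addeACA -EFinD -ge0_muleDl ?lee_fin ?mulr_ge0 // -EFinD.
have -> : S * B + S * B = 2 * (S * B) by ring.
by have -> : 2 * M + 2 * M = 4 * M by ring.
Qed.

End CesaroPointwise.

Section BorelDilation.
Variable R : realType.
Local Notation C := R[i].

Lemma borel_fun_dilated (P : R -> (nat -> C) -> \bar R) : borel_fun P ->
  borel_fun (fun t u => P t (fun j => (t%:C)%C * u j)).
Proof.
move=> bP d T s c ms mc; apply: (bP _ _ s (fun x j => ((s x)%:C)%C * c x j)) => // j.
have [m1 m2] := mc j; split.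
  rewrite (_ : (fun _ => _) = fun x => s x * complex.Re (c x j)).
    exact: measurable_funM.
  by apply/funext => x; rewrite Re_realM.
rewrite (_ : (fun _ => _) = fun x => s x * complex.Im (c x j)).
  exact: measurable_funM.
by apply/funext => x; rewrite Im_realM.
Qed.

Lemma borel_integral (Q : R -> (nat -> C) -> \bar R) : borel_fun Q ->
  (forall t u, 0 <= Q t u)%E -> borel (fun u => \int[@lebesgue_measure R]_t Q t u)%E.
Proof.
move=> bQ Q0 d T c mc.
apply: (@measurable_fun_fubini_tonelli_F _ _ _ _ R (@lebesgue_measure R)
  (fun q : T * R => Q q.2 (c q.1))) => [|q]; last exact: Q0.
apply: (bQ _ _ snd (fun q => c q.1)) => [|j]; first exact: measurable_snd.
by have [m1 m2] := mc j; split; [exact: (measurableT_comp m1 measurable_fst)|exact: (measurableT_comp m2 measurable_fst)].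
Qed.

End BorelDilation.

(** * Tonelli and the dilation [w = t z] *)

Section HardyDensity.
Variables (R : realType) (n : nat).
Local Notation C := R[i].
Local Notation mu := (@lebesgue_measure R).
Variables (p sig tau : R).
Hypotheses (p1 : 1 <= p) (tauE : tau = 1 - sig * (p - 1)).
Hypotheses (tau0 : 0 < tau) (tau1 : tau <= 1).
Implicit Types (z w : Cn R n) (f g : Cn R n -> R[i]^o).

Local Notation upper := (`[(2^-1)%R, 1%R]%classic : set R).

(** The integrand left by Jensen's inequality, written at [w = t z]. The first exponential and the
    square come from the density at [w]; the second is what remains of the weight at [z], since
    [|z|^2 = |w|^2 / t^2]. The condition [|w|^2 < t^2] says that [z] is in the ball. *)
Definition hardy_density f (t : R) w : R :=
  cutb (fun w => cabs (f w)) w `^ p *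
  (expR (- (sig * (p - 1) / (1 - sqnorm w))) / (1 - sqnorm w) ^+ 2) *
  (if sqnorm w < t ^+ 2 then expR (- (tau / (1 - sqnorm w / t ^+ 2))) else 0) * \1_upper t.

Lemma hardy_density_ge0 f t w : 0 <= hardy_density f t w.
Proof.
apply: mulr_ge0; last by rewrite indicE.
apply: mulr_ge0; last by case: ifP => // _; exact: expR_ge0.
by apply: mulr_ge0; [exact: powR_ge0|rewrite divr_ge0 ?expR_ge0 ?sqr_ge0].
Qed.

Lemma hardy_density_borel f : holomorphic_on_ball f ->
  borel_fun (fun (t : R) (u : nat -> C) => (hardy_density f t (\row_(i < n) u i))%:E).
Proof.
move=> hf d T s c ms mc; apply/measurable_EFinP.
have mq : measurable_fun setT (fun x : T => sqnorm (\row_(i < n) c x i)) by exact: bmeas_sqnorm.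
have m1q : measurable_fun setT (fun x : T => 1 - sqnorm (\row_(i < n) c x i)).
  by apply: measurable_funB => //; exact: measurable_cst.
apply: measurable_funM; last first.
  by apply: (measurableT_comp _ ms); apply/measurable_indicP; exact: measurable_itv.
apply: measurable_funM.
  apply: measurable_funM; first exact: (bmeas_powR p (bmeas_cut_cabs hf)).
  apply: measurable_funM; last by apply: measurable_inv; exact: measurable_funX.
  apply: (measurableT_comp (@measurable_expR R)); apply: measurable_funN.
  by apply: measurable_funM; [exact: measurable_cst|exact: measurable_inv].
have ms2 : measurable_fun setT (fun x : T => s x ^+ 2) by exact: measurable_funX.
apply: measurable_fun_ifT; last exact: measurable_cst.
  exact: measurable_fun_ltr.
apply: (measurableT_comp (@measurable_expR R)); apply: measurable_funN.
apply: measurable_funM; first exact: measurable_cst.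
apply: measurable_inv; apply: measurable_funB; first exact: measurable_cst.
by apply: measurable_funM => //; exact: measurable_inv.
Qed.

(** The factor [(1 - |w|^2)^2] gained over [t] cancels the denominator, and the two exponentials
    recombine to the full weight because [sig (p - 1) + tau = 1]. *)
Lemma hardy_density_integral f w :
  (\int[mu]_t (hardy_density f t w)%:E <=
   (32 * pi / tau)%:E * (cutb (fun w => cabs (f w)) w `^ p * cutb (fun w => weight w) w * 1)%:E)%E.
Proof.
have p0 : 0 < p by apply: lt_le_trans p1.
have K0 : 0 <= 32 * pi / tau by exact: divr_ge0 (mulr_ge0 _ (pi_ge0 _)) (ltW tau0).
have [w1|w1] := ltP (sqnorm w) 1; last first.
  have E : cutb (fun w => cabs (f w)) w = 0 by rewrite /cutb ltNge w1.
  rewrite integral0_eq => [|t _]; last by rewrite /hardy_density E powR0 ?gt_eqF // !mul0r.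
  by rewrite E powR0 ?gt_eqF // !mul0r mule0.
set c := cutb _ w `^ p; have c0 : 0 <= c by exact: powR_ge0.
have d0 : 0 < 1 - sqnorm w by rewrite subr_gt0.
pose c' := c * (expR (- (sig * (p - 1) / (1 - sqnorm w))) / (1 - sqnorm w) ^+ 2).
have c'0 : 0 <= c' by rewrite mulr_ge0 // divr_ge0 ?expR_ge0 ?sqr_ge0.
apply: le_trans (_ : \int[mu]_(t in upper) (c' * if sqnorm w < t ^+ 2 then
    expR (- (tau / (1 - sqnorm w / t ^+ 2))) else 0)%:E <= _)%E.
  rewrite [leRHS]integral_mkcond le_eqVlt; apply/orP; left; apply/eqP; apply: eq_integral => t _.
  rewrite /patch /hardy_density -/c -/c' indicE; case: (t \in upper); last by rewrite mulr0.
  by rewrite mulr1.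
apply: le_trans (dilation_kernel_integral tau0 tau1 (sqnorm_ge0 w) w1 c'0) _.
rewrite -EFinM lee_fin; apply: ler_wpM2l => //.
have -> : cutb (fun w => weight w) w = weight w by rewrite /cutb w1.
rewrite /c' le_eqVlt; apply/orP; left; apply/eqP.
have -> : weight w = expR (- (sig * (p - 1) / (1 - sqnorm w))) * expR (- (tau / (1 - sqnorm w))).
  rewrite /weight -expRD; congr expR; rewrite tauE; field; rewrite gt_eqF //.
by field; rewrite gt_eqF.
Qed.

(** Tonelli brings the [t] integral outside, the dilation is undone for each fixed [t], and Tonelli
    again brings it inside, where [hardy_density_integral] applies at each point. *)
Lemma hardy_density_total f : holomorphic_on_ball f ->
  (iter_int n (fun u : nat -> C => \int[mu]_t (hardy_density f t ((t%:C)%C *: \row_(i < n) u i)%R)%:E) <=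
   (4 ^+ n * (32 * pi / tau))%:E * ball_int p (fun=> 1%R) f)%E.
Proof.
move=> hf; have p0 : 0 < p by apply: lt_le_trans p1.
have bP := hardy_density_borel hf.
pose P (t : R) (u : nat -> C) : \bar R := (hardy_density f t (\row_(i < n) u i))%:E.
have P0 t u : (0 <= P t u)%E by rewrite lee_fin hardy_density_ge0.
have rowZ (t : R) (u : nat -> C) :
    \row_(i < n) ((t%:C)%C * u i) = (t%:C)%C *: (\row_(i < n) u i) :> Cn R n.
  by apply/rowP => i; rewrite !mxE.
pose Q (t : R) (u : nat -> C) : \bar R := P t (fun j => (t%:C)%C * u j).
have bQ : borel_fun Q by exact: borel_fun_dilated.
have -> : (fun u : nat -> C => \int[mu]_t (hardy_density f t ((t%:C)%C *: \row_(i < n) u i)%R)%:E)%E =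
    (fun u : nat -> C => \int[mu]_t Q t u)%E.
  by apply/funext => u; apply: eq_integral => t _; rewrite /Q /P rowZ.
rewrite -(@iter_int_tonelli R n _ _ mu Q bQ (fun t u => P0 _ _)).
have bPt t : borel (P t).
  by move=> d T c mc; apply: (bP _ _ (fun=> t)) => //; exact: measurable_cst.
have four0 : 0 <= 4 ^+ n :> R by rewrite exprn_ge0.
have step : (\int[mu]_t iter_int n (Q t) <= \int[mu]_t ((4 ^+ n)%:E * iter_int n (P t)))%E.
  apply: ge0_le_integral_nomeas => t; first by apply: iter_int_ge0 => u; exact: P0.
  have [/andP[t0 t1]|tn] := boolP ((2^-1 <= t) && (t <= 1)); last first.
    rewrite (_ : Q t = fun=> 0%E).
      rewrite (_ : iter_int n _ = 0%E) ?mule_ge0 ?lee_fin //; last first.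
        by elim: (n) => //= k IH; rewrite integral0_eq // => x _; rewrite integral0_eq.
      by apply: iter_int_ge0 => u; exact: P0.
    apply/funext => u; rewrite /Q /P /hardy_density indicE memNset ?mulr0 //.
    by rewrite /= in_itv /=; apply/negP.
  have tp : 0 < t by apply: lt_le_trans t0; rewrite invr_gt0.
  rewrite (@iter_int_dilation R n t (P t) tp (bPt t) (P0 t)) -/(Q t) muleA -EFinM.
  rewrite -[leLHS]mul1e; apply: lee_wpmul2r; first by apply: iter_int_ge0 => u; exact: P0.
  (* Undoing the dilation costs [t^(-2n)], at most [4^n] for [t >= 1/2]. *)
  rewrite lee_fin exprM -exprMn exprn_ege1 //.
  apply: (@le_trans _ _ (4 * 2^-1 ^+ 2)); first by rewrite expr2; lra.
  by rewrite ler_pM2l // lerXn2r ?nnegrE ?invr_ge0 // ltW.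
apply: le_trans step _.
have mP := @measurable_iter_int R n _ _ P bP P0.
have iP0 t : setT t -> (0 <= iter_int n (P t))%E by move=> _; apply: iter_int_ge0 => u; exact: P0.
rewrite (ge0_integralZl_EFin mu measurableT iP0 mP four0) EFinM -muleA.
apply: lee_wpmul2l; first by rewrite lee_fin.
rewrite (@iter_int_tonelli R n _ _ mu P bP P0) ball_intE //.
have K0 : 0 <= 32 * pi / tau by exact: divr_ge0 (mulr_ge0 _ (pi_ge0 _)) (ltW tau0).
rewrite -iter_intZl //; last 2 first.
- exact: (borel_ball_int p hf (bmeas_cst n 1)).
- move=> u; rewrite lee_fin mulr1 mulr_ge0 ?powR_ge0 // /cutb; case: ifP => // _; exact: expR_ge0.
apply: le_iter_int => u; first by apply: integral_ge0 => t _; exact: P0.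
exact: hardy_density_integral.
Qed.

End HardyDensity.

(** * The weighted power of the operator at a point *)

Section CesaroNorm.
Variables (R : realType) (n : nat).
Local Notation C := R[i].
Local Notation mu := (@lebesgue_measure R).
Variables (p sig tau : R).
Hypotheses (p1 : 1 <= p) (sig0 : 0 < sig) (tauE : tau = 1 - sig * (p - 1)).
Implicit Types (z w : Cn R n) (f g : Cn R n -> R[i]^o).

Local Notation upper := (`[(2^-1)%R, 1%R]%classic : set R).

Lemma powRD_le (x y : R) : 0 <= x -> 0 <= y -> (x + y) `^ p <= 2 `^ p * (x `^ p + y `^ p).
Proof.
have p0 : 0 <= p by apply: le_trans p1.
wlog xy : x y / x <= y.
  move=> H x0 y0; have [|/ltW] := leP x y; first by move=> ?; exact: H.
  by move=> yx; rewrite addrC [X in _ * X]addrC; exact: H.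
move=> x0 y0; apply: (@le_trans _ _ ((2 * y) `^ p)).
  by apply: ge0_ler_powR; rewrite ?nnegrE ?addr_ge0 ?mulr_ge0 //; lra.
by rewrite powRM // ler_wpM2l ?powR_ge0 // lerDr powR_ge0.
Qed.

(** Jensen's inequality with [phi = |f| e^(-sig/(1 - t^2 s))] against [e], the density
    [e^(sig/(1 - t^2 s)) (1 - t^2 s)^(-2)]. The compensating exponential in [phi] leaves
    [e^(-sig (p-1)/(1 - t^2 s))] in [phi^p e]. *)
Lemma hardy_holder f z (I : R) : holomorphic_on_ball f -> ball_n n z -> 0 <= I ->
  (I%:E <= \int[mu]_(t in upper) (arc f z t / (1 - t ^+ 2 * sqnorm z) ^+ 2)%:E)%E ->
  ((I `^ p * weight z)%:E <= ((8 * pi * hardyK sig) `^ (p - 1))%:E *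
     \int[mu]_t (hardy_density p sig tau f t ((t%:C)%C *: z)%R)%:E)%E.
Proof.
move=> hf zb I0 hI; pose s := sqnorm z; have s0 : 0 <= s := sqnorm_ge0 z.
have s1 : s < 1 := zb; have d0 : 0 < 1 - s by rewrite subr_gt0.
have hK0 : 0 < hardyK sig.
  by rewrite /hardyK mulr_gt0 // ltr_wpDr // divr_ge0 // sqr_ge0.
have K0 : 0 < 8 * pi * hardyK sig by exact: mulr_gt0 (mulr_gt0 _ (pi_gt0 _)) hK0.
pose E (t : R) := expR (sig / (1 - t ^+ 2 * s)).
pose phi (t : R) := arc f z t * expR (- (sig / (1 - t ^+ 2 * s))).
pose e (t : R) := E t / (1 - t ^+ 2 * s) ^+ 2.
pose N := 8 * pi * hardyK sig * expR (sig / (1 - s)).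
have N0 : 0 < N by rewrite mulr_gt0 // expR_gt0.
have mup : measurable upper by exact: measurable_itv.
have mq : measurable_fun setT (fun t : R => sig / (1 - t ^+ 2 * s)).
  apply: measurable_funM; first exact: measurable_cst.
  by apply: measurable_inv; exact: measurable_dilated_defect.
have mphi : measurable_fun upper phi.
  apply: measurable_funTS; apply: measurable_funM; first exact: measurable_arc.
  by apply: (measurableT_comp (@measurable_expR R)); exact: measurable_funN.
have me : measurable_fun upper e.
  apply: measurable_funTS; apply: measurable_funM; first exact: (measurableT_comp (@measurable_expR R)).
  by apply: measurable_inv; apply: measurable_funX; exact: measurable_dilated_defect.
have phi0 t : upper t -> 0 <= phi t by rewrite mulr_ge0 ?arc_ge0 ?expR_ge0.
have e0 t : upper t -> 0 <= e t by rewrite divr_ge0 ?expR_ge0 ?sqr_ge0.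
have heN := hardy_weight_integral sig0 s0 s1.
have hI' : (I%:E <= \int[mu]_(t in upper) (phi t * e t)%:E)%E.
  apply: le_trans hI _; rewrite le_eqVlt; apply/orP; left; apply/eqP; apply: eq_integral => t _.
  rewrite /phi /e /E mulrA -(mulrA (arc f z t)) -expRD addNr expR0 mulr1 //.
have := jensen_powR mup mphi me phi0 e0 p1 N0 I0 heN hI' => H.
have W0 : 0 <= weight z by exact: expR_ge0.
have We : (0 <= (weight z)%:E :> \bar R)%E by rewrite lee_fin.
have := lee_wpmul2r We H; rewrite -EFinM => {}H; apply: le_trans H _.
rewrite muleC muleA -EFinM.
(* The mass to the power [p - 1] takes [sig (p - 1)] from the exponent of the weight and leaves
   [tau]. *)
have -> : weight z * N `^ (p - 1) = (8 * pi * hardyK sig) `^ (p - 1) * expR (- (tau / (1 - s))).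
  rewrite /N powRM ?expR_ge0 ?(ltW K0) // mulrCA; congr (_ * _).
  rewrite -expRM -expRD /weight -/s; congr expR; rewrite tauE; field; rewrite gt_eqF //.
rewrite EFinM -muleA; apply: lee_wpmul2l; first by rewrite lee_fin powR_ge0.
have mpe : measurable_fun upper (fun t => (phi t `^ p * e t)%:E).
  apply/measurable_EFinP; apply: measurable_funM => //.
  exact: (measurableT_comp (measurable_powR p) mphi).
have pe0 t : upper t -> (0 <= (phi t `^ p * e t)%:E)%E.
  by move=> /e0 h; rewrite lee_fin mulr_ge0 ?powR_ge0.
rewrite -(ge0_integralZl_EFin mu mup pe0 mpe (expR_ge0 _)) integral_mkcond.
rewrite le_eqVlt; apply/orP; left; apply/eqP; apply: eq_integral => t _.
rewrite /patch /hardy_density indicE; case: ifPn => [|tu]; last by rewrite mulr0.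
rewrite inE /= in_itv /= => /andP[t0 t1]; rewrite -EFinM mulr1; congr EFin.
have tp : 0 < t by apply: lt_le_trans t0; rewrite invr_gt0.
have qt : sqnorm ((t%:C)%C *: z) = t ^+ 2 * s.
  by rewrite sqnormZ cabs_real ger0_norm // ltW.
rewrite qt gtr_pMr ?exprn_gt0 // s1 -/(arc f z t).
have -> : t ^+ 2 * s / t ^+ 2 = s by field; rewrite gt_eqF.
rewrite mulrC; congr (_ * _); rewrite /phi /e /E powRM ?arc_ge0 ?expR_ge0 // -expRM -!mulrA.
congr (_ * _); rewrite mulrA -expRD; congr (expR _ * _); ring.
Qed.

Lemma cesaro_power f g (S B M : R) z : holomorphic_on_ball f -> holomorphic_on_ball g ->
  0 <= S -> 0 < M ->
  (forall w, sqnorm w <= 4^-1 -> cabs (f w) <= S) ->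
  (forall w, sqnorm w <= 4^-1 -> \sum_(j < n) cabs ('D_('e_j) g w) <= B) ->
  (forall w, ball_n n w -> cabs (radial_deriv g w) * (1 - sqnorm w) ^+ 2 <= M) ->
  ball_n n z ->
  ((cabs (Defs.cesaro g f z) `^ p * weight z)%:E <=
    (2 `^ p * (2 * (S * B)) `^ p * weight z)%:E +
    (2 `^ p * (4 * M) `^ p * (8 * pi * hardyK sig) `^ (p - 1))%:E *
      \int[mu]_t (hardy_density p sig tau f t ((t%:C)%C *: z)%R)%:E)%E.
Proof.
move=> hf hg S0 M0 hS hB hM zb; have p0 : 0 <= p by apply: le_trans p1.
have := cesaro_pointwise hf hg S0 (ltW M0) hS hB hM zb.
have B0 : 0 <= B.
  apply: le_trans (hB 0 _); first by apply: sumr_ge0 => j _; exact: cabs_ge0.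
  by rewrite /sqnorm big1 ?invr_ge0 // => j _; rewrite mxE cabs0 expr0n.
set F := cabs (Defs.cesaro g f z); set J := (\int[mu]_(t in upper) _)%E => hJ.
pose a := 2 * (S * B); have a0 : 0 <= a by rewrite !mulr_ge0.
pose b := 4 * M; have b0 : 0 < b by rewrite mulr_gt0.
rewrite -/a -/b in hJ *.
have J0 : (0 <= J)%E.
  by apply: integral_ge0 => t _; rewrite lee_fin divr_ge0 ?arc_ge0 ?sqr_ge0.
(* The integral [J] may be infinite, while [hardy_holder] takes a real lower bound for it; this one
   is the least that the pointwise estimate forces. *)
pose I := Num.max 0 ((F - a) / b); have I0 : 0 <= I by rewrite le_max lexx.
have IJ : (I%:E <= J)%E.
  rewrite /I; have [h|h] := leP 0 ((F - a) / b); last by [].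
  move: hJ J0; case: J => [r| |]; [|by move=> *; rewrite leey|by []].
  by rewrite -EFinM -EFinD !lee_fin => h1 _; rewrite ler_pdivrMr //; lra.
have FI : F <= a + b * I.
  rewrite -lerBlDl -ler_pdivrMl // mulrC; by rewrite /I le_max lexx orbT.
have H := hardy_holder hf zb I0 IJ.
have W0 : 0 <= weight z by exact: expR_ge0.
have step : F `^ p * weight z <= 2 `^ p * a `^ p * weight z + 2 `^ p * b `^ p * (I `^ p * weight z).
  have -> : 2 `^ p * a `^ p * weight z + 2 `^ p * b `^ p * (I `^ p * weight z) =
    2 `^ p * (a `^ p + (b * I) `^ p) * weight z by rewrite powRM ?(ltW b0) //; ring.
  apply: ler_wpM2r => //; apply: le_trans (powRD_le _ _) => //; last by rewrite mulr_ge0 // ltW.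
  by apply: ge0_ler_powR; rewrite ?nnegrE ?cabs_ge0 // addr_ge0 // mulr_ge0 // ltW.
apply: (@le_trans _ _ ((2 `^ p * a `^ p * weight z)%:E + (2 `^ p * b `^ p)%:E * (I `^ p * weight z)%:E)%E).
  by rewrite -EFinM -EFinD lee_fin.
apply: leeD => //; rewrite [X in (_ <= X * _)%E]EFinM -muleA; apply: lee_wpmul2l => //.
by rewrite lee_fin mulr_ge0 ?powR_ge0.
Qed.

End CesaroNorm.

(** * From the radial bound to boundedness and to the Carleson inequality *)

Section RadialBound.
Variables (R : realType) (n : nat).
Local Notation C := R[i].
Local Notation mu := (@lebesgue_measure R).
Implicit Types (z w : Cn R n) (f g : Cn R n -> R[i]^o).

Lemma zero_in_ball : ball_n n (0 : Cn R n).
Proof. by rewrite /ball_n /= /sqnorm big1 // => j _; rewrite mxE cabs0 expr0n. Qed.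

(** For [a = 0] and [p = 1] the exponent of the test function is [D = 1/(1-|z|^2) - 1], so the
    weight is at most [e^(-D)] and [test_fun_int] bounds its integral. *)
Lemma weight_total : (iter_int n (fun u => (cutb (fun z : Cn R n => weight z) (\row_(i < n) u i))%:E) <=
  (gapK R (2 * n) * ell_vol (0 : Cn R n))%:E)%E.
Proof.
apply: le_trans (test_fun_int ltr01 zero_in_ball); rewrite /ball_int /vol_int.
apply: le_iter_int => u; first by rewrite lee_fin /cutb; case: ifP => // _; exact: expR_ge0.
set z := \row_i u i; rewrite /cutb; case: ifPn => // zb; rewrite mulr1 lee_fin.
rewrite (test_fun_weight zero_in_ball zb ltr01) ler_expR lerNr opprK.
have i0 : inner z 0 = 0 by rewrite /inner big1 // => j _; rewrite !mxE conjc0 mulr0.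
have d0 : defect (0 : Cn R n) = 1 by rewrite /defect /sqnorm big1 ?subr0 // => j _; rewrite mxE cabs0 expr0n.
rewrite /gapD i0 d0 subr0 /= expr1n expr0n addr0 invr1 ?mulr1 ?divr1 /defect; lra.
Qed.

Lemma partials_bounded g : holomorphic_on_ball g ->
  exists B : R, forall w, sqnorm w <= 4^-1 -> \sum_(j < n) cabs ('D_('e_j) g w) <= B.
Proof.
move=> hg; have r1 : 4^-1 < 1 :> R by lra.
have hD j : exists M : R, forall z, sqnorm z <= 4^-1 -> cabs ('D_('e_j) g z) <= M.
  by have [M M0 H] := hol_bounded (partial_hol j hg) r1; exists M.
have [Mg hMg] := choice hD; exists (\sum_(j < n) Mg j) => w w4.
by apply: ler_sum => j _; exact: hMg.
Qed.

Lemma radial_bound_cesaro (p : R) g : 1 <= p -> holomorphic_on_ball g ->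
  (exists M : R, forall z, ball_n n z -> cabs (radial_deriv g z) * (1 - sqnorm z) ^+ 2 <= M) ->
  cesaro_bounded p g.
Proof.
move=> p1 hg [M' hM']; have p0 : 0 < p by apply: lt_le_trans p1.
pose M := Num.max M' 1; have M0 : 0 < M by rewrite lt_max ltr01 orbT.
have hM z : ball_n n z -> cabs (radial_deriv g z) * (1 - sqnorm z) ^+ 2 <= M.
  by move=> /hM' h; rewrite le_max h.
have [B hB] := partials_bounded hg.
have B0 : 0 <= B.
  apply: le_trans (hB 0 _); first by apply: sumr_ge0 => j _; exact: cabs_ge0.
  by rewrite /sqnorm big1 ?invr_ge0 // => j _; rewrite mxE cabs0 expr0n.
(* This choice gives [sig (p - 1) <= 1 / 2] for every [p >= 1], so [tau] stays in [[1/2, 1]]. *)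
pose sig := (2 * p)^-1; have sig0 : 0 < sig by rewrite invr_gt0 mulr_gt0.
pose tau := 1 - sig * (p - 1).
have sp : 0 <= sig * (p - 1) by rewrite mulr_ge0 ?subr_ge0 // ltW.
have sp2 : sig * (p - 1) <= 2^-1 by rewrite /sig mulrC ler_pdivrMr ?mulr_gt0 //; lra.
have tau0 : 0 < tau by rewrite /tau; lra.
have tau1 : tau <= 1 by rewrite /tau; lra.
pose V := gapK R (2 * n) * ell_vol (0 : Cn R n).
have V0 : 0 <= V by rewrite mulr_ge0 // ltW ?ell_vol_gt0 ?gapK_gt0 //; exact: zero_in_ball.
have hb0 := half_ballK_gt0 R n.
pose A2 := 2 `^ p * (4 * M) `^ p * (8 * pi * hardyK sig) `^ (p - 1).
have A20 : 0 <= A2 by rewrite !mulr_ge0 ?powR_ge0.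
pose c1 := 2 `^ p * (2 * B) `^ p / half_ballK R n * V.
have c10 : 0 <= c1 by rewrite mulr_ge0 // divr_ge0 ?(ltW hb0) // mulr_ge0 ?powR_ge0.
pose c2 := A2 * (4 ^+ n * (32 * pi / tau)).
have c20 : 0 <= c2.
  apply: mulr_ge0 => //; apply: mulr_ge0; first exact: exprn_ge0.
  exact: divr_ge0 (mulr_ge0 _ (pi_ge0 _)) (ltW tau0).
(* [c1] handles [t <= 1/2], [c2] the rest; the final [1] keeps the constant positive. *)
exists (c1 + c2 + 1); split; first by rewrite ltr_wpDl // addr_ge0.
move=> f [hf fint].
suff H : (ball_int p (fun=> 1%R) (Defs.cesaro g f) <= (c1 + c2 + 1)%:E * ball_int p (fun=> 1%R) f)%E.
  split => //; split; first exact: cesaro_hol.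
  by apply: le_lt_trans H _; apply: lte_mul_pinfty => //; rewrite lee_fin !addr_ge0.
have f0 : (0 <= ball_int p (fun=> 1%R) f)%E.
  apply: iter_int_ge0 => u; case: ifP => // _.
  by rewrite lee_fin mulr1 mulr_ge0 ?powR_ge0 ?expR_ge0.
have fE : ball_int p (fun=> 1%R) f = (fine (ball_int p (fun=> 1%R) f))%:E.
  by rewrite fineK // ge0_fin_numE.
set b := fine _ in fE; have b0 : 0 <= b by rewrite fine_ge0.
(* The sup bound on the half ball. Its [p]-th power is linear in the integral [b] of [|f|^p], so the
   first half of the estimate is also a multiple of [b]. *)
pose S := (b / half_ballK R n) `^ p^-1; have S0 : 0 <= S by exact: powR_ge0.
have bh0 : 0 <= b / half_ballK R n by rewrite divr_ge0 // ltW.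
have hS w : sqnorm w <= 4^-1 -> cabs (f w) <= S.
  move=> w4; apply: powR_le_root => //; first exact: cabs_ge0.
  have := half_ball_sup p1 hf w4; rewrite fE lee_fin mulrC.
  by rewrite -ler_pdivlMr.
have Sp : S `^ p = b / half_ballK R n.
  by rewrite /S -powRrM mulVf ?powRr1 // gt_eqF.
pose A1 := 2 `^ p * (2 * (S * B)) `^ p; have A10 : 0 <= A1 by rewrite mulr_ge0 ?powR_ge0.
have A1E : A1 * V = c1 * b.
  rewrite /A1 /c1 (_ : 2 * (S * B) = S * (2 * B)); last by ring.
  by rewrite powRM ?mulr_ge0 // Sp; ring.
pose G1 (u : nat -> C) : \bar R := (cutb (fun z : Cn R n => weight z) (\row_(i < n) u i))%:E.
pose G2 (u : nat -> C) : \bar R :=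
  (\int[mu]_t (hardy_density p sig tau f t ((t%:C)%C *: \row_(i < n) u i)%R)%:E)%E.
have G10 u : (0 <= G1 u)%E by rewrite lee_fin /cutb; case: ifP => // _; exact: expR_ge0.
have G20 u : (0 <= G2 u)%E.
  by apply: integral_ge0 => t _; rewrite lee_fin; exact: hardy_density_ge0.
have bG1 : borel G1 by apply: bmeas_borel; exact: bmeas_weight.
have bG2 : borel G2.
  have rowZ (t : R) (u : nat -> C) :
      \row_(i < n) ((t%:C)%C * u i) = (t%:C)%C *: (\row_(i < n) u i) :> Cn R n.
    by apply/rowP => i; rewrite !mxE.
  have -> : G2 = fun u => (\int[mu]_t
      (hardy_density p sig tau f t (\row_(i < n) ((t%:C)%C * u i)))%:E)%E.
    by apply/funext => u; apply: eq_integral => t _; rewrite rowZ.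
  apply: (borel_integral (borel_fun_dilated (hardy_density_borel p sig tau hf))) => t u.
  by rewrite lee_fin; exact: hardy_density_ge0.
have scaled (A : R) (G : (nat -> C) -> \bar R) : 0 <= A -> borel G -> borel (fun u => A%:E * G u)%E.
  by move=> _ bG d T c mc; apply: measurable_funeM; exact: bG.
apply: (@le_trans _ _ (iter_int n (fun u => A1%:E * G1 u + A2%:E * G2 u)%E)).
  apply: le_iter_int => u; set z := \row_i u i.
    by case: ifP => // _; rewrite lee_fin mulr1 mulr_ge0 ?powR_ge0 ?expR_ge0.
  case: ifPn => [zb|_]; last by rewrite adde_ge0 // mule_ge0.
  rewrite mulr1; have := cesaro_power p1 sig0 erefl hf hg S0 M0 hS hB hM zb.
  by rewrite /G1 /cutb -/z zb -EFinM.
rewrite iter_intD; last 4 first.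
- exact: scaled.
- exact: scaled.
- by move=> u; rewrite mule_ge0.
- by move=> u; rewrite mule_ge0.
rewrite !iter_intZl //.
have t1 : (A1%:E * iter_int n G1 <= (c1 * b)%:E)%E.
  rewrite -A1E (EFinM A1 V); apply: lee_wpmul2l; first by rewrite lee_fin.
  exact: weight_total.
have t2 : (A2%:E * iter_int n G2 <= (c2 * b)%:E)%E.
  rewrite /c2 -mulrA (EFinM A2); apply: lee_wpmul2l; first by rewrite lee_fin.
  apply: le_trans (hardy_density_total p1 erefl tau0 tau1 hf) _.
  by rewrite fE -EFinM.
apply: le_trans (leeD t1 t2) _; rewrite fE -EFinM -EFinD lee_fin; lra.
Qed.

Lemma radial_bound_carleson (p : R) g : 1 <= p ->
  (exists M : R, forall z, ball_n n z -> cabs (radial_deriv g z) * (1 - sqnorm z) ^+ 2 <= M) ->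
  carleson_density p (fun z => cabs (radial_deriv g z) `^ p * (1 - sqnorm z) `^ (2 * p)).
Proof.
move=> p1 [M' hM']; have p0 : 0 < p by apply: lt_le_trans p1.
pose M := Num.max M' 1; have M0 : 0 < M by rewrite lt_max ltr01 orbT.
exists (M `^ p); split; first by rewrite powR_gt0.
move=> f [hf _]; rewrite (ball_intE (fun=> 1) f p0) -iter_intZl; last 3 first.
- exact: powR_ge0.
- exact: (borel_ball_int p hf (bmeas_cst n 1)).
- by move=> u; rewrite lee_fin mulr1 mulr_ge0 ?powR_ge0 // /cutb; case: ifP => // _; exact: expR_ge0.
apply: le_iter_int => u; set z := \row_i u i.
  by case: ifP => // _; rewrite lee_fin !mulr_ge0 ?powR_ge0 ?expR_ge0.
rewrite /cutb; case: ifPn => [zb|_]; last by rewrite powR0 ?gt_eqF // !mul0r mule0.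
rewrite -EFinM lee_fin mulr1 mulrC; apply: ler_wpM2r.
  by rewrite mulr_ge0 ?powR_ge0 ?expR_ge0.
have d0 : 0 <= 1 - sqnorm z by rewrite subr_ge0 ltW.
rewrite powRrM powR_mulrn // -powRM ?cabs_ge0 ?sqr_ge0 //.
apply: ge0_ler_powR; rewrite ?nnegrE ?(ltW p0) ?(ltW M0) ?mulr_ge0 ?cabs_ge0 ?sqr_ge0 //.
by rewrite le_max hM'.
Qed.

End RadialBound.

Theorem theorem4p3 (R : realType) (n : nat) (p : R) (g : 'rV[R[i]]_n -> R[i]^o) :
  1 <= p -> holomorphic_on_ball g ->
  [/\ cesaro_bounded p g <->
        carleson_density p
          (fun z => cabs (radial_deriv g z) `^ p * (1 - sqnorm z) `^ (2 * p)),
      carleson_density p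
          (fun z => cabs (radial_deriv g z) `^ p * (1 - sqnorm z) `^ (2 * p))
        <-> (exists M : R, forall z, ball_n n z ->
               cabs (radial_deriv g z) * (1 - sqnorm z) ^+ 2 <= M) &
      (exists M : R, forall z, ball_n n z ->
               cabs (radial_deriv g z) * (1 - sqnorm z) ^+ 2 <= M)
        <-> cesaro_bounded p g].
Proof.
move=> p1 hg; split; split.
- by move=> /(cesaro_radial_bound p1 hg)/(radial_bound_carleson p1).
- by move=> /(carleson_radial_bound p1 hg)/(radial_bound_cesaro p1 hg).
- exact: carleson_radial_bound.
- exact: radial_bound_carleson.
- exact: radial_bound_cesaro.
- exact: cesaro_radial_bound.
Qed.
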